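(* Let $d\ge 1$, let $D\in End(\mathbb{R}^d)$ satisfy $0<\lambda_D\le\Lambda_D<1$, let $A=A_1+iA_2$ be a linear operator on $\mathbb{C}^d$ with $A_1,A_2$ real $d\times d$ matrices, and let $X=\{X(t)\}$ be the (proper) operator fractional Brownian motion $$X(t)=\int_0^\infty G_1(x,t)\,W_1(dx)+\int_0^\infty G_2(x,t)\,W_2(dx).$$ For $n\in\mathbb{N}$ let $$X_n(t)=\int_0^\infty G_1(x,t)\,\theta_n(x)\,dx+\int_0^\infty G_2(x,t)\,\hat\theta_n(x)\,dx,\qquad t\in[0,1].$$ Then, as $n\to\infty$, the laws of $\{X_n(t)\}_{t\in[0,1]}$ in $\mathcal{C}^d[0,1]$ converge weakly to the law of $\{X(t)\}_{t\in[0,1]}$.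
   Context: $End(\mathbb{R}^d)$ is the set of linear operators on $\mathbb{R}^d$, identified with real $d\times d$ matrices; $I$ is the identity. For $D\in End(\mathbb{R}^d)$ and $c>0$, $c^D=\exp((\log c)D)$. $\lambda_D$ and $\Lambda_D$ are the minimum and the maximum of the real parts of the eigenvalues of $D$. $\mathcal{C}^d[0,1]=\mathcal{C}([0,1],\mathbb{R}^d)$ with the uniform topology. For $x>0$, $t\in\mathbb{R}$, $$G_1(x,t)=\frac{\sin tx}{x}x^{-(D-\frac I2)}A_1+\frac{\cos tx-1}{x}x^{-(D-\frac I2)}A_2,$$ $$G_2(x,t)=\frac{\sin tx}{x}x^{-(D-\frac I2)}A_2+\frac{1-\cos tx}{x}x^{-(D-\frac I2)}A_1.$$ One has $\int_0^\infty\|G_i(x,t)\|^2dx<\infty$ for $i=1,2$. $W_1,W_2$ are independent standard $\mathbb{R}^d$-valued Brownian motions on $[0,\infty)$, and the integrals defining $X$ are Wiener integrals. $X$ is assumed proper: for $t\ne0$ the support of the law of $X(t)$ is not contained in a proper hyperplane of $\mathbb{R}^d$. Let $N_n$ be a Poisson process with intensity $n$ and $\theta_n^0(t)=\sqrt n\,(-1)^{N_n(t)}$, $t\ge 0$. Then $\theta_n(t)=(\theta_n^1(t),\dots,\theta_n^d(t))'$, where $\theta_n^1,\dots,\theta_n^d$ are independent copies of $\theta_n^0$, and $\hat\theta_n$ is an independent copy of $\theta_n$. For $f\in L^2([0,\infty);End(\mathbb{R}^d))$, the integral $\int_0^\infty f(x)\theta_n(x)dx$ is understood as the limit in $L^2(\Omega)$,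 as $T\to\infty$, of $\int_0^Tf(x)\theta_n(x)dx$. $X_n$ denotes the version with continuous paths. *)

(* Defs.v *)
From HB Require Import structures.
From mathcomp Require Import all_boot all_order all_algebra.
From mathcomp Require Import complex.
From mathcomp Require Import all_classical all_reals all_analysis.

Set Implicit Arguments.
Unset Strict Implicit.
Unset Printing Implicit Defensive.

Import Order.TTheory GRing.Theory Num.Theory.
Import numFieldNormedType.Exports.

Local Open Scope classical_set_scope.
Local Open Scope ring_scope.

Section operators.
Context {R : realType} {d : nat}.
Implicit Types (A B D : 'M[R]_d) (c x t : R).

Definition expmx A : 'M[R]_d :=
  limn (series (fun k => k`!%:R^-1 *: A ^+ k)).

(* Meaningful for 0 < c only, as ln c = 0 for c <= 0. *)
Definition mxpowR c D : 'M[R]_d := expmx (ln c *: D).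

Definition spectrum_re D : set R :=
  [set complex.Re z | z in
    [set z : R[i] | eigenvalue (map_mx (fun x : R => (x%:C)%C) D) z]].

(* The spectrum is finite and, for 0 < d, nonempty: inf and sup are the minimum
   and the maximum. *)
Definition lambda_min D : R := inf (spectrum_re D).
Definition lambda_max D : R := sup (spectrum_re D).

Definition kernel_pow D x : 'M[R]_d := mxpowR x (- (D - (2^-1)%:M)).

Definition G1 D A1 A2 x t : 'M[R]_d :=
  (sin (t * x) / x) *: (kernel_pow D x *m A1) +
  ((cos (t * x) - 1) / x) *: (kernel_pow D x *m A2).

Definition G2 D A1 A2 x t : 'M[R]_d :=
  (sin (t * x) / x) *: (kernel_pow D x *m A2) +
  ((1 - cos (t * x)) / x) *: (kernel_pow D x *m A1).

End operators.

Section independence.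
Context {R : realType} {dO : measure_display} {Omega : measurableType dO}.
Variable P : probability Omega R.

Definition sigma_of {I : Type} {dS} {S : measurableType dS} (J : set I)
    (X : I -> Omega -> S) : set_system Omega :=
  <<s \bigcup_(i in J) preimage_set_system setT (X i) measurable >>.

(* As each F i contains setT when it is a sigma-algebra, the product rule over
   the whole of I entails the product rule over each subfamily. *)
Definition independent {I : finType} (F : I -> set_system Omega) : Prop :=
  forall A : I -> set Omega, (forall i, F i (A i)) ->
    fine (P (\bigcap_i A i)) = \prod_(i : I) fine (P (A i)).

Definition independent_increments (X : R -> Omega -> R) : Prop :=
  forall (m : nat) (t : nat -> R), 0 <= t 0%N -> nondecreasing_seq t ->
    independent (fun k : 'I_m =>
      sigma_of [set: unit] (fun _ w => X (t k.+1) w - X (t k) w)).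

Definition time : set R := `[0, +oo[.

Definition coord_process {d} (X : R -> Omega -> 'cV[R]_d) (i : 'I_d) :
    R -> Omega -> R := fun t w => X t w i 0.

Definition independent_coords {d} (X : R -> Omega -> 'cV[R]_d) : Prop :=
  independent (fun i : 'I_d => sigma_of time (coord_process X i)).

Definition sigma_process {d} (X : R -> Omega -> 'cV[R]_d) : set_system Omega :=
  sigma_of (time `*` [set: 'I_d]) (fun ti => coord_process X ti.2 ti.1).

Definition independent_processes {d} (X Y : R -> Omega -> 'cV[R]_d) : Prop :=
  independent (fun b : bool => sigma_process (if b then X else Y)).

End independence.

Section noises.
Context {R : realType} {dO : measure_display} {Omega : measurableType dO}.
Variable P : probability Omega R.

Record brownian_motion (B : R -> Omega -> R) : Prop := BrownianMotion {
  bm_measurable : forall t, 0 <= t -> measurable_fun setT (B t) ;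
  bm_start : {ae P, forall w, B 0 w = 0} ;
  bm_indep : independent_increments P B ;
  bm_gauss : forall s t, 0 <= s < t -> forall U : set R, measurable U ->
    P ((fun w => B t w - B s w) @^-1` U) = normal_prob 0 (Num.sqrt (t - s)) U ;
  bm_continuous : {ae P, forall w, {within time, continuous (B ^~ w)}}
}.

Definition std_brownian_motion {d} (W : R -> Omega -> 'cV[R]_d) : Prop :=
  (forall i, brownian_motion (coord_process W i)) /\ independent_coords P W.

Record poisson_process (rate : R) (N : R -> Omega -> nat) : Prop :=
  PoissonProcess {
  pp_measurable : forall t, 0 <= t -> measurable_fun setT (N t) ;
  pp_start : forall w, N 0 w = 0%N ;
  pp_mono : forall w s t, 0 <= s <= t -> (N s w <= N t w)%N ;
  pp_right_continuous : forall w t, 0 <= t ->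
    \forall s \near t^'+, N s w = N t w ;
  pp_indep : independent_increments P (fun t w => (N t w)%:R) ;
  pp_law : forall s t, 0 <= s < t -> forall k : nat,
    P [set w | N t w = (N s w + k)%N] = (poisson_pmf (rate * (t - s)) k)%:E
}.

(* Independence is required of the coordinates of theta themselves; each is
   sqrt n (-1)^N for its own Poisson process N of intensity n. *)
Definition kac_noise {d} (n : nat) (theta : R -> Omega -> 'cV[R]_d) : Prop :=
  (exists N : 'I_d -> R -> Omega -> nat,
    (forall i, poisson_process n%:R (N i)) /\
    (forall i t w, 0 <= t ->
      theta t w i 0 = Num.sqrt n%:R * (-1) ^+ N i t w)) /\
  independent_coords P theta.

End noises.

Section integrals.
Context {R : realType} {dO : measure_display} {Omega : measurableType dO}.
Variable P : probability Omega R.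
Context {d : nat}.
Implicit Types (f : R -> 'M[R]_d) (Y : Omega -> 'cV[R]_d).
Implicit Types (X : R -> Omega -> 'cV[R]_d).

Let mu := @lebesgue_measure R.

Definition measurable_vec Y : Prop :=
  forall i, measurable_fun setT (fun w => Y w i 0).

(* `|_| is the max norm on vectors and matrices; the norm is immaterial for L2
   convergence in finite dimension. *)
Definition L2dist Y Y' : \bar R := (\int[P]_w ((`|Y w - Y' w| ^+ 2)%:E))%E.

(* The list of the (a, b, M) stands for the sum of the M 1_(a, b]. *)
Definition step_data : Type := seq (R * R * 'M[R]_d).

Definition step_wf (s : step_data) : Prop :=
  forall p, p \in s -> 0 <= p.1.1 <= p.1.2.

Definition step_fun (s : step_data) (x : R) : 'M[R]_d :=
  \sum_(p <- s) (if p.1.1 < x <= p.1.2 then p.2 else 0).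

Definition step_integral (s : step_data) X (w : Omega) : 'cV[R]_d :=
  \sum_(p <- s) p.2 *m (X p.1.2 w - X p.1.1 w).

(* L2 extension of the integral of step functions; Y is determined up to almost
   sure equality. *)
Definition wiener_integral W f Y : Prop :=
  measurable_vec Y /\
  exists s : nat -> step_data,
  [/\ forall k, step_wf (s k),
      (\int[mu]_(x in time)
         (`|f x - step_fun (s k) x| ^+ 2)%:E)%E @[k --> \oo] --> 0%E &
      L2dist Y (step_integral (s k) W) @[k --> \oo] --> 0%E].

(* Pathwise in w, coordinate by coordinate *)
Definition integral_upto f X (T : R) (w : Omega) : 'cV[R]_d :=
  \col_i \int[mu]_(x in `[0, T]) ((f x *m X x w) i 0).

(* Limit in L2(P) as T grows, hence Y is determined up to almost sure equality. *)
Definition noise_integral theta f Y : Prop :=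
  measurable_vec Y /\
  L2dist Y (integral_upto f theta T) @[T --> +oo] --> 0%E.

Definition ofbm D A1 A2 (W1 W2 : R -> Omega -> 'cV[R]_d) X : Prop :=
  forall t : R, exists Y1 Y2,
  [/\ wiener_integral W1 (G1 D A1 A2 ^~ t) Y1,
      wiener_integral W2 (G2 D A1 A2 ^~ t) Y2 &
      X t = (fun w => Y1 w + Y2 w)].

Definition ofbm_approx D A1 A2 (theta theta' : R -> Omega -> 'cV[R]_d) X :
    Prop :=
  forall t : R, 0 <= t <= 1 -> exists Y1 Y2,
  [/\ noise_integral theta (G1 D A1 A2 ^~ t) Y1,
      noise_integral theta' (G2 D A1 A2 ^~ t) Y2 &
      X t = (fun w => Y1 w + Y2 w)].

Definition law_support Y : set 'cV[R]_d :=
  [set x | forall U : set 'cV[R]_d, open U -> U x -> (0 < P (Y @^-1` U))%E].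

Definition proper_process X : Prop :=
  forall t : R, t != 0 -> forall (u : 'rV[R]_d) (c : R), u != 0 ->
    ~ (law_support (X t) `<=` [set x | (u *m x) 0 0 = c]).

End integrals.

Section path_space.
Context (R : realType) (d : nat).

Definition unit_itv : set R := `[0, 1].

(* ArrowAsUniformType provides the topology of uniform convergence. *)
Definition Cspace : Type := continuousType unit_itv 'cV[R]_d.

Import ArrowAsUniformType.
HB.instance Definition _ :=
  Uniform.copy Cspace (continuousType unit_itv 'cV[R]_d).
HB.instance Definition _ := isPointed.Build Cspace (cst 0).

End path_space.

Section weak_convergence.
Context {R : realType}.

Definition borel (T : ptopologicalType) := g_sigma_algebraType (@open T).

Definition weak_cvg {T : ptopologicalType}
    (mu_ : nat -> probability (borel T) R) (mu : probability (borel T) R) :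
    Prop :=
  forall f : T -> R, continuous f -> bounded_fun f ->
    (\int[mu_ n]_x (f x)%:E)%E @[n --> \oo] --> (\int[mu]_x (f x)%:E)%E.

Definition continuous_version {dO} {Omega : measurableType dO}
    (P : probability Omega R) {d} (X : R -> Omega -> 'cV[R]_d)
    (Xc : {RV P >-> borel (Cspace R d)}) : Prop :=
  forall t : @unit_itv R,
    {ae P, forall w, (Xc w : Cspace R d) t = X (val t) w}.

End weak_convergence.

(* Main.v *)
Require Import Defs.
From HB Require Import structures.
From mathcomp Require Import all_boot all_order all_algebra.
From mathcomp Require Import complex.
From mathcomp Require Import all_classical all_reals all_analysis.
From mathcomp Require Import measurable_realfun.
From mathcomp Require Import ring lra zify.

Set Implicit Arguments.
Unset Strict Implicit.
Unset Printing Implicit Defensive.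

Import Order.TTheory GRing.Theory Num.Theory.
Import numFieldNormedType.Exports.

Local Open Scope classical_set_scope.
Local Open Scope ring_scope.

(* Weak convergence on the path space is tested on bounded functionals that are
   Lipschitz for the uniform distance. Such a functional moves little when a path
   is replaced by its dyadic interpolation, by the chaining argument and the bound
   E |X_n(t) - X_n(s)|^p <= C (t - s)^2, uniform in n; so only the values at finitely
   many dyadic times matter. The moment bound comes from the exponential moments of
   the integrals of the signs (-1)^N against square integrable functions, and from
   the Hoelder continuity of t |-> G_i(., t) in L2, which holds because the entries
   of x^(-(D - I/2)) are bounded by powers of x given by the real parts of the
   eigenvalues of D.
   At finitely many times, replacing G_i(., t) by a step function on a regular grid
   costs little in L2, uniformly in n, for the Brownian integrals and for the
   telegraph ones alike. What remains is the convergence of the increments of the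
   integrated telegraph processes to those of independent Brownian motions; it is
   the Lindeberg exchange of the blocks of a Markov chain of signs with Gaussian
   variables, one block at a time. *)

(** The difficulty is uniformity in n. For each n the signs are sampled with a mesh dt that goes to
    0 first, so the chain estimates are asked only when 2 n dt <= 1, and the constants that remain
    do not depend on n. In the exponential moment the second-order cost of one step carries the
    factor 1 - rho, with rho = exp(- 2 n dt); it keeps the sum of the costs bounded as the number of
    steps grows. All powers p are then available, and p is taken to be twice the inverse of the
    Hoelder exponent of the kernels, which produces the square of t - s. Successive blocks are
    dependent, since each inherits the last sign of the previous one. That sign enters the mean of a
    block only, by at most 1 / (2 sqrt n), the integral of sqrt n exp(- 2 n t) over t > 0; the
    second moment is the same for both signs. Estimates that hold for every initial sign therefore
    allow the exchanges to follow one another. Independence is assumed of the noises rather than of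
    the Poisson processes behind them; flips are recovered from products of noise values. *)

(** * Integrals of bounded functions against a probability *)

Section bounded_integration.
Context {dT : measure_display} {T : measurableType dT} {R : realType}.
Variable P : probability T R.
Implicit Types (F G : T -> R).

Lemma bounded_integrable (B : R) F : measurable_fun setT F ->
  (forall x, `|F x| <= B) -> P.-integrable setT (EFin \o F).
Proof.
move=> mF bF; apply: measurable_bounded_integrable => //.
  by rewrite -ge0_fin_numE// fin_num_measure.
exists B; split; first exact: num_real.
by move=> M BM x _ /=; rewrite (le_trans (bF x))// ltW.
Qed.

Lemma Rintegral_EFin (B : R) F : measurable_fun setT F ->
  (forall x, `|F x| <= B) ->
  (\int[P]_x (F x)%:E = (\int[P]_x F x)%:E)%E.
Proof.
move=> mF bF; rewrite /Rintegral fineK//.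
exact/integrable_fin_num/(bounded_integrable mF bF).
Qed.

Lemma Rintegral_probability_cst (c : R) : \int[P]_x c = c.
Proof. by rewrite /Rintegral integral_cst//= probability_setT mule1. Qed.

Lemma Rintegral_dominated_cvg (B : R) (F_ : nat -> T -> R) F :
  (forall n, measurable_fun setT (F_ n)) -> (forall n x, `|F_ n x| <= B) ->
  (forall x, F_ n x @[n --> \oo] --> F x) ->
  \int[P]_x F_ n x @[n --> \oo] --> \int[P]_x F x.
Proof.
move=> mF bF cF.
have mFl : measurable_fun setT F.
  by apply: (@measurable_realfun.measurable_fun_cvg _ _ _ _ F_) => // x _; exact: cF.
have bFl x : `|F x| <= B.
  have cn : `|F_ n x| @[n --> \oo] --> `|F x| by apply: cvg_norm; exact: cF.
  rewrite -(cvg_lim _ cn)//; apply: limr_le; first by apply/cvg_ex; exists `|F x|.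
  by near=> n; exact: bF.
have : (\int[P]_x (F_ n x)%:E)%E @[n --> \oo] --> (\int[P]_x (F x)%:E)%E.
  apply: (@dominated_cvg _ _ _ P _ measurableT (fun n x => (F_ n x)%:E)
    (fun x => (F x)%:E) (cst B%:E)) => //.
  - by move=> n; apply/measurable_EFinP.
  - by move=> x _; apply/cvg_EFin; [by near=> n|exact: cF].
  - apply: (@bounded_integrable `|B|) => //=.
  - by move=> n x _; rewrite lee_fin; exact: bF.
rewrite (Rintegral_EFin mFl bFl).
under eq_cvg do rewrite (Rintegral_EFin (mF _) (bF _)).
by move/fine_cvg.
Unshelve. all: by end_near. Qed.

Lemma le_Rintegral_bounded (B B' : R) F G : measurable_fun setT F ->
  (forall x, `|F x| <= B) -> measurable_fun setT G ->
  (forall x, `|G x| <= B') -> (forall x, F x <= G x) ->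
  \int[P]_x F x <= \int[P]_x G x.
Proof.
move=> mF bF mG bG FG; apply: le_Rintegral => //.
  exact: bounded_integrable bF.
exact: bounded_integrable bG.
Qed.

Lemma Rintegral_dist_le (B B' : R) F G (h : T -> \bar R) :
  measurable_fun setT F -> (forall x, `|F x| <= B) ->
  measurable_fun setT G -> (forall x, `|G x| <= B') ->
  measurable_fun setT h -> (forall x, (`|F x - G x|%:E <= h x)%E) ->
  ((`|\int[P]_x F x - \int[P]_x G x|)%:E <= \int[P]_x h x)%E.
Proof.
move=> mF bF mG bG mh FGh.
have iF := bounded_integrable mF bF; have iG := bounded_integrable mG bG.
rewrite -RintegralB//.
have iFG : P.-integrable setT (EFin \o (F \- G)).
  by rewrite (_ : _ \o _ = (EFin \o F) \- (EFin \o G))%E//; exact: integrableB.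
rewrite EFin_normr_Rintegral//.
apply: (le_trans (le_abse_integral _ _ _)) => //.
  exact: measurable_int iFG.
apply: ge0_le_integral => //=.
by apply/measurable_EFinP; apply: measurableT_comp => //; exact: measurable_funB.
Qed.

(** Young's inequality t <= e / 2 + t^2 / (2 e) turns the mean of [|D|] into a mean square. It is
    sharp at t = e, which gives the exact factor [L * e]. *)
Lemma Rintegral_dist_L2 (B B' L e : R) F G (D : T -> R) : 0 < e -> 0 <= L ->
  measurable_fun setT F -> (forall x, `|F x| <= B) ->
  measurable_fun setT G -> (forall x, `|G x| <= B') ->
  measurable_fun setT D -> (forall x, `|F x - G x| <= L * `|D x|) ->
  (\int[P]_x (`|D x| ^+ 2)%:E <= (e ^+ 2)%:E)%E ->
  `|\int[P]_x F x - \int[P]_x G x| <= L * e.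
Proof.
move=> e0 L0 mF bF mG bG mD FGD De.
have mD2 : measurable_fun setT (fun x => `|D x| ^+ 2).
  by apply: measurable_funX; exact: measurableT_comp.
pose k := L / 2 / e.
have k0 : 0 <= k by rewrite !divr_ge0// ltW.
rewrite -lee_fin; apply: le_trans.
  apply: (@Rintegral_dist_le B B' F G
    (fun x => (L * e / 2)%:E + k%:E * (`|D x| ^+ 2)%:E)%E) => //.
  - apply: emeasurable_funD => //; apply: measurable_funeM.
    exact/measurable_EFinP.
  - move=> x; rewrite -EFinM -EFinD lee_fin (le_trans (FGD x))//.
    have -> : L * e / 2 + k * `|D x| ^+ 2 =
        L * `|D x| + k * (`|D x| - e) ^+ 2.
      by rewrite /k; field; rewrite gt_eqF.
    by rewrite lerDl mulr_ge0// sqr_ge0.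
rewrite ge0_integralD//; last 3 first.
  - by move=> x _; rewrite lee_fin mulr_ge0// mulr_ge0// ltW.
  - by move=> x _; rewrite -EFinM lee_fin mulr_ge0// exprn_ge0.
  - apply: measurable_funeM; exact/measurable_EFinP.
rewrite integral_cst//= probability_setT mule1 ge0_integralZl//; last exact/measurable_EFinP.
apply: (@le_trans _ _ ((L * e / 2)%:E + k%:E * (e ^+ 2)%:E)%E).
  by rewrite leeD2l// lee_wpmul2l// lee_fin.
rewrite -EFinM -EFinD lee_fin le_eqVlt; apply/orP; left; apply/eqP.
by rewrite /k; field; rewrite gt_eqF.
Qed.

Lemma Rintegral_distribution dS (S : measurableType dS)
    (X : {RV P >-> S}) (F : S -> R) (B : R) :
  measurable_fun setT F -> (forall x, `|F x| <= B) ->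
  \int[distribution P X]_x F x = \int[P]_x F (X x).
Proof.
move=> mF bF; rewrite /Rintegral; congr fine.
rewrite integral_distribution//; first exact/measurable_EFinP.
apply: (@bounded_integrable B) => //.
exact: measurableT_comp.
Qed.

End bounded_integration.

(** * Reduction to Lipschitz functionals *)

Section cspace.
Context {R : realType} {d : nat}.
Implicit Types (f g : Cspace R d).

Lemma cspace_nbhsP f (A : set (Cspace R d)) :
  nbhs f A <->
  exists2 e : R, 0 < e & forall g, (forall t, `|f t - g t| < e) -> A g.
Proof.
split.
  rewrite -nbhs_entourageE => -[B [C [E entE EC] CB] BA].
  move: entE; rewrite -entourage_ballE => -[e /= e0 eE].
  exists e => // g fg; apply: BA; rewrite /xsection/= inE.
  by apply: CB; apply: EC => t /=; apply: eE => /=; rewrite -ball_normE/=.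
case=> e e0 eA; rewrite -nbhs_entourageE.
exists [set fg : Cspace R d * Cspace R d | forall t, ball (fg.1 t) e (fg.2 t)].
  exists [set fg : (@unit_itv R -> 'cV[R]_d) * (@unit_itv R -> 'cV[R]_d) |
    forall t, ball (fg.1 t) e (fg.2 t)].
    exists [set xy | ball xy.1 e xy.2] => //.
    by rewrite -entourage_ballE; exists e.
  by move=> [].
move=> g /=; rewrite /xsection/= inE/= => fg; apply: eA => t.
by have := fg t; rewrite -ball_normE.
Qed.

Lemma cspace_continuousP (F : Cspace R d -> R) :
  continuous F <-> forall f e, 0 < e ->
    exists2 r, 0 < r & forall g, (forall t, `|f t - g t| < r) -> `|F f - F g| < e.
Proof.
split.
  move=> cF f e e0.
  have /cvgrPdist_lt/(_ e e0)/cspace_nbhsP[r r0 rP] := cF f.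
  by exists r.
move=> H f A /nbhs_ballP[e /= e0 eA]; have [r r0 rP] := H f e e0.
by apply/cspace_nbhsP; exists r => // g /rP fg; exact: eA.
Qed.

End cspace.

Section lipschitz_test_functions.
Context {R : realType} {d : nat}.
Implicit Types (f g w : Cspace R d) (F : Cspace R d -> R).

(** An upper bound for the uniform distance, kept as a relation so that no supremum has to be
    formed. *)
Definition unif_near (e : R) f g := forall t, `|f t - g t| <= e.

Definition unif_lipschitz (k : R) F :=
  forall f g e, 0 <= e -> unif_near e f g -> `|F f - F g| <= k * e.

Lemma unif_lipschitz_continuous k F : 0 <= k -> unif_lipschitz k F ->
  continuous F.
Proof.
move=> k0 kF; apply/cspace_continuousP => f e e0.
have k1 : 0 < k + 1 by rewrite ltr_wpDl.
exists (e / (k + 1)); first by rewrite divr_gt0.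
move=> g fg; apply: (@le_lt_trans _ _ (k * (e / (k + 1)))).
  by apply: kF => [|t]; [rewrite divr_ge0// ltW|exact/ltW].
by rewrite mulrA ltr_pdivrMr// mulrC ltr_pM2l// ltrDl.
Qed.

Lemma continuous_borel_measurable F :
  continuous F -> measurable_fun setT (F : borel (Cspace R d) -> R).
Proof.
move=> /continuousP cF; apply: (measurability _ (RGenOpens.measurableE R)) => //.
move=> _ [_ [a [b ->] <-]]; rewrite setTI.
apply: sub_sigma_algebra; apply: cF; exact: interval_open.
Qed.

(** The Pasch-Hausdorff envelope, i.e. the infimum over g of F g + k dist(w, g). The distance is
    replaced by all its upper bounds, which leaves the infimum unchanged. *)
Definition inf_conv (k : R) F w : R :=
  inf [set F ge.1 + k * ge.2 |
       ge in [set ge : Cspace R d * R | 0 <= ge.2 /\ unif_near ge.2 w ge.1]].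

Variables (F : Cspace R d -> R) (B : R).
Hypothesis bF : forall w, `|F w| <= B.

Let conv_set k w := [set F ge.1 + k * ge.2 |
  ge in [set ge : Cspace R d * R | 0 <= ge.2 /\ unif_near ge.2 w ge.1]].

Let conv_set_self k w : conv_set k w (F w).
Proof.
exists (w, 0); last by rewrite /= mulr0 addr0.
by split=> //= t; rewrite subrr normr0.
Qed.

Let conv_set_lb k w : 0 <= k -> lbound (conv_set k w) (- B).
Proof.
move=> k0 _ [[g e] [/= e0 _] <-].
rewrite (@le_trans _ _ (F g))// ?lerDl ?mulr_ge0//.
by have := bF g; rewrite ler_norml => /andP[].
Qed.

Lemma inf_conv_le k w : 0 <= k -> inf_conv k F w <= F w.
Proof.
by move=> k0; apply: ge_inf; [exists (- B); exact: conv_set_lb|exact: conv_set_self].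
Qed.

Lemma inf_conv_norm_le k w : 0 <= k -> `|inf_conv k F w| <= B.
Proof.
move=> k0; rewrite ler_norml; apply/andP; split.
  by apply: lb_le_inf; [exists (F w); exact: conv_set_self|exact: conv_set_lb].
by rewrite (le_trans (inf_conv_le w k0))//; have := bF w; rewrite ler_norml => /andP[].
Qed.

Lemma inf_conv_lipschitz k : 0 <= k -> unif_lipschitz k (inf_conv k F).
Proof.
move=> k0.
have H f g e : 0 <= e -> unif_near e f g -> inf_conv k F f <= inf_conv k F g + k * e.
  move=> e0 fg; rewrite -lerBlDr; apply: lb_le_inf.
    by exists (F g); exact: conv_set_self.
  move=> _ [[h e'] [/= e'0 gh] <-]; rewrite lerBlDr -addrA -mulrDr.
  apply: ge_inf; first by exists (- B); exact: conv_set_lb.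
  exists (h, e' + e) => //=; split; first by rewrite addr_ge0.
  move=> t; rewrite (_ : f t - h t = (g t - h t) + (f t - g t)); last first.
    by rewrite [RHS]addrC subrKA.
  by rewrite (le_trans (ler_normD _ _))// lerD.
move=> f g e e0 fg; rewrite ler_distl; apply/andP; split.
  by rewrite lerBlDr; apply: H => // t; rewrite distrC; exact: fg.
exact: H.
Qed.

Lemma inf_conv_cvg : continuous F ->
  forall w, inf_conv n%:R F w @[n --> \oo] --> F w.
Proof.
move=> /cspace_continuousP cF w; apply/cvgrPdist_le => e e0.
have [r r0 rP] := cF w e e0.
have B0 : 0 <= B by rewrite (le_trans _ (bF w)).
near=> n.
have nr : B + B <= n%:R * r.
  by rewrite -ler_pdivrMr//; near: n; exact: nbhs_infty_ger.
rewrite ger0_norm; last by rewrite subr_ge0 inf_conv_le.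
rewrite lerBlDl -lerBlDr; apply: lb_le_inf.
  by exists (F w); exact: conv_set_self.
move=> _ [[g s] [/= s0 wg] <-].
(* A competitor near w has almost the value F w by continuity; a far one pays at least n r >= 2 B,
   as much as F can oscillate. *)
have [sr|rs] := ltP s r.
  have : `|F w - F g| < e by apply: rP => t; exact: le_lt_trans (wg t) sr.
  rewrite ltr_distl => /andP[_ /ltW h]; rewrite lerBlDr (le_trans h)//.
  by rewrite addrAC lerDl mulr_ge0.
have : n%:R * r <= n%:R * s by rewrite ler_wpM2l.
have := bF w; have := bF g; rewrite !ler_norml => /andP[h1 _] /andP[_ h2].
by move=> h3; move: e0 h1 h2 h3 nr; lra.
Unshelve. all: by end_near. Qed.

End lipschitz_test_functions.

Section weak_cvg_lipschitz.
Context {R : realType} {d : nat}.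
Variables (mu_ : nat -> probability (borel (Cspace R d)) R)
  (mu : probability (borel (Cspace R d)) R).
Hypothesis mu_cvg : forall (F : Cspace R d -> R) (k B : R),
  0 <= k -> unif_lipschitz k F -> (forall w, `|F w| <= B) ->
  \int[mu_ n]_x F x @[n --> \oo] --> \int[mu]_x F x.

(** A single inequality comes out because the Lipschitz envelopes increase to F from below; the
    opposite one is this statement for - F. *)
Let weak_cvg_half (F : Cspace R d -> R) (B e : R) : continuous F ->
  (forall w, `|F w| <= B) -> 0 < e ->
  \forall n \near \oo, \int[mu]_x F x <= \int[mu_ n]_x F x + e.
Proof.
move=> cF bF e0.
have mF := continuous_borel_measurable cF.
have mK k : measurable_fun setT (inf_conv k%:R F : borel (Cspace R d) -> R).
  apply: continuous_borel_measurable.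
  by apply: unif_lipschitz_continuous (inf_conv_lipschitz bF _).
have bK k x : `|inf_conv k%:R F x| <= B by exact: inf_conv_norm_le.
have e20 : 0 < e / 2 by rewrite divr_gt0.
have /cvgrPdist_le/(_ _ e20) := Rintegral_dominated_cvg (P := mu) mK bK
  (inf_conv_cvg bF cF).
case=> k _ /(_ k (leqnn k)) /=; rewrite ler_distl => /andP[_ hk].
have /cvgrPdist_le/(_ _ e20) := mu_cvg (ler0n _ k)
  (inf_conv_lipschitz bF (ler0n _ k)) (bK k).
apply: filterS => n; rewrite ler_distl => /andP[_ hn].
have h : \int[mu_ n]_x inf_conv k%:R F x <= \int[mu_ n]_x F x.
  apply: (le_Rintegral_bounded _ (mK k) (bK k) mF bF) => x.
  exact: inf_conv_le.
by move: hk hn h; lra.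
Qed.

Lemma weak_cvg_lipschitz : weak_cvg mu_ mu.
Proof.
move=> F cF [B0 [_ /(_ (`|B0| + 1))]].
rewrite ltr_pwDr// ?ler_norm// => /(_ isT) bF.
set B := `|B0| + 1 in bF.
have {}bF w : `|F w| <= B by exact: bF.
have mF := continuous_borel_measurable cF.
rewrite (Rintegral_EFin mu mF bF).
under eq_cvg do rewrite (Rintegral_EFin (mu_ _) mF bF).
apply/cvg_EFin; first by near=> n.
apply/cvgrPdist_le => e e0 /=.
have cNF : continuous (fun x => - F x) .
  apply/cspace_continuousP => f r r0.
  have [s s0 sP] := (cspace_continuousP F).1 cF f r r0.
  by exists s => // g /sP; rewrite -opprD normrN.
have bNF w : `|- F w| <= B by rewrite normrN.
have NE (nu : probability (borel (Cspace R d)) R) :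
    \int[nu]_x (- F x) = - \int[nu]_x F x.
  rewrite -mulN1r -RintegralZl//; last exact: bounded_integrable mF bF.
  by apply: eq_Rintegral => x _; rewrite mulN1r.
near=> n.
rewrite ler_distl; apply/andP; split.
  have : \int[mu]_x - F x <= \int[mu_ n]_x (- F x) + e.
    by near: n; exact: weak_cvg_half bNF e0.
  by rewrite !NE; lra.
by near: n; exact: weak_cvg_half bF e0.
Unshelve. all: by end_near. Qed.

End weak_cvg_lipschitz.

(** * Dyadic interpolation and chaining *)

Section interpolation.
Context {R : realType} {d : nat}.
Implicit Types (v : nat -> 'cV[R]_d) (w : R -> 'cV[R]_d).

Definition clamp01 (x : R) : R := Num.min 1 (Num.max 0 x).

Lemma clamp01_ge0 x : 0 <= clamp01 x.
Proof. by rewrite /clamp01 le_min ler01 le_max lexx. Qed.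

Lemma clamp01_le1 x : clamp01 x <= 1.
Proof. by rewrite /clamp01 ge_min lexx. Qed.

Lemma clamp01_id x : 0 <= x <= 1 -> clamp01 x = x.
Proof. by move=> /andP[x0 x1]; rewrite /clamp01 max_r// min_r. Qed.

Lemma clamp01_eq1 x : 1 <= x -> clamp01 x = 1.
Proof. by move=> x1; rewrite /clamp01 min_l// le_max x1 orbT. Qed.

Lemma clamp01_eq0 x : x <= 0 -> clamp01 x = 0.
Proof. by move=> x0; rewrite /clamp01 max_l// min_r. Qed.

Lemma continuous_clamp01 : continuous clamp01.
Proof.
move=> x; apply: continuous_min; first exact: cvg_cst.
by apply: continuous_max; [exact: cvg_cst|exact: cvg_id].
Qed.

Definition dyadic (m k : nat) : R := k%:R / (2 ^ m)%:R.

Lemma dyadic_itv m k : (k <= 2 ^ m)%N -> 0 <= dyadic m k <= 1.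
Proof.
move=> km; rewrite /dyadic divr_ge0//=.
by rewrite ler_pdivrMr// mul1r ler_nat.
Qed.

Lemma dyadicS m k : dyadic m.+1 k.*2 = dyadic m k.
Proof.
rewrite /dyadic -mul2n expnS !natrM invfM mulrACA divff ?mul1r// pnatr_eq0.
Qed.

(** Piecewise linear interpolation written as accumulated increments: the clamped factor is 1 on the
    cells already crossed and 0 on those to come. Continuity in t and the Lipschitz bound in v are
    then read term by term. *)
Definition interp (m : nat) v (t : R) : 'cV[R]_d :=
  v 0%N + \sum_(0 <= k < 2 ^ m) clamp01 ((2 ^ m)%:R * t - k%:R) *: (v k.+1 - v k).

Lemma continuous_interp m v : continuous (interp m v).
Proof.
move=> t; apply: cvgD; first exact: cvg_cst.
apply: cvg_big => [|k _]; first exact: add_continuous.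
apply: cvgZr_tmp.
apply: (@cvg_comp _ _ _ (fun x => (2 ^ m)%:R * x - k%:R) clamp01); last first.
  exact: continuous_clamp01.
apply: cvgB; last exact: cvg_cst.
by apply: cvgMr; exact: cvg_id.
Qed.

(** The constant grows with m, which is harmless: m is fixed before n tends to infinity. *)
Lemma interp_lipschitz m v v' (e : R) t : 0 <= e ->
  (forall k, (k <= 2 ^ m)%N -> `|v k - v' k| <= e) ->
  `|interp m v t - interp m v' t| <= (1 + (2 ^ m)%:R * 2) * e.
Proof.
move=> e0 vv'; rewrite /interp opprD addrACA -sumrB.
rewrite (le_trans (ler_normD _ _))// mulrDl mul1r lerD ?vv'//.
rewrite (le_trans (ler_norm_sum _ _ _))//.
apply: (@le_trans _ _ (\sum_(0 <= k < 2 ^ m) (2 * e))); last first.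
  by rewrite sumr_const_nat subn0 -[_ *+ (2 ^ m)]mulr_natl mulrA.
rewrite big_nat [X in _ <= X]big_nat; apply: ler_sum => k /andP[_ km].
rewrite -scalerBr normrZ ger0_norm ?clamp01_ge0//.
rewrite -[X in _ <= X]mul1r ler_pM// ?clamp01_ge0 ?clamp01_le1//.
rewrite (_ : _ - _ = (v k.+1 - v' k.+1) - (v k - v' k)); last first.
  by rewrite !opprB [LHS]addrACA [RHS]addrACA; congr (_ + _); exact: addrC.
rewrite (le_trans (ler_normB _ _))// mulr_natl mulr2n lerD// vv'//.
exact: ltnW.
Qed.

(** The value k = 2 ^ m occurs at t = 1 only, where no cell is left; hence the conditional. *)
Lemma interpE m v t : 0 <= t <= 1 -> forall k,
  k = Num.truncn ((2 ^ m)%:R * t) ->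
  interp m v t = v k +
    (if (k < 2 ^ m)%N then ((2 ^ m)%:R * t - k%:R) *: (v k.+1 - v k) else 0).
Proof.
move=> /andP[t0 t1] k kE; rewrite /interp.
have x0 : 0 <= (2 ^ m)%:R * t by rewrite mulr_ge0.
have := truncn_itv x0; rewrite -kE => /andP[kx xk].
have km : (k <= 2 ^ m)%N.
  by rewrite -(ler_nat R) (le_trans kx)// ler_piMr.
rewrite (big_cat_nat (leq0n k) km)/=.
have -> : \sum_(0 <= i < k) clamp01 ((2 ^ m)%:R * t - i%:R) *: (v i.+1 - v i) =
    v k - v 0%N.
  rewrite -telescope_sumr// big_nat [RHS]big_nat; apply: eq_bigr => i /andP[_ ik].
  rewrite clamp01_eq1 ?scale1r// lerBrDr (le_trans _ kx)//.
  by rewrite addrC natr1 ler_nat.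
rewrite addrA [v 0%N + _]addrC subrK; congr (_ + _).
case: ifPn => [km'|]; last by rewrite -leqNgt => h; rewrite big_geq.
rewrite big_ltn// big_nat big1 ?addr0 => [|i /andP[ki _]]; last first.
  rewrite clamp01_eq0 ?scale0r// subr_le0 (le_trans (ltW xk))// ler_nat//.
rewrite clamp01_id// subr_ge0 kx/= lerBlDr.
by rewrite addrC natr1 ltW.
Qed.

Lemma interp_dist m w t : 0 <= t <= 1 -> forall k,
  k = Num.truncn ((2 ^ m)%:R * t) ->
  `|w t - interp m (fun k => w (dyadic m k)) t| <= `|w t - w (dyadic m k)| +
    (if (k < 2 ^ m)%N then `|w (dyadic m k.+1) - w (dyadic m k)| else 0).
Proof.
move=> t01 k kE; rewrite (interpE _ t01 kE) opprD addrA.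
rewrite (le_trans (ler_normD _ _))// lerD// normrN.
case: ifPn => [km'|]; last by rewrite normr0.
have x0 : 0 <= (2 ^ m)%:R * t by rewrite mulr_ge0//; case/andP: t01.
have := truncn_itv x0; rewrite -kE => /andP[kx xk].
rewrite normrZ ger0_norm ?subr_ge0// ler_piMl//.
by rewrite lerBlDr addrC natr1 ltW.
Qed.

Lemma dyadic_truncn_near m t : 0 <= t ->
  `|t - dyadic m (Num.truncn ((2 ^ m)%:R * t))| <= (2 ^ m)%:R^-1.
Proof.
move=> t0; have x0 : 0 <= (2 ^ m)%:R * t by rewrite mulr_ge0.
have := truncn_itv x0; set k := Num.truncn _ => /andP[kx xk].
have e : t = ((2 ^ m)%:R * t) / (2 ^ m)%:R by rewrite mulrC mulKf// gt_eqF.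
rewrite {1}e /dyadic -mulrBl normrM [X in _ * X]ger0_norm ?invr_ge0//.
rewrite ler_piMl ?invr_ge0// ger0_norm ?subr_ge0//.
by rewrite lerBlDr addrC natr1 ltW.
Qed.

Lemma dyadic_truncn_le m (t : R) : 0 <= t <= 1 ->
  (Num.truncn ((2 ^ m)%:R * t) <= 2 ^ m)%N.
Proof.
move=> /andP[t0 t1]; have x0 : 0 <= (2 ^ m)%:R * t by rewrite mulr_ge0.
have := truncn_itv x0; set k := Num.truncn _ => /andP[kx xk].
by rewrite -(ler_nat R) (le_trans kx)// ler_piMr.
Qed.

Lemma truncn_double (x : R) : 0 <= x ->
  Num.truncn (2 * x) = (Num.truncn x).*2 \/
  Num.truncn (2 * x) = (Num.truncn x).*2.+1.
Proof.
move=> x0; have := truncn_itv x0; set k := Num.truncn x => /andP[kx xk].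
have x20 : 0 <= 2 * x by rewrite mulr_ge0.
have := truncn_itv x20; set l := Num.truncn (2 * x) => /andP[lx xl].
have h1 : (k.*2 < l.+1)%N.
  rewrite -(ltr_nat R); apply: le_lt_trans xl.
  by rewrite -mul2n natrM ler_pM2l.
have h2 : (l < k.*2.+2)%N.
  rewrite -(ltr_nat R); apply: (le_lt_trans lx).
  by rewrite -doubleS -mul2n natrM ltr_pM2l.
move: h1; rewrite ltnS leq_eqVlt => /orP[/eqP <-|h1]; first by left.
by right; apply/eqP; rewrite eqn_leq h1 andbT -ltnS.
Qed.

(* A path is controlled by its increments over dyadic intervals: the dyadic
   approximations of t from below move by at most one step at each level. *)
Lemma interp_chaining (a : nat -> R) m w t (S : R) : 0 <= t <= 1 ->
  {for t, continuous w} ->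
  (forall j, 0 <= a j) ->
  (forall j k, (k < 2 ^ j)%N -> `|w (dyadic j k.+1) - w (dyadic j k)| <= a j) ->
  (forall J, \sum_(m <= j < J) a j <= S) ->
  `|w t - interp m (fun k => w (dyadic m k)) t| <= S.
Proof.
move=> t01 cw a0 aP SP; have /andP[t0 t1] := t01.
pose T j := dyadic j (Num.truncn ((2 ^ j)%:R * t)).
have step j : `|w (T j.+1) - w (T j)| <= a j.+1.
  rewrite /T; have := @truncn_double ((2 ^ j)%:R * t).
  rewrite mulrA -natrM -expnS => /(_ _)[|e|e]; first by rewrite mulr_ge0.
    by rewrite e dyadicS subrr normr0.
  rewrite e -[dyadic j _]dyadicS; apply: aP.
  rewrite expnS mul2n ltn_double.
  by have := dyadic_truncn_le j.+1 t01; rewrite e expnS mul2n; lia.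
have cT : w (T j) @[j --> \oo] --> w t.
  apply: (cvg_comp T w _ cw); apply/cvgrPdist_le => e e0.
  near=> j; apply: (le_trans (dyadic_truncn_near j t0)).
  rewrite -[e]invrK lef_pV2 ?posrE ?invr_gt0//.
  apply: (@le_trans _ _ j%:R); first by near: j; exact: nbhs_infty_ger.
  by rewrite ler_nat ltnW// ltn_expl.
have chain J : (m <= J)%N -> `|w (T J) - w (T m)| <= \sum_(m.+1 <= j < J.+1) a j.
  move=> /subnK <-; elim: (J - m)%N => [|i IH].
    by rewrite add0n subrr normr0 big_geq.
  rewrite addSn big_nat_recr//=; last by rewrite ltnS leq_addl.
  rewrite -(subrKA (w (T (i + m)%N))) addrC.
  by rewrite (le_trans (ler_normD _ _))// lerD// step.
(* One copy of [a m] is set aside for the cell of level m that contains t, across which the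
   interpolation itself moves. *)
have le_S : `|w t - w (T m)| <= S - a m.
  have cn : `|w (T j) - w (T m)| @[j --> \oo] --> `|w t - w (T m)|.
    by apply: cvg_norm; apply: cvgB => //; exact: cvg_cst.
  rewrite -(cvg_lim _ cn)//; apply: limr_le; first by apply/cvg_ex; eexists; exact: cn.
  near=> J; have mJ : (m <= J)%N by near: J; exact: nbhs_infty_ge.
  rewrite (le_trans (chain _ mJ))// lerBrDl.
  by have := SP J.+1; rewrite big_ltn.
apply: (le_trans (interp_dist w t01 erefl)).
have -> : S = (S - a m) + a m by rewrite subrK.
apply: lerD => //; case: ifPn => // km; exact: aP.
Unshelve. all: by end_near. Qed.

Lemma interp_cvg_unif w (e : R) : continuous w -> 0 < e ->
  \forall m \near \oo, forall t, 0 <= t <= 1 ->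
    `|w t - interp m (fun k => w (dyadic m k)) t| <= e.
Proof.
move=> cw e0.
(* Compactness in its near-covering form plays the role of uniform continuity: a bound valid near
   each point for large m becomes uniform over the interval. *)
have cpt : compact (`[0 : R, 1]%classic) by exact: segment_compact.
have := (compact_near_coveringP _).1 cpt nat \oo
  (fun m t => 0 <= t <= 1 -> `|w t - interp m (fun k => w (dyadic m k)) t| <= e) _.
have H : forall x : R, `[0 : R, 1]%classic x ->
    \forall x' \near x & i \near \oo, 0 <= x' <= 1 ->
      `|w x' - interp i (fun k : nat => w (dyadic i k)) x'| <= e.
  move=> x _.
  have e4 : 0 < e / 4 by rewrite divr_gt0.
  have /cvgrPdist_le/(_ _ e4)/nbhs_ballP[r /= r0 rP] := cw x.
  have r2 : 0 < r / 2 by rewrite divr_gt0.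
  exists (ball x (r / 2), [set m | ((2 ^ m)%:R : R)^-1 < r / 2]).
    split => /=; first exact: nbhsx_ballx.
    near=> j; rewrite /= -[r / 2]invrK ltf_pV2 ?posrE ?invr_gt0//.
    apply: (@le_lt_trans _ _ j%:R); first by near: j; exact: nbhs_infty_ger.
    by rewrite ltr_nat ltn_expl.
  move=> [t m] [/= xt mr] t01; have /andP[t0 t1] := t01.
  have near_pt s : `|t - s| <= (2 ^ m)%:R^-1 -> `|w x - w s| <= e / 4.
    move=> ts; apply: rP; rewrite -ball_normE /=.
    rewrite -(subrKA t) (le_lt_trans (ler_normD _ _))//.
    move: xt; rewrite -ball_normE/= => xt.
    by rewrite [r](splitr r) ltrD// (le_lt_trans ts).
  have d2 s s' : `|t - s| <= (2 ^ m)%:R^-1 -> `|t - s'| <= (2 ^ m)%:R^-1 ->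
      `|w s - w s'| <= e / 2.
    move=> h h'; rewrite -(subrKA (w x)) (le_trans (ler_normD _ _))//.
    rewrite distrC (_ : e / 2 = e / 4 + e / 4); last by field.
    by rewrite lerD// near_pt.
  apply: (le_trans (interp_dist w t01 erefl)).
  have ht := dyadic_truncn_near m t0.
  rewrite [e]splitr; apply: lerD.
    by apply: d2 => //; rewrite subrr normr0 invr_ge0.
  case: ifPn => [km|_]; last by rewrite divr_ge0// ltW.
  apply: d2 => //.
  have x0 : 0 <= (2 ^ m)%:R * t by rewrite mulr_ge0.
  have := truncn_itv x0; set k := Num.truncn _ => /andP[kx xk].
  have et : t = ((2 ^ m)%:R * t) / (2 ^ m)%:R by rewrite mulrC mulKf// gt_eqF.
  rewrite {1}et /dyadic -mulrBl normrM [X in _ * X]ger0_norm ?invr_ge0//.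
  rewrite ler_piMl ?invr_ge0// distrC ger0_norm; last first.
    by rewrite subr_ge0 ltW.
  by rewrite lerBlDr -natr1 addrC lerD2l.
move=> /(_ _ H).
by apply: filterS => m hm t t01; apply: hm => //=; rewrite in_itv.
Unshelve. all: by end_near. Qed.

End interpolation.

Section path_evaluation.
Context {R : realType} {d : nat}.
Implicit Types (f g : Cspace R d).

Fact unit_pt_subproof (t : R) : Num.max 0 (Num.min 1 t) \in @unit_itv R.
Proof.
by apply/mem_set; rewrite /unit_itv/= in_itv/= le_max lexx/= ge_max ler01/= ge_min lexx.
Qed.

Definition unit_pt (t : R) : @unit_itv R :=
  exist (fun x => x \in @unit_itv R) _ (unit_pt_subproof t).

(** Constant beyond both ends of the unit interval, so that a path becomes a continuous function of
    a real time. *)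
Definition ev f (t : R) : 'cV[R]_d := f (unit_pt t).

Lemma val_unit_pt t : 0 <= t <= 1 -> val (unit_pt t) = t.
Proof. by move=> /andP[t0 t1] /=; rewrite min_r// max_r. Qed.

Lemma unit_ptK (t : @unit_itv R) : unit_pt (val t) = t.
Proof.
apply/val_inj; rewrite val_unit_pt//.
by have := set_valP t; rewrite /unit_itv/= in_itv.
Qed.

Lemma unit_itvP (t : @unit_itv R) : 0 <= val t <= 1.
Proof. by have := set_valP t; rewrite /unit_itv/= in_itv. Qed.

Lemma continuous_ev f : continuous (ev f).
Proof.
have cpt : continuous unit_pt.
  apply: continuous_comp_initial => t /=.
  apply: continuous_max; first exact: cvg_cst.
  by apply: continuous_min; [exact: cvg_cst|exact: cvg_id].
by move=> t; apply: (continuous_comp (cpt t)); exact: cts_fun.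
Qed.

Lemma unif_near_ev e f g t : unif_near e f g -> `|ev f t - ev g t| <= e.
Proof. exact. Qed.

Lemma ev_coord_measurable t i :
  measurable_fun setT (fun f : borel (Cspace R d) => ev f t i 0).
Proof.
apply: continuous_borel_measurable.
apply: (@unif_lipschitz_continuous _ _ 1) => // f g e e0 fg; rewrite mul1r.
have := fg (unit_pt t); apply: le_trans.
rewrite [leRHS]mx_normrE (le_trans _ (le_bigmax _ _ (i, 0)))//= !mxE//.
Qed.

Lemma ev_dist_measurable s t :
  measurable_fun setT (fun f : borel (Cspace R d) => `|ev f s - ev f t|).
Proof.
apply: continuous_borel_measurable.
apply: (@unif_lipschitz_continuous _ _ 2) => // f g e e0 fg.
rewrite (le_trans (ler_dist_dist _ _))//.
rewrite (_ : _ - _ = (ev f s - ev g s) - (ev f t - ev g t)); last first.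
  by rewrite !opprB [LHS]addrACA [RHS]addrACA; congr (_ + _); exact: addrC.
by rewrite (le_trans (ler_normB _ _))// mulr_natl mulr2n lerD// unif_near_ev.
Qed.

Lemma continuous_interp_val (m : nat) (v : nat -> 'cV[R]_d) :
  continuous (fun t : @unit_itv R => interp m v (val t)).
Proof.
move=> t; apply: (@continuous_comp _ _ _ (fun t : @unit_itv R => val t)).
  exact: initial_continuous.
exact: continuous_interp.
Qed.

Definition interp_path (m : nat) (v : nat -> 'cV[R]_d) : Cspace R d :=
  mkcts (@continuous_interp_val m v).

Definition dyadic_values (m : nat) f : nat -> 'cV[R]_d :=
  fun k => ev f (dyadic m k).

Lemma interp_path_lipschitz F (k : R) m v v' e : 0 <= k ->
  unif_lipschitz k F -> 0 <= e ->
  (forall i, (i <= 2 ^ m)%N -> `|v i - v' i| <= e) ->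
  `|F (interp_path m v) - F (interp_path m v')| <=
    k * (1 + (2 ^ m)%:R * 2) * e.
Proof.
move=> k0 kF e0 vv'; rewrite -mulrA; apply: kF; first by rewrite mulr_ge0.
by move=> t; exact: interp_lipschitz.
Qed.

Lemma interp_dyadic_lipschitz F (k : R) m : 0 <= k -> unif_lipschitz k F ->
  unif_lipschitz (k * (1 + (2 ^ m)%:R * 2))
    (fun f => F (interp_path m (dyadic_values m f))).
Proof.
move=> k0 kF f g e e0 fg; apply: interp_path_lipschitz => // i _.
exact: unif_near_ev.
Qed.

End path_evaluation.

Lemma bernoulli_pow_ge {R : realType} (x : R) p : 0 <= x <= 1 ->
  1 - p%:R * x <= (1 - x) ^+ p.
Proof.
move=> /andP[x0 x1]; elim: p => [|p IH]; first by rewrite mul0r subr0 expr0.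
rewrite exprS (@le_trans _ _ ((1 - x) * (1 - p%:R * x)))//; last first.
  by rewrite ler_wpM2l// subr_ge0.
rewrite -natr1.
have -> : (1 - x) * (1 - p%:R * x) = 1 - (p%:R + 1) * x + p%:R * x ^+ 2 by ring.
by rewrite lerDl mulr_ge0// sqr_ge0.
Qed.

Section chaining.
Context {R : realType} {d : nat} {dT : measure_display} {T : measurableType dT}.
Variables (P : probability T R) (Y : {RV P >-> borel (Cspace R d)}).
Variables (p : nat) (C r : R).
Hypotheses (p0 : (0 < p)%N) (C0 : 0 <= C) (r01 : 0 < r < 1)
  (rp : 2^-1 <= r ^+ p).
Hypothesis moment : forall s t : R, 0 <= s <= 1 -> 0 <= t <= 1 ->
  (\int[P]_w (`|ev (Y w) t - ev (Y w) s| ^+ p)%:E <= (C * (t - s) ^+ 2)%:E)%E.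

Let D j i w := `|ev (Y w) (dyadic j i.+1) - ev (Y w) (dyadic j i)|.

(* [x <= l (1 + (x / l) ^ p)] bounds the largest increment of level j by a
   quantity whose mean is controlled by the p-th moments. *)
Let a j w := r ^+ j * (1 + \sum_(i < 2 ^ j) (r ^+ j) ^- p * D j i w ^+ p).

Let mD j i : measurable_fun setT (D j i).
Proof.
apply: (measurableT_comp (f := fun f : borel (Cspace R d) =>
  `|ev f (dyadic j i.+1) - ev f (dyadic j i)|)) => //.
exact: ev_dist_measurable.
Qed.

Let r0 : 0 < r. Proof. by case/andP: r01. Qed.

Let rj0 j : 0 < r ^+ j. Proof. by rewrite exprn_gt0. Qed.

Let D0 j i w : 0 <= D j i w. Proof. exact: normr_ge0. Qed.

Let term_ge0 j i w : 0 <= (r ^+ j) ^- p * D j i w ^+ p.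
Proof. by apply: mulr_ge0; [rewrite invr_ge0 exprn_ge0// ltW|exact: exprn_ge0]. Qed.

Let a0 j w : 0 <= a j w.
Proof.
apply: mulr_ge0; first exact: ltW.
by apply: addr_ge0 => //; apply: sumr_ge0 => i _; exact: term_ge0.
Qed.

Let D_le_a j k w : (k < 2 ^ j)%N -> D j k w <= a j w.
Proof.
move=> kj; rewrite /a -ler_pdivrMl//.
rewrite (bigD1 (Ordinal kj))//= addrA -[leLHS]addr0 lerD//; last first.
  by apply: sumr_ge0 => i _; exact: term_ge0.
have -> : r ^+ j ^- p * D j k w ^+ p = (r ^- j * D j k w) ^+ p.
  by rewrite exprMn exprVn.
set x := _ * D j k w; have x0 : 0 <= x by rewrite mulr_ge0// invr_ge0 ltW.
have [x1|x1] := leP x 1; first by rewrite (le_trans x1)// lerDl exprn_ge0.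
by rewrite -[leLHS]add0r lerD// -{1}[x]expr1 ler_eXn2l// ltW.
Qed.

Let ma j : measurable_fun setT (a j).
Proof.
apply: measurable_funM => //; apply: measurable_funD => //.
apply: measurable_sum => i; apply: measurable_funM => //.
exact: measurable_funX.
Qed.

(** There are 2^j increments, each of p-th moment at most C / 4^j and weighted by r^(- j p). Their
    sum is C (2 r^p)^(- j), at most C by the assumption [rp]. *)
Let integral_a j : (\int[P]_w (a j w)%:E <= (r ^+ j * (1 + C))%:E)%E.
Proof.
have mDp i : measurable_fun setT (fun w => (D j i w ^+ p)%:E).
  by apply/measurable_EFinP; exact: measurable_funX.
have ge0 i w : (0 <= ((r ^+ j) ^- p)%:E * (D j i w ^+ p)%:E)%E.
  by rewrite -EFinM lee_fin; exact: term_ge0.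
under eq_integral => w _.
  rewrite /a EFinM EFinD -sumEFin.
  under eq_bigr do rewrite EFinM.
  over.
have msum : measurable_fun setT (fun w =>
    \sum_(i < 2 ^ j) ((r ^+ j) ^- p)%:E * (D j i w ^+ p)%:E)%E.
  by apply: emeasurable_sum => i; exact: measurable_funeM.
rewrite ge0_integralZl//; last 3 first.
- exact: emeasurable_funD.
- by move=> w _; rewrite adde_ge0// sume_ge0.
- by rewrite lee_fin ltW.
rewrite EFinM; apply: lee_wpmul2l; first by rewrite lee_fin ltW.
rewrite ge0_integralD//; last by move=> w _; rewrite sume_ge0.
rewrite integral_cst//= probability_setT mule1 EFinD leeD2l//.
rewrite ge0_integral_sum//; last by move=> i; exact: measurable_funeM.
apply: (@le_trans _ _ (\sum_(i < 2 ^ j)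
    ((r ^+ j) ^- p * (C * ((2 ^ j)%:R^-1) ^+ 2))%:E)%E).
  apply: lee_sum => i _; rewrite ge0_integralZl//; last 2 first.
  - by move=> w _; rewrite lee_fin; exact: exprn_ge0.
  - by rewrite lee_fin invr_ge0 exprn_ge0// ltW.
  rewrite EFinM; apply: lee_wpmul2l.
    by rewrite lee_fin invr_ge0 exprn_ge0// ltW.
  apply: (le_trans (moment _ _)).
  - by apply: dyadic_itv; exact: ltnW.
  - exact: dyadic_itv.
  rewrite lee_fin ler_wpM2l// /dyadic -mulrBl -natr1 addrAC subrr add0r mul1r//.
rewrite sumEFin lee_fin sumr_const card_ord -[_ *+ (2 ^ j)]mulr_natl.
have -> : (2 ^ j)%:R * ((r ^+ j) ^- p * (C * (2 ^ j)%:R^-1 ^+ 2)) =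
    C * ((r ^+ p * 2) ^+ j)^-1.
  rewrite exprMn -natrX -!exprM [(p * j)%N]mulnC.
  have x0 : r ^+ (j * p) != 0 by rewrite expf_neq0// gt_eqF.
  have y0 : (2 ^ j)%:R != 0 :> R by rewrite pnatr_eq0 expn_eq0.
  by move: x0 y0; set x := r ^+ _; set y := _%:R => x0 y0; field; rewrite x0 y0.
rewrite ler_piMr// invf_le1 ?exprn_gt0 ?mulr_gt0 ?exprn_gt0//.
by rewrite exprn_ege1// -ler_pdivrMr// mul1r.
Qed.

(** The sum S of the level bounds from m on dominates the interpolation error along each path, and
    its mean is the tail of a geometric series. *)
Lemma chaining_approximation (F : Cspace R d -> R) (k B : R) m : 0 <= k ->
  unif_lipschitz k F -> (forall f, `|F f| <= B) ->
  `|\int[P]_w F (Y w) -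
    \int[P]_w F (interp_path m (dyadic_values m (Y w)))| <=
  (k + 1) * ((1 + C) * r ^+ m / (1 - r)).
Proof.
move=> k0 kF bF.
pose S w := (\sum_(j <oo) (a (j + m) w)%:E)%E.
(* With [k + 1] in place of [k] the factor is positive, so the bound is infinite, hence trivial,
   where the series S diverges. *)
have k1 : 0 < k + 1 by rewrite ltr_wpDl.
have mS : measurable_fun setT S.
  rewrite /S; apply: ge0_emeasurable_sum => [j w _ _|j _].
    by rewrite lee_fin; exact: a0.
  exact/measurable_EFinP.
have S0 w : (0 <= S w)%E by apply: nneseries_ge0 => j _ _; rewrite lee_fin; exact: a0.
rewrite -lee_fin; apply: le_trans.
  apply: (@Rintegral_dist_le _ _ _ P B B _ _ (fun w => (k + 1)%:E * S w)%E).
  - apply: (measurableT_comp (f := F : borel (Cspace R d) -> R)) => //.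
    by apply: continuous_borel_measurable; exact: unif_lipschitz_continuous kF.
  - by [].
  - apply: (measurableT_comp (f := (fun f : borel (Cspace R d) =>
      F (interp_path m (dyadic_values m f))))) => //.
    apply: continuous_borel_measurable.
    apply: (unif_lipschitz_continuous _ (@interp_dyadic_lipschitz R d F k m k0 kF)).
    by rewrite mulr_ge0.
  - by [].
  - exact: measurable_funeM.
  move=> w; case sE : (S w) (S0 w) => [s| |]//; last first.
    by move=> _; rewrite gt0_muley ?lte_fin// leey.
  rewrite lee_fin => s0; rewrite -EFinM lee_fin.
  apply: (@le_trans _ _ (k * s)); last by rewrite ler_wpM2r// lerDl.
  apply: kF => // t; rewrite -{1}[t]unit_ptK.
  apply: (@interp_chaining _ _ (a ^~ w) m (ev (Y w)) (val t) s) => //.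
  - exact: unit_itvP.
  - exact: continuous_ev.
  - by move=> j i ij; exact: D_le_a.
  - move=> J; rewrite -lee_fin -sE -sumEFin -{1}[m]add0n big_addn.
    by apply: nneseries_lim_ge => i _ _; rewrite lee_fin.
rewrite ge0_integralZl//; last by rewrite lee_fin ltW.
rewrite EFinM lee_wpmul2l ?lee_fin ?(ltW k1)//.
rewrite integral_nneseries//; last 2 first.
- by move=> j; apply/measurable_EFinP.
- by move=> j w _; rewrite lee_fin.
apply: lime_le; first by apply: is_cvg_nneseries => j _ _; apply: integral_ge0 => w _; rewrite lee_fin; exact: a0.
near=> J.
apply: (@le_trans _ _ (\sum_(0 <= j < J) (r ^+ (j + m) * (1 + C))%:E)%E).
  by apply: lee_sum => j _; exact: integral_a.
rewrite sumEFin lee_fin.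
have -> : \sum_(0 <= j < J) r ^+ (j + m) * (1 + C) =
    series (geometric ((1 + C) * r ^+ m) r) J.
  by apply: eq_bigr => j _; rewrite exprD /= mulrC [r ^+ j * _]mulrC mulrA.
case/andP: r01 => _ r1.
rewrite geometric_seriesE ?lt_eqF//= ler_wpM2r ?invr_ge0 ?subr_ge0 ?(ltW r1)//.
rewrite ler_piMr ?mulr_ge0 ?addr_ge0 ?exprn_ge0 ?(ltW r0)//.
by rewrite lerBlDr lerDl exprn_ge0// ltW.
Unshelve. all: by end_near. Qed.

End chaining.

Section weak_cvg_of_fdd.
Context {R : realType} {d : nat}.
Context {dO : measure_display} {Omega : measurableType dO}.
Variables (P : probability Omega R) (Y : {RV P >-> borel (Cspace R d)}).
Variables (dOn : nat -> measure_display)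
  (Omegan : forall n, measurableType (dOn n))
  (Pn : forall n, probability (Omegan n) R)
  (Yn : forall n, {RV (Pn n) >-> borel (Cspace R d)}).

(** Both expectations are compared with those of the interpolated paths. For the approximations the
    moment bound gives a rate that is uniform in n; for the limit process dominated convergence
    along its continuous paths suffices. *)
Lemma weak_cvg_fdd_moment :
  (forall m (Phi : (nat -> 'cV[R]_d) -> R) K B, 0 <= K ->
    (forall v, `|Phi v| <= B) ->
    (forall v v' e, 0 <= e ->
      (forall k, (k <= 2 ^ m)%N -> `|v k - v' k| <= e) ->
      `|Phi v - Phi v'| <= K * e) ->
    \int[Pn n]_w Phi (dyadic_values m (Yn n w)) @[n --> \oo] -->
    \int[P]_w Phi (dyadic_values m (Y w))) ->
  (exists p C, [/\ (0 < p)%N, 0 <= C & forall n s t, (0 < n)%N ->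
    0 <= s <= 1 -> 0 <= t <= 1 ->
    (\int[Pn n]_w (`|ev (Yn n w) t - ev (Yn n w) s| ^+ p)%:E
      <= (C * (t - s) ^+ 2)%:E)%E]) ->
  weak_cvg (fun n => distribution (Pn n) (Yn n)) (distribution P Y).
Proof.
move=> fdd [p [C [p0 C0 mom]]]; apply: weak_cvg_lipschitz => F k B k0 kF bF.
have mF : measurable_fun setT (F : borel (Cspace R d) -> R).
  by apply: continuous_borel_measurable; exact: unif_lipschitz_continuous kF.
rewrite (Rintegral_distribution _ mF bF).
under eq_cvg do rewrite (Rintegral_distribution _ mF bF).
(* By Bernoulli's inequality r^p >= 1 - p / (2 p) = 1/2, the condition under which the level sums
   stay bounded. *)
pose r : R := 1 - (2 * p%:R)^-1.
have p2 : 1 < 2 * p%:R :> R by rewrite -natrM ltr1n; lia.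
have p20 : 0 < 2 * p%:R :> R by rewrite (lt_trans _ p2).
have r01 : 0 < r < 1.
  by rewrite subr_gt0 invf_lt1//= p2/= ltrBlDr ltrDl invr_gt0.
have rp : 2^-1 <= r ^+ p.
  apply: le_trans (bernoulli_pow_ge _ _).
    by rewrite le_eqVlt; apply/orP; left; apply/eqP; field; rewrite pnatr_eq0 -lt0n.
  by rewrite invr_ge0 ltW//= invf_le1// ltW.
apply/cvgrPdist_le => e e0.
have e3 : 0 < e / 3 by rewrite divr_gt0.
have mI m : measurable_fun setT (fun f : borel (Cspace R d) =>
    F (interp_path m (dyadic_values m f))).
  apply: continuous_borel_measurable.
  apply: (unif_lipschitz_continuous _ (@interp_dyadic_lipschitz R d F k m k0 kF)).
  by rewrite mulr_ge0.
have lim1 : \int[P]_w F (interp_path m (dyadic_values m (Y w))) @[m --> \oo] -->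
    \int[P]_w F (Y w).
  apply: (@Rintegral_dominated_cvg _ _ _ P B) => //.
  - by move=> m; exact: (measurableT_comp (mI m)).
  - move=> w; apply/cvgrPdist_lt => s s0.
    have := (cspace_continuousP F).1 (unif_lipschitz_continuous k0 kF) (Y w) s s0.
    move=> [q q0 qP].
    have q2 : 0 < q / 2 by rewrite divr_gt0.
    have := interp_cvg_unif (@continuous_ev _ _ (Y w)) q2.
    apply: filterS => m mP; apply: qP => t; rewrite -{1}[t]unit_ptK.
    rewrite (le_lt_trans (mP _ (unit_itvP t)))//.
    by rewrite ltr_pdivrMr// ltr_pMr// ltr1n.
have lim2 : (k + 1) * ((1 + C) * r ^+ m / (1 - r)) @[m --> \oo] --> (0 : R).
  have -> : (fun m => (k + 1) * ((1 + C) * r ^+ m / (1 - r))) =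
      (fun m => ((k + 1) * (1 + C) / (1 - r)) * r ^+ m).
    by apply/funext => m; rewrite -!mulrA [r ^+ m * _]mulrC.
  rewrite -[X in _ --> X](mulr0 ((k + 1) * (1 + C) / (1 - r))).
  apply: cvgMr; apply: cvg_expr.
  by case/andP: r01 => h1 h2; rewrite ger0_norm// ltW.
have [m [h1 h2]] : exists m, `|\int[P]_w F (Y w) -
    \int[P]_w F (interp_path m (dyadic_values m (Y w)))| <= e / 3 /\
    (k + 1) * ((1 + C) * r ^+ m / (1 - r)) <= e / 3.
  near \oo => m; exists m; split; near: m.
    by move/cvgrPdist_le : lim1; apply.
  move/cvgrPdist_le : lim2 => /(_ _ e3); apply: filterS => m.
  by rewrite sub0r normrN; apply: le_trans; exact: ler_norm.
have := fdd m (fun v => F (interp_path m v)) (k * (1 + (2 ^ m)%:R * 2)) B _ _ _.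
have K0 : 0 <= k * (1 + (2 ^ m)%:R * 2) by rewrite mulr_ge0.
have HL v v' (s : R) : 0 <= s ->
    (forall i, (i <= 2 ^ m)%N -> `|v i - v' i| <= s) ->
    `|F (interp_path m v) - F (interp_path m v')| <= k * (1 + (2 ^ m)%:R * 2) * s.
  exact: interp_path_lipschitz.
move=> /(_ K0 (fun v => bF _) HL) /cvgrPdist_le/(_ _ e3) hfdd.
near=> n.
have n0 : (0 < n)%N by near: n; exact: nbhs_infty_gt.
have h3 : `|\int[P]_w F (interp_path m (dyadic_values m (Y w))) -
   \int[Pn n]_w F (interp_path m (dyadic_values m (Yn n w)))| <= e / 3.
  by near: n; exact: hfdd.
have h4 := @chaining_approximation _ _ _ _ _ (Yn n) p C r p0 C0 r01 rp
  (fun s t => mom n s t n0) F k B m k0 kF bF.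
have {}h4 := le_trans h4 h2.
move: h1 h3 h4; rewrite !ler_norml => /andP[? ?] /andP[? ?] /andP[? ?].
by apply/andP; split; lra.
Unshelve. all: by end_near. Qed.

End weak_cvg_of_fdd.

(** * Entries of the matrix exponential *)

Section matrix_entries.
Context {R : realType}.

Lemma mx_entry_le m n (A : 'M[R]_(m, n)) i j : `|A i j| <= `|A|.
Proof. by rewrite [leRHS]mx_normrE (le_trans _ (le_bigmax _ _ (i, j))). Qed.

Lemma mx_norm_le m n (A : 'M[R]_(m, n)) c : 0 <= c ->
  (forall i j, `|A i j| <= c) -> `|A| <= c.
Proof. by move=> c0 Ac; rewrite [leLHS]mx_normrE; apply: bigmax_le => // -[]. Qed.

Lemma cvg_mx_entry m n (f : nat -> 'M[R]_(m, n)) (L : 'M[R]_(m, n)) :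
  (forall i j, f k i j @[k --> \oo] --> L i j) -> f k @[k --> \oo] --> L.
Proof.
move=> fL; apply/cvgrPdist_le => e e0.
have H : \forall k \near \oo, forall ij : 'I_m * 'I_n,
    `|L ij.1 ij.2 - f k ij.1 ij.2| <= e.
  apply: filter_forall => -[i j] /=.
  by move/cvgrPdist_le : (fL i j); apply.
apply: filterS H => k H; apply: mx_norm_le; first exact: ltW.
by move=> i j; rewrite !mxE; exact: (H (i, j)).
Qed.

End matrix_entries.

Section exponential_entries.
Context {R : realType} {d : nat}.
Implicit Types (M B C : 'M[R]_d) (u : R).

(* Coefficients of the power series in u of the entries of exp(uM) B. *)
Definition expmx_coef M B i j : nat -> R := fun k => k`!%:R^-1 * (M ^+ k *m B) i j.

(** The right factor B makes the family stable under differentiation in u, which replaces B by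
    [M *m B]. All the analysis then takes place on scalar power series. *)
Definition expmx_entry M B i j u : R := limn (pseries (expmx_coef M B i j) u).

Let total M : R := \sum_i \sum_j `|M i j|.

Let row_le M i : \sum_j `|M i j| <= total M.
Proof.
by rewrite /total [leRHS](bigD1 i)//= lerDl sumr_ge0// => k _; rewrite sumr_ge0.
Qed.

Let expr_entry_le M B k i j : `|(M ^+ k *m B) i j| <= total M ^+ k * total B.
Proof.
elim: k i => [|k IH] i.
  rewrite expr0 mul1r [X in X *m _](_ : _ = 1%:M)// mul1mx.
  apply: le_trans (row_le B i); rewrite (bigD1 j)//= lerDl sumr_ge0//.
rewrite exprS [_ * _](_ : _ = M *m (M ^+ k))// -mulmxA mxE.
rewrite (le_trans (ler_norm_sum _ _ _))// exprS -mulrA.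
apply: (@le_trans _ _ (\sum_l `|M i l| * (total M ^+ k * total B))).
  by apply: ler_sum => l _; rewrite normrM ler_wpM2l.
rewrite -mulr_suml; apply: ler_wpM2r; last exact: row_le.
by apply: mulr_ge0; rewrite ?exprn_ge0//; apply: sumr_ge0 => ? _; rewrite sumr_ge0.
Qed.

Lemma is_cvg_expmx_entry M B i j u : cvgn (pseries (expmx_coef M B i j) u).
Proof.
apply: normed_cvg.
apply: (@series_le_cvg _ _ (fun k => total B * exp_coeff (total M * `|u|) k)).
- by move=> k /=.
- move=> k; rewrite mulr_ge0//.
    by rewrite sumr_ge0// => ? _; rewrite sumr_ge0.
  rewrite /exp_coeff /= divr_ge0// exprn_ge0// mulr_ge0//.
  by rewrite sumr_ge0// => ? _; rewrite sumr_ge0.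
- move=> k /=; rewrite /expmx_coef /exp_coeff /= !normrM normfV normr_nat exprMn normrX.
  have := expr_entry_le M B k i j.
  rewrite -(ler_pM2r (_ : 0 < k`!%:R^-1)) ?invr_gt0 ?ltr0n ?fact_gt0// => h.
  rewrite [X in X <= _](_ : _ = `|(M ^+ k *m B) i j| / k`!%:R * `|u| ^+ k); last ring.
  rewrite [leRHS](_ : _ = (total M ^+ k * total B) / k`!%:R * `|u| ^+ k); last ring.
  by rewrite ler_wpM2r// exprn_ge0.
- rewrite (_ : series _ = (fun n => total B * series (exp_coeff (total M * `|u|)) n)).
    by apply: is_cvgMr; exact: is_cvg_series_exp_coeff.
  by apply/funext => n; rewrite /series /= mulr_sumr.
Qed.

Lemma cvg_expmx_entry M B i j u :
  pseries (expmx_coef M B i j) u @ \oo --> expmx_entry M B i j u.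
Proof. exact: is_cvg_expmx_entry. Qed.

Lemma expmx_coef_diffs M B i j :
  pseries_diffs (expmx_coef M B i j) = expmx_coef M (M *m B) i j.
Proof.
apply/funext => k; rewrite /pseries_diffs /expmx_coef factS natrM invfM mulrA.
rewrite mulrA divff ?pnatr_eq0// mul1r; congr (_ * _).
by rewrite exprSr [_ * M](_ : _ = M ^+ k *m M)// mulmxA.
Qed.

Lemma is_derive_expmx_entry M B i j u :
  is_derive u 1 (expmx_entry M B i j) (expmx_entry M (M *m B) i j u).
Proof.
rewrite /expmx_entry -expmx_coef_diffs.
apply: (@pseries_snd_diffs _ _ (`|u| + 1)); rewrite ?expmx_coef_diffs;
  [exact: is_cvg_expmx_entry..|].
by rewrite [ltRHS]ger0_norm ?addr_ge0// ltrDl.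
Qed.

Lemma continuous_expmx_entry M B i j : continuous (expmx_entry M B i j).
Proof.
move=> u; apply/differentiable_continuous/derivable1_diffP.
by have [] := is_derive_expmx_entry M B i j u.
Qed.

Lemma expmx_entryD M B C i j u (b c : R) :
  expmx_entry M (b *: B + c *: C) i j u =
  b * expmx_entry M B i j u + c * expmx_entry M C i j u.
Proof.
apply: cvg_lim => //.
rewrite (_ : pseries _ u = fun n => b * pseries (expmx_coef M B i j) u n +
    c * pseries (expmx_coef M C i j) u n).
  by apply: cvgD; apply: cvgMr; exact: cvg_expmx_entry.
apply/funext => n; rewrite /pseries /series /= !mulr_sumr -big_split/=.
apply: eq_bigr => k _; rewrite /expmx_coef mulmxDr -!scalemxAr !mxE; ring.
Qed.

Lemma expmx_entry0 M i j u : expmx_entry M 0 i j u = 0.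
Proof. by have := expmx_entryD M 0 0 i j u 0 0; rewrite !scale0r addr0 !mul0r addr0. Qed.

Lemma expmx_entryE M i j u : expmx (u *: M) i j = expmx_entry M 1%:M i j u.
Proof.
have -> : expmx (u *: M) = \matrix_(i, j) expmx_entry M 1%:M i j u.
  apply: cvg_lim; first exact: norm_hausdorff.
  apply: cvg_mx_entry => {}i {}j; rewrite mxE.
  rewrite (_ : (fun k => _) = pseries (expmx_coef M 1%:M i j) u).
    exact: cvg_expmx_entry.
  apply/funext => n; rewrite /series /pseries /series /= summxE.
  apply: eq_bigr => k _; rewrite !mxE /expmx_coef mulmx1 -mulrA; congr (_ * _).
  have -> : (u *: M) ^+ k = u ^+ k *: M ^+ k.
    elim: k => [|k IH]; first by rewrite !expr0 scale1r.
    rewrite !exprS IH [LHS](_ : _ = (u *: M) *m (u ^+ k *: M ^+ k))//.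
    by rewrite -scalemxAl -scalemxAr scalerA.
  by rewrite mxE mulrC.
by rewrite mxE.
Qed.

Lemma expmx_mul_entryE M B i j u :
  (expmx (u *: M) *m B) i j = expmx_entry M B i j u.
Proof.
rewrite mxE; under eq_bigr do rewrite expmx_entryE.
apply/esym/cvg_lim => //.
rewrite (_ : pseries _ u = fun n => \sum_l
    pseries (expmx_coef M 1%:M i l) u n * B l j).
  apply: cvg_big => [|l _]; first exact: add_continuous.
  by apply: cvgMl; exact: cvg_expmx_entry.
apply/funext => n; rewrite /pseries /series /=.
under [RHS]eq_bigr do rewrite mulr_suml.
rewrite exchange_big /=; apply: eq_bigr => k _.
rewrite /expmx_coef mxE mulr_sumr mulr_suml; apply: eq_bigr => l _.
rewrite mulmx1; ring.
Qed.

End exponential_entries.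

Section energy.
Context {R : realType}.

Lemma derive_le0_le (f df : R -> R) : (forall x : R, is_derive x 1 f (df x)) ->
  (forall x : R, 0 <= x -> df x <= 0) -> forall u, 0 <= u -> f u <= f 0.
Proof.
move=> fd df0 u u0.
have cf : {within `[0, u], continuous f}.
  by apply: derivable_within_continuous => x _; have [] := fd x.
have [c] := @MVT_segment _ f df 0 u u0 (fun x _ => fd x) cf.
rewrite in_itv/= => /andP[c0 _] e.
by rewrite -subr_le0 e subr0 mulr_le0_ge0// df0.
Qed.

(* The squared modulus [a^2 + b^2] of a solution of [z' = (al + i om) z + y],
   damped by [exp(-2 be u)], satisfies a dissipative differential inequality. *)
Lemma energy_bound (a b y1 y2 : R -> R) (al om be C : R) : al < be -> 0 <= C ->
  (forall u : R, is_derive u 1 a (al * a u - om * b u + y1 u)) ->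
  (forall u : R, is_derive u 1 b (om * a u + al * b u + y2 u)) ->
  (forall u, 0 <= u -> `|y1 u| <= C * expR (be * u)) ->
  (forall u, 0 <= u -> `|y2 u| <= C * expR (be * u)) ->
  exists2 K, 0 <= K & forall u, 0 <= u ->
    `|a u| <= K * expR (be * u) /\ `|b u| <= K * expR (be * u).
Proof.
move=> albe C0 da db hy1 hy2.
pose g := be - al; have g0 : 0 < g by rewrite subr_gt0.
(* With this exponent the damped modulus keeps a dissipation of rate g, which absorbs the cross
   terms 2 a y1 and 2 b y2 up to (y1^2 + y2^2) / g. K is then such that the derivative of [K * E2]
   equals the remaining forcing. *)
pose mu := g - 2 * be.
pose K := 2 * C ^+ 2 / g ^+ 2.
pose E1 u := expR (mu * u). pose E2 u := expR (g * u).
pose h u := (a u ^+ 2 + b u ^+ 2) * E1 u - K * E2 u.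
pose a' u := al * a u - om * b u + y1 u.
pose b' u := om * a u + al * b u + y2 u.
pose dh u := (2 * a u * a' u + 2 * b u * b' u) * E1 u +
  (a u ^+ 2 + b u ^+ 2) * (mu * E1 u) - K * (g * E2 u).
have dE (c u : R) : is_derive u 1 (fun u => expR (c * u)) (c * expR (c * u)).
  have hc : is_derive u 1 (fun u : R => c * u) c.
    have := @is_deriveZ _ _ _ id c u 1 1 (is_derive_id u 1).
    by rewrite /GRing.scale/= mulr1.
  have he : is_derive (c * u) 1 (@expR R) (expR (c * u)) by exact: is_derive_expR.
  have := @is_derive1_comp _ expR (fun u => c * u) u _ _ he hc.
  by rewrite mulrC.
have hd (u : R) : is_derive u 1 h (dh u).
  have hE1 := dE mu u; have hE2 := dE g u; have ha := da u; have hb := db u.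
  rewrite /h; apply: is_derive_eq; rewrite /dh /E1 /E2 -/(a' u) -/(b' u) /GRing.scale/=.
  ring.
have K0 : 0 <= K by rewrite !mulr_ge0// ?invr_ge0 exprn_ge0// ltW.
have sq y u : 0 <= u -> `|y| <= C * expR (be * u) ->
    y ^+ 2 * E1 u <= C ^+ 2 * E2 u.
  move=> u0 hy; have : y ^+ 2 <= (C * expR (be * u)) ^+ 2.
    by rewrite -real_normK ?num_real// ler_sqr ?nnegrE// mulr_ge0 ?expR_ge0.
  move=> /(ler_wpM2r (expR_ge0 (mu * u))) => /le_trans; apply.
  rewrite exprMn -mulrA ler_wpM2l ?exprn_ge0// -expRM_natl -expRD /E2.
  by rewrite (_ : _ + _ = g * u)// /mu; ring.
have dh0 u : 0 <= u -> dh u <= 0.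
  move=> u0.
  have s1 := sq _ u u0 (hy1 u u0); have s2 := sq _ u u0 (hy2 u u0).
  have amgm x y : 2 * x * y <= g * x ^+ 2 + y ^+ 2 / g.
    rewrite -subr_ge0 (_ : _ - _ = (g * x - y) ^+ 2 / g); last first.
      by field; rewrite gt_eqF.
    by rewrite divr_ge0 ?sqr_ge0// ltW.
  have -> : dh u = ((2 * a u * y1 u + 2 * b u * y2 u) -
      g * (a u ^+ 2 + b u ^+ 2)) * E1 u - K * (g * E2 u).
    by rewrite /dh /a' /b' /mu /g; ring.
  have -> : K * (g * E2 u) = (C ^+ 2 * E2 u) / g + (C ^+ 2 * E2 u) / g.
    by rewrite /K; field; rewrite gt_eqF.
  have h1 : (2 * a u * y1 u + 2 * b u * y2 u) - g * (a u ^+ 2 + b u ^+ 2) <=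
      (y1 u ^+ 2 + y2 u ^+ 2) / g.
    by have := amgm (a u) (y1 u); have := amgm (b u) (y2 u); lra.
  rewrite subr_le0; apply: (le_trans (ler_wpM2r (expR_ge0 _) h1)).
  rewrite mulrAC mulrDl mulrDl; apply: lerD;
    by rewrite ler_wpM2r// invr_ge0 ltW.
pose N0 := a 0 ^+ 2 + b 0 ^+ 2.
have N00 : 0 <= N0 by rewrite addr_ge0// sqr_ge0.
have NK0 : 0 <= 1 + N0 + K by apply: addr_ge0 => //; apply: addr_ge0.
exists (1 + N0 + K) => //.
move=> u u0.
have hu := derive_le0_le hd dh0 u0.
have E20 : 1 <= E2 u by rewrite /E2 -expR0 ler_expR mulr_ge0// ltW.
have N_le : a u ^+ 2 + b u ^+ 2 <= ((1 + N0 + K) * expR (be * u)) ^+ 2.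
  rewrite -(ler_pM2r (expR_gt0 (mu * u))).
  have -> : ((1 + N0 + K) * expR (be * u)) ^+ 2 * expR (mu * u) =
      (1 + N0 + K) ^+ 2 * E2 u.
    rewrite exprMn -mulrA -expRM_natl -expRD /E2; congr (_ * expR _).
    by rewrite /mu; ring.
  apply: (@le_trans _ _ ((N0 + K) * E2 u)).
    move: hu; rewrite /h /E1 /E2 !mulr0 expR0 !mulr1 -/N0 -/(E1 u) -/(E2 u) => hu.
    have : N0 <= N0 * E2 u by rewrite ler_peMr.
    by move: hu K0; rewrite mulrDl; lra.
  rewrite ler_wpM2r ?expR_ge0//.
  have : 0 <= (N0 + K) ^+ 2 by rewrite sqr_ge0.
  by nra.
have bnd x : x ^+ 2 <= ((1 + N0 + K) * expR (be * u)) ^+ 2 ->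
    `|x| <= (1 + N0 + K) * expR (be * u).
  rewrite -[x ^+ 2]real_normK ?num_real// ler_sqr ?nnegrE// mulr_ge0 ?expR_ge0//.
split; apply: bnd; apply: le_trans N_le.
  by rewrite lerDl sqr_ge0.
by rewrite lerDr sqr_ge0.
Qed.

End energy.

Section spectral_bound.
Context {R : realType} {d : nat}.
Implicit Types (M : 'M[R]_d) (Z : 'M[R[i]]_d).

Let Mc M : 'M[R[i]]_d := map_mx (fun x : R => (x%:C)%C) M.
Let reM Z : 'M[R]_d := map_mx (@complex.Re R) Z.
Let imM Z : 'M[R]_d := map_mx (@complex.Im R) Z.

Let Re_sum (I : Type) (r : seq I) (F : I -> R[i]) :
  complex.Re (\sum_(i <- r) F i) = \sum_(i <- r) complex.Re (F i).
Proof. by apply: (big_morph (@complex.Re R)) => // -[a b] [a' b']. Qed.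

Let Im_sum (I : Type) (r : seq I) (F : I -> R[i]) :
  complex.Im (\sum_(i <- r) F i) = \sum_(i <- r) complex.Im (F i).
Proof. by apply: (big_morph (@complex.Im R)) => // -[a b] [a' b']. Qed.

Let shift M (z : R[i]) Z := (Mc M - z%:M) *m Z.

(** The real part of M Z = (M - z) Z + z Z. The coefficients 1 give it the two-term shape that
    [expmx_entryD] rewrites, twice. *)
Let M_reM M z Z : M *m reM Z = 1 *: (1 *: reM (shift M z Z) + complex.Re z *: reM Z)
  + (- complex.Im z) *: imM Z.
Proof.
rewrite /shift mulmxBl mul_scalar_mx; apply/matrixP => i j; rewrite !mxE.
have -> : complex.Re (\sum_k (Mc M) i k * Z k j - z * Z i j) =
    \sum_k M i k * complex.Re (Z k j) - (complex.Re z * complex.Re (Z i j) -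
      complex.Im z * complex.Im (Z i j)).
  have -> (x y : R[i]) : complex.Re (x - y) = complex.Re x - complex.Re y.
    by case: x y => [a b] [a' b'].
  rewrite Re_sum; congr (_ - _); last by case: z (Z i j) => [a b] [a' b'].
  by apply: eq_bigr => k _; rewrite !mxE; case: (Z k j) => a b /=; ring.
under eq_bigr do rewrite mxE.
by ring.
Qed.

Let M_imM M z Z : M *m imM Z = 1 *: (1 *: imM (shift M z Z) + complex.Im z *: reM Z)
  + complex.Re z *: imM Z.
Proof.
rewrite /shift mulmxBl mul_scalar_mx; apply/matrixP => i j; rewrite !mxE.
have -> : complex.Im (\sum_k (Mc M) i k * Z k j - z * Z i j) =
    \sum_k M i k * complex.Im (Z k j) - (complex.Re z * complex.Im (Z i j) +
      complex.Im z * complex.Re (Z i j)).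
  have -> (x y : R[i]) : complex.Im (x - y) = complex.Im x - complex.Im y.
    by case: x y => [a b] [a' b'].
  rewrite Im_sum; congr (_ - _); last by case: z (Z i j) => [a b] [a' b'].
  by apply: eq_bigr => k _; rewrite !mxE; case: (Z k j) => a b /=; ring.
under eq_bigr do rewrite mxE.
by ring.
Qed.

(** The function y(u) = exp(u M) Z solves y' = z y + exp(u M) (M - z) Z. A bound for (M - z) Z thus
    yields one for Z by the energy estimate, and the induction starts at the zero matrix. *)
Let bound_shifts M (be : R) rs : (forall z, z \in rs -> complex.Re z < be) ->
  forall Z, foldl (fun Z z => shift M z Z) Z rs = 0 ->
  exists2 K, 0 <= K & forall i j u, 0 <= u ->
    `|expmx_entry M (reM Z) i j u| <= K * expR (be * u) /\
    `|expmx_entry M (imM Z) i j u| <= K * expR (be * u).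
Proof.
elim: rs => [_ Z /= ->|z rs IH zrs Z /= hZ].
  exists 0 => // i j u _.
  have -> : reM 0 = 0 by apply/matrixP => a b; rewrite !mxE.
  have -> : imM 0 = 0 by apply/matrixP => a b; rewrite !mxE.
  by rewrite !expmx_entry0 normr0 mul0r.
have [K K0 KP] := IH (fun y hy => zrs y (mem_behead (s := z :: rs) hy)) _ hZ.
have H (ij : 'I_d * 'I_d) : exists K', 0 <= K' /\ forall u, 0 <= u ->
    `|expmx_entry M (reM Z) ij.1 ij.2 u| <= K' * expR (be * u) /\
    `|expmx_entry M (imM Z) ij.1 ij.2 u| <= K' * expR (be * u).
  case: ij => i j /=.
  have zbe : complex.Re z < be by apply: zrs; rewrite mem_head.
  have [||||K' K'0 K'P] := @energy_bound R (expmx_entry M (reM Z) i j)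
    (expmx_entry M (imM Z) i j)
    (expmx_entry M (reM (shift M z Z)) i j) (expmx_entry M (imM (shift M z Z)) i j)
    (complex.Re z) (complex.Im z) be K zbe K0.
  - move=> u; have := is_derive_expmx_entry M (reM Z) i j u.
    by rewrite (M_reM M z Z) 2!expmx_entryD !mul1r => h; apply: is_derive_eq; ring.
  - move=> u; have := is_derive_expmx_entry M (imM Z) i j u.
    by rewrite (M_imM M z Z) 2!expmx_entryD !mul1r => h; apply: is_derive_eq; ring.
  - by move=> u u0; case: (KP i j u u0).
  - by move=> u u0; case: (KP i j u u0).
  by exists K'.
have [F FP] := choice H.
exists (\sum_ij F ij); first by apply: sumr_ge0 => ij _; case: (FP ij).
move=> i j u u0; have [F0 /(_ u u0)[/= h1 h2]] := FP (i, j).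
have le : F (i, j) <= \sum_ij F ij.
  by rewrite (bigD1 (i, j))//= lerDl sumr_ge0// => ij _; case: (FP ij).
by split; [apply: (le_trans h1)|apply: (le_trans h2)]; rewrite ler_wpM2r ?expR_ge0.
Qed.

(** The Cayley-Hamilton theorem supplies the list of shifts: the factors M - z over the roots z of
    the characteristic polynomial multiply to 0. The strict inequality pays for the powers of u due
    to multiple roots. *)
Lemma expmx_spectral_bound M (be : R) :
  (forall z, eigenvalue (Mc M) z -> complex.Re z < be) ->
  exists2 K, 0 <= K & forall i j u, 0 <= u ->
    `|expmx (u *: M) i j| <= K * expR (be * u).
Proof.
move=> Mbe.
suff [rs rsM rs0] : exists2 rs, (forall z, z \in rs -> eigenvalue (Mc M) z) &
    foldl (fun Z z => shift M z Z) 1%:M rs = 0.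
  have [K K0 KP] := bound_shifts (fun z hz => Mbe z (rsM z hz)) rs0.
  exists K => // i j u u0; rewrite expmx_entryE.
  have -> : 1%:M = reM 1%:M.
    by apply/matrixP => a b; rewrite !mxE; case: (a == b).
  by case: (KP i j u u0).
rewrite /shift; move: (Mc M) => {Mbe}; case: d => [|n] N.
  by exists [::] => //=; apply/matrixP => -[].
have [rs rsE] := closed_field_poly_normal (char_poly N).
rewrite (monicP (char_poly_monic N)) scale1r in rsE.
exists rs => [z zrs|].
  by rewrite eigenvalue_root_char rsE root_prod_XsubC.
suff H (Z : 'M[R[i]]_n.+1) : foldl (fun (Z : 'M[R[i]]_n.+1) z => (N - z%:M) *m Z) Z rs =
    horner_mx N (\prod_(z <- rs) ('X - z%:P)) *m Z.
  by rewrite H -rsE Cayley_Hamilton mul0mx.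
elim: {rsE} rs Z => [|z rs IH] Z /=.
  by rewrite big_nil rmorph1 [X in X *m _](_ : _ = 1%:M)// mul1mx.
rewrite IH big_cons mulrC rmorphM rmorphB/= horner_mx_X horner_mx_C.
exact: mulmxA.
Qed.

End spectral_bound.

Section kernel_bound.
Context {R : realType} {d : nat}.
Variables (D : 'M[R]_d).
Hypotheses (D0 : 0 < lambda_min D) (D1 : lambda_max D < 1).

Let Dc : 'M[R[i]]_d := map_mx (fun x : R => (x%:C)%C) D.

Let spectrum_bounded : exists B : R, forall z, eigenvalue Dc z -> `|complex.Re z| <= B.
Proof.
have [rs rsE] := closed_field_poly_normal (char_poly Dc).
rewrite (monicP (char_poly_monic Dc)) scale1r in rsE.
exists (\sum_(z <- rs) `|complex.Re z|) => z.
rewrite eigenvalue_root_char rsE root_prod_XsubC => zrs.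
by rewrite (big_rem z zrs)/= lerDl sumr_ge0.
Qed.

Let eigenvalue_re z : eigenvalue Dc z ->
  lambda_min D <= complex.Re z <= lambda_max D.
Proof.
move=> hz; have [B BP] := spectrum_bounded; apply/andP; split.
  apply: ge_inf; last by exists z.
  by exists (- B) => _ [y hy <-]; have := BP y hy; rewrite ler_norml => /andP[].
apply: ub_le_sup; last by exists z.
by exists B => _ [y hy <-]; have := BP y hy; rewrite ler_norml => /andP[].
Qed.

(** The spectral bound is for nonnegative times, so it is applied to D - 1/2 at time - ln x when x
    <= 1 and to its opposite at time ln x when x >= 1. An exponent al < 1/2 makes the kernel square
    integrable at 0; the gain ka does so at infinity once the factor 1 / x is added. *)
Lemma kernel_pow_bound : exists K al ka : R,
  [/\ 0 <= K, 0 < al < 2^-1, 0 < ka < 2^-1,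
      (forall x i j, 0 < x -> x <= 1 ->
        `|kernel_pow D x i j| <= K * expR (- al * ln x)) &
      (forall x i j, 1 <= x ->
        `|kernel_pow D x i j| <= K * expR ((2^-1 - ka) * ln x))].
Proof.
(* Halving leaves the strict inequality that the spectral bound asks for, and 1/4 keeps ka below
   1/2. *)
pose ka := Num.min (lambda_min D / 2) (4^-1).
have ka0 : 0 < ka by rewrite lt_min divr_gt0//= invr_gt0.
have ka1 : ka < lambda_min D by rewrite gt_min ltr_pdivrMr// ltr_pMr// ltr1n.
have ka2 : ka < 2^-1 by rewrite gt_min ltf_pV2 ?posrE// ltr_nat orbT.
(* A number strictly between [lambda_max D] and 1; the alternative 3/4 ensures that [L - h] is
   positive. *)
pose L := Num.max ((1 + lambda_max D) / 2) (3 / 4).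
have d1 : lambda_max D < 1 by [].
have L1 : L < 1.
  rewrite gt_max ltr_pdivrMr// ltr_pdivrMr// mul1r mul1r; apply/andP; split; lra.
have L2 : 2^-1 < L by rewrite lt_max; apply/orP; right; lra.
have L3 : lambda_max D < L by rewrite lt_max; apply/orP; left; lra.
pose h := 2^-1 : R.
have mapE : map_mx (fun x : R => (x%:C)%C) (D - h%:M) = Dc - ((h%:C)%C)%:M.
  apply/matrixP => i j; rewrite !mxE; rewrite rmorphB/=; congr (_ - _).
  by rewrite rmorphMn.
have H1 z : eigenvalue (map_mx (fun x : R => (x%:C)%C) (D - h%:M)) z ->
    complex.Re z < L - h.
  rewrite mapE => /eigenvalueP[v hv v0].
  have /eigenvalue_re : eigenvalue Dc (z + (h%:C)%C).
    apply/eigenvalueP; exists v => //.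
    by rewrite scalerDl -hv mulmxBr mul_mx_scalar subrK.
  by case: z {hv} => a b /= /andP[_ hz]; move: hz L3; lra.
have [K1 K10 K1P] := expmx_spectral_bound H1.
have H2 z : eigenvalue (map_mx (fun x : R => (x%:C)%C) (- (D - h%:M))) z ->
    complex.Re z < h - ka.
  have -> : map_mx (fun x : R => (x%:C)%C) (- (D - h%:M)) = - (Dc - ((h%:C)%C)%:M).
    by rewrite -mapE; apply/matrixP => i j; rewrite !mxE rmorphN.
  move=> /eigenvalueP[v hv v0].
  have /eigenvalue_re : eigenvalue Dc ((h%:C)%C - z).
    apply/eigenvalueP; exists v => //.
    by rewrite scalerBl -hv mulmxN mulmxBr mul_mx_scalar opprK addrC subrK.
  by case: z {hv} => a b /= /andP[hz _]; move: hz ka1; lra.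
have [K2 K20 K2P] := expmx_spectral_bound H2.
exists (K1 + K2), (L - h), ka; split.
- by rewrite addr_ge0.
- by rewrite /h; apply/andP; split; lra.
- by rewrite ka0.
- move=> x i j x0 x1; rewrite /kernel_pow /mxpowR.
  have lx : 0 <= - ln x by rewrite oppr_ge0 ln_le0.
  have -> : ln x *: - (D - (2^-1)%:M) = (- ln x) *: (D - h%:M).
    by rewrite scalerN scaleNr.
  rewrite (le_trans (K1P i j _ lx))// mulrN mulNr ler_wpM2r ?expR_ge0//.
  by rewrite lerDl.
- move=> x i j x1; rewrite /kernel_pow /mxpowR.
  have lx : 0 <= ln x by rewrite ln_ge0.
  by rewrite (le_trans (K2P i j _ lx))// ler_wpM2r ?expR_ge0// lerDr.
Qed.

End kernel_bound.

(** * Chains of random signs *)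

Section nested_expectation.
Context {R : realType} {T : finType}.
Implicit Types (p : T -> R) (ps : seq (T -> R)) (Phi Psi : seq T -> R).

Definition pmass p : Prop := (forall t, 0 <= p t) /\ \sum_t p t = 1.

(** The expectation of Phi over a list of independent variables with masses [ps], as iterated finite
    sums; conditioning on a prefix is then mere computation. *)
Fixpoint nestE ps Phi : R :=
  if ps is p :: ps' then \sum_t p t * nestE ps' (fun l => Phi (t :: l))
  else Phi [::].

Lemma eq_nestE ps Phi Psi : (forall l, size l = size ps -> Phi l = Psi l) ->
  nestE ps Phi = nestE ps Psi.
Proof.
elim: ps Phi Psi => [|p ps IH] Phi Psi H /=; first exact: H.
apply: eq_bigr => t _; congr (_ * _); apply: IH => l sl.
by apply: H; rewrite /= sl.
Qed.

Lemma le_nestE ps Phi Psi : {in ps, forall p, pmass p} ->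
  (forall l, size l = size ps -> Phi l <= Psi l) ->
  nestE ps Phi <= nestE ps Psi.
Proof.
elim: ps Phi Psi => [|p ps IH] Phi Psi Hp H /=; first exact: H.
apply: ler_sum => t _; apply: ler_wpM2l.
  by case: (Hp p (mem_head _ _)).
apply: IH => [q qps|l sl]; first by apply: Hp; rewrite in_cons qps orbT.
by apply: H; rewrite /= sl.
Qed.

Lemma nestE_affine ps Phi Psi (a b : R) :
  nestE ps (fun l => a * Phi l + b * Psi l) = a * nestE ps Phi + b * nestE ps Psi.
Proof.
elim: ps Phi Psi => [//|p ps IH] Phi Psi /=.
rewrite !mulr_sumr -big_split; apply: eq_bigr => t _ /=.
rewrite IH; ring.
Qed.

Lemma nestE_cst ps (c : R) : {in ps, forall p, pmass p} ->
  nestE ps (fun => c) = c.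
Proof.
elim: ps => [//|p ps IH] Hp /=.
rewrite IH => [|q qps]; last by apply: Hp; rewrite in_cons qps orbT.
by rewrite -mulr_suml (Hp p (mem_head _ _)).2 mul1r.
Qed.

Lemma nestEZ ps Phi (a : R) : nestE ps (fun l => a * Phi l) = a * nestE ps Phi.
Proof.
have := nestE_affine ps Phi Phi a 0; rewrite mul0r addr0 => <-.
by apply: eq_nestE => l _; rewrite mul0r addr0.
Qed.

Lemma nestED ps Phi Psi :
  nestE ps (fun l => Phi l + Psi l) = nestE ps Phi + nestE ps Psi.
Proof.
have := nestE_affine ps Phi Psi 1 1; rewrite !mul1r => <-.
by apply: eq_nestE => l _; rewrite !mul1r.
Qed.

Lemma nestE_norm_le ps Phi Psi : {in ps, forall p, pmass p} ->
  (forall l, size l = size ps -> `|Phi l| <= Psi l) ->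
  `|nestE ps Phi| <= nestE ps Psi.
Proof.
move=> Hp H; rewrite ler_norml; apply/andP; split.
  rewrite -[X in X <= _]mulN1r -nestEZ; apply: le_nestE => // l sl.
  by rewrite mulN1r lerNl (le_trans (ler_norm _))// normrN H.
by apply: le_nestE => // l sl; rewrite (le_trans (ler_norm _))// H.
Qed.

Lemma nestE_dist_le ps Phi Psi (c : R) : {in ps, forall p, pmass p} ->
  (forall l, size l = size ps -> `|Phi l - Psi l| <= c) ->
  `|nestE ps Phi - nestE ps Psi| <= c.
Proof.
move=> Hp H.
have -> : nestE ps Phi - nestE ps Psi = nestE ps (fun l => Phi l - Psi l).
  have := nestE_affine ps Phi Psi 1 (-1); rewrite mul1r mulN1r => <-.
  by apply: eq_nestE => l _; rewrite mul1r mulN1r.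
rewrite -[leRHS](nestE_cst c Hp); exact: nestE_norm_le.
Qed.

Lemma nestE_cat ps qs Phi : nestE (ps ++ qs) Phi =
  nestE ps (fun l => nestE qs (fun l' => Phi (l ++ l'))).
Proof.
by elim: ps Phi => [//|p ps IH] Phi /=; apply: eq_bigr => t _; rewrite IH.
Qed.

End nested_expectation.

Section sign_chain.
Context {R : realType}.
Implicit Types (rho a s : R) (cs : seq R) (l : seq bool).

(** The value [true] means that the sign flips, and rho is the mean of (-1)^b. *)
Definition flip_mass rho (b : bool) : R := (1 + rho * (-1) ^+ b) / 2.

Lemma flip_mass_pmass rho : 0 <= rho <= 1 -> pmass (flip_mass rho).
Proof.
move=> /andP[r0 r1]; split => [b|]; last first.
  by rewrite big_bool /flip_mass /= expr0 expr1; field.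
by rewrite /flip_mass; case: b; rewrite /= ?expr0 ?expr1 divr_ge0//; lra.
Qed.

(** The sign is updated before it is weighted, in accordance with Riemann sums at right
    endpoints. *)
Fixpoint chain_sum s cs l : R :=
  match cs, l with
  | c :: cs', b :: l' =>
      c * (s * (-1) ^+ b) + chain_sum (s * (-1) ^+ b) cs' l'
  | _, _ => 0
  end.

Lemma chain_sum_scale s cs l : chain_sum s cs l = s * chain_sum 1 cs l.
Proof.
elim: cs s l => [|c cs IH] s [|b l] //=; rewrite ?mulr0//.
by rewrite IH [in RHS]IH mul1r; ring.
Qed.

Lemma chain_sumZ a s cs l : chain_sum s [seq a * c | c <- cs] l = a * chain_sum s cs l.
Proof.
by elim: cs s l => [|c cs IH] s [|b l] //=; rewrite ?mulr0// IH; ring.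
Qed.

(** Factor out e^x and use e^(- 2 x) <= 1 - 2 x + 8 x^2 for small x. The point is that the quadratic
    term keeps the factor 1 - rho, about 2 n dt when the mesh is fine. *)
Lemma flip_exp_le rho x : 0 <= rho <= 1 -> `|x| <= 4^-1 ->
  \sum_b flip_mass rho b * expR (x * (-1) ^+ b) <=
  expR (rho * x + 4 * (1 - rho) * x ^+ 2).
Proof.
move=> /andP[r0 r1] hx.
rewrite big_bool /flip_mass /= expr0 expr1 !mulr1 !mulrN1.
have h1 : expR (- (2 * x)) <= 1 - 2 * x + 8 * x ^+ 2.
  have := expR_ge1Dx (2 * x) => h.
  have pos : 0 < 1 + 2 * x by move: hx; rewrite ler_norml => /andP[]; lra.
  rewrite expRN (@le_trans _ _ (1 + 2 * x)^-1)//.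
    by rewrite lef_pV2 ?posrE// expR_gt0.
  rewrite -[leLHS]mul1r ler_pdivrMr//.
  have : 0 <= x ^+ 2 by rewrite sqr_ge0.
  move: hx; rewrite ler_norml => /andP[hx1 hx2] x2.
  have : 0 <= x ^+ 2 * (x + 4^-1) by rewrite mulr_ge0//; lra.
  have -> : (1 - 2 * x + 8 * x ^+ 2) * (1 + 2 * x) =
    1 + 4 * x ^+ 2 + 16 * (x ^+ 2 * x) by ring.
  by rewrite mulrDr; lra.
have -> : expR (- x) = expR x * expR (- (2 * x)).
  by rewrite -expRD; congr expR; ring.
have e0 := expR_gt0 x.
apply: (@le_trans _ _ (expR x * (1 - (1 - rho) * (x - 4 * x ^+ 2)))).
  have : (1 - rho) / 2 * (expR x * expR (- (2 * x))) <=
      (1 - rho) / 2 * (expR x * (1 - 2 * x + 8 * x ^+ 2)).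
    by rewrite ler_wpM2l ?divr_ge0 ?subr_ge0// ler_wpM2l// ltW.
  by lra.
have -> : rho * x + 4 * (1 - rho) * x ^+ 2 = x + - ((1 - rho) * (x - 4 * x ^+ 2)).
  by ring.
by rewrite expRD ler_wpM2l ?(ltW e0)// expR_ge1Dx.
Qed.

(* [expR (chain_drift * s + chain_cost)] bounds the conditional exponential
   moment of the remaining sum, s being the current sign. *)
Fixpoint chain_drift rho cs : R :=
  if cs is c :: cs' then rho * (c + chain_drift rho cs') else 0.

Fixpoint chain_cost rho cs : R :=
  if cs is c :: cs' then
    4 * (1 - rho) * (c + chain_drift rho cs') ^+ 2 + chain_cost rho cs'
  else 0.

Fixpoint chain_small rho cs : Prop :=
  if cs is c :: cs' then
    `|c + chain_drift rho cs'| <= 4^-1 /\ chain_small rho cs'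
  else True.

(** Backward induction: once the later signs are averaged, the exponent is linear in the first new
    sign, with coefficient [c + chain_drift rho cs], and one flip is averaged by [flip_exp_le]. *)
Lemma chain_exp_le rho cs s : 0 <= rho <= 1 -> s ^+ 2 = 1 -> chain_small rho cs ->
  nestE (nseq (size cs) (flip_mass rho)) (fun l => expR (chain_sum s cs l)) <=
  expR (chain_drift rho cs * s + chain_cost rho cs).
Proof.
move=> r01; elim: cs s => [|c cs IH] s s1 /=.
  by rewrite mul0r addr0 lexx.
move=> [csm sm].
have [m0 _] := flip_mass_pmass r01.
set b := chain_drift rho cs.
apply: (@le_trans _ _ (\sum_t flip_mass rho t *
    expR ((c + b) * s * (-1) ^+ t + chain_cost rho cs))).
  apply: ler_sum => t _; apply: ler_wpM2l; first exact: m0.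
  have st1 : (s * (-1) ^+ t) ^+ 2 = 1 by rewrite exprMn s1 mul1r sqrr_sign.
  under eq_nestE => l _ do rewrite expRD.
  rewrite nestEZ.
  apply: (le_trans (ler_wpM2l (expR_ge0 _) (IH _ st1 sm))).
  by rewrite -/b -expRD le_eqVlt; apply/orP; left; apply/eqP; congr expR; ring.
under eq_bigr do rewrite expRD mulrA.
rewrite -mulr_suml expRD mulrA -[X in _ <= X]expRD.
have ns : `|s| = 1.
  by apply/eqP; rewrite -(@pexpr_eq1 _ _ 2)// -normrX s1 normr1.
have := @flip_exp_le rho ((c + b) * s) r01.
rewrite normrM ns mulr1 => /(_ csm) h.
apply: (le_trans (ler_wpM2r (expR_ge0 _) h)).
rewrite -expRD le_eqVlt; apply/orP; left; apply/eqP; congr expR.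
rewrite exprMn s1; ring.
Qed.

(* The chain sampled with step dt: each flip has mean exp(-2 n dt), and the
   weights are sqrt n dt c_k. *)
Variables (n dt : R).
Hypotheses (n0 : 0 < n) (dt0 : 0 < dt).

Definition kac_corr : R := expR (- (2 * n * dt)).

Definition kac_weight : R := Num.sqrt n * dt.

Definition kac_flip : bool -> R := flip_mass kac_corr.

Definition energy cs : R := dt * \sum_(c <- cs) c ^+ 2.

Let y := 2 * n * dt.

Let y0 : 0 < y. Proof. by rewrite !mulr_gt0. Qed.

Lemma kac_corr_itv : 0 <= kac_corr <= 1.
Proof. by rewrite expR_ge0/= -expR0 ler_expR oppr_le0 ltW. Qed.

Lemma kac_flip_pmass m : {in nseq m kac_flip, forall p, pmass p}.
Proof. by move=> p; rewrite mem_nseq => /andP[_ /eqP ->]; exact/flip_mass_pmass/kac_corr_itv. Qed.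

Lemma kac_weight_sqr : kac_weight ^+ 2 = dt * y / 2.
Proof. by rewrite exprMn sqr_sqrtr ?ltW// /y; field. Qed.

Let corr_y : kac_corr * (1 + y) <= 1.
Proof.
rewrite /kac_corr expRN -/y mulrC ler_pdivrMr ?expR_gt0// mul1r.
exact: expR_ge1Dx.
Qed.

(** A potential for the recursion of drift and cost. With b the drift, one step contracts its square
    to at most r b^2 + q. The weight 1/8 makes the new cost at most (1 - r) (a^2 + b^2), so that the
    coefficients of b^2 add up to 1 and the step adds q + q / 2 only. *)
Lemma kac_potential cs : y <= 1 -> let as_ := [seq kac_weight * c | c <- cs] in
  chain_drift kac_corr as_ ^+ 2 + chain_cost kac_corr as_ / 8 <=
    3 / 2 * energy cs.
Proof.
move=> y1; elim: cs => [|c cs /= IH] /=.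
  by rewrite /energy big_nil mulr0 expr0n/= mul0r addr0 mulr0.
rewrite /energy big_cons [dt * _]mulrDr -/(energy cs).
move: IH; set b := chain_drift _ _; set g := chain_cost _ _; set r := kac_corr.
set a := kac_weight * c; set q := dt * c ^+ 2 => IH.
have a2 : a ^+ 2 = q * y / 2 by rewrite exprMn kac_weight_sqr /q; field.
have q0 : 0 <= q by rewrite mulr_ge0 ?sqr_ge0// ltW.
have [r0 r1] := andP kac_corr_itv; rewrite -/r in r0 r1.
have h1 : r ^+ 2 * (a + b) ^+ 2 <= r * b ^+ 2 + q.
  have h : (a + b) ^+ 2 <= (1 + y) * b ^+ 2 + (1 + y) / y * a ^+ 2.
    rewrite -subr_ge0 (_ : _ - _ = (y * b - a) ^+ 2 / y); last first.
      by field; rewrite gt_eqF.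
    by rewrite divr_ge0 ?sqr_ge0// ltW.
  apply: (le_trans (ler_wpM2l (sqr_ge0 r) h)).
  have -> : r ^+ 2 * ((1 + y) * b ^+ 2 + (1 + y) / y * a ^+ 2) =
      (r * (1 + y)) * (r * b ^+ 2) + (r * (1 + y)) * (r * (q / 2)).
    by rewrite a2; field; rewrite gt_eqF.
  have ry0 : 0 <= r * (1 + y) by rewrite mulr_ge0// addr_ge0// ltW.
  apply: lerD; first by rewrite ler_piMl// mulr_ge0// sqr_ge0.
  apply: (@le_trans _ _ (r * (q / 2))).
    by rewrite ler_piMl// mulr_ge0// divr_ge0.
  apply: (@le_trans _ _ (q / 2)); first by rewrite ler_piMl// divr_ge0.
  by lra.
have h2 : (1 - r) * a ^+ 2 <= q / 2.
  have h : (1 - r) * a ^+ 2 <= 1 * a ^+ 2.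
    by rewrite ler_wpM2r ?sqr_ge0// lerBlDr lerDl.
  apply: (le_trans h); rewrite mul1r a2 ler_wpM2r ?invr_ge0//.
  by rewrite ler_piMr.
have h3 : (a + b) ^+ 2 <= 2 * a ^+ 2 + 2 * b ^+ 2.
  by rewrite -subr_ge0 (_ : _ - _ = (a - b) ^+ 2) ?sqr_ge0//; ring.
have h4 : (1 - r) * (a + b) ^+ 2 <= (1 - r) * (2 * a ^+ 2 + 2 * b ^+ 2).
  by rewrite ler_wpM2l// subr_ge0.
rewrite exprMn; move: h1 h2 h4 IH; lra.
Qed.

Lemma kac_small cs : y <= 1 -> energy cs <= 64^-1 ->
  chain_small kac_corr [seq kac_weight * c | c <- cs].
Proof.
move=> y1; elim: cs => [//|c cs IH] /= hE.
have eE : energy (c :: cs) = dt * c ^+ 2 + energy cs.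
  by rewrite /energy big_cons mulrDr.
have E0 : 0 <= energy cs.
  by rewrite mulr_ge0 ?(ltW dt0)// sumr_ge0// => i _; rewrite sqr_ge0.
have q0 : 0 <= dt * c ^+ 2 by rewrite mulr_ge0 ?sqr_ge0// ltW.
have hE' : energy cs <= 64^-1 by move: hE; rewrite eE; lra.
split; last exact: IH.
have := kac_potential cs y1 => /=.
set b := chain_drift _ _; set g := chain_cost _ _; set a := kac_weight * c => h.
have g0 : 0 <= g.
  have [r0 r1] := andP kac_corr_itv.
  rewrite /g; elim: {IH hE eE E0 hE' h b g} cs => [//|c' cs' IH] /=.
  by rewrite addr_ge0// mulr_ge0 ?sqr_ge0// mulr_ge0// subr_ge0.
have a2 : a ^+ 2 <= dt * c ^+ 2 / 2.
  rewrite exprMn kac_weight_sqr.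
  have : (dt * c ^+ 2) * y <= dt * c ^+ 2 by rewrite ler_piMr.
  by lra.
(* Together with the bounds on a^2 and b^2 this gives at most 9/4 of the energy, i.e. 9/256, which
   is below (1/4)^2. *)
have h3 : (a + b) ^+ 2 <= 3 * a ^+ 2 + 3 / 2 * b ^+ 2.
  rewrite -subr_ge0 (_ : _ - _ = (2 * a - b) ^+ 2 / 2); last by field.
  by rewrite divr_ge0// sqr_ge0.
rewrite -ler_sqr ?nnegrE// real_normK ?num_real//.
by move: h a2 h3 g0 hE E0; rewrite eE; lra.
Qed.

Lemma kac_exp_le cs s : y <= 1 -> energy cs <= 64^-1 -> s ^+ 2 = 1 ->
  nestE (nseq (size cs) kac_flip)
    (fun l => expR (chain_sum s [seq kac_weight * c | c <- cs] l)) <= expR 1.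
Proof.
move=> y1 hE s1.
have := @chain_exp_le kac_corr _ s kac_corr_itv s1 (kac_small y1 hE).
rewrite size_map => /le_trans; apply; rewrite ler_expR.
have := kac_potential cs y1 => /=.
set b := chain_drift _ _; set g := chain_cost _ _ => h.
have : b * s <= (b ^+ 2 + 1) / 2.
  rewrite -subr_ge0 (_ : _ - _ = (b - s) ^+ 2 / 2); last first.
    by rewrite -{1}s1; field.
  by rewrite divr_ge0// sqr_ge0.
have b0 : 0 <= b ^+ 2 by rewrite sqr_ge0.
by move: h hE; lra.
Qed.

Lemma norm_expn_le_expR (k : nat) (x : R) : `|x| ^+ k <= k`!%:R * (expR x + expR (- x)).
Proof.
have f0 : 0 < k`!%:R :> R by rewrite ltr0n fact_gt0.
rewrite -ler_pdivrMl// mulrC.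
have h : `|x| ^+ k / k`!%:R <= expR `|x|.
  case: k f0 => [|k] f0.
    by rewrite expr0 fact0 divr1 -expR0 ler_expR.
  have := @expR_ge1Dxn _ `|x| k (normr_ge0 _).
  by apply: le_trans; rewrite lerDr.
apply: (le_trans h); case: (ger0P x) => _.
  by rewrite lerDl expR_ge0.
by rewrite lerDr expR_ge0.
Qed.

Lemma kac_moment_le cs s (k : nat) (r : R) : y <= 1 -> 0 < r ->
  energy cs <= r ^+ 2 -> s ^+ 2 = 1 ->
  nestE (nseq (size cs) kac_flip)
    (fun l => `|chain_sum s [seq kac_weight * c | c <- cs] l| ^+ k) <=
  k`!%:R * 2 * expR 1 * (8 * r) ^+ k.
Proof.
move=> y1 r0 hE s1.
pose z := (8 * r)^-1; have z0 : 0 < z by rewrite invr_gt0 mulr_gt0.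
pose cs' := [seq z * c | c <- cs].
have hE' : energy cs' <= 64^-1.
  have -> : energy cs' = z ^+ 2 * energy cs.
    rewrite /energy big_map mulrCA; congr (_ * _); rewrite mulr_sumr.
    by apply: eq_bigr => c _; rewrite exprMn.
  apply: (@le_trans _ _ (z ^+ 2 * r ^+ 2)); first by rewrite ler_wpM2l ?sqr_ge0.
  by rewrite le_eqVlt; apply/orP; left; apply/eqP; rewrite /z; field; rewrite gt_eqF.
pose w l := chain_sum s [seq kac_weight * c | c <- cs] l.
have wE l : chain_sum s [seq kac_weight * c | c <- cs'] l = z * w l.
  rewrite -chain_sumZ; congr chain_sum; rewrite -!map_comp.
  by apply: eq_map => c /=; rewrite mulrCA.
have wEN l : chain_sum (- s) [seq kac_weight * c | c <- cs'] l = - (z * w l).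
  by rewrite chain_sum_scale -wE [in RHS]chain_sum_scale mulNr.
have sN : (- s) ^+ 2 = 1 by rewrite sqrrN.
have := kac_exp_le y1 hE' s1; have := kac_exp_le y1 hE' sN.
rewrite size_map.
rewrite (eq_nestE (Psi := fun l => expR (- (z * w l)))) => [hN|l _]; last by rewrite wEN.
rewrite (eq_nestE (Psi := fun l => expR (z * w l))) => [hP|l _]; last by rewrite wE.
have -> : k`!%:R * 2 * expR 1 * (8 * r) ^+ k =
    (k`!%:R / z ^+ k) * (expR 1 + expR 1).
  by rewrite /z exprVn invrK; ring.
apply: (@le_trans _ _ (nestE (nseq (size cs) kac_flip)
    (fun l => (k`!%:R / z ^+ k) * (expR (z * w l) + expR (- (z * w l)))))).
  apply: le_nestE => [|l _]; first exact: kac_flip_pmass.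
  have := norm_expn_le_expR k (z * w l).
  rewrite normrM exprMn gtr0_norm// => h.
  by rewrite mulrAC ler_pdivlMr ?exprn_gt0// mulrC.
rewrite nestEZ nestED ler_wpM2l ?lerD// divr_ge0// exprn_ge0// ltW//.
Qed.

End sign_chain.

(** * Gaussian moments and the central limit theorem *)

Section density.
Context {d : measure_display} {T : measurableType d} {R : realType}.
Local Open Scope ereal_scope.
Variables (mu nu : {measure set T -> \bar R}) (g : T -> R).
Hypotheses (mg : measurable_fun setT g) (g0 : forall x, (0 <= g x)%R).
Hypothesis nuE : forall A, measurable A -> nu A = \int[mu]_(x in A) (g x)%:E.

Let integral_density_indic A : measurable A ->
  \int[nu]_x (\1_A x)%:E = \int[mu]_x ((\1_A x)%:E * (g x)%:E).
Proof.
move=> mA; rewrite integral_indic// setIT nuE// integral_mkcond.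
apply: eq_integral => x _; rewrite patchE indicE.
by case: (x \in A); rewrite ?mul1e ?mul0e.
Qed.

Import HBNNSimple.

Let integral_density_nnsfun (h : {nnsfun T >-> R}) :
  \int[nu]_x (h x)%:E = \int[mu]_x ((h x)%:E * (g x)%:E).
Proof.
under [LHS]eq_integral do rewrite fimfunE -fsumEFin//.
rewrite ge0_integral_fsum//; last 2 first.
- by move=> r; exact/measurable_EFinP/measurableT_comp.
- by move=> r x _; rewrite EFinM nnfun_muleindic_ge0.
under [RHS]eq_integral.
  move=> x _; rewrite fimfunE -fsumEFin// ge0_mule_fsuml; last first.
    by move=> r; rewrite EFinM nnfun_muleindic_ge0.
  over.
rewrite [RHS]ge0_integral_fsum//; last 2 first.
- move=> r; apply: emeasurable_funM; last exact/measurable_EFinP.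
  exact/measurable_EFinP/measurableT_comp.
- move=> r x _; apply: mule_ge0; last by rewrite lee_fin.
  by rewrite EFinM nnfun_muleindic_ge0.
apply: eq_fsbigr => r _.
have [r0|r0] := leP 0%R r; last first.
  rewrite !integral0_eq//= => x _; rewrite preimage_nnfun0// indic0 mulr0//.
  by rewrite mul0e.
rewrite integralZl_indic_nnsfun// integral_density_indic//.
under [RHS]eq_integral do rewrite EFinM -muleA.
rewrite ge0_integralZl//; last 2 first.
- apply: emeasurable_funM; last exact/measurable_EFinP.
  exact/measurable_EFinP/measurable_indic.
- by move=> x _; rewrite mule_ge0 ?lee_fin.
Qed.

Lemma integral_density (f : T -> \bar R) : measurable_fun setT f ->
  (forall x, 0 <= f x) -> \int[nu]_x f x = \int[mu]_x (f x * (g x)%:E).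
Proof.
move=> mf f0; pose f_ := nnsfun_approx measurableT mf.
have ndf x m n : (m <= n)%N -> (f_ m x)%:E <= (f_ n x)%:E.
  by move=> mn; rewrite lee_fin; exact/lefP/nd_nnsfun_approx.
have cf x : (f_ n x)%:E @[n --> \oo] --> f x by exact: cvg_nnsfun_approx.
transitivity (limn (fun n => \int[nu]_x (f_ n x)%:E)).
  rewrite -monotone_convergence//=.
  - by apply: eq_integral => x _; apply/esym/cvg_lim.
  - by move=> n; exact/measurable_EFinP.
  - by move=> n x _; rewrite lee_fin.
  - by move=> x _ m n; exact: ndf.
transitivity (limn (fun n => \int[mu]_x ((f_ n x)%:E * (g x)%:E))).
  by apply: congr_lim; apply/funext => n; exact: integral_density_nnsfun.
rewrite -monotone_convergence//=.
- apply: eq_integral => x _; apply/cvg_lim => //.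
  by apply: cvgeZr => //.
- by move=> n; apply: emeasurable_funM; exact/measurable_EFinP.
- by move=> n x _; rewrite mule_ge0 ?lee_fin.
- by move=> x _ m n mn; rewrite lee_wpmul2r ?lee_fin// -lee_fin ndf.
Qed.

End density.

Section exponential_taylor.
Context {R : realType}.

Let expR_taylor_pos (u : R) : 0 <= u -> 0 <= expR u - 1 - u - u ^+ 2 / 2 <= u ^+ 3 * expR u.
Proof.
have e1 x : 0 <= x -> expR x - 1 <= x * expR x :> R.
  move=> x0; have h := expR_ge1Dx (- x).
  have := expR_ge0 x => ex0; have := ler_wpM2r ex0 h.
  by rewrite -expRD addNr expR0; lra.
have e2 x : 0 <= x -> expR x - 1 - x <= x ^+ 2 * expR x :> R.
  move=> x0.
  pose j y : R := expR y - 1 - y - y ^+ 2 * expR y.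
  have dj (y : R) : is_derive y 1 j (expR y - 1 - (2 * y + y ^+ 2) * expR y).
    by rewrite /j; apply: is_derive_eq; rewrite /GRing.scale/=; ring.
  have := derive_le0_le dj _ x0; rewrite /j expr0n expR0 mul0r !subr0 subrr subr_le0.
  apply=> y y0; have h1 := e1 y y0; have h2 : 0 <= (y + y ^+ 2) * expR y.
    by rewrite mulr_ge0 ?expR_ge0// addr_ge0// sqr_ge0.
  by move: h1 h2; rewrite !mulrDl; lra.
move=> u0; apply/andP; split.
  pose i y : R := 1 + y + y ^+ 2 / 2 - expR y.
  have di (y : R) : is_derive y 1 i (1 + y - expR y).
    by rewrite /i; apply: is_derive_eq; rewrite /GRing.scale/=; field.
  have := derive_le0_le di _ u0; rewrite /i expr0n expR0 mul0r !addr0 subrr.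
  have h (y : R) : 0 <= y -> 1 + y - expR y <= 0 by move=> _; rewrite subr_le0 expR_ge1Dx.
  by move/(_ h); lra.
pose k y : R := expR y - 1 - y - y ^+ 2 / 2 - y ^+ 3 * expR y.
have dk (y : R) : is_derive y 1 k (expR y - 1 - y - (3 * y ^+ 2 + y ^+ 3) * expR y).
  by rewrite /k; apply: is_derive_eq; rewrite /GRing.scale/=; field.
have := derive_le0_le dk _ u0; rewrite /k !expr0n expR0 !mul0r !subr0 subrr subr_le0.
apply=> y y0; have h1 := e2 y y0; have h2 : 0 <= (2 * y ^+ 2 + y ^+ 3) * expR y.
  by rewrite mulr_ge0 ?expR_ge0// addr_ge0// ?mulr_ge0 ?exprn_ge0.
by move: h1 h2; rewrite !mulrDl; lra.
Qed.

Let expR_taylor_neg (u : R) : 0 <= u ->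
  - u ^+ 3 <= expR (- u) - 1 + u - u ^+ 2 / 2 <= 0.
Proof.
have e1 x : 0 <= x -> expR (- x) - 1 + x - x ^+ 2 / 2 <= 0 :> R.
  move=> x0; pose f y : R := expR (- y) - 1 + y - y ^+ 2 / 2.
  have df (y : R) : is_derive y 1 f (- expR (- y) + 1 - y).
    have he : is_derive (- y) 1 (@expR R) (expR (- y)) by exact: is_derive_expR.
    have hn : is_derive y 1 (fun y : R => - y) (-1).
      by have := @is_deriveN _ _ _ id y 1 1 (is_derive_id y 1).
    have := @is_derive1_comp _ expR (fun u => - u) y _ _ he hn => hc.
    by rewrite /f; apply: is_derive_eq; rewrite /GRing.scale/=; field.
  have := derive_le0_le df _ x0; rewrite /f expr0n oppr0 expR0 mul0r subrr !addr0 subr0.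
  by apply=> y y0; have := expR_ge1Dx (- y); lra.
move=> u0; apply/andP; split; last exact: e1.
pose f y : R := - (expR (- y) - 1 + y - y ^+ 2 / 2) - y ^+ 3.
have df (y : R) : is_derive y 1 f (expR (- y) - 1 + y - 3 * y ^+ 2).
  have he : is_derive (- y) 1 (@expR R) (expR (- y)) by exact: is_derive_expR.
  have hn : is_derive y 1 (fun y : R => - y) (-1).
    by have := @is_deriveN _ _ _ id y 1 1 (is_derive_id y 1).
  have := @is_derive1_comp _ expR (fun u => - u) y _ _ he hn => hc.
  by rewrite /f; apply: is_derive_eq; rewrite /GRing.scale/=; field.
have := derive_le0_le df _ u0.
rewrite /f !expr0n oppr0 expR0 mul0r subrr !addr0 !subr0 oppr0.
have h (y : R) : 0 <= y -> expR (- y) - 1 + y - 3 * y ^+ 2 <= 0.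
  by move=> y0; have := e1 y y0; have := sqr_ge0 y; lra.
by move/(_ h); lra.
Qed.

Lemma expR_taylor (z : R) :
  `|expR z - 1 - z - z ^+ 2 / 2| <= `|z| ^+ 3 * expR `|z|.
Proof.
have [z0|z0] := ger0P z.
  by have /andP[h1 h2] := expR_taylor_pos z0; rewrite ger0_norm.
have Nz0 : 0 <= - z by rewrite oppr_ge0 ltW.
have /andP[] := expR_taylor_neg Nz0; rewrite opprK sqrrN => h1 h2.
rewrite ler0_norm; last by move: h2; lra.
apply: (@le_trans _ _ ((- z) ^+ 3)); first by move: h1; lra.
by rewrite ler_peMr ?exprn_ge0// -expR0 ler_expR.
Qed.

End exponential_taylor.

Section gaussian_moments.
Context {R : realType}.
Variable s : R.
Hypothesis s0 : 0 < s.
Local Notation N := (normal_prob (0 : R) s).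

(** Completing the square: the tilted density is the normal density of mean c s^2, up to the factor
    on the right. *)
Lemma normal_mgf (c : R) :
  (\int[N]_x (expR (c * x))%:E = (expR (c ^+ 2 * s ^+ 2 / 2))%:E)%E.
Proof.
rewrite (@integral_density _ _ _ lebesgue_measure N (normal_pdf 0 s))//; last 3 first.
- exact: measurable_normal_pdf.
- by move=> x; exact: normal_pdf_ge0.
- apply/measurable_EFinP; apply: measurableT_comp => //; exact: mulrl_measurable.
have sn0 : s != 0 by rewrite gt_eqF.
transitivity (\int[lebesgue_measure]_x ((expR (c ^+ 2 * s ^+ 2 / 2))%:E *
    (normal_pdf (c * s ^+ 2) s x)%:E))%E.
  apply: eq_integral => x _; rewrite -!EFinM; congr EFin.
  rewrite /normal_pdf (negbTE sn0) /normal_fun mulrCA [RHS]mulrCA; congr (_ * _).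
  rewrite -!expRD; congr expR.
  by rewrite -mulr_natr; field.
rewrite ge0_integralZl//; last 2 first.
- apply/measurable_EFinP; exact: measurable_normal_pdf.
- by move=> x _; rewrite lee_fin normal_pdf_ge0.
by rewrite integral_normal_pdf mule1.
Qed.

Let mexp (c : R) : measurable_fun setT (fun x => expR (c * x)).
Proof. by apply: measurableT_comp => //; exact: mulrl_measurable. Qed.

Lemma normal_exp_integrable c : N.-integrable setT (fun x => (expR (c * x))%:E).
Proof.
apply/integrableP; split; first by apply/measurable_EFinP; exact: mexp.
under eq_integral do rewrite /= ger0_norm ?expR_ge0//.
by rewrite normal_mgf ltry.
Qed.

Lemma normal_exp_Rintegral c : \int[N]_x expR (c * x) = expR (c ^+ 2 * s ^+ 2 / 2).
Proof. by rewrite /Rintegral normal_mgf. Qed.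

Lemma normal_dominated_integrable (f : R -> R) (K c : R) : measurable_fun setT f ->
  (forall x, `|f x| <= K * (expR (c * x) + expR (- c * x))) ->
  N.-integrable setT (EFin \o f).
Proof.
move=> mf fK.
have iE := integrableD measurableT (normal_exp_integrable c) (normal_exp_integrable (- c)).
have := integrableZl measurableT K iE; apply: le_integrable => //.
  exact/measurable_EFinP.
move=> x _ /=; rewrite lee_fin (le_trans (fK x))//.
exact: ler_norm.
Qed.

(** The exponential bound on |x|^k at the scale 1 / s, in the same shape as the moment bound for the
    chain of signs. *)
Lemma normal_moment_le (k : nat) :
  \int[N]_x (`|x| ^+ k) <= k`!%:R * 2 * expR 1 * s ^+ k.
Proof.
have c0 : 0 < s^-1 by rewrite invr_gt0.
have hk x : `|x| ^+ k <= (k`!%:R * s ^+ k) * (expR (s^-1 * x) + expR (- s^-1 * x)).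
  have := norm_expn_le_expR k (s^-1 * x).
  rewrite normrM exprMn gtr0_norm// exprVn mulNr.
  by rewrite ler_pdivrMl ?exprn_gt0// mulrA [s ^+ k * _]mulrC.
have mk : measurable_fun setT (fun x : R => `|x| ^+ k).
  by apply: measurable_funX; exact: normr_measurable.
have ik : N.-integrable setT (EFin \o (fun x : R => `|x| ^+ k)).
  apply: (normal_dominated_integrable mk (K := k`!%:R * s ^+ k) (c := s^-1)) => x.
  by rewrite ger0_norm ?exprn_ge0.
have i1 := normal_exp_integrable s^-1; have i2 := normal_exp_integrable (- s^-1).
have iD := integrableD measurableT i1 i2.
apply: (@le_trans _ _ (\int[N]_x ((k`!%:R * s ^+ k) *
    (expR (s^-1 * x) + expR (- s^-1 * x))))).
  apply: le_Rintegral => //.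
  exact: (integrableZl measurableT (k`!%:R * s ^+ k) iD).
rewrite RintegralZl// RintegralD// !normal_exp_Rintegral sqrrN.
have e : s^-1 ^+ 2 * s ^+ 2 = 1 by rewrite -exprMn mulVf ?gt_eqF// expr1n.
rewrite e div1r.
have : expR 2^-1 <= expR 1 :> R by rewrite ler_expR invf_le1// ler1n.
move=> /(ler_wpM2l (_ : 0 <= k`!%:R * s ^+ k)) h.
have := h (mulr_ge0 (ler0n _ _) (exprn_ge0 k (ltW s0))).
by lra.
Qed.

(* Moments are read off the expansion of the moment generating function at 0. *)
Let K := \int[N]_x (`|x| ^+ 3 * expR `|x|).

Let mabs3 : measurable_fun setT (fun x : R => `|x| ^+ 3 * expR `|x|).
Proof.
apply: measurable_funM; first by apply: measurable_funX; exact: normr_measurable.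
by apply: measurableT_comp => //; exact: normr_measurable.
Qed.

Let abs3_le (x : R) : `|x| ^+ 3 * expR `|x| <= 6 * (expR (2 * x) + expR (- 2 * x)).
Proof.
have h : `|x| ^+ 3 <= 6 * expR `|x|.
  have := @expR_ge1Dxn _ `|x| 2 (normr_ge0 _) => h.
  have : `|x| ^+ 3 / 6 <= expR `|x| by apply: le_trans h; rewrite lerDr.
  by rewrite ler_pdivrMr// mulrC.
have := ler_wpM2r (expR_ge0 `|x|) h => /le_trans; apply.
rewrite -mulrA -expRD -mulr2n -[_ *+ 2]mulr_natl; apply: ler_wpM2l => //.
by case: (ger0P x) => _; rewrite ?mulrN ?mulNr ?lerDl ?lerDr expR_ge0.
Qed.

Let iabs3 : N.-integrable setT (EFin \o (fun x : R => `|x| ^+ 3 * expR `|x|)).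
Proof.
apply: (normal_dominated_integrable mabs3 (K := 6) (c := 2)) => x.
by rewrite ger0_norm ?abs3_le// mulr_ge0 ?exprn_ge0 ?expR_ge0.
Qed.

Lemma normal_pow_integrable k : N.-integrable setT (EFin \o (fun x : R => x ^+ k)).
Proof.
apply: (normal_dominated_integrable _ (K := k`!%:R) (c := 1)).
  by apply: measurable_funX; exact: measurable_id.
by move=> x; rewrite normrX mul1r mulN1r; exact: norm_expn_le_expR.
Qed.

Lemma normal_abs_integrable k : N.-integrable setT (EFin \o (fun x : R => `|x| ^+ k)).
Proof.
apply: (normal_dominated_integrable _ (K := k`!%:R) (c := 1)).
  by apply: measurable_funX; exact: normr_measurable.
move=> x; rewrite ger0_norm ?exprn_ge0// mul1r mulN1r; exact: norm_expn_le_expR.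
Qed.

Let taylor_le (c x : R) : 0 < c <= 1 ->
  `|expR (c * x) - 1 - c * x - c ^+ 2 * x ^+ 2 / 2| <= c ^+ 3 * (`|x| ^+ 3 * expR `|x|).
Proof.
move=> /andP[c0 c1]; have := expR_taylor (c * x).
rewrite -exprMn => /le_trans; apply.
rewrite normrM exprMn gtr0_norm// -mulrA ler_wpM2l ?exprn_ge0 ?(ltW c0)//.
by rewrite ler_wpM2l ?exprn_ge0// ler_expR ler_piMl.
Qed.

Let m1 := \int[N]_x x.
Let m2 := \int[N]_x (x ^+ 2).

Let expansion (c : R) : 0 < `|c| <= 1 ->
  `|expR (c ^+ 2 * s ^+ 2 / 2) - 1 - c * m1 - c ^+ 2 / 2 * m2| <= `|c| ^+ 3 * K.
Proof.
move=> c01.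
have i1 := normal_pow_integrable 1; have i2 := normal_pow_integrable 2.
have ie := normal_exp_integrable c.
have i0 : N.-integrable setT (EFin \o cst (1 : R)).
  by apply: (@bounded_integrable _ _ _ _ 1) => //= x; rewrite normr1.
have ic1 : N.-integrable setT (EFin \o (fun x : R => c * x)).
  exact: (integrableZl measurableT c i1).
have ic2 : N.-integrable setT (EFin \o (fun x : R => c ^+ 2 / 2 * x ^+ 2)).
  exact: (integrableZl measurableT (c ^+ 2 / 2) i2).
have ie0 : N.-integrable setT (EFin \o (fun x : R => expR (c * x) - 1)).
  exact: (integrableB measurableT ie i0).
have ie1 : N.-integrable setT (EFin \o (fun x : R => expR (c * x) - 1 - c * x)).
  exact: (integrableB measurableT ie0 ic1).
have ie2 : N.-integrable setT
    (EFin \o (fun x : R => expR (c * x) - 1 - c * x - c ^+ 2 / 2 * x ^+ 2)).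
  exact: (integrableB measurableT ie1 ic2).
have -> : expR (c ^+ 2 * s ^+ 2 / 2) - 1 - c * m1 - c ^+ 2 / 2 * m2 =
    \int[N]_x (expR (c * x) - 1 - c * x - c ^+ 2 / 2 * x ^+ 2).
  rewrite RintegralB// RintegralB// RintegralB// normal_exp_Rintegral.
  rewrite Rintegral_probability_cst RintegralZl// RintegralZl//.
apply: (le_trans (le_normr_Rintegral _ ie2)) => //.
rewrite /K -RintegralZl//; apply: le_Rintegral => //.
- exact: integrable_abse ie2.
- exact: (integrableZl measurableT (`|c| ^+ 3) iabs3).
move=> x _.
have := @taylor_le `|c| (Num.sg c * x) c01.
have sgc : `|c| * (Num.sg c * x) = c * x by rewrite mulrA [_ * Num.sg c]mulrC -numEsg.
have c0 : c != 0 by case/andP: c01; rewrite normr_gt0.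
have nsg : `|Num.sg c * x| = `|x| by rewrite normrM normr_sg c0 mul1r.
rewrite -exprMn sgc nsg; apply: le_trans; rewrite le_eqVlt; apply/orP; left.
by apply/eqP; congr `|_|; rewrite exprMn; field.
Qed.

Let K0 : 0 <= K.
Proof. by apply: Rintegral_ge0 => x _; rewrite mulr_ge0 ?exprn_ge0 ?expR_ge0. Qed.

(** Lets c tend to 0 in an expansion whose remainder has one more power of c than the term to be
    identified. *)
Let small_le (a C : R) : (forall c, 0 < c <= 1 -> a <= c * C) -> a <= 0.
Proof.
move=> h; have [//|a0] := leP a 0.
have C0 : 0 < C by have := h 1; rewrite ltr01 lexx mul1r => /(_ isT); exact: lt_le_trans.
pose c := Num.min 1 (a / (2 * C)).
have c0 : 0 < c <= 1.
  by rewrite lt_min ltr01/= divr_gt0 ?mulr_gt0//= ge_min lexx.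
have := h c c0; have : c * C <= a / 2.
  have : c <= a / (2 * C) by rewrite ge_min lexx orbT.
  move=> /(ler_wpM2r (ltW C0)); have -> : a / (2 * C) * C = a / 2.
    by field; rewrite gt_eqF.
  by [].
by move=> h1 h2; have := le_trans h2 h1; lra.
Qed.

(** The generating function is even in c, so subtracting its expansions at c and - c isolates 2 c
    m1, with an error of order c^3. *)
Lemma normal_mean0 : \int[N]_x x = 0.
Proof.
suff h : `|m1| <= 0 by apply/eqP; rewrite -normr_le0.
apply: (@small_le _ K) => c c01; have /andP[c0 c1] := c01.
have h1 := @expansion c; have h2 := @expansion (- c).
rewrite normrN ger0_norm ?(ltW c0)// in h1 h2.
have {}h1 := h1 c01; have {}h2 := h2 c01.
rewrite sqrrN in h2; set e := expR _ in h1 h2.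
have : `|2 * c * m1| <= 2 * (c ^+ 3 * K).
  rewrite (_ : 2 * c * m1 = (e - 1 - - c * m1 - c ^+ 2 / 2 * m2) -
    (e - 1 - c * m1 - c ^+ 2 / 2 * m2)); last by ring.
  by rewrite (le_trans (ler_normB _ _))// mulr_natl mulr2n lerD.
rewrite !normrM gtr0_norm// (gtr0_norm c0) -mulrA ler_pM2l//.
rewrite -ler_pdivlMl// => /le_trans; apply.
have -> : c^-1 * (c ^+ 3 * K) = c * (c * K) by field; rewrite gt_eqF.
by rewrite ler_wpM2l ?(ltW c0)// ler_piMl.
Qed.

(** The coefficients of c^2 in two expansions are compared: that of the generating function by
    moments, and that of its closed form exp(c^2 s^2 / 2). *)
Lemma normal_variance : \int[N]_x (x ^+ 2) = s ^+ 2.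
Proof.
apply/eqP; rewrite -subr_eq0 -normr_le0.
pose u := s ^+ 2 / 2.
have u0 : 0 <= u by rewrite divr_ge0 ?sqr_ge0.
apply: (@small_le _ (2 * K + u ^+ 2 + 2 * (u ^+ 3 * expR u))) => c c01.
have /andP[c0 c1] := c01.
have h1 := @expansion c; rewrite ger0_norm ?(ltW c0)// in h1.
have {}h1 := h1 c01.
have -> : \int[N]_x x ^+ 2 = m2 by [].
have hm : m1 = 0 := normal_mean0.
rewrite hm mulr0 subr0 in h1.
have e : c ^+ 2 * s ^+ 2 / 2 = c ^+ 2 * u by rewrite /u; field.
rewrite e in h1.
have h2 := expR_taylor (c ^+ 2 * u).
have cu0 : 0 <= c ^+ 2 * u by rewrite mulr_ge0 ?sqr_ge0.
rewrite (ger0_norm cu0) in h2.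
have c21 : c ^+ 2 <= 1 by rewrite expr_le1// ltW.
have h3 : (c ^+ 2 * u) ^+ 3 * expR (c ^+ 2 * u) <= c ^+ 2 * c * (u ^+ 3 * expR u).
  rewrite exprMn -[leLHS]mulrA; apply: ler_pM.
  - by rewrite exprn_ge0// sqr_ge0.
  - by rewrite mulr_ge0 ?exprn_ge0 ?expR_ge0.
  - rewrite -exprM -exprSr; apply: ler_wiXn2l => //; exact: ltW.
  - rewrite ler_wpM2l ?exprn_ge0// ler_expR ler_piMl//.
have h4 : `|c ^+ 2 * (m2 - s ^+ 2)| <=
    2 * (c ^+ 3 * K) + c ^+ 2 * c * (u ^+ 2 + 2 * (u ^+ 3 * expR u)).
  rewrite (_ : c ^+ 2 * (m2 - s ^+ 2) =
    - 2 * (expR (c ^+ 2 * u) - 1 - c ^+ 2 / 2 * m2) +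
    2 * (expR (c ^+ 2 * u) - 1 - c ^+ 2 * u - (c ^+ 2 * u) ^+ 2 / 2) +
    (c ^+ 2 * u) ^+ 2); last by rewrite /u; field.
  have -> : 2 * (c ^+ 3 * K) + c ^+ 2 * c * (u ^+ 2 + 2 * (u ^+ 3 * expR u)) =
      2 * (c ^+ 3 * K) + 2 * (c ^+ 2 * c * (u ^+ 3 * expR u)) + c ^+ 2 * c * u ^+ 2.
    by ring.
  rewrite (le_trans (ler_normD _ _))//; apply: lerD.
    rewrite (le_trans (ler_normD _ _))//; apply: lerD.
      by rewrite normrM normrN (gtr0_norm (ltr0n R 2)) ler_pM2l.
    by rewrite normrM (gtr0_norm (ltr0n R 2)) ler_pM2l// (le_trans h2).
  rewrite ger0_norm ?sqr_ge0// exprMn ler_wpM2r ?sqr_ge0//.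
  by rewrite -exprM -exprSr; apply: ler_wiXn2l => //; exact: ltW.
rewrite normrM ger0_norm ?sqr_ge0// in h4.
have c20 : 0 < c ^+ 2 by rewrite exprn_gt0.
rewrite -(ler_pM2l c20) (le_trans h4)//.
by rewrite le_eqVlt; apply/orP; left; apply/eqP; ring.
Qed.

End gaussian_moments.

(** * Smooth approximation of Lipschitz functions, with uniform Taylor bounds *)

Section smoothing.
Context {R : realType}.
Implicit Types (f g psi : R -> R).

Definition lipschitz_fun (L : R) f := forall x y, `|f x - f y| <= L * `|x - y|.

Lemma lipschitz_fun_continuous L f : 0 <= L -> lipschitz_fun L f -> continuous f.
Proof.
move=> L0 Lf x; apply/cvgrPdist_le => e e0.
have L1 : 0 < L + 1 by rewrite ltr_wpDl.
have d0 : 0 < e / (L + 1) by exact: divr_gt0.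
have /cvgrPdist_le/(_ _ d0) : y @[y --> x] --> x by exact: cvg_id.
apply: filterS => y h.
apply: (le_trans (Lf x y)); apply: (@le_trans _ _ ((L + 1) * (e / (L + 1)))); last first.
  by rewrite mulrC divfK// gt_eqF.
by apply: ler_pM => //; rewrite lerDl.
Qed.

Lemma lipschitz_fun_measurable L f : 0 <= L -> lipschitz_fun L f ->
  measurable_fun setT f.
Proof.
by move=> L0 Lf; apply: continuous_measurable_fun; exact: lipschitz_fun_continuous Lf.
Qed.

Lemma derive_bounded_dist f df (c y : R) : (forall x : R, is_derive x 1 f (df x)) ->
  f 0 = 0 -> (forall x, `|x| <= `|y| -> `|df x| <= c) -> `|f y| <= c * `|y|.
Proof.
move=> fd f0 dfc.
have cf a b : {within `[a, b], continuous f}.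
  by apply: derivable_within_continuous => x _; have [] := fd x.
have [y0|y0] := leP 0 y.
  have [x] := @MVT_segment _ f df 0 y y0 (fun x _ => fd x) (cf _ _).
  rewrite in_itv/= => /andP[x0 xy]; rewrite f0 !subr0 => ->.
  by rewrite normrM ler_wpM2r// dfc// !ger0_norm.
have [x] := @MVT_segment _ f df y 0 (ltW y0) (fun x _ => fd x) (cf _ _).
rewrite in_itv/= => /andP[xy x0]; rewrite f0 !sub0r => h.
rewrite -normrN h normrM normrN ler_wpM2r// dfc//.
by rewrite !ler0_norm// ?lerN2// ltW.
Qed.

Lemma is_derive_shift_comp f (x c d : R) :
  is_derive (x + c) 1 f d -> is_derive x 1 (fun t => f (t + c)) d.
Proof.
move=> fd.
have hs : is_derive x 1 (fun t : R => t + c) 1.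
  have := @is_deriveD _ _ _ id (cst c) x 1 1 0 (is_derive_id x 1) (is_derive_cst c x 1).
  by rewrite addr0.
by have := @is_derive1_comp _ f (fun t => t + c) x _ _ fd hs; rewrite mulr1.
Qed.

Lemma derive_bounded_lipschitz f df (L : R) :
  (forall x : R, is_derive x 1 f (df x)) -> (forall x, `|df x| <= L) ->
  lipschitz_fun L f.
Proof.
move=> fd dfL x y.
pose g t := f (t + y) - f y.
have gd (t : R) : is_derive t 1 g (df (t + y)).
  have h := is_derive_shift_comp (fd (t + y)).
  by rewrite /g; apply: is_derive_eq; rewrite subr0.
have := @derive_bounded_dist g _ L (x - y) gd _ (fun t _ => dfL _).
by rewrite /g add0r subrr subrK; exact.
Qed.

(** A forward moving average. It gains one derivative, a difference quotient, and keeps the sup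
    bound and the Lipschitz constant. *)
Definition box_avg (dl : R) psi (x : R) : R :=
  dl^-1 * \int[lebesgue_measure]_(t in `[x, x + dl]) psi t.

Lemma box_avg_derive (dl : R) psi (x : R) : 0 < dl -> continuous psi ->
  is_derive x 1 (box_avg dl psi) ((psi (x + dl) - psi x) / dl) /\
  exists2 y, x <= y <= x + dl & box_avg dl psi x = psi y.
Proof.
(* The primitive starts strictly to the left of x, so that it is differentiable on a neighbourhood
   of x. *)
move=> dl0 cpsi; pose a := x - 1.
have ipsi b : lebesgue_measure.-integrable `[a, b] (EFin \o psi).
  apply: continuous_compact_integrable; first exact: segment_compact.
  exact: continuous_subspaceT.
pose G t := \int[lebesgue_measure]_(u in `[a, t]) psi u.
have Gd (t : R) : a < t -> is_derive t 1 G (psi t).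
  move=> at_; have t1 : t < t + 1 by rewrite ltrDl.
  have [h1 h2] := @continuous_FTC1_closed _ psi a t (t + 1) t1 (ipsi _) at_ (cpsi t).
  by rewrite -h2 derive1E; exact: derivableP.
have boxE t : a < t -> box_avg dl psi t = dl^-1 * (G (t + dl) - G t).
  move=> at_; rewrite /box_avg /G; congr (_ * _).
  rewrite (@Rintegral_itvB _ psi (BLeft a) (BRight (t + dl)) t)//.
  - rewrite Rintegral_itv_obnd_cbnd//.
    apply: integrableS (ipsi (t + dl)) => //.
    by apply: subset_itvScc; rewrite bnd_simp// ltW.
  - by rewrite bnd_simp ltW.
  - by rewrite bnd_simp lerDl ltW.
have ax : a < x by rewrite /a ltrBlDr ltrDl.
have axd : a < x + dl by rewrite (lt_trans ax)// ltrDl.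
split.
  apply: (@near_eq_is_derive _ _ _ (fun t => dl^-1 * (G (t + dl) - G t))).
    near=> t; rewrite boxE//; near: t.
    exact: lt_nbhsr.
  have h1 := Gd x ax; have h2 := is_derive_shift_comp (Gd _ axd).
  by apply: is_derive_eq; rewrite /GRing.scale/= mulrC.
have xd : x <= x + dl by rewrite lerDl ltW.
have H1 : forall t : R, t \in `]x, (x + dl)[ -> is_derive t 1 G (psi t).
  by move=> t; rewrite in_itv/= => /andP[xt _]; apply: Gd; exact: lt_trans xt.
have H2 : {within `[x, x + dl], continuous G}.
  apply: derivable_within_continuous => t; rewrite in_itv/= => /andP[xt _].
  by have [] := Gd t (lt_le_trans ax xt).
have [y yi h] := @MVT_segment _ G psi x (x + dl) xd H1 H2.
exists y; first by move: yi; rewrite in_itv.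
by rewrite boxE// h [x + dl]addrC addrK mulrC mulfK// gt_eqF.
Unshelve. all: by end_near. Qed.

Section box.
Variables (dl B L : R) (psi : R -> R).
Hypotheses (dl0 : 0 < dl) (L0 : 0 <= L) (psiB : forall x, `|psi x| <= B)
  (psiL : lipschitz_fun L psi).

Let cpsi : continuous psi. Proof. exact: lipschitz_fun_continuous psiL. Qed.

Lemma box_avg_bounded x : `|box_avg dl psi x| <= B.
Proof. by have [_ [y _ ->]] := box_avg_derive x dl0 cpsi. Qed.

Lemma box_avg_lipschitz : lipschitz_fun L (box_avg dl psi).
Proof.
apply: (derive_bounded_lipschitz (df := fun x => (psi (x + dl) - psi x) / dl)).
  by move=> x; have [] := box_avg_derive x dl0 cpsi.
move=> x; rewrite normrM (gtr0_norm (_ : 0 < dl^-1)) ?invr_gt0// ler_pdivrMr//.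
have := psiL (x + dl) x; rewrite (_ : x + dl - x = dl); last by ring.
by rewrite (gtr0_norm dl0).
Qed.

Lemma box_avg_near x : `|box_avg dl psi x - psi x| <= L * dl.
Proof.
have [_ [y /andP[xy yx] ->]] := box_avg_derive x dl0 cpsi.
rewrite (le_trans (psiL y x))// ler_wpM2l// ger0_norm ?subr_ge0//.
by rewrite lerBlDl.
Qed.

End box.

(* [f1] and [f2] play the role of the first two derivatives of [f]; unlike
   differentiability, these bounds pass to averages at no cost. *)
Definition taylor3 (M : R) f f1 f2 : Prop :=
  [/\ forall x, `|f x| <= M, forall x, `|f1 x| <= M, forall x, `|f2 x| <= M,
      [/\ lipschitz_fun M f, lipschitz_fun M f1 & lipschitz_fun M f2] &
      forall x y, `|f (x + y) - f x - f1 x * y - f2 x * y ^+ 2 / 2| <= M * `|y| ^+ 3].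

Lemma taylor3_derive f f1 f2 (M : R) : 0 <= M ->
  (forall x : R, is_derive x 1 f (f1 x)) -> (forall x : R, is_derive x 1 f1 (f2 x)) ->
  lipschitz_fun M f2 -> forall x y,
  `|f (x + y) - f x - f1 x * y - f2 x * y ^+ 2 / 2| <= M * `|y| ^+ 3.
Proof.
move=> M0 fd f1d f2L x y.
pose g s := f (s + x) - f x - f1 x * s - f2 x / 2 * s ^+ 2.
pose g1 s := f1 (s + x) - f1 x - f2 x * s.
have gd (s : R) : is_derive s 1 g (g1 s).
  have h := is_derive_shift_comp (fd (s + x)).
  by rewrite /g; apply: is_derive_eq; rewrite /g1 /GRing.scale/=; field.
have g1d (s : R) : is_derive s 1 g1 (f2 (s + x) - f2 x).
  have h := is_derive_shift_comp (f1d (s + x)).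
  by rewrite /g1; apply: is_derive_eq; rewrite /GRing.scale/=; ring.
have g1b s : `|s| <= `|y| -> `|g1 s| <= M * `|y| ^+ 2.
  move=> sy; have := @derive_bounded_dist g1 _ (M * `|y|) s g1d _ _.
  rewrite {1}/g1 add0r subrr mulr0 subrr => /(_ erefl) h.
  apply: (@le_trans _ _ (M * `|y| * `|s|)).
    apply: h => t ts; apply: (le_trans (f2L _ _)); rewrite addrK ler_wpM2l//.
    exact: le_trans ts sy.
  by rewrite expr2 mulrA ler_wpM2l// mulr_ge0.
have := @derive_bounded_dist g _ (M * `|y| ^+ 2) y gd _ g1b.
rewrite /g add0r subrr mulr0 expr0n mulr0 !subrr => /(_ erefl).
have -> : M * `|y| ^+ 2 * `|y| = M * `|y| ^+ 3 by ring.
by rewrite [y + x]addrC [f2 x / 2 * _]mulrAC.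
Qed.

(** Two moving averages of width e / (2 L) displace psi by e / 2 each. M is chosen before psi, which
    makes the central limit theorem uniform over bounded Lipschitz test functions. *)
Lemma smoothing (B L e : R) : 0 < B -> 0 < L -> 0 < e ->
  exists2 M, 0 < M & forall psi, (forall x, `|psi x| <= B) -> lipschitz_fun L psi ->
  exists f f1 f2, taylor3 M f f1 f2 /\ forall x, `|f x - psi x| <= e.
Proof.
move=> B0 L0 e0; pose dl := e / (2 * L).
have dl0 : 0 < dl by rewrite divr_gt0// mulr_gt0.
pose M := B + L + 2 * L / dl + 4 * B / dl ^+ 2 + 4 * L / dl ^+ 2.
have t1 : 0 < 2 * L / dl by rewrite divr_gt0// mulr_gt0.
have t2 : 0 < 4 * B / dl ^+ 2 by rewrite divr_gt0 ?exprn_gt0// mulr_gt0.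
have t3 : 0 < 4 * L / dl ^+ 2 by rewrite divr_gt0 ?exprn_gt0// mulr_gt0.
exists M => [|psi psiB psiL]; first by rewrite !addr_gt0.
have L0' := ltW L0.
pose I1 := box_avg dl psi.
have I1B := box_avg_bounded dl0 L0' psiB psiL.
have I1L := box_avg_lipschitz dl0 L0' psiL.
have cpsi := lipschitz_fun_continuous L0' psiL.
have cI1 := lipschitz_fun_continuous L0' I1L.
pose f := box_avg dl I1.
pose f1 x := (I1 (x + dl) - I1 x) / dl.
pose f2 x := ((psi (x + dl + dl) - psi (x + dl)) / dl - (psi (x + dl) - psi x) / dl) / dl.
have fd (x : R) : is_derive x 1 f (f1 x) by have [] := box_avg_derive x dl0 cI1.
have I1d (x : R) : is_derive x 1 I1 ((psi (x + dl) - psi x) / dl).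
  by have [] := box_avg_derive x dl0 cpsi.
have f1d (x : R) : is_derive x 1 f1 (f2 x).
  have h1 := I1d x; have h2 := is_derive_shift_comp (I1d (x + dl)).
  rewrite /f1; apply: is_derive_eq; rewrite /GRing.scale/= /f2.
  by rewrite mulr0 add0r mulrC.
have f2E x : f2 x = (psi (x + dl + dl) - psi (x + dl) - (psi (x + dl) - psi x)) / dl ^+ 2.
  by rewrite /f2; field; rewrite gt_eqF.
have ndl2 : `|(dl ^+ 2)^-1| = (dl ^+ 2)^-1 by rewrite gtr0_norm// invr_gt0 exprn_gt0.
have f2L : lipschitz_fun (4 * L / dl ^+ 2) f2.
  move=> x y; rewrite !f2E -mulrBl normrM ndl2 -mulrA [X in _ <= _ * X]mulrC mulrA.
  rewrite ler_wpM2r ?invr_ge0 ?exprn_ge0 ?(ltW dl0)//.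
  have -> : psi (x + dl + dl) - psi (x + dl) - (psi (x + dl) - psi x) -
      (psi (y + dl + dl) - psi (y + dl) - (psi (y + dl) - psi y)) =
      (psi (x + dl + dl) - psi (y + dl + dl)) - (psi (x + dl) - psi (y + dl)) -
      (psi (x + dl) - psi (y + dl)) + (psi x - psi y) by ring.
  have p1 := psiL (x + dl + dl) (y + dl + dl); have p2 := psiL (x + dl) (y + dl).
  have p3 := psiL x y.
  have -> : 4 * L * `|x - y| = L * `|x - y| + L * `|x - y| + L * `|x - y| + L * `|x - y| by ring.
  have e1 : x + dl + dl - (y + dl + dl) = x - y by ring.
  have e2 : x + dl - (y + dl) = x - y by ring.
  rewrite e1 in p1; rewrite e2 in p2.
  apply: (le_trans (ler_normD _ _)); apply: lerD => //.
  apply: (le_trans (ler_normB _ _)); apply: lerD => //.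
  by apply: (le_trans (ler_normB _ _)); apply: lerD.
have f1L x : `|f1 x| <= L.
  rewrite /f1 normrM (gtr0_norm (_ : 0 < dl^-1)) ?invr_gt0// ler_pdivrMr//.
  have := I1L (x + dl) x; rewrite (_ : x + dl - x = dl); last by ring.
  by rewrite (gtr0_norm dl0).
have f2B x : `|f2 x| <= 4 * B / dl ^+ 2.
  rewrite f2E normrM ndl2 ler_wpM2r ?invr_ge0 ?exprn_ge0 ?(ltW dl0)//.
  have -> : 4 * B = B + B + (B + B) by ring.
  apply: (le_trans (ler_normB _ _)); apply: lerD.
    by apply: (le_trans (ler_normB _ _)); apply: lerD.
  by apply: (le_trans (ler_normB _ _)); apply: lerD.
have LM : L <= M by rewrite /M; lra.
have t2M : 4 * B / dl ^+ 2 <= M by rewrite /M; lra.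
have t3M : 4 * L / dl ^+ 2 <= M by rewrite /M; lra.
have lipW K g : K <= M -> lipschitz_fun K g -> lipschitz_fun M g.
  by move=> KM gK x y; apply: (le_trans (gK x y)); rewrite ler_wpM2r.
have M0 : 0 <= M by apply: le_trans LM.
have f2LM : lipschitz_fun M f2 by exact: lipW f2L.
exists f, f1, f2; split; last first.
  move=> x; have -> : f x - psi x = (f x - I1 x) + (I1 x - psi x) by ring.
  have -> : e = L * dl + L * dl by rewrite /dl; field; rewrite gt_eqF.
  apply: (le_trans (ler_normD _ _)); apply: lerD; first exact: box_avg_near.
  exact: box_avg_near.
split.
- move=> x; apply: (le_trans (box_avg_bounded dl0 L0' I1B I1L x)).
  by rewrite /M; lra.
- by move=> x; apply: le_trans (f1L x) LM.
- by move=> x; apply: le_trans (f2B x) t2M.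
- split => //.
    by apply: (lipW L) => //; exact: derive_bounded_lipschitz fd f1L.
  exact: (lipW _ _ t2M (derive_bounded_lipschitz f1d f2B)).
- exact: taylor3_derive.
Qed.

End smoothing.

Section independent_pair.
Context {R : realType} {dO : measure_display} {Omega : measurableType dO}.
Variable P : probability Omega R.

(** The law of the pair agrees with the product measure on rectangles, hence everywhere, and
    Fubini's theorem applies. *)
Lemma independent_pair_expectation d1 d2 (T1 : measurableType d1)
    (T2 : measurableType d2) (X : Omega -> T1) (Y : Omega -> T2)
    (mu : probability T1 R) (nu : probability T2 R) (F : T1 -> T2 -> R) (B : R) :
  measurable_fun setT X -> measurable_fun setT Y ->
  (forall U V, measurable U -> measurable V ->
    P (X @^-1` U `&` Y @^-1` V) = (mu U * nu V)%E) ->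
  measurable_fun setT (fun z => F z.1 z.2) -> (forall x y, `|F x y| <= B) ->
  \int[P]_w F (X w) (Y w) = \int[mu]_x \int[nu]_y F x y.
Proof.
move=> mX mY law mF FB.
have mXY : measurable_fun setT (fun w => (X w, Y w)) by exact: measurable_fun_pair.
pose Z : {RV P >-> (T1 * T2)%type} := mfun_Sub (mem_set mXY).
have FB' z : `|F z.1 z.2| <= B by [].
have h1 := Rintegral_distribution Z mF FB'.
rewrite -[LHS]h1.
have h2 U : measurable U -> (mu \x nu)%E U = distribution P Z U.
  apply: (@product_measure_unique _ _ T1 T2 R mu nu) => U' V' mU mV.
  exact: law.
have h3 : (\int[distribution P Z]_z (F z.1 z.2)%:E = \int[(mu \x nu)%E]_z (F z.1 z.2)%:E)%E.
  by apply: eq_measure_integral => A mA _; apply/esym; exact: h2.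
have iF : (mu \x nu)%E.-integrable setT (EFin \o (fun z => F z.1 z.2)).
  exact: bounded_integrable FB'.
have h4 := integral12_prod_meas1 iF.
rewrite /Rintegral h3 -h4; congr fine.
apply: eq_integral => x _ /=.
rewrite -/(Rintegral _ _ _) -(@Rintegral_EFin _ _ _ nu B (F x))//.
exact: measurableT_comp (mF) (measurable_pair1 x).
Qed.

Lemma law_expectation d1 (T1 : measurableType d1) (X : Omega -> T1)
    (mu : probability T1 R) (F : T1 -> R) (B : R) :
  measurable_fun setT X -> (forall U, measurable U -> P (X @^-1` U) = mu U) ->
  measurable_fun setT F -> (forall x, `|F x| <= B) ->
  \int[P]_w F (X w) = \int[mu]_x F x.
Proof.
move=> mX law mF FB; pose Z : {RV P >-> T1} := mfun_Sub (mem_set mX).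
rewrite -[LHS](Rintegral_distribution Z mF FB) /Rintegral; congr fine.
by apply: eq_measure_integral => U mU _; exact: law.
Qed.

End independent_pair.

Lemma integrable_scale {R : realType} {dT} {T : measurableType dT}
    (mu : {measure set T -> \bar R}) (c : R) (g : T -> R) :
  mu.-integrable setT (EFin \o g) -> mu.-integrable setT (EFin \o (fun u => c * g u)).
Proof. by move=> ig; have := integrableZl measurableT c ig; apply: eq_integrable. Qed.

Section gaussian_operator.
Context {R : realType}.
Implicit Types (f : R -> R) (s a b L M : R).

Definition gauss s f (x : R) : R := \int[normal_prob 0 s]_y f (x + y).

Let measurable_shift f (x : R) : measurable_fun setT f ->
  measurable_fun setT (fun y : R => f (x + y)).
Proof. by move=> mf; apply: measurableT_comp => //; exact: measurable_funD. Qed.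

Let integrable_shift s f (x B : R) : measurable_fun setT f -> (forall x, `|f x| <= B) ->
  (normal_prob 0 s).-integrable setT (EFin \o (fun y : R => f (x + y))).
Proof.
move=> mf fB; apply: (@bounded_integrable _ _ _ (normal_prob 0 s) B) => //.
exact: measurable_shift.
Qed.

Lemma Rintegral_norm_le {dT} {T : measurableType dT} (P : probability T R)
    (F : T -> R) (B : R) : measurable_fun setT F -> (forall x, `|F x| <= B) ->
  `|\int[P]_x F x| <= B.
Proof.
move=> mF FB; have iF := bounded_integrable P mF FB.
apply: (le_trans (le_normr_Rintegral _ iF)) => //.
rewrite -[leRHS](Rintegral_probability_cst P).
apply: (@le_Rintegral_bounded _ _ _ P B B) => //; first exact: measurableT_comp.
  by move=> x; rewrite normr_id.
move=> x; rewrite ger0_norm//; exact: le_trans (FB x).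
Qed.

Lemma gauss_lipschitz s L f B : 0 <= L -> lipschitz_fun L f -> (forall x, `|f x| <= B) ->
  lipschitz_fun L (gauss s f).
Proof.
move=> L0 fL fB x y; have mf := lipschitz_fun_measurable L0 fL.
rewrite /gauss -RintegralB//; [|exact: integrable_shift mf fB..].
apply: Rintegral_norm_le; first by apply: measurable_funB; exact: measurable_shift.
by move=> z; apply: (le_trans (fL _ _)); rewrite (_ : x + z - (y + z) = x - y)//; ring.
Qed.

Lemma gauss_bounded s f B : measurable_fun setT f -> (forall x, `|f x| <= B) ->
  forall x, `|gauss s f x| <= B.
Proof.
by move=> mf fB x; apply: Rintegral_norm_le => //; exact: measurable_shift.
Qed.

Lemma gauss_taylor3 s M f f1 f2 : 0 <= M -> taylor3 M f f1 f2 ->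
  taylor3 M (gauss s f) (gauss s f1) (gauss s f2).
Proof.
move=> M0 [fB f1B f2B [fL f1L f2L] fT].
have mf := lipschitz_fun_measurable M0 fL.
have mf1 := lipschitz_fun_measurable M0 f1L.
have mf2 := lipschitz_fun_measurable M0 f2L.
split; [exact: gauss_bounded..| |].
  split; [exact: gauss_lipschitz fL fB|exact: gauss_lipschitz f1L f1B|exact: gauss_lipschitz f2L f2B].
move=> x y; rewrite /gauss.
have ig (g : R -> R) (z : R) : measurable_fun setT g -> (forall x, `|g x| <= M) ->
    (normal_prob 0 s).-integrable setT (EFin \o (fun u => g (z + u))).
  by move=> mg gB; exact: integrable_shift mg gB.
have ir (g : R -> R) c : (normal_prob 0 s).-integrable setT (EFin \o g) ->
    (normal_prob 0 s).-integrable setT (EFin \o (fun u => g u * c)).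
  by move=> ig'; under [X in EFin \o X]eq_fun do rewrite mulrC; exact: integrable_scale.
have i0 := ig f (x + y) mf fB; have i1 := ig f x mf fB.
have i2 := ir _ y (ig f1 x mf1 f1B); have i3 := ir _ (y ^+ 2 / 2) (ig f2 x mf2 f2B).
have i01 : (normal_prob 0 s).-integrable setT (EFin \o (fun u => f (x + y + u) - f (x + u))).
  exact: (integrableB measurableT i0 i1).
have i012 : (normal_prob 0 s).-integrable setT
    (EFin \o (fun u => f (x + y + u) - f (x + u) - f1 (x + u) * y)).
  exact: (integrableB measurableT i01 i2).
rewrite -mulrA -!RintegralZr//; [|exact: ig..].
rewrite -RintegralB// -RintegralB// -RintegralB//.
apply: Rintegral_norm_le => [|u].
  apply: measurable_funB; last by apply: measurable_funM => //; exact: measurable_shift.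
  apply: measurable_funB; last by apply: measurable_funM => //; exact: measurable_shift.
  by apply: measurable_funB; exact: measurable_shift.
have := fT (x + u) y; rewrite (_ : x + u + y = x + y + u); last by ring.
by rewrite -mulrA.
Qed.

(** The mean vanishes and the variance is s^2, so only the cubic remainder is left; 12 is 3! times 2
    in the bound for the third absolute moment. *)
Lemma gauss_step s M f f1 f2 x : 0 < s -> 0 <= M -> taylor3 M f f1 f2 ->
  `|gauss s f x - f x - f2 x * s ^+ 2 / 2| <= M * (12 * expR 1 * s ^+ 3).
Proof.
move=> s0 M0 [fB f1B f2B [fL f1L f2L] fT].
have mf := lipschitz_fun_measurable M0 fL.
set N : probability _ _ := normal_prob 0 s.
have i0 : N.-integrable setT (EFin \o (fun u => f (x + u))).
  exact: integrable_shift mf fB.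
have i1 : N.-integrable setT (EFin \o (fun u : R => f x)).
  by apply: (@bounded_integrable _ _ _ N M).
have i2 : N.-integrable setT (EFin \o (fun u : R => f1 x * u)).
  exact: (integrable_scale _ (normal_pow_integrable s0 1)).
have i3 : N.-integrable setT (EFin \o (fun u : R => f2 x / 2 * u ^+ 2)).
  exact: (integrable_scale _ (normal_pow_integrable s0 2)).
have i01 : N.-integrable setT (EFin \o (fun u => f (x + u) - f x)).
  exact: (integrableB measurableT i0 i1).
have i012 : N.-integrable setT (EFin \o (fun u => f (x + u) - f x - f1 x * u)).
  exact: (integrableB measurableT i01 i2).
have i0123 : N.-integrable setT (EFin \o (fun u => f (x + u) - f x - f1 x * u - f2 x / 2 * u ^+ 2)).
  exact: (integrableB measurableT i012 i3).
have i4 : N.-integrable setT (EFin \o (fun u : R => M * `|u| ^+ 3)).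
  exact: (integrable_scale _ (normal_abs_integrable s0 3)).
have -> : gauss s f x - f x - f2 x * s ^+ 2 / 2 =
    \int[N]_u (f (x + u) - f x - f1 x * u - f2 x / 2 * u ^+ 2).
  rewrite RintegralB// RintegralB// RintegralB// Rintegral_probability_cst.
  rewrite RintegralZl//; last exact: (normal_pow_integrable s0 1).
  rewrite RintegralZl//; last exact: (normal_pow_integrable s0 2).
  by rewrite normal_mean0// normal_variance// mulr0 subr0 mulrAC.
apply: (le_trans (le_normr_Rintegral _ i0123)) => //.
apply: (@le_trans _ _ (\int[N]_u (M * `|u| ^+ 3))).
  apply: le_Rintegral => //; first exact: (integrable_norm i0123).
  by move=> u _ /=; have := fT x u; rewrite [f2 x * _ / 2]mulrAC.
rewrite RintegralZl//; last exact: normal_abs_integrable.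
rewrite ler_wpM2l//; apply: (le_trans (normal_moment_le s0 3)).
by rewrite (_ : 3`!%:R * 2 = 12 :> R)//= -natrM.
Qed.

End gaussian_operator.

Section gaussian_convolution.
Context {R : realType} {dO : measure_display} {Omega : measurableType dO}.
Variables (P : probability Omega R) (B : R -> Omega -> R).
Hypothesis bmB : brownian_motion P B.
Implicit Types (f : R -> R) (a b : R).

(* The increments of [B] over [0, a^2] and [a^2, a^2 + b^2] realize two
   independent normal variables whose sum is normal. *)
Lemma gauss_conv a b f L C : 0 < a -> 0 < b -> 0 <= L -> lipschitz_fun L f ->
  (forall x, `|f x| <= C) -> forall x,
  gauss a (gauss b f) x = gauss (Num.sqrt (a ^+ 2 + b ^+ 2)) f x.
Proof.
move=> a0 b0 L0 fL fC x; have mf := lipschitz_fun_measurable L0 fL.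
have a20 : 0 < a ^+ 2 by rewrite exprn_gt0.
have b20 : 0 < b ^+ 2 by rewrite exprn_gt0.
pose X w := B (a ^+ 2) w - B 0 w; pose Y w := B (a ^+ 2 + b ^+ 2) w - B (a ^+ 2) w.
have mB t : 0 <= t -> measurable_fun setT (B t) by exact: bm_measurable bmB _.
have mX : measurable_fun setT X by apply: measurable_funB; apply: mB => //; exact: ltW.
have mY : measurable_fun setT Y.
  by apply: measurable_funB; apply: mB; rewrite ltW// addr_gt0.
have law U V : measurable U -> measurable V ->
    P (X @^-1` U `&` Y @^-1` V) = (normal_prob 0 a U * normal_prob 0 b V)%E.
  move=> mU mV.
  pose t k := if k is k'.+1 then if k' is 0%N then a ^+ 2 else a ^+ 2 + b ^+ 2 else 0 : R.
  have t_nd : nondecreasing_seq t.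
    apply/nondecreasing_seqP => -[|[|k]] /=; rewrite ?lexx//; first exact: ltW.
    by rewrite lerDl ltW.
  have := @bm_indep _ _ _ _ _ bmB 2 t (lexx 0) t_nd.
  pose A (k : 'I_2) := if val k is 0%N then X @^-1` U else Y @^-1` V.
  move=> /(_ A); rewrite big_ord_recl big_ord1/=.
  have AE : \bigcap_i A i = X @^-1` U `&` Y @^-1` V.
    apply/seteqP; split => w.
      by move=> h; split; [exact: (h ord0 I)|exact: (h (lift ord0 ord0) I)].
    by move=> [h1 h2] -[[|[|k]] hk] _.
  rewrite AE => h; have {}h := congr1 EFin (h _).
  have PXY : P (X @^-1` U) = normal_prob 0 a U /\ P (Y @^-1` V) = normal_prob 0 b V.
    split.
      have := @bm_gauss _ _ _ _ _ bmB 0 (a ^+ 2) _ U mU.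
      by rewrite lexx a20 => /(_ erefl) ->; rewrite subr0 sqrtr_sqr gtr0_norm.
    have := @bm_gauss _ _ _ _ _ bmB (a ^+ 2) (a ^+ 2 + b ^+ 2) _ V mV.
    rewrite ltW// ltrDl b20 => /(_ erefl) ->.
    by rewrite [a ^+ 2 + _]addrC addrK sqrtr_sqr gtr0_norm.
  have mXU : measurable (X @^-1` U) by rewrite -[X @^-1` U]setTI; exact: mX.
  have mYV : measurable (Y @^-1` V) by rewrite -[Y @^-1` V]setTI; exact: mY.
  move: h; rewrite (_ : A ord0 = X @^-1` U)// (_ : A (lift ord0 ord0) = Y @^-1` V)//.
  rewrite -!PXY.1 -!PXY.2 EFinM !fineK; last 3 first.
  - exact: fin_num_measure.
  - exact: fin_num_measure.
  - by apply: fin_num_measure; exact: measurableI.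
  apply=> -[[|[|k]] hk]//=; apply: sub_sigma_algebra; exists tt => //.
    by exists U => //; rewrite setTI.
  by exists V => //; rewrite setTI.
have mF : measurable_fun setT (fun z : R * R => f (x + z.1 + z.2)).
  apply: measurableT_comp => //; apply: measurable_funD => //.
  exact: measurable_funD.
have := @independent_pair_expectation _ _ _ P _ _ (measurableTypeR R) (measurableTypeR R) X Y (normal_prob 0 a) (normal_prob 0 b)
  (fun u v => f (x + u + v)) C mX mY law mF (fun u v => fC _).
rewrite /gauss => <-.
pose Z w := B (a ^+ 2 + b ^+ 2) w - B 0 w.
have mZ : measurable_fun setT Z.
  by apply: measurable_funB; apply: mB => //; rewrite ltW// addr_gt0.
have mfx : measurable_fun setT (fun y : R => f (x + y)).
  by apply: measurableT_comp => //; exact: measurable_funD.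
rewrite /gauss -(@law_expectation _ _ _ P _ (measurableTypeR R) Z _ _ C mZ _ mfx)//.
  by apply: eq_Rintegral => w _; congr f; rewrite /X /Y /Z/=; ring.
move=> U mU; have := @bm_gauss _ _ _ _ _ bmB 0 (a ^+ 2 + b ^+ 2) _ U mU.
by rewrite lexx addr_gt0// subr0 => h; exact: (h erefl).
Qed.

End gaussian_convolution.

(** * Moments of one block of signs and its exchange with a Gaussian variable *)

Section chain_moments.
Context {R : realType}.
Variables (n dt : R).
Hypotheses (n0 : 0 < n) (dt0 : 0 < dt).
Implicit Types (s x M : R) (m : nat) (f : R -> R).

Let y := 2 * n * dt.
Let y0 : 0 < y. Proof. by rewrite /y !mulr_gt0. Qed.
Let rho := kac_corr n dt.
Let a := kac_weight n dt.
Let a0 : 0 < a. Proof. by rewrite /a /kac_weight mulr_gt0// sqrtr_gt0. Qed.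
Let rho01 : 0 <= rho <= 1. Proof. exact: kac_corr_itv. Qed.

Let aE : a = y * (2 * Num.sqrt n)^-1.
Proof.
have sn0 : 0 < Num.sqrt n by rewrite sqrtr_gt0.
rewrite /a /kac_weight /y -[X in 2 * X * dt](sqr_sqrtr (ltW n0)); field.
by rewrite gt_eqF.
Qed.

Let rho_ge : 1 - y <= rho.
Proof.
by rewrite /rho /kac_corr -/y; have := expR_ge1Dx (- y); rewrite addrC.
Qed.

Let rho_le : rho * (1 + y) <= 1.
Proof.
rewrite /rho /kac_corr -/y.
apply: (@le_trans _ _ (expR (- y) * expR y)).
  by rewrite ler_wpM2l ?expR_ge0// expR_ge1Dx.
by rewrite -expRD addNr expR0.
Qed.

Lemma chain_sum_cat s (cs cs' : seq R) (l l' : seq bool) : size l = size cs ->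
  chain_sum s (cs ++ cs') (l ++ l') =
  chain_sum s cs l + chain_sum (s * \prod_(b <- l) (-1) ^+ b) cs' l'.
Proof.
elim: cs l s => [|c cs IH] [|b l] s //=; first by rewrite big_nil mulr1 add0r.
by move=> [szl]; rewrite IH// big_cons addrA; congr (_ + chain_sum _ _ _); rewrite mulrA.
Qed.

Lemma sign_prod_sqr (l : seq bool) : (\prod_(b <- l) (-1) ^+ b : R) ^+ 2 = 1.
Proof.
elim: l => [|b l IH]; first by rewrite big_nil expr1n.
by rewrite big_cons exprMn IH mulr1 sqrr_sign.
Qed.

(** The mean of a sum of m weighted signs when the initial sign is 1; for the initial sign s it is
    multiplied by s. *)
Definition kac_mean m : R := iter m (fun e => rho * (a + e)) 0.

Definition kac_var m : R := \sum_(j < m) (a ^+ 2 + 2 * a * kac_mean j).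

Let flip_sum (F : R -> R) s : s ^+ 2 = 1 ->
  \sum_b flip_mass rho b * F (s * (-1) ^+ b) =
  (1 + rho) / 2 * F s + (1 - rho) / 2 * F (- s).
Proof.
move=> s2; rewrite (bigD1 false)//= (bigD1 true)//= big1 ?addr0; last by case.
by rewrite /flip_mass !expr0 !expr1 !mulr1 !mulrN1.
Qed.

Lemma chain_mean m s : s ^+ 2 = 1 ->
  nestE (nseq m (kac_flip n dt)) (fun l => chain_sum s (nseq m a) l) = s * kac_mean m.
Proof.
elim: m s => [|m IH] s s2 /=; first by rewrite mulr0.
rewrite (eq_bigr (fun b => flip_mass rho b * (a * (s * (-1) ^+ b) + (s * (-1) ^+ b) * kac_mean m))).
  rewrite (@flip_sum (fun z => a * z + z * kac_mean m))// /kac_mean /= -/(kac_mean m).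
  by rewrite /GRing.scale; field.
move=> b _; congr (_ * _).
have s2' : (s * (-1) ^+ b) ^+ 2 = 1.
  by rewrite exprMn s2 mul1r sqrr_sign.
rewrite -IH// -(nestE_cst (a * (s * (-1) ^+ b)) (@kac_flip_pmass _ n dt n0 dt0 m)) -nestED.
by apply: eq_nestE => l _; rewrite nestE_cst//; exact: kac_flip_pmass.
Qed.

Lemma chain_second_moment m s : s ^+ 2 = 1 ->
  nestE (nseq m (kac_flip n dt)) (fun l => chain_sum s (nseq m a) l ^+ 2) = kac_var m.
Proof.
elim: m s => [|m IH] s s2 /=; first by rewrite /kac_var big_ord0 expr0n.
rewrite (eq_bigr (fun b => flip_mass rho b * (a ^+ 2 + 2 * a * kac_mean m + kac_var m))).
  rewrite (@flip_sum (fun z => a ^+ 2 + 2 * a * kac_mean m + kac_var m) _ s2) /kac_var big_ord_recr/=.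
  by field.
move=> b _; congr (_ * _).
have s2' : (s * (-1) ^+ b) ^+ 2 = 1.
  by rewrite exprMn s2 mul1r sqrr_sign.
set s' := s * (-1) ^+ b in s2' *.
rewrite -(IH s' s2').
have -> : a ^+ 2 + 2 * a * kac_mean m = a ^+ 2 + 2 * a * s' * (s' * kac_mean m).
  by rewrite mulrA -[2 * a * s' * s']mulrA -expr2 s2' mulr1.
rewrite -(chain_mean m s2') -nestEZ.
rewrite -(nestE_cst (a ^+ 2) (@kac_flip_pmass _ n dt n0 dt0 m)) -!nestED.
apply: eq_nestE => l _; rewrite sqrrD exprMn s2' mulr1; congr (_ + _ + _).
by rewrite -mulr_natl; ring.
Qed.

(** The bound is preserved by the recursion because a + 1 / (2 sqrt n) = (1 + y) / (2 sqrt n) and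
    rho (1 + y) <= 1. It is the total correlation, the integral of sqrt n exp(- 2 n t). *)
Lemma kac_mean_itv m : 0 <= kac_mean m <= (2 * Num.sqrt n)^-1.
Proof.
have sn0 : 0 < Num.sqrt n by rewrite sqrtr_gt0.
have sn2 : Num.sqrt n ^+ 2 = n by rewrite sqr_sqrtr// ltW.
have [r0 r1] := andP rho01.
elim: m => [|m /andP[IH1 IH2]] /=; first by rewrite lexx invr_ge0 mulr_ge0// ltW.
rewrite -/(kac_mean m) mulr_ge0 ?addr_ge0 ?(ltW a0)//=.
apply: (@le_trans _ _ (rho * (a + (2 * Num.sqrt n)^-1))).
  by rewrite ler_wpM2l// lerD2l.
have -> : a + (2 * Num.sqrt n)^-1 = (1 + y) * (2 * Num.sqrt n)^-1.
  by rewrite aE [in RHS]mulrDl mul1r [RHS]addrC.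
by rewrite mulrA ler_piMl// invr_ge0 mulr_ge0// ltW.
Qed.

(** A step adds a^2 + 2 a [kac_mean j], which is close to dt once the mean has reached its limit 1 /
    (2 sqrt n), since a / (2 sqrt n) = dt / 2. The initial steps, where it has not, account for the
    term n^-1. *)
Lemma kac_var_near m : y <= 1 ->
  `|kac_var m - m%:R * dt| <= m%:R * dt * y + n^-1.
Proof.
move=> y1; have sn0 : 0 < Num.sqrt n by rewrite sqrtr_gt0.
have sn2 : Num.sqrt n ^+ 2 = n by rewrite sqr_sqrtr// ltW.
have [r0 r1] := andP rho01.
have a2E : a ^+ 2 = dt * y / 2 by exact: kac_weight_sqr.
have asn : a * (2 * Num.sqrt n)^-1 = dt / 2.
  by rewrite /a /kac_weight; field; rewrite gt_eqF.
have meanE k : kac_mean k >= (1 - y) * (1 - rho ^+ k) * (2 * Num.sqrt n)^-1.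
  elim: k => [|k IH] /=; first by rewrite expr0 subrr mulr0 mul0r.
  rewrite -/(kac_mean k).
  apply: (@le_trans _ _ (rho * (a + (1 - y) * (1 - rho ^+ k) * (2 * Num.sqrt n)^-1))); last first.
    by rewrite ler_wpM2l// lerD2l.
  rewrite {1}aE -mulrDl mulrA ler_wpM2r ?invr_ge0 ?mulr_ge0 ?(ltW sn0)//.
  rewrite exprS -subr_ge0.
  have -> : rho * (y + (1 - y) * (1 - rho ^+ k)) - (1 - y) * (1 - rho * rho ^+ k) =
    rho - (1 - y) by ring.
  by rewrite subr_ge0.
have y0' := ltW y0.
have up : kac_var m <= m%:R * dt * (1 + y).
  rewrite /kac_var; apply: (@le_trans _ _ (\sum_(j < m) (dt * (1 + y)))); last first.
    by rewrite sumr_const card_ord -mulrA -[_ *+ m]mulr_natl.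
  apply: ler_sum => j _; have /andP[_ h] := kac_mean_itv j.
  have : a * kac_mean j <= dt / 2 by rewrite -asn ler_wpM2l// ltW.
  rewrite a2E => h'; have : dt * y / 2 <= dt * y.
    by have := mulr_ge0 (ltW dt0) y0'; lra.
  by rewrite -mulrA => h''; lra.
(* The deficit at step k is at most dt rho^k; the geometric sum of these is carried through the
   induction in place of its limit n^-1. *)
have lo k : (k%:R * dt) * (1 - y) - n^-1 * (1 - rho ^+ k) <= kac_var k.
  elim: k => [|k IH]; first by rewrite /kac_var big_ord0 !mul0r expr0 subrr mulr0 subrr.
  rewrite /kac_var big_ord_recr/= -/(kac_var k).
  have h1 : a * kac_mean k >= dt / 2 * ((1 - y) * (1 - rho ^+ k)).
    by rewrite -asn -mulrA ler_wpM2l ?(ltW a0)// mulrC.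
  have rk : 0 <= rho ^+ k <= 1 by rewrite exprn_ge0//= exprn_ile1.
  have h2 : n^-1 * (rho ^+ k - rho ^+ k.+1) >= dt * rho ^+ k.
    rewrite exprS -[X in X - _]mul1r -mulrBl mulrA ler_wpM2r//; first by case/andP: rk.
    rewrite -(ler_pM2l n0) mulrA divff ?gt_eqF// mul1r.
    have : rho * (1 + y) <= 1 := rho_le.
    have hy : y / 2 * (1 + y) <= y by rewrite -mulrA ler_piMr//; nra.
    have -> : n * dt = y / 2 by rewrite /y; field.
    have : 0 < 1 + y by rewrite addr_gt0.
    nra.
  have h3 : 0 <= dt * y by rewrite mulr_ge0// ltW.
  have h4 : 0 <= dt * y * rho ^+ k by rewrite mulr_ge0//; case/andP: rk.
  rewrite -natr1.
  have -> : (k%:R + 1) * dt * (1 - y) - n^-1 * (1 - rho ^+ k.+1) =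
    (k%:R * dt * (1 - y) - n^-1 * (1 - rho ^+ k)) + dt * (1 - y) - n^-1 * (rho ^+ k - rho ^+ k.+1) by ring.
  have := sqr_ge0 a; nra.
have := lo m; have n1 : 0 < n^-1 by rewrite invr_gt0.
have rm : 0 <= rho ^+ m by rewrite exprn_ge0.
have := up; rewrite ler_norml; have : 0 <= m%:R * dt * y by rewrite !mulr_ge0// ltW.
nra.
Qed.

Lemma chain_abs3_le m s : (0 < m)%N -> y <= 1 -> s ^+ 2 = 1 ->
  nestE (nseq m (kac_flip n dt)) (fun l => `|chain_sum s (nseq m a) l| ^+ 3) <=
  12 * expR 1 * 512 * Num.sqrt (m%:R * dt) ^+ 3.
Proof.
move=> m0 y1 s2.
have md0 : 0 < m%:R * dt by rewrite mulr_gt0// ltr0n.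
have r0 : 0 < Num.sqrt (m%:R * dt) by rewrite sqrtr_gt0.
have en : energy dt (nseq m 1) <= Num.sqrt (m%:R * dt) ^+ 2.
  rewrite sqr_sqrtr ?(ltW md0)// /energy big_nseq expr1n mulrC.
  by rewrite iter_addr_0.
have := @kac_moment_le _ n dt n0 dt0 (nseq m 1) s 3 _ y1 r0 en s2.
rewrite size_nseq map_nseq mulr1 => h; apply: (le_trans h).
rewrite exprMn (_ : 3`!%:R * 2 = 12 :> R); last by rewrite -natrM.
by rewrite (_ : 8 ^+ 3 = 512 :> R) ?mulrA//; ring.
Qed.

(** In turn: the bias due to the initial sign, the error on the variance, and the cubic remainders,
    with factor 512 = 8^3 for the signs and 1 for the Gaussian variable. *)
Definition kac_step_error M m : R :=
  M * ((2 * Num.sqrt n)^-1 + (m%:R * dt * y + n^-1) + 12 * expR 1 * 513 * Num.sqrt (m%:R * dt) ^+ 3).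

(** Both sides are expanded to second order at x; what remains is the difference of the first two
    moments and the two cubic remainders. *)
Lemma chain_block_step M f f1 f2 m x s : 0 <= M -> taylor3 M f f1 f2 ->
  (0 < m)%N -> y <= 1 -> s ^+ 2 = 1 ->
  `|nestE (nseq m (kac_flip n dt)) (fun l => f (x + chain_sum s (nseq m a) l)) -
    gauss (Num.sqrt (m%:R * dt)) f x| <= kac_step_error M m.
Proof.
move=> M0 fT m0 y1 s2; pose ps := nseq m (kac_flip n dt).
have pp : {in ps, forall p, pmass p} by exact: kac_flip_pmass.
have md0 : 0 < m%:R * dt by rewrite mulr_gt0// ltr0n.
have r0 : 0 < Num.sqrt (m%:R * dt) by rewrite sqrtr_gt0.
have r2 : Num.sqrt (m%:R * dt) ^+ 2 = m%:R * dt by rewrite sqr_sqrtr// ltW.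
have gs := gauss_step x r0 M0 fT; rewrite r2 in gs.
have [_ f1B f2B _ fR] := fT.
pose eta l := chain_sum s (nseq m a) l.
have h1 : `|nestE ps (fun l => f (x + eta l) - f x - f1 x * eta l - f2 x * eta l ^+ 2 / 2)| <=
    M * (12 * expR 1 * 512 * Num.sqrt (m%:R * dt) ^+ 3).
  apply: (@le_trans _ _ (nestE ps (fun l => M * `|eta l| ^+ 3))).
    by apply: nestE_norm_le => // l _; exact: fR.
  by rewrite nestEZ ler_wpM2l//; exact: chain_abs3_le.
have h2 : nestE ps (fun l => f (x + eta l) - f x - f1 x * eta l - f2 x * eta l ^+ 2 / 2) =
    nestE ps (fun l => f (x + eta l)) - f x - f1 x * (s * kac_mean m) - f2 x / 2 * kac_var m.
  rewrite (@eq_nestE _ _ _ _ (fun l => (f (x + eta l) + - f x) +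
    ((- f1 x) * eta l + (- (f2 x / 2)) * eta l ^+ 2))); last by move=> l _; field.
  rewrite !nestED !nestEZ nestE_cst// /eta chain_mean// chain_second_moment//.
  by rewrite /ps; ring.
rewrite h2 in h1.
have h3 : `|f1 x * (s * kac_mean m)| <= M * (2 * Num.sqrt n)^-1.
  rewrite normrM ler_pM//; have /andP[e0 e1] := kac_mean_itv m.
  rewrite normrM (ger0_norm e0) (_ : `|s| = 1) ?mul1r//.
  by apply/eqP; rewrite -(@eqrXn2 _ 2)// expr1n real_normK ?num_real// s2.
have h4 : `|f2 x / 2 * (kac_var m - m%:R * dt)| <= M * (m%:R * dt * y + n^-1).
  rewrite normrM ler_pM ?kac_var_near// normrM (gtr0_norm (_ : 0 < 2^-1))//.
  by have := f2B x; lra.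
rewrite /kac_step_error.
have -> : nestE ps (fun l => f (x + eta l)) - gauss (Num.sqrt (m%:R * dt)) f x =
  (nestE ps (fun l => f (x + eta l)) - f x - f1 x * (s * kac_mean m) - f2 x / 2 * kac_var m) +
  f1 x * (s * kac_mean m) + f2 x / 2 * (kac_var m - m%:R * dt) -
  (gauss (Num.sqrt (m%:R * dt)) f x - f x - f2 x * (m%:R * dt) / 2) by field.
have -> : M * ((2 * Num.sqrt n)^-1 + (m%:R * dt * y + n^-1) + 12 * expR 1 * 513 * Num.sqrt (m%:R * dt) ^+ 3) =
  M * (12 * expR 1 * 512 * Num.sqrt (m%:R * dt) ^+ 3) + M * (2 * Num.sqrt n)^-1 + M * (m%:R * dt * y + n^-1)
  + M * (12 * expR 1 * Num.sqrt (m%:R * dt) ^+ 3) by ring.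
apply: (le_trans (ler_normB _ _)); apply: lerD => //.
apply: (le_trans (ler_normD _ _)); apply: lerD => //.
by apply: (le_trans (ler_normD _ _)); apply: lerD.
Qed.

End chain_moments.

Section kac_clt.
Context {R : realType} {dO : measure_display} {Omega : measurableType dO}.
Variables (P : probability Omega R) (B : R -> Omega -> R).
Hypothesis bmB : brownian_motion P B.

(** Lindeberg exchange of k sub-blocks of m steps. The Gaussian smoothing of f satisfies the same
    Taylor bounds, so each exchange costs the same, and convolution gathers the variances. The case
    k = 0 is set apart because convolution is stated for positive deviations. *)
Lemma chain_blocks (n dt M : R) f f1 f2 (m k : nat) x s : 0 < n -> 0 < dt ->
  0 <= M -> taylor3 M f f1 f2 -> (0 < m)%N -> 2 * n * dt <= 1 -> s ^+ 2 = 1 ->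
  `|nestE (nseq (k * m) (kac_flip n dt))
      (fun l => f (x + chain_sum s (nseq (k * m) (kac_weight n dt)) l)) -
    (if k == 0%N then f x else gauss (Num.sqrt (k%:R * (m%:R * dt))) f x)| <=
  k%:R * kac_step_error n dt M m.
Proof.
move=> n0 dt0 M0 fT m0 y1.
have t0 : 0 < m%:R * dt by rewrite mulr_gt0// ltr0n.
pose u (k : nat) f := if k == 0%N then f else gauss (Num.sqrt (k%:R * (m%:R * dt))) f.
have uT k' : exists g1 g2, taylor3 M (u k' f) g1 g2.
  rewrite /u; case: eqP => _; first by exists f1, f2.
  by do 2 eexists; exact: gauss_taylor3 fT.
have uS k' z : u k'.+1 f z = gauss (Num.sqrt (m%:R * dt)) (u k' f) z.
  rewrite /u /=; case: eqP => [->|/eqP k0]; first by rewrite mul1r.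
  have [fB _ _ [fL _ _] _] := fT.
  have k'0 : 0 < k'%:R * (m%:R * dt) by rewrite mulr_gt0// ltr0n lt0n.
  have h1 : 0 < Num.sqrt (m%:R * dt) by rewrite sqrtr_gt0.
  have h2 : 0 < Num.sqrt (k'%:R * (m%:R * dt)) by rewrite sqrtr_gt0.
  rewrite (gauss_conv bmB h1 h2 M0 fL fB z) (sqr_sqrtr (ltW t0)) (sqr_sqrtr (ltW k'0)).
  by rewrite -natr1 mulrDl mul1r addrC.
rewrite -[if _ then _ else _]/(if k == 0%N then f x else _).
have -> : (if k == 0%N then f x else gauss (Num.sqrt (k%:R * (m%:R * dt))) f x) = u k f x.
  by rewrite /u; case: eqP.
elim: k x s => [|k IH] x s s2.
  by rewrite mul0n /= addr0 /u eqxx subrr normr0 mul0r.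
rewrite mulSn !nseqD nestE_cat uS.
have [g1 [g2 gT]] := uT k.
have h1 := @chain_block_step _ n dt n0 dt0 M _ _ _ m x s M0 gT m0 y1 s2.
rewrite -natr1 mulrDl mul1r.
apply: (le_trans (ler_distD (nestE (nseq m (kac_flip n dt))
  (fun l => u k f (x + chain_sum s (nseq m (kac_weight n dt)) l))) _ _)).
apply: lerD => //; apply: nestE_dist_le; first exact: kac_flip_pmass.
move=> l; rewrite size_nseq => szl.
have s2' : (s * \prod_(b <- l) (-1) ^+ (b : bool)) ^+ 2 = 1 by rewrite exprMn s2 sign_prod_sqr mulr1.
have := IH (x + chain_sum s (nseq m (kac_weight n dt)) l) _ s2'.
rewrite (@eq_nestE _ _ _ _ (fun l' => f (x + chain_sum s (nseq m (kac_weight n dt) ++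
    nseq (k * m) (kac_weight n dt)) (l ++ l'))))// => l' _.
by rewrite chain_sum_cat ?size_nseq// addrA.
Qed.

Lemma exists_nat_ge (z : R) : exists N : nat, (0 < N)%N /\ z <= N%:R.
Proof.
exists (Num.bound `|z|).+1; split => //.
apply: (le_trans (ler_norm z)); rewrite -natr1 ler_wpDr// ltW//.
exact: archi_boundP.
Qed.

(** The order of choices matters. K sub-blocks make the cubic errors small, of order K (h /
    K)^(3/2); n then makes K times the bias small; for that n, a large m makes y = 2 n dt small. All
    this is uniform in psi, x and the initial sign. *)
Lemma kac_clt (C L h e : R) : 0 < C -> 0 < L -> 0 < h -> 0 < e ->
  exists K n0 : nat, (0 < K)%N /\ forall n : nat, (n0 <= n)%N ->
  exists m0 : nat, forall (m : nat) (dt : R), (m0 <= m)%N -> dt = h / (K * m)%:R ->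
  forall psi x s, (forall x, `|psi x| <= C) -> lipschitz_fun L psi -> s ^+ 2 = 1 ->
  `|nestE (nseq (K * m) (kac_flip n%:R dt))
      (fun l => psi (x + chain_sum s (nseq (K * m) (kac_weight n%:R dt)) l)) -
    gauss (Num.sqrt h) psi x| <= e.
Proof.
move=> C0 L0 h0 e0; have e40 : 0 < e / 4 by rewrite divr_gt0.
have [M M0 smooth] := smoothing C0 L0 e40.
have [c c0 cE] : exists2 c : R, 0 < c & c = 12 * expR 1 * 513.
  by eexists; last by []; rewrite pmulr_rgt0 ?pmulr_rgt0 ?expR_gt0 ?ltr0n.
(* The four error terms get e / 8 each; the cubic one, M c h sqrt(h / K), is then below its share as
   soon as sqrt(h / K) <= q. *)
pose q := e / (8 * M * c * h).
have q0 : 0 < q by rewrite divr_gt0// !mulr_gt0.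
have [K [K0 Kq]] := exists_nat_ge (h / q ^+ 2).
have KR0 : 0 < K%:R :> R by rewrite ltr0n.
(* Chosen so that K M <= (e / 8) z; both K M / (2 sqrt n) and K M / n fall below e / 8 once sqrt n
   >= z >= 1. *)
pose z := 8 * K%:R * M / e + 1.
have z1 : 1 <= z by rewrite lerDr divr_ge0 ?(ltW e0)// !mulr_ge0// ltW.
have [n0 [n00 n0z]] := exists_nat_ge (z ^+ 2).
exists K, n0; split => // n n0n.
have nz : z ^+ 2 <= n%:R by apply: (le_trans n0z); rewrite ler_nat.
have nR0 : 0 < n%:R :> R by rewrite ltr0n (leq_trans n00).
(* This forces y (1 + 8 M h / e) <= 1, hence y <= 1 and M h y <= e / 8 at the same time. *)
have [m0 [m00 m0z]] := exists_nat_ge (2 * n%:R * h * (1 + 8 * M * h / e)).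
exists m0 => m dt m0m dtE psi x s psiC psiL s2.
have m0' : (0 < m)%N by exact: leq_trans m0m.
have mR0 : 0 < m%:R :> R by rewrite ltr0n.
have mz : 2 * n%:R * h * (1 + 8 * M * h / e) <= m%:R by apply: (le_trans m0z); rewrite ler_nat.
have dt0 : 0 < dt by rewrite dtE divr_gt0// ltr0n muln_gt0 K0.
have KmE : K%:R * (m%:R * dt) = h.
  by rewrite dtE natrM; field; rewrite !gt_eqF.
have mdtE : m%:R * dt = h / K%:R by rewrite -KmE [RHS]mulrC mulKf// gt_eqF.
pose y := 2 * n%:R * dt.
have w0 : 0 < 8 * M * h / e by rewrite divr_gt0// !mulr_gt0.
have y0 : 0 < y by rewrite !mulr_gt0.
have yle : y * (1 + 8 * M * h / e) <= 1.
  rewrite /y dtE natrM.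
  apply: (@le_trans _ _ (m%:R / (K%:R * m%:R))).
    rewrite [2 * _ * (_ / _)]mulrA mulrAC ler_wpM2r// invr_ge0 mulr_ge0// ltW//.
  by rewrite ler_pdivrMr ?mulr_gt0// mul1r ler_peMl ?(ltW mR0)// ler1n.
have y1 : y <= 1.
  by apply: le_trans yle; rewrite ler_peMr ?(ltW y0)// lerDl ltW.
have [f [f1 [f2 [fT fpsi]]]] := smooth psi psiC psiL.
have := @chain_blocks n%:R dt M f f1 f2 m K x s nR0 dt0 (ltW M0) fT m0' y1 s2.
rewrite (gtn_eqF K0) KmE => h1.
have [fB _ _ [fL _ _] _] := fT.
have err : K%:R * kac_step_error n%:R dt M m <= e / 2.
  rewrite /kac_step_error mdtE -/y -cE.
  have sn : z <= Num.sqrt n%:R.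
    by rewrite -[z]gtr0_norm ?(lt_le_trans _ z1)// -sqrtr_sqr ler_wsqrtr.
  have zn : z <= n%:R by apply: le_trans nz; rewrite expr2 ler_peMl// (le_trans _ z1).
  have KMz : K%:R * M <= e / 8 * z.
    rewrite /z mulrDr mulr1 -[leLHS]addr0 lerD ?divr_ge0 ?(ltW e0)//.
    rewrite le_eqVlt; apply/orP; left; apply/eqP; field; exact: lt0r_neq0.
  have z0 : 0 < z by exact: lt_le_trans z1.
  have e80 : 0 <= e / 8 by rewrite divr_ge0// ltW.
  have b1 : K%:R * M * (2 * Num.sqrt n%:R)^-1 <= e / 8.
    have s0 := lt_le_trans z0 sn.
    rewrite ler_pdivrMr ?mulr_gt0//; apply: (le_trans KMz).
    by rewrite ler_wpM2l//; lra.
  have b2 : K%:R * M * n%:R^-1 <= e / 8.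
    rewrite ler_pdivrMr//; apply: (le_trans KMz); by rewrite ler_wpM2l.
  have b3 : M * h * y <= e / 8.
    have : y * (8 * M * h / e) <= 1.
      by apply: le_trans yle; rewrite ler_wpM2l ?(ltW y0)// lerDr.
    have -> : y * (8 * M * h / e) = (M * h * y) / (e / 8) by field; rewrite gt_eqF.
    by rewrite ler_pdivrMr ?divr_gt0// mul1r.
  have b4 : M * c * h * Num.sqrt (h / K%:R) <= e / 8.
    have hK : Num.sqrt (h / K%:R) <= q.
      rewrite -[q]gtr0_norm// -sqrtr_sqr ler_wsqrtr//.
      by rewrite ler_pdivrMr// mulrC -ler_pdivrMr// exprn_gt0.
    apply: (@le_trans _ _ (M * c * h * q)).
      by rewrite ler_wpM2l// !mulr_ge0// ltW.
    by rewrite /q le_eqVlt; apply/orP; left; apply/eqP; field; rewrite !gt_eqF.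
  have -> : K%:R * (M * ((2 * Num.sqrt n%:R)^-1 + (h / K%:R * y + n%:R^-1) + c * Num.sqrt (h / K%:R) ^+ 3)) =
     K%:R * M * (2 * Num.sqrt n%:R)^-1 + M * h * y + K%:R * M * n%:R^-1 +
     M * c * h * Num.sqrt (h / K%:R).
    have -> : Num.sqrt (h / K%:R) ^+ 3 = h / K%:R * Num.sqrt (h / K%:R).
      by rewrite exprSr sqr_sqrtr// divr_ge0// ltW.
    set r1 := (2 * Num.sqrt n%:R)^-1; set r2 := n%:R^-1; set r3 := Num.sqrt _.
    by field; rewrite gt_eqF.
  lra.
have -> : e = e / 4 + (e / 2 + e / 4) by field.
apply: (le_trans (ler_distD (nestE (nseq (K * m) (kac_flip n%:R dt))
  (fun l => f (x + chain_sum s (nseq (K * m) (kac_weight n%:R dt)) l))) _ _)).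
apply: lerD.
  apply: nestE_dist_le; first exact: kac_flip_pmass.
  by move=> l _; rewrite distrC.
apply: (le_trans (ler_distD (gauss (Num.sqrt h) f x) _ _)).
apply: lerD; first exact: le_trans err.
have mf := lipschitz_fun_measurable (ltW M0) fL.
have mpsi := lipschitz_fun_measurable (ltW L0) psiL.
have ms (g : R -> R) : measurable_fun setT g -> measurable_fun setT (fun y : R => g (x + y)).
  by move=> mg; apply: measurableT_comp => //; exact: measurable_funD.
rewrite /gauss -RintegralB//; last 2 first.
- by apply: (@bounded_integrable _ _ _ (normal_prob 0 (Num.sqrt h)) M) => //; exact: ms.
- by apply: (@bounded_integrable _ _ _ (normal_prob 0 (Num.sqrt h)) C) => //; exact: ms.
apply: (@Rintegral_norm_le _ _ _ (normal_prob 0 (Num.sqrt h))) => //.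
by apply: measurable_funB; exact: ms.
Qed.

End kac_clt.

(** * Exchange of blocks with Gaussian variables *)

Section sequence_functionals.
Context {R : realType}.
Implicit Types (F : seq R -> R) (v : seq R) (r : nat) (L B : R).

Definition seq_dist v v' : R := \sum_(z <- zip v v') `|z.1 - z.2|.

Definition seq_lipschitz r L F : Prop := forall v v', size v = r -> size v' = r ->
  `|F v - F v'| <= L * seq_dist v v'.

Lemma seq_dist_refl v : seq_dist v v = 0.
Proof.
elim: v => [|x v IH]; first by rewrite /seq_dist big_nil.
by rewrite /seq_dist/= big_cons/= subrr normr0 add0r; exact: IH.
Qed.

Lemma seq_dist_cons x y v v' : seq_dist (x :: v) (y :: v') = `|x - y| + seq_dist v v'.
Proof. by rewrite /seq_dist /= big_cons. Qed.

Lemma seq_lipschitz_tail r L F x : seq_lipschitz r.+1 L F ->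
  seq_lipschitz r L (fun v => F (x :: v)).
Proof.
move=> FL v v' sv sv'; have := FL (x :: v) (x :: v').
by rewrite /= sv sv' seq_dist_cons subrr normr0 add0r; apply.
Qed.

Lemma seq_lipschitz_head r L F v : seq_lipschitz r.+1 L F -> size v = r ->
  lipschitz_fun L (fun x => F (x :: v)).
Proof.
move=> FL sv x y; have := FL (x :: v) (y :: v).
by rewrite /= sv seq_dist_cons seq_dist_refl addr0; apply.
Qed.

Fixpoint gaussE (s : R) r F : R :=
  if r is r'.+1 then gauss s (fun y => gaussE s r' (fun v => F (y :: v))) 0
  else F [::].

Lemma gaussE_cst s r (c : R) : gaussE s r (fun => c) = c.
Proof.
elim: r => //= r IH; rewrite IH /gauss.
exact: (@Rintegral_probability_cst _ _ _ (normal_prob 0 s)).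
Qed.

(** The induction hypothesis is used three times: for the Lipschitz dependence on the head, hence
    measurability of the integrand; for its bound; and for the comparison itself. *)
Lemma gaussE_dist s r L B F F' c : 0 <= L -> (forall v, `|F v| <= B) ->
  (forall v, `|F' v| <= B) -> seq_lipschitz r L F -> seq_lipschitz r L F' ->
  (forall v, size v = r -> `|F v - F' v| <= c) ->
  `|gaussE s r F - gaussE s r F'| <= c.
Proof.
move=> L0; elim: r F F' c => [|r IH] F F' c FB F'B FL F'L FF' /=; first exact: FF'.
have lip (G : seq R -> R) : (forall v, `|G v| <= B) -> seq_lipschitz r.+1 L G ->
    lipschitz_fun L (fun y => gaussE s r (fun v => G (y :: v))).
  move=> GB GL x y; apply: IH => //; [exact: seq_lipschitz_tail..|].
  by move=> v sv; exact: (seq_lipschitz_head GL sv).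
have bnd (G : seq R -> R) : (forall v, `|G v| <= B) -> seq_lipschitz r.+1 L G ->
    forall y, `|gaussE s r (fun v => G (y :: v))| <= B.
  move=> GB GL y; rewrite -[X in `|X|]subr0 -[X in _ - X](gaussE_cst s r).
  have B0 : 0 <= B by exact: le_trans (GB [::]).
  apply: IH => //; [by move=> v; rewrite normr0|exact: seq_lipschitz_tail| |].
    by move=> v v' _ _; rewrite subrr normr0 mulr_ge0// /seq_dist sumr_ge0.
  by move=> v _; rewrite subr0.
have m (G : seq R -> R) : (forall v, `|G v| <= B) -> seq_lipschitz r.+1 L G ->
    measurable_fun setT (fun y : R => gaussE s r (fun v => G (0 + y :: v))).
  move=> GB GL; under eq_fun do rewrite add0r.
  exact: lipschitz_fun_measurable (lip _ GB GL).
rewrite /gauss -RintegralB//; last 2 first.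
- by apply: (@bounded_integrable _ _ _ (normal_prob 0 s) B) => [|y]; [exact: m|exact: bnd].
- by apply: (@bounded_integrable _ _ _ (normal_prob 0 s) B) => [|y]; [exact: m|exact: bnd].
apply: (@Rintegral_norm_le _ _ _ (normal_prob 0 s)).
  by apply: measurable_funB; exact: m.
move=> y; apply: IH => //; [exact: seq_lipschitz_tail..|].
by move=> v sv; apply: FF'; rewrite /= sv.
Qed.

Lemma gaussE_lipschitz s r L B F : 0 <= L -> (forall v, `|F v| <= B) ->
  seq_lipschitz r.+1 L F -> lipschitz_fun L (fun y => gaussE s r (fun v => F (y :: v))).
Proof.
move=> L0 FB FL x y; apply: (@gaussE_dist s r L B) => //; [exact: seq_lipschitz_tail..|].
by move=> v sv; exact: (seq_lipschitz_head FL sv).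
Qed.

Lemma gaussE_bounded s r L B F : 0 <= L -> (forall v, `|F v| <= B) ->
  seq_lipschitz r L F -> `|gaussE s r F| <= B.
Proof.
move=> L0 FB FL; rewrite -[X in `|X|]subr0 -[X in _ - X](gaussE_cst s r).
have B0 : 0 <= B by exact: le_trans (FB [::]).
apply: (@gaussE_dist s r L B) => //; first by move=> v; rewrite normr0.
  by move=> v v' _ _; rewrite subrr normr0 mulr_ge0// /seq_dist sumr_ge0.
by move=> v _; rewrite subr0.
Qed.

(* A flag marks the blocks at which the sign is reset. *)
Fixpoint block_sums (w : R) (fl : seq bool) (M : nat) (s : R) (l : seq bool) : seq R :=
  if fl is b :: fl' then
    let s0 := if b then 1 else s in
    chain_sum s0 (nseq M w) (take M l) ::
    block_sums w fl' M (s0 * \prod_(b <- take M l) (-1) ^+ b) (drop M l)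
  else [::].

(** For a fixed first block the later ones are exchanged by induction, whatever sign they start
    from; the first block is then exchanged inside the Gaussian expectation of the rest. Each block
    costs [kappa]. *)
Lemma block_exchange (p : bool -> R) (w sigma kappa L B : R) (M : nat) fl s F :
  pmass p -> 0 <= L -> s ^+ 2 = 1 ->
  (forall psi x s, (forall x, `|psi x| <= B) -> lipschitz_fun L psi -> s ^+ 2 = 1 ->
    `|nestE (nseq M p) (fun l => psi (x + chain_sum s (nseq M w) l)) -
      gauss sigma psi x| <= kappa) ->
  (forall v, `|F v| <= B) -> seq_lipschitz (size fl) L F ->
  `|nestE (nseq (size fl * M) p) (fun l => F (block_sums w fl M s l)) -
    gaussE sigma (size fl) F| <= (size fl)%:R * kappa.
Proof.
move=> pp L0 + step; elim: fl s F => [|b fl IH] s F s2 FB FL /=.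
  by rewrite subrr normr0 mul0r.
have pps k : {in nseq k p, forall q, pmass q} by move=> q; rewrite mem_nseq => /andP[_ /eqP->].
rewrite mulSn nseqD nestE_cat -natr1 mulrDl mul1r.
pose s0 := if b then 1 else s.
have s02 : s0 ^+ 2 = 1 by rewrite /s0; case: (b); rewrite ?expr1n.
apply: (le_trans (ler_distD (nestE (nseq M p)
  (fun l => gaussE sigma (size fl) (fun v => F (chain_sum s0 (nseq M w) l :: v)))) _ _)).
apply: lerD; last first.
  have := step (fun y => gaussE sigma (size fl) (fun v => F (y :: v))) 0 s0 _ _ s02.
  under eq_nestE do rewrite add0r.
  apply; last exact: gaussE_lipschitz FB FL.
  by move=> y; apply: (gaussE_bounded _ L0) => //; exact: seq_lipschitz_tail.
apply: nestE_dist_le => // l; rewrite size_nseq => szl.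
have s12 : (s0 * \prod_(b <- l) (-1) ^+ (b : bool)) ^+ 2 = 1 by rewrite exprMn s02 sign_prod_sqr mulr1.
have := IH _ _ s12 (fun v => FB (chain_sum s0 (nseq M w) l :: v)) (seq_lipschitz_tail _ FL).
rewrite (@eq_nestE _ _ _ _ (fun l' => F (chain_sum s0 (nseq M w) (take M (l ++ l')) ::
    block_sums w fl M (s0 * \prod_(b <- take M (l ++ l')) (-1) ^+ (b : bool)) (drop M (l ++ l')))))//.
by move=> l' _; rewrite take_size_cat// drop_size_cat.
Qed.

(** Here [sgn i k] is the sign after k steps of block i. A new path begins at each multiple of N,
    with sign 1; elsewhere a block starts where the previous one ended. *)
Lemma block_sums_map (sgn : nat -> nat -> R) (V : nat -> bool) (w : R) (M N i0 r : nat) s :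
  (forall i, (i %% N = 0)%N -> sgn i 0%N = 1) ->
  (forall i, (i.+1 %% N != 0)%N -> sgn i.+1 0%N = sgn i M) ->
  (forall i k, (k < M)%N -> sgn i k.+1 = sgn i k * (-1) ^+ V (i * M + k)%N) ->
  ((i0 %% N != 0)%N -> s = sgn i0 0%N) ->
  block_sums w [seq (i %% N == 0)%N | i <- iota i0 r] M s
    [seq V j | j <- iota (i0 * M) (r * M)] =
  [seq w * \sum_(k < M) sgn i k.+1 | i <- iota i0 r].
Proof.
move=> h0 h1 h2; elim: r i0 s => [|r IH] i0 s hs //=.
have -> : take M [seq V j | j <- iota (i0 * M) (r.+1 * M)] = [seq V j | j <- iota (i0 * M) M].
  by rewrite -map_take take_iota mulSn (minn_idPl _)// leq_addr.
have -> : drop M [seq V j | j <- iota (i0 * M) (r.+1 * M)] = [seq V j | j <- iota (i0.+1 * M) (r * M)].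
  by rewrite -map_drop drop_iota !mulSn addKn addnC.
set s0 := if _ then _ else _.
have s0E : s0 = sgn i0 0%N.
  by rewrite /s0; case: eqP => [/h0 ->//|/eqP/hs].
have prodE k : (k <= M)%N -> sgn i0 0%N * \prod_(b <- [seq V j | j <- iota (i0 * M) k]) (-1) ^+ b = sgn i0 k.
  elim: k => [|k IHk] kM; first by rewrite big_nil mulr1.
  rewrite -addn1 iotaD map_cat big_cat/= big_seq1 mulrA IHk ?addn1 ?h2//.
  exact: ltnW.
rewrite s0E; congr (_ :: _); last first.
  by apply: IH => /h1 ->; rewrite prodE.
have sumE k k' s' : (k + k' = M)%N -> s' = sgn i0 k ->
    chain_sum s' (nseq k' w) [seq V j | j <- iota (i0 * M + k) k'] =
    w * \sum_(k <= j < k + k') sgn i0 j.+1.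
  elim: k' k s' => [|k' IHk] k s' kk' s'E /=; first by rewrite addn0 big_geq// mulr0.
  have kM : (k < M)%N by rewrite -kk' -addSnnS leq_addr.
  rewrite big_ltn ?addnS ?ltnS ?leq_addr// mulrDr s'E h2//; congr (_ + _).
  have kk1 : (k.+1 + k' = M)%N by rewrite addSnnS.
  by have := IHk k.+1 _ kk1 (esym (h2 i0 k kM)); rewrite addnS addSn.
by have := sumE 0%N M (sgn i0 0%N) (add0n M) erefl; rewrite addn0 add0n big_mkord.
Qed.

End sequence_functionals.

Section finite_sums.
Context {R : realType} {dO : measure_display} {Omega : measurableType dO}.
Variable P : probability Omega R.

Lemma Rintegral_bounded_sum (I : Type) (s : seq I) (F : I -> Omega -> R) (B : R) :
  (forall i, measurable_fun setT (F i)) -> (forall i w, `|F i w| <= B) ->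
  \int[P]_w (\sum_(i <- s) F i w) = \sum_(i <- s) \int[P]_w F i w.
Proof.
move=> mF FB; elim: s => [|i s IH].
  by under eq_Rintegral do rewrite big_nil; rewrite Rintegral_probability_cst big_nil.
under eq_Rintegral do rewrite big_cons.
rewrite RintegralD//; first by rewrite IH big_cons.
  exact: bounded_integrable (FB i).
apply: (@bounded_integrable _ _ _ P (\sum_(i <- s) B)).
  by apply: measurable_sum.
by move=> w; apply: (le_trans (ler_norm_sum _ _ _)); exact: ler_sum.
Qed.

Lemma Rintegral_indic_cst (A : set Omega) (c : R) : measurable A ->
  \int[P]_w (\1_A w * c) = fine (P A) * c.
Proof.
move=> mA; rewrite RintegralZr//; last first.
  by apply: (@bounded_integrable _ _ _ P 1) => // w; rewrite /= indicE; case: (w \in A); rewrite ?normr1 ?normr0.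
congr (_ * _); rewrite /Rintegral; congr fine.
by rewrite integral_indic// setIT.
Qed.

Lemma indic_mul_bounded (A : set Omega) (G : Omega -> R) (B : R) w :
  (forall w, `|G w| <= B) -> `|\1_A w * G w| <= B.
Proof.
move=> GB; rewrite normrM indicE; case: (w \in A); rewrite ?normr1 ?mul1r ?normr0 ?mul0r//.
exact: le_trans (GB w).
Qed.

Lemma split_value (g : R -> R) (vals : seq R) (X : Omega -> R) (G : R -> R) w :
  uniq vals -> (forall x, g x \in vals) ->
  G (g (X w)) = \sum_(v <- vals) \1_(X @^-1` (g @^-1` [set v])) w * G v.
Proof.
move=> uv gv; rewrite (bigD1_seq (g (X w)))//= big1 ?addr0 => [|v vg].
  by rewrite indicE mem_set ?mul1r.
by rewrite indicE memNset ?mul0r//= => h; rewrite h eqxx in vg.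
Qed.

End finite_sums.

(** * Laws of finite sequences of independent variables *)

Section sequence_laws.
Context {R : realType} {dO : measure_display} {Omega : measurableType dO}.
Variable P : probability Omega R.

Fixpoint cells (E : nat -> set Omega) (i r : nat) : set Omega :=
  if r is r'.+1 then E i `&` cells E i.+1 r' else setT.

Lemma cellsS E i r : cells E i r.+1 = E i `&` cells E i.+1 r.
Proof. by []. Qed.

Lemma cellsP E i r w : cells E i r w <-> forall j, (i <= j < i + r)%N -> E j w.
Proof.
elim: r i => [|r IH] i /=.
  by rewrite addn0; split=> // _ j; case: ltngtP.
split=> [[Ei /IH Er] j /andP[]|H].
  rewrite leq_eqVlt => /orP[/eqP <- //|ij jr]; apply: Er.
  by rewrite ij addSnnS.
split; first by apply: H; rewrite leqnn addnS ltnS leq_addr.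
apply/IH => j /andP[ij jr]; apply: H; by rewrite ltnW//= -addSnnS.
Qed.

Lemma eq_cells E E' i r : (forall j, (i <= j)%N -> E j = E' j) -> cells E i r = cells E' i r.
Proof.
elim: r i => //= r IH i H; rewrite H// (IH i.+1)// => j ij; apply: H.
exact: ltnW.
Qed.

(** The event A records the variables already revealed and the number a its probability, so that the
    induction can fix the value of one variable at a time. *)
Lemma nestE_law (T : finType) (V : nat -> Omega -> T) (t0 : T) (p : nat -> T -> R) (r i : nat)
    (A : set Omega) (a B : R) (Phi : seq T -> R) :
  (forall i t, measurable (V i @^-1` [set t])) -> measurable A ->
  (forall l, `|Phi l| <= B) ->
  (forall l : nat -> T, fine (P (A `&` cells (fun i => V i @^-1` [set l i]) i r)) =
    a * \prod_(j <- iota i r) p j (l j)) ->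
  measurable_fun setT (fun w => Phi [seq V j w | j <- iota i r]) /\
  \int[P]_w (\1_A w * Phi [seq V j w | j <- iota i r]) = a * nestE [seq p j | j <- iota i r] Phi.
Proof.
move=> mV; elim: r i A a Phi => [|r IH] i A a Phi mA PhiB law /=.
  split => //; rewrite Rintegral_indic_cst//; congr (_ * _).
  by have := law (fun=> t0); rewrite /= big_nil mulr1 setIT.
have PhiE w : Phi [seq V j w | j <- iota i r.+1] =
    \sum_(t <- enum T) \1_(V i @^-1` [set t]) w * Phi (t :: [seq V j w | j <- iota i.+1 r]).
  rewrite (bigD1_seq (V i w)) ?mem_enum ?enum_uniq//= big1 ?addr0 => [|t tV].
    by rewrite indicE mem_set ?mul1r.
  by rewrite indicE memNset ?mul0r//= => h; rewrite h eqxx in tV.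
have IHt t := IH i.+1 (A `&` V i @^-1` [set t]) (a * p i t) (fun l => Phi (t :: l))
  (measurableI _ _ mA (mV i t)) (fun l => PhiB (t :: l)).
have lawt t (l : nat -> T) : fine (P (A `&` V i @^-1` [set t] `&` cells (fun j => V j @^-1` [set l j]) i.+1 r)) =
    a * p i t * \prod_(j <- iota i.+1 r) p j (l j).
  have := law (fun j => if j == i then t else l j); rewrite /= big_cons eqxx setIA.
  rewrite (@eq_cells _ (fun j => V j @^-1` [set l j])) => [->|j ij]; last by rewrite gtn_eqF.
  rewrite -mulrA; congr (_ * (_ * _)); apply: eq_big_seq => j.
  by rewrite mem_iota => /andP[ij _]; rewrite gtn_eqF.
have mt t : measurable_fun setT (fun w => Phi (t :: [seq V j w | j <- iota i.+1 r])).
  by have [] := IHt t (lawt t).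
have mi t : measurable_fun setT (\1_(V i @^-1` [set t]) : Omega -> R).
  exact: measurable_indic.
split.
  under eq_fun do rewrite -[_ :: _]/[seq V j _ | j <- iota i r.+1] PhiE.
  by apply: measurable_sum => t; exact: measurable_funM.
transitivity (\int[P]_w \sum_(t <- enum T)
    (\1_(A `&` V i @^-1` [set t]) w * Phi (t :: [seq V j w | j <- iota i.+1 r]))).
  apply: eq_Rintegral => w _; rewrite -[_ :: _]/[seq V j w | j <- iota i r.+1] PhiE mulr_sumr.
  by apply: eq_bigr => t _; rewrite mulrA indicI.
rewrite (@Rintegral_bounded_sum _ _ _ P _ _ _ B) => [|t|t w]; last 2 first.
- by apply: measurable_funM => //; apply: measurable_indic; exact: measurableI.
- exact: (@indic_mul_bounded _ _ _ _ (fun w => Phi (t :: [seq V j w | j <- iota i.+1 r]))).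
rewrite big_enum/= mulr_sumr; apply: eq_bigr => t _.
by have [_ ->] := IHt t (lawt t); rewrite mulrA.
Qed.

Import HBSimple.

(** The identity as a limit of functions with finitely many values: a functional of a list is then
    treated by fixing the value of its head. *)
Lemma simple_approximation_id : exists (g : nat -> R -> R) (vals : nat -> seq R),
  [/\ forall j, measurable_fun setT (g j), forall j, uniq (vals j),
      forall j x, g j x \in vals j & forall x, g j x @[j --> \oo] --> x].
Proof.
have mE : measurable_fun setT (@EFin R) by exact: EFin_measurable.
have [h gx] := approximation_sfun measurableT mE.
pose g j : R -> R := h j.
have fin j : exists s : seq R, range (g j) = [set` s].
  by apply/finite_seqP; exact: (fimfunP (h j)).
have [vals valsE] := choice fin.
exists g, (fun j => undup (vals j)); split => //.
- by move=> j; exact: undup_uniq.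
- move=> j x; rewrite mem_undup.
  have : range (g j) (g j x) by exists x.
  by rewrite valsE.
- by move=> x; have /fine_cvg := gx x I; exact.
Qed.

Lemma seq_lipschitz_measurable (X : nat -> Omega -> R) (r i : nat) (L : R) (F : seq R -> R) :
  0 <= L -> (forall i, measurable_fun setT (X i)) -> seq_lipschitz r L F ->
  measurable_fun setT (fun w => F [seq X j w | j <- iota i r]).
Proof.
move=> L0 mX; elim: r i F => [|r IH] i F FL //=.
have [g [vals [mg uv gv gx]]] := simple_approximation_id.
apply: (measurable_fun_cvg (h := fun j w => F (g j (X i w) :: [seq X j w | j <- iota i.+1 r]))).
  move=> j; rewrite (_ : (fun w => _) = fun w => \sum_(v <- vals j)
      \1_(X i @^-1` (g j @^-1` [set v])) w * F (v :: [seq X j w | j <- iota i.+1 r])); last first.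
    by apply/funext => w; exact: (split_value _ (fun x => F (x :: _)) w (uv j) (gv j)).
  apply: measurable_sum => v; apply: measurable_funM.
    apply: measurable_indic; rewrite -[X in measurable X]setTI; apply: mX => //.
    by rewrite -[X in measurable X]setTI; exact: mg.
  by apply: (IH _ (fun u => F (v :: u))); exact: seq_lipschitz_tail.
move=> w _; have := lipschitz_fun_continuous L0 (seq_lipschitz_head FL _) => /(_ [seq X j w | j <- iota i.+1 r]).
rewrite size_map size_iota => /(_ erefl (X i w)) c.
exact: (cvg_comp _ _ (gx (X i w)) c).
Qed.

(** The induction of [nestE_law] for real variables: the head takes finitely many values on both
    sides, and dominated convergence removes the approximation. *)
Lemma gaussE_law (X : nat -> Omega -> R) (s : R) (r i : nat) (A : set Omega)
    (a L B : R) (F : seq R -> R) :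
  0 <= L -> (forall i, measurable_fun setT (X i)) -> measurable A ->
  (forall v, `|F v| <= B) -> seq_lipschitz r L F ->
  (forall U : nat -> set R, (forall i, measurable (U i)) ->
    fine (P (A `&` cells (fun i => X i @^-1` U i) i r)) =
    a * \prod_(j <- iota i r) fine (normal_prob 0 s (U j))) ->
  \int[P]_w (\1_A w * F [seq X j w | j <- iota i r]) = a * gaussE s r F.
Proof.
move=> L0 mX; elim: r i A a F => [|r IH] i A a F mA FB FL law /=.
  rewrite Rintegral_indic_cst//; congr (_ * _).
  by have := law (fun=> setT) (fun=> measurableT); rewrite /= big_nil mulr1 setIT.
have [g [vals [mg uv gv gx]]] := simple_approximation_id.
pose tl w := [seq X j w | j <- iota i.+1 r].
have mtl v : measurable_fun setT (fun w => F (v :: tl w)).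
  by apply: (@seq_lipschitz_measurable _ r i.+1 L (fun u => F (v :: u)) L0 mX); exact: seq_lipschitz_tail.
have mgX j v : measurable (X i @^-1` (g j @^-1` [set v])).
  rewrite -[X in measurable X]setTI; apply: mX => //.
  by rewrite -[X in measurable X]setTI; exact: mg.
have mgv j v : measurable (g j @^-1` [set v]).
  by rewrite -[X in measurable X]setTI; exact: mg.
have m1 (C : set Omega) : measurable C -> measurable_fun setT (\1_C : Omega -> R).
  by move=> mC; exact: measurable_indic.
have gm : measurable_fun setT (fun y : R => gaussE s r (fun v => F (y :: v))).
  exact: lipschitz_fun_measurable (gaussE_lipschitz _ L0 FB FL).
have gB y : `|gaussE s r (fun v => F (y :: v))| <= B.
  by apply: (gaussE_bounded _ L0) => //; exact: seq_lipschitz_tail.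
(* Both sides agree when the first variable is replaced by a simple function of it. *)
have simple j : \int[P]_w (\1_A w * F (g j (X i w) :: tl w)) =
    a * \int[normal_prob 0 s]_y gaussE s r (fun v => F (g j y :: v)).
  transitivity (\int[P]_w \sum_(v <- vals j)
      (\1_(A `&` X i @^-1` (g j @^-1` [set v])) w * F (v :: tl w))).
    apply: eq_Rintegral => w _.
    rewrite (split_value (X i) (fun x => F (x :: tl w)) w (uv j) (gv j)) mulr_sumr.
    by apply: eq_bigr => v _; rewrite mulrA indicI.
  rewrite (@Rintegral_bounded_sum _ _ _ P _ _ _ B) => [|v|v w]; last 2 first.
  - by apply: measurable_funM => //; apply: m1; exact: measurableI.
  - exact: (@indic_mul_bounded _ _ _ _ (fun w => F (v :: tl w))).
  transitivity (\sum_(v <- vals j) a * (fine (normal_prob 0 s (g j @^-1` [set v])) *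
      gaussE s r (fun u => F (v :: u)))).
    apply: eq_bigr => v _; rewrite mulrA; apply: IH => //.
    - exact: measurableI.
    - exact: seq_lipschitz_tail.
    move=> U mU; pose U' k := if k == i then g j @^-1` [set v] else U k.
    have mU' k : measurable (U' k) by rewrite /U'; case: eqP.
    have U'i : U' i = g j @^-1` [set v] by rewrite /U' eqxx.
    have := law U' mU'; rewrite cellsS [iota i r.+1]/= big_cons U'i setIA mulrA.
    rewrite (@eq_cells _ (fun k => X k @^-1` U k)) => [->|k ik]; last by rewrite /U' gtn_eqF.
    by congr (_ * _); apply: eq_big_seq => k; rewrite mem_iota /U' => /andP[ik _]; rewrite gtn_eqF.
  rewrite -mulr_sumr; congr (_ * _).
  transitivity (\int[normal_prob 0 s]_y \sum_(v <- vals j)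
      (\1_(g j @^-1` [set v]) y * gaussE s r (fun u => F (v :: u)))).
    rewrite (@Rintegral_bounded_sum _ _ _ (normal_prob 0 s) _ _ _ B) => [|v|v y]; last 2 first.
    - by apply: measurable_funM => //; apply: measurable_indic; exact: mgv.
    - exact: (@indic_mul_bounded _ _ _ _ (fun=> gaussE s r (fun u => F (v :: u)))).
    apply: eq_bigr => v _; apply/esym.
    exact: (@Rintegral_indic_cst _ _ _ (normal_prob 0 s) _ _ (mgv j v)).
  apply: eq_Rintegral => y _.
  by rewrite (split_value id (fun x => gaussE s r (fun u => F (x :: u))) y (uv j) (gv j)).
have Fx w : F (g j (X i w) :: tl w) @[j --> \oo] --> F (X i w :: tl w).
  have := lipschitz_fun_continuous L0 (seq_lipschitz_head FL _) => /(_ (tl w)).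
  rewrite size_map size_iota => /(_ erefl (X i w)) c.
  exact: (cvg_comp _ _ (gx (X i w)) c).
have Gx y : gaussE s r (fun v => F (g j y :: v)) @[j --> \oo] --> gaussE s r (fun v => F (y :: v)).
  have c := @lipschitz_fun_continuous R L _ L0 (gaussE_lipschitz s L0 FB FL) y.
  exact: (cvg_comp _ _ (gx y) c).
have mF1 j : measurable_fun setT (fun w => F (g j (X i w) :: tl w)).
  rewrite (_ : (fun w => _) = fun w => \sum_(v <- vals j)
      \1_(X i @^-1` (g j @^-1` [set v])) w * F (v :: tl w)); last first.
    by apply/funext => w; exact: (split_value _ (fun x => F (x :: _)) w (uv j) (gv j)).
  by apply: measurable_sum => v; apply: measurable_funM => //; exact: m1.
have lhs := @Rintegral_dominated_cvg _ _ _ P B (fun j w => \1_A w * F (g j (X i w) :: tl w))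
  (fun w => \1_A w * F (X i w :: tl w)) _ _ _.
have rhs := @Rintegral_dominated_cvg _ _ _ (normal_prob 0 s) B
  (fun j y => gaussE s r (fun v => F (g j y :: v))) (fun y => gaussE s r (fun v => F (y :: v))) _ _ _.
have {}rhs := rhs (fun j => measurableT_comp gm (mg j)) (fun j y => gB _) Gx.
have {}lhs := lhs (fun j => measurable_funM (m1 _ mA) (mF1 j))
  (fun j w => indic_mul_bounded A w (fun w => FB _)) (fun w => cvgMl_tmp (Fx w)).
have {}rhs := @cvgMl_tmp _ _ _ _ _ a _ rhs.
have -> : gauss s (fun y => gaussE s r (fun v => F (y :: v))) 0 =
    \int[normal_prob 0 s]_y gaussE s r (fun v => F (y :: v)).
  by rewrite /gauss; apply: eq_Rintegral => y _; rewrite add0r.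
have e1 := cvg_lim (@Rhausdorff R) (lhs _); have e2 := cvg_lim (@Rhausdorff R) (rhs _).
rewrite -[LHS]e1 -[RHS]e2; congr (lim (_ @ \oo)); apply/funext => j; exact: simple.
Qed.

End sequence_laws.

(** * From sampled chains to telegraph processes *)

Lemma Rintegral_sum {R : realType} {dT} {T : measurableType dT}
    (mu : {measure set T -> \bar R}) (D : set T) (I : Type) (s : seq I) (F : I -> T -> R) :
  measurable D -> (forall i, mu.-integrable D (EFin \o F i)) ->
  \int[mu]_(x in D) (\sum_(i <- s) F i x) = \sum_(i <- s) \int[mu]_(x in D) F i x.
Proof.
move=> mD iF; elim: s => [|i s IH].
  under eq_Rintegral do rewrite big_nil.
  by rewrite big_nil Rintegral_cst// mul0r.
under eq_Rintegral do rewrite big_cons.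
rewrite RintegralD//; first by rewrite IH big_cons.
have := integrable_sum measurableT.
move=> _; rewrite (_ : _ \o _ = (fun x => \sum_(j <- s) (F j x)%:E)%E); last first.
  by apply/funext => x; rewrite /= sumEFin.
by apply: integrable_sum => // j _; exact: iF.
Qed.

Section riemann_sums.
Context {R : realType}.
Implicit Types (f Psi : R -> R) (a b x y : R).
Local Notation mu := (@lebesgue_measure R).

Definition riemann f a b (m : nat) : R :=
  (b - a) / m%:R * \sum_(k < m) f (a + k.+1%:R * ((b - a) / m%:R)).

Let riemann_step f a b (m : nat) x : R :=
  \sum_(k < m) f (a + k.+1%:R * ((b - a) / m%:R)) *
    \1_(`]a + k%:R * ((b - a) / m%:R), a + k.+1%:R * ((b - a) / m%:R)]%classic) x.

Let riemann_stepE f a b (m : nat) x : a < b -> (0 < m)%N -> a < x <= b ->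
  exists y, [/\ x <= y, y <= b, y < x + (b - a) / m%:R & riemann_step f a b m x = f y].
Proof.
move=> ab m0 /andP[ax xb]; set dt := (b - a) / m%:R.
have mR0 : 0 < m%:R :> R by rewrite ltr0n.
have dt0 : 0 < dt by rewrite divr_gt0// subr_gt0.
have tm : a + m%:R * dt = b by rewrite /dt; field; rewrite gt_eqF.
pose t (k : nat) := a + k%:R * dt.
have tS k : t k.+1 = t k + dt by rewrite /t -natr1; ring.
have t_le j k : (j <= k)%N -> t j <= t k.
  by move=> jk; rewrite lerD2l ler_wpM2r ?(ltW dt0)// ler_nat.
have ex : exists k, x <= t k.+1.
  by exists m.-1; rewrite prednK// /t tm.
have [k xk kmin] := ex_minnP ex.
have km : (k < m)%N.
  have : (k <= m.-1)%N by apply: kmin; rewrite prednK// /t tm.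
  by rewrite -ltnS prednK.
have tkx : t k < x.
  case: k xk kmin km => [|k] xk kmin km; first by rewrite /t mul0r addr0.
  by rewrite ltNge; apply/negP => /kmin; rewrite ltnn.
exists (t k.+1); split => //.
- by rewrite -tm; exact: (t_le k.+1 m).
- by rewrite tS ltrD2r.
rewrite /riemann_step (bigD1 (Ordinal km))//= big1 => [|j jk].
  by rewrite addr0 indicE mem_set ?mulr1//= in_itv/=; apply/andP; split.
rewrite indicE memNset ?mulr0//= in_itv/= => /andP[h1 h2].
have : (j != k :> nat) by [].
rewrite neq_ltn => /orP[jk'|kj].
  by move: (le_trans h2 (t_le _ _ jk')); rewrite leNgt tkx.
by move: (le_lt_trans (t_le _ _ kj) h1); rewrite ltNge xk.
Qed.

Let measurable_riemann_step f a b m : measurable_fun setT (riemann_step f a b m).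
Proof.
by apply: measurable_sum => k; apply: measurable_funM => //; exact: measurable_indic.
Qed.

Let integral_riemann_step f a b (m : nat) : a < b -> (0 < m)%N ->
  \int[mu]_(x in `]a, b]) riemann_step f a b m x = riemann f a b m.
Proof.
move=> ab m0; set dt := (b - a) / m%:R.
have mR0 : 0 < m%:R :> R by rewrite ltr0n.
have dt0 : 0 < dt by rewrite divr_gt0// subr_gt0.
have tm : a + m%:R * dt = b by rewrite /dt; field; rewrite gt_eqF.
pose I (k : nat) : set R := `]a + k%:R * dt, a + k.+1%:R * dt]%classic.
have IE k : (k < m)%N -> (mu (I k `&` `]a, b]) = dt%:E)%E.
  move=> km; rewrite (_ : I k `&` _ = I k); last first.
    apply: setIidl => x /=; rewrite !in_itv/= => /andP[h1 h2]; apply/andP; split.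
      by apply: le_lt_trans h1; rewrite lerDl mulr_ge0// ltW.
    have h2' : x <= a + k.+1%:R * dt by [].
    have h3 : k.+1%:R * dt <= m%:R * dt by rewrite ler_wpM2r ?(ltW dt0)// ler_nat.
    by apply: (le_trans h2'); rewrite -[leRHS]tm lerD2l.
  rewrite lebesgue_measure_itv/= lte_fin ltrD2l ltr_pM2r// ltr_nat ltnSn.
  by rewrite -EFinB; congr (_%:E); rewrite -natr1; ring.
have ii k : mu.-integrable `]a, b] (EFin \o \1_(I k)).
  apply: (integrableS measurableT) => //.
  exact: integrable_indic_itv.
have ic k c : mu.-integrable `]a, b] (EFin \o (fun x => c * \1_(I k) x)).
  have := @integrableZl _ _ _ mu `]a, b]%classic _ c _ (ii k).
  by apply.
rewrite /riemann_step /riemann -/dt (@Rintegral_sum _ _ _ mu)//; last by move=> k; exact: ic.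
rewrite mulr_sumr; apply: eq_bigr => k _.
rewrite RintegralZl//; last exact: ii.
rewrite mulrC; congr (_ * _).
rewrite /Rintegral (_ : (\int[mu]_(x in _) _)%E = dt%:E)//.
by rewrite integral_indic//; exact: IE.
Qed.

(** The sum is the integral of a step function that takes at x the value of f at the right end of
    its cell. Right continuity gives pointwise convergence; since Psi is nonincreasing, its value at
    x dominates, even when f is singular at a. *)
Lemma riemann_cvg f Psi a b : a < b ->
  (forall x, a < x < b -> f y @[y --> x^'+] --> f x) ->
  (forall x, a < x <= b -> `|f x| <= Psi x) ->
  (forall x y, a < x <= y -> y <= b -> Psi y <= Psi x) ->
  mu.-integrable `]a, b] (EFin \o Psi) ->
  mu.-integrable `]a, b] (EFin \o f) /\
  riemann f a b m @[m --> \oo] --> \int[mu]_(x in `]a, b]) f x.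
Proof.
move=> ab fr fPsi Psini iPsi; have ba0 : 0 < b - a by rewrite subr_gt0.
have cvg_step x : a < x <= b -> riemann_step f a b m.+1 x @[m --> \oo] --> f x.
  move=> axb; have /andP[ax xb] := axb.
  apply/cvgrPdist_le => e e0.
  have [dl dl0 near_x] : exists2 dl, 0 < dl & forall y, x <= y -> y <= b -> y < x + dl ->
      `|f x - f y| <= e.
    have [xb'|bx] := ltP x b; last first.
      by exists 1 => // y xy yb _; rewrite (_ : y = x) ?subrr ?normr0 ?ltW//;
        apply/eqP; rewrite eq_le xy (le_trans yb bx).
    have axb' : a < x < b by rewrite ax.
    have /cvgrPdist_le/(_ _ e0) := fr x axb'.
    rewrite near_withinE => /nbhs_ballP[dl /= dl0 H]; exists dl => // y xy _ yx.
    move: xy; rewrite le_eqVlt => /orP[/eqP <-|xy]; first by rewrite subrr normr0 ltW.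
    by apply: H => //; rewrite /ball/= distrC gtr0_norm ?subr_gt0// ltrBlDl.
  have [N [N0 Nge]] := exists_nat_ge ((b - a) / dl).
  exists N => // m /= Nm.
  have [y [xy yb yx ->]] := riemann_stepE f ab (ltn0Sn m) axb.
  apply: near_x => //; apply: (lt_le_trans yx); rewrite lerD2l.
  rewrite ler_pdivrMr ?ltr0n// mulrC -ler_pdivrMr//; apply: (le_trans Nge).
  by rewrite ler_nat ltnW// ltnS.
have bound m x : a < x <= b -> `|riemann_step f a b m.+1 x| <= Psi x.
  move=> axb; have /andP[ax xb] := axb.
  have [y [xy yb _ ->]] := riemann_stepE f ab (ltn0Sn m) axb.
  apply: (le_trans (fPsi y _)); first by rewrite yb (lt_le_trans ax).
  by apply: Psini => //; rewrite ax.
have mf : measurable_fun `]a, b] f.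
  apply: (measurable_fun_cvg (h := fun m => riemann_step f a b m.+1)).
    by move=> m; apply: measurable_funTS; exact: measurable_riemann_step.
  by move=> x /=; rewrite in_itv/=; exact: cvg_step.
have iff : mu.-integrable `]a, b] (EFin \o f).
  apply: le_integrable iPsi => //; first exact/measurable_EFinP.
  move=> x /=; rewrite in_itv/= => axb; rewrite lee_fin (le_trans (fPsi x axb))//.
  exact: ler_norm.
split => //.
have mD : measurable (`]a, b]%classic : set R) by exact: measurable_itv.
have H : (\int[mu]_(x in `]a, b]) (riemann_step f a b m.+1 x)%:E @[m --> \oo] -->
    (\int[mu]_(x in `]a, b]) f x)%:E)%E.
  rewrite /Rintegral fineK; last exact: integrable_fin_num.
  apply: (@dominated_cvg _ _ _ mu _ mD (fun m x => (riemann_step f a b m.+1 x)%:E)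
    (EFin \o f) (EFin \o Psi)) => //.
  - by move=> m; apply/measurable_EFinP; apply: measurable_funTS; exact: measurable_riemann_step.
  - by move=> x /=; rewrite in_itv/= => axb; apply: cvg_EFin; [exact: nearW|exact: cvg_step].
have K : riemann f a b m.+1 @[m --> \oo] --> \int[mu]_(x in `]a, b]) f x.
  rewrite (_ : (fun m => riemann f a b m.+1) =
    (fun m => fine (\int[mu]_(x in `]a, b]) (riemann_step f a b m.+1 x)%:E)%E)).
    exact: fine_cvg H.
  by apply/funext => m; rewrite -integral_riemann_step.
by rewrite -(cvg_shiftS (riemann f a b) (nbhs (\int[mu]_(x in `]a, b]) f x))).
Qed.

End riemann_sums.

Section increments_law.
Context {R : realType} {dO : measure_display} {Omega : measurableType dO}.
Variable P : probability Omega R.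

Lemma big_iota (m : nat) (F : nat -> R) : \prod_(j <- iota 0 m) F j = \prod_(j < m) F j.
Proof. by rewrite -(big_mkord xpredT F) /index_iota subn0. Qed.

Lemma cells_shift (E : nat -> set Omega) k i r :
  cells E (k + i)%N r = cells (fun j => E (k + j)%N) i r.
Proof. by elim: r i => //= r IH i; rewrite -addnS IH. Qed.

Lemma eq_cells_in (E E' : nat -> set Omega) i r :
  (forall j, (i <= j < i + r)%N -> E j = E' j) -> cells E i r = cells E' i r.
Proof.
by move=> EE'; apply/seteqP; split => w /cellsP h; apply/cellsP => j ij;
  have := h j ij; rewrite EE'.
Qed.

Lemma cells_bigcap (E : nat -> set Omega) r : cells E 0 r = \bigcap_(k : 'I_r) E k.
Proof.
apply/seteqP; split => w.
  by move=> /cellsP h k _; apply: h; rewrite add0n ltn_ord.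
by move=> h; apply/cellsP => j /=; rewrite add0n => jr; exact: (h (Ordinal jr)).
Qed.

Lemma independent_increments_cells (X : R -> Omega -> R) (t : nat -> R)
    (U : nat -> set R) (r : nat) :
  independent_increments P X -> 0 <= t 0%N -> nondecreasing_seq t ->
  (forall j, measurable (U j)) ->
  fine (P (cells (fun j => (fun w => X (t j.+1) w - X (t j) w) @^-1` U j) 0 r)) =
  \prod_(j <- iota 0 r) fine (P ((fun w => X (t j.+1) w - X (t j) w) @^-1` U j)).
Proof.
move=> iX t0 tn mU; rewrite big_iota cells_bigcap; apply: (iX r t t0 tn) => i.
apply: sub_sigma_algebra; exists tt => //; exists (U i) => //.
by rewrite setTI.
Qed.

Variables (n : R) (N : R -> Omega -> nat).
Hypotheses (n0 : 0 < n) (ppN : poisson_process P n N).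

Let flip (s t : R) w : bool := odd (N t w - N s w).

Lemma measurable_increment (s t : R) k : 0 <= s -> s <= t ->
  measurable [set w | N t w = (N s w + k)%N].
Proof.
move=> s0 st; have t0 := le_trans s0 st.
rewrite (_ : [set _ | _] = \bigcup_j ((N s @^-1` [set j]) `&` (N t @^-1` [set (j + k)%N]))).
  apply: bigcup_measurable => j _; apply: measurableI.
    by rewrite -[X in measurable X]setTI; apply: (pp_measurable ppN s0).
  by rewrite -[X in measurable X]setTI; apply: (pp_measurable ppN t0).
apply/seteqP; split => w /=; first by move=> h; exists (N s w).
by move=> [j _ [/= <- ->]].
Qed.

(** The alternating sum of the Poisson masses is e^(- lam) e^(- lam). The sign is approached by its
    truncations to increments less than K, for which the expectation is a finite sum. *)
Let sign_expectation (s t : R) : 0 <= s < t ->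
  \int[P]_w ((-1) ^+ (N t w - N s w)%N) = expR (- (2 * n * (t - s))).
Proof.
move=> /andP[s0 st]; have t0 := le_trans s0 (ltW st).
pose lam := n * (t - s); have lam0 : 0 < lam by rewrite mulr_gt0// subr_gt0.
pose E k := [set w | N t w = (N s w + k)%N].
have mE k : measurable (E k) by apply: measurable_increment => //; exact: ltW.
pose f (K : nat) w : R := \sum_(k < K) \1_(E k) w * (-1) ^+ k.
have Nst w : (N s w <= N t w)%N by apply: (pp_mono ppN); rewrite s0 ltW.
have EN w k : E k w -> k = (N t w - N s w)%N by rewrite /E/= => ->; rewrite addKn.
have fE w K : f K w = if (N t w - N s w < K)%N then (-1) ^+ (N t w - N s w) else 0.
  have [h|h] := ltnP.
    rewrite /f (bigD1 (Ordinal h))//= big1 ?addr0 => [|k kh].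
      by rewrite indicE mem_set ?mul1r// /E/= subnKC.
    rewrite indicE memNset ?mul0r// => /EN kE; move: kh; rewrite -val_eqE/= kE eqxx//.
  rewrite /f big1// => k _; rewrite indicE memNset ?mul0r// => /EN kE.
  by move: (ltn_ord k); rewrite kE ltnNge h.
have mf K : measurable_fun setT (f K).
  by apply: measurable_sum => k; apply: measurable_funM => //; exact: measurable_indic.
have f1 K w : `|f K w| <= 1.
  by rewrite fE; case: ifP => _; rewrite ?normr0// normrX normrN1 expr1n.
have fcvg w : f K w @[K --> \oo] --> ((-1) ^+ (N t w - N s w)%N : R).
  apply: cvg_near_cst; exists (N t w - N s w).+1 => // K /= h.
  by rewrite fE h.
have h1 := @Rintegral_dominated_cvg _ _ _ P 1 f _ mf f1 fcvg.
have fint K : \int[P]_w f K w = expR (- lam) * series (exp_coeff (- lam)) K.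
  rewrite /f (@Rintegral_bounded_sum _ _ _ P _ _ _ 1) => [|k|k w]; last 2 first.
  - by apply: measurable_funM => //; exact: measurable_indic.
  - by apply: (@indic_mul_bounded _ _ _ _ (fun=> _)) => _; rewrite normrX normrN1 expr1n.
  rewrite /series/= big_mkord mulr_sumr; apply: eq_bigr => k _.
  rewrite Rintegral_indic_cst// (pp_law ppN)/= ?s0//.
  rewrite /poisson_pmf -/lam lam0 /exp_coeff/= [(- lam) ^+ k]exprNn; ring.
have h2 : \int[P]_w f K w @[K --> \oo] --> expR (- lam) * expR (- lam).
  rewrite (_ : (fun K => _) = fun K => expR (- lam) * series (exp_coeff (- lam)) K); last first.
    by apply/funext => K; exact: fint.
  by apply: cvgMl_tmp; exact: is_cvg_series_exp_coeff.
have e1 := cvg_lim (@Rhausdorff R) h1; have e2 := cvg_lim (@Rhausdorff R) h2.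
by rewrite -[LHS]e1 e2 -expRD /lam; congr expR; ring.
Qed.

Lemma measurable_flip (s t : R) b : 0 <= s -> s <= t -> measurable (flip s t @^-1` [set b]).
Proof.
move=> s0 st; rewrite (_ : _ @^-1` _ = \bigcup_(k in [set k | odd k = b]) [set w | N t w = (N s w + k)%N]).
  by apply: bigcup_measurable => k _; exact: measurable_increment.
apply/seteqP; split => w /=.
  move=> h; exists (N t w - N s w)%N => //=.
  by rewrite subnKC//; apply: (pp_mono ppN); rewrite s0 st.
by move=> [k /= kb h]; rewrite /flip h addKn.
Qed.

Lemma poisson_flip_law (s t : R) b : 0 <= s < t ->
  fine (P (flip s t @^-1` [set b])) = flip_mass (expR (- (2 * n * (t - s)))) b.
Proof.
move=> st; have /andP[s0 st'] := st; have h := sign_expectation st.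
have mF b' : measurable (flip s t @^-1` [set b']) by apply: measurable_flip => //; exact: ltW.
have b1 (b' : bool) w : `|\1_(flip s t @^-1` [set b']) w * (-1) ^+ b' : R| <= 1.
  by apply: (@indic_mul_bounded _ _ _ _ (fun=> _)) => _; rewrite normrX normrN1 expr1n.
have m1 (b' : bool) : measurable_fun setT (fun w => \1_(flip s t @^-1` [set b']) w * (-1) ^+ b' : R).
  by apply: measurable_funM => //; exact: measurable_indic.
have split_b w : (-1) ^+ (N t w - N s w)%N =
    \sum_(b <- [:: false; true]) \1_(flip s t @^-1` [set b]) w * (-1) ^+ b :> R.
  rewrite big_cons big_seq1 !indicE -signr_odd -/(flip s t w).
  case E : (flip s t w).
    by rewrite memNset ?mem_set ?mul0r ?add0r ?mul1r//= E.
  by rewrite mem_set ?memNset ?mul0r ?addr0 ?mul1r//= E.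
have h1 : fine (P (flip s t @^-1` [set false])) - fine (P (flip s t @^-1` [set true])) =
    expR (- (2 * n * (t - s))).
  rewrite -h; under [RHS]eq_Rintegral do rewrite split_b.
  rewrite (@Rintegral_bounded_sum _ _ _ P _ _ _ 1)//.
  by rewrite big_cons big_seq1 !Rintegral_indic_cst// expr0 expr1 mulr1 mulrN1.
have h2 : fine (P (flip s t @^-1` [set false])) + fine (P (flip s t @^-1` [set true])) = 1.
  rewrite -fineD ?fin_num_measure// -measureU//.
    rewrite (_ : _ `|` _ = setT :> set Omega); last first.
      by apply/seteqP; split => // w _ /=; case: (flip s t w); [right|left].
    exact: (congr1 fine (probability_setT P)).
  by apply/seteqP; split => // w [/= -> ].
by rewrite -h1 /flip_mass; case: b; rewrite ?expr0 ?expr1; move: h2; lra.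
Qed.

Lemma poisson_flips_law (dt : R) (l : nat -> bool) (r : nat) : 0 < dt ->
  fine (P (cells (fun j => flip (j%:R * dt) (j.+1%:R * dt) @^-1` [set l j]) 0 r)) =
  \prod_(j <- iota 0 r) kac_flip n dt (l j).
Proof.
(* Increments are independent as real variables, so the parity of a count becomes membership in a
   set of reals. *)
move=> dt0; pose t j := j%:R * dt; pose U b : set R := \bigcup_(k in [set k | odd k = b]) [set k%:R].
have mU b : measurable (U b) by apply: bigcup_measurable => k _; exact: measurable_set1.
have tn : nondecreasing_seq t.
  by move=> j k jk; rewrite ler_wpM2r ?(ltW dt0)// ler_nat.
have t0 j : 0 <= t j by rewrite mulr_ge0// ltW.
have UE b j : (fun w => (N (t j.+1) w)%:R - (N (t j) w)%:R) @^-1` U b = flip (t j) (t j.+1) @^-1` [set b].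
  apply/seteqP; split => w /=; have Nw : (N (t j) w <= N (t j.+1) w)%N.
  - by apply: (pp_mono ppN); rewrite t0 tn.
  - rewrite -natrB// => -[k /= <-] /eqP; rewrite eqr_nat => /eqP kE.
    by rewrite /flip kE.
  - by apply: (pp_mono ppN); rewrite t0 tn.
  by move=> h; exists (N (t j.+1) w - N (t j) w)%N => //=; rewrite natrB.
have := independent_increments_cells r (pp_indep ppN) (t0 0%N) tn (fun j => mU (l j)).
rewrite (@eq_cells _ _ _ (fun j => flip (t j) (t j.+1) @^-1` [set l j])) => [->|j _]; last exact: UE.
apply: eq_bigr => j _; rewrite UE poisson_flip_law.
  rewrite /kac_flip /kac_corr; congr (flip_mass (expR (- (_ * _))) _).
  by rewrite /t -natr1; ring.
by rewrite t0/= /t -natr1 mulrDl mul1r ltrDl.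
Qed.

End increments_law.

Section grid_laws.
Context {R : realType} {dO : measure_display} {Omega : measurableType dO}.
Variable P : probability Omega R.

Lemma sigma_of_measurable {I : Type} {dS} {S : measurableType dS} (J : set I)
    (X : I -> Omega -> S) i : J i ->
  @measurable_fun _ _ (g_sigma_algebraType (\bigcup_(i in J) preimage_set_system setT (X i) measurable))
    S setT (X i).
Proof.
move=> Ji _ U mU; rewrite setTI; apply: sub_sigma_algebra; exists i => //.
by exists U => //; rewrite setTI.
Qed.

Lemma sigma_of_cells {I : Type} {dS} {S : measurableType dS} (J : set I)
    (X : I -> Omega -> S) E i r : (forall j, (i <= j < i + r)%N -> sigma_of J X (E j)) ->
  sigma_of J X (cells E i r).
Proof.
set G := \bigcup_(i in J) preimage_set_system setT (X i) measurable.
elim: r i => [|r IH] i h /=; first exact: (@measurableT _ (g_sigma_algebraType G)).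
apply: (@measurableI _ (g_sigma_algebraType G)).
  by apply: h; rewrite leqnn addnS ltnS leq_addr.
by apply: IH => j /andP[ij jr]; apply: h; rewrite (ltnW ij) -addSnnS.
Qed.

Context {d : nat}.
Implicit Types (Y : R -> Omega -> 'cV[R]_d).

Lemma sigma_coord_process Y l : sigma_of time (coord_process Y l) `<=` sigma_process Y.
Proof.
apply: sub_sigma_algebra2 => A [t tt [U mU <-]].
by exists (t, l) => //; exists U.
Qed.

(** Independence has two levels: first between the two noises, then between the coordinates of
    each. *)
Lemma grid_independence (Y : bool -> R -> Omega -> 'cV[R]_d) (A : bool -> 'I_d -> set Omega) :
  independent_processes P (Y true) (Y false) -> (forall c, independent_coords P (Y c)) ->
  (forall c l, sigma_of time (coord_process (Y c) l) (A c l)) ->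
  fine (P (\bigcap_c \bigcap_l A c l)) = \prod_c \prod_l fine (P (A c l)).
Proof.
move=> iY iYc sA.
rewrite (iY (fun c => \bigcap_l A c l)); first by apply: eq_bigr => c _; exact: iYc.
move=> c; have -> : (if c then Y true else Y false) = Y c by case: c.
rewrite /sigma_process /sigma_of; set G := \bigcup_(ti in _) _.
apply: (@fin_bigcap_measurable _ (g_sigma_algebraType G)) => [|l _]; first exact: finite_finset.
exact: sigma_coord_process.
Qed.

Variable i0 : 'I_d.

(** Lines up all coordinates of both noises in one sequence; [i0] serves only as the default beyond
    the last rank. *)
Definition coord_of (k : nat) : bool * 'I_d := nth (true, i0) (enum {: bool * 'I_d}) k.

Lemma coord_ofK (p : bool * 'I_d) : coord_of (enum_rank p) = p.
Proof. by rewrite /coord_of nth_enum_rank. Qed.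

(** Position k r + j belongs to the coordinate of rank k, so the events split into stretches of
    length r, one for each coordinate, independent of one another; the product rule within a stretch
    is the second hypothesis on E. *)
Lemma grid_law (Y : bool -> R -> Omega -> 'cV[R]_d) (r : nat) (E : nat -> set Omega) (q : nat -> R) :
  independent_processes P (Y true) (Y false) -> (forall c, independent_coords P (Y c)) ->
  (forall k, sigma_of time (coord_process (Y (coord_of k).1) (coord_of k).2) (cells E (k * r) r)) ->
  (forall k, fine (P (cells E (k * r) r)) = \prod_(j <- iota (k * r) r) q j) ->
  fine (P (cells E 0 (#|{: bool * 'I_d}| * r))) =
  \prod_(j <- iota 0 (#|{: bool * 'I_d}| * r)) q j.
Proof.
move=> iY iYc sE lE; set D := #|_|.
pose rk (c : bool) (l : 'I_d) : nat := enum_rank (c, l).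
have -> : cells E 0 (D * r) = \bigcap_c \bigcap_l cells E (rk c l * r) r.
  apply/seteqP; split => w.
    move=> /cellsP h c _ l _; apply/cellsP => j /andP[j1 j2]; apply: h.
    rewrite add0n (leq_trans j2)//= -mulSnr leq_mul2r; apply/orP; right.
    exact: ltn_ord.
  move=> h; apply/cellsP => j /=; rewrite add0n => jDr.
  have r0 : (0 < r)%N by move: jDr; case: (r) => //; rewrite muln0.
  have kD : (j %/ r < D)%N by rewrite ltn_divLR.
  have := h (enum_val (Ordinal kD)).1 I (enum_val (Ordinal kD)).2 I.
  move/cellsP; apply; rewrite /rk -surjective_pairing enum_valK/=.
  by rewrite leq_divM/= -mulSnr ltn_ceil.
rewrite (grid_independence iY iYc); last first.
  by move=> c l; have := sE (rk c l); rewrite coord_ofK.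
transitivity (\prod_(0 <= j < D * r) q j); last by rewrite /index_iota subn0.
rewrite big_nat_mul big_mkord pair_big/=.
rewrite (eq_bigl (fun p => p \in {: bool * 'I_d}))//.
rewrite (big_enum_val (A := {: bool * 'I_d})); apply: eq_bigr => k _.
rewrite /rk -surjective_pairing enum_valK lE /index_iota.
by rewrite mulSn addnK.
Qed.

End grid_laws.

Lemma block_index (N k j : nat) : (k * N <= j < k * N + N)%N ->
  exists j', [/\ (j' < N)%N, j = (k * N + j')%N, (j %/ N = k)%N & (j %% N = j')%N].
Proof.
move=> /andP[h1 h2]; have N0 : (0 < N)%N by move: h1 h2; case: (N) => //; rewrite addn0; lia.
exists (j - k * N)%N; have jE : j = (k * N + (j - k * N))%N by rewrite subnKC.
have lt : (j - k * N < N)%N by rewrite ltn_subLR.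
split => //; first by rewrite {1}jE divnMDl// divn_small// addn0.
by rewrite {1}jE modnMDl modn_small.
Qed.

Lemma prod_iota_shift {R : comNzRingType} (k r : nat) (F : nat -> R) :
  \prod_(j <- iota k r) F j = \prod_(j <- iota 0 r) F (k + j)%N.
Proof. by rewrite -{1}[k]addn0 iotaDl big_map. Qed.

Lemma map_cst_iota (T : Type) (x : T) (i r : nat) : [seq x | _ <- iota i r] = nseq r x.
Proof. by elim: r i => //= r IH i; rewrite IH. Qed.

Lemma integrable_cst_oc {R : realType} (a b c : R) :
  (@lebesgue_measure R).-integrable `]a, b] (EFin \o (fun=> c)).
Proof.
apply: (@integrableS _ _ _ lebesgue_measure `[a, b]) => //.
  by apply: subset_itvScc; rewrite bnd_simp.
apply: continuous_compact_integrable; first exact: segment_compact.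
by apply: continuous_subspaceT => x; exact: cvg_cst.
Qed.

Section brownian_grid.
Context {R : realType} {dO : measure_display} {Omega : measurableType dO}.
Variable P : probability Omega R.
Context {d : nat}.
Variables (i0 : 'I_d) (W : bool -> R -> Omega -> 'cV[R]_d).
Hypotheses (hW : forall c, std_brownian_motion P (W c))
  (iW : independent_processes P (W true) (W false)).
Variables (h : R) (N : nat).
Hypothesis h0 : 0 < h.

Local Notation D := (#|{: bool * 'I_d}|).

(* [i] encodes the noise and the coordinate of rank [i %/ N], and the cell [i %% N] of
   the grid. *)
Definition grid_increment (Y : bool -> R -> Omega -> 'cV[R]_d) (i : nat) (w : Omega) : R :=
  Y (coord_of i0 (i %/ N)).1 ((i %% N).+1%:R * h) w (coord_of i0 (i %/ N)).2 0 -
  Y (coord_of i0 (i %/ N)).1 ((i %% N)%:R * h) w (coord_of i0 (i %/ N)).2 0.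

Let hk (k : nat) : 0 <= k%:R * h. Proof. by rewrite mulr_ge0// ltW. Qed.

Lemma measurable_grid_increment i : measurable_fun setT (grid_increment W i).
Proof.
have [bm _] := hW (coord_of i0 (i %/ N)).1.
by apply: measurable_funB; exact: (bm_measurable (bm _)).
Qed.

Lemma brownian_grid_law (F : seq R -> R) (L B : R) : 0 <= L ->
  (forall v, `|F v| <= B) -> seq_lipschitz (D * N) L F ->
  \int[P]_w F [seq grid_increment W i w | i <- iota 0 (D * N)] =
  gaussE (Num.sqrt h) (D * N) F.
Proof.
move=> L0 FB FL; rewrite -[RHS]mul1r.
rewrite -(@gaussE_law _ _ _ P (grid_increment W) (Num.sqrt h) (D * N) 0 setT 1 L B F L0)//.
- by apply: eq_Rintegral => w _; rewrite indicE mem_set// mul1r.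
- exact: measurable_grid_increment.
move=> U mU; rewrite setTI mul1r.
apply: (@grid_law _ _ _ P d i0 W N (fun i => grid_increment W i @^-1` U i)
  (fun j => fine (normal_prob 0 (Num.sqrt h) (U j)))) => //.
- by move=> c; have [] := hW c.
- move=> k; apply: sigma_of_cells => j /block_index[j' [j'N _ jN jN']].
  set c := coord_of i0 k.
  have mt t : 0 <= t -> @measurable_fun _ _ (g_sigma_algebraType (\bigcup_(i in time)
      preimage_set_system setT (coord_process (W c.1) c.2 i) measurable)) _ setT
      (coord_process (W c.1) c.2 t).
    by move=> t0; apply: sigma_of_measurable; rewrite /time/= in_itv/= t0.
  have := measurable_funB (mt _ (hk j'.+1)) (mt _ (hk j')).
  move=> /(_ (@measurableT _ _) _ (mU j)); rewrite setTI.
  by rewrite /grid_increment jN jN'.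
- move=> k; set c := coord_of i0 k.
  have [bm _] := hW c.1; have bmc := bm c.2.
  pose X t w := coord_process (W c.1) c.2 t w.
  pose t j := j%:R * h.
  have tn : nondecreasing_seq t.
    by move=> j k' jk; rewrite ler_wpM2r ?(ltW h0)// ler_nat.
  have EX j : (j < N)%N -> grid_increment W (k * N + j) = (fun w => X (t j.+1) w - X (t j) w).
    move=> jN; have [|j' [_ jE j1 j2]] := @block_index N k (k * N + j).
      by rewrite leq_addr ltn_add2l.
    have {}jE : j = j' by move/eqP: jE; rewrite eqn_add2l => /eqP.
    by apply/funext => w; rewrite /grid_increment j1 j2 -jE.
  have -> : cells (fun i => grid_increment W i @^-1` U i) (k * N) N =
      cells (fun j => (fun w => X (t j.+1) w - X (t j) w) @^-1` U (k * N + j)%N) 0 N.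
    rewrite -[(k * N)%N]addn0 cells_shift addn0; apply: eq_cells_in => j /=.
    by rewrite add0n => jN; rewrite EX.
  rewrite (independent_increments_cells N (bm_indep bmc) (hk 0) tn (fun j => mU (k * N + j)%N)).
  rewrite [RHS]prod_iota_shift.
  apply: eq_bigr => j _.
  have := @bm_gauss _ _ _ _ _ bmc (t j) (t j.+1) _ (U (k * N + j)%N) (mU _).
  rewrite hk ltr_pM2r// ltr_nat ltnSn => /(_ erefl) ->.
  by rewrite (_ : t j.+1 - t j = h)// /t -natr1; ring.
Qed.

End brownian_grid.

Section kac_grid.
Context {R : realType} {dO : measure_display} {Omega : measurableType dO}.
Variable P : probability Omega R.
Context {d : nat}.
Variables (i0 : 'I_d) (n : nat) (Y : bool -> R -> Omega -> 'cV[R]_d).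
Variable Nc : bool -> 'I_d -> R -> Omega -> nat.
Hypotheses (n0 : (0 < n)%N) (ppN : forall c l, poisson_process P n%:R (Nc c l))
  (YN : forall c l t w, 0 <= t -> Y c t w l 0 = Num.sqrt n%:R * (-1) ^+ Nc c l t w)
  (cY : forall c, independent_coords P (Y c))
  (iY : independent_processes P (Y true) (Y false)).

Local Notation D := (#|{: bool * 'I_d}|).
Local Notation mu := (@lebesgue_measure R).

Let nR0 : 0 < n%:R :> R. Proof. by rewrite ltr0n. Qed.

Definition grid_flip (dt : R) (r i : nat) (w : Omega) : bool :=
  odd (Nc (coord_of i0 (i %/ r)).1 (coord_of i0 (i %/ r)).2 ((i %% r).+1%:R * dt) w -
       Nc (coord_of i0 (i %/ r)).1 (coord_of i0 (i %/ r)).2 ((i %% r)%:R * dt) w).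

Lemma grid_flip_law (dt : R) (r : nat) (Phi : seq bool -> R) (B : R) : 0 < dt ->
  (forall l, `|Phi l| <= B) ->
  measurable_fun setT (fun w => Phi [seq grid_flip dt r i w | i <- iota 0 (D * r)]) /\
  \int[P]_w Phi [seq grid_flip dt r i w | i <- iota 0 (D * r)] =
  nestE (nseq (D * r) (kac_flip n%:R dt)) Phi.
Proof.
move=> dt0 PhiB.
have tk (k : nat) : 0 <= k%:R * dt by rewrite mulr_ge0// ltW.
have tS (k : nat) : k%:R * dt <= k.+1%:R * dt by rewrite ler_wpM2r ?(ltW dt0)// ler_nat.
have [|||| m law] := @nestE_law _ _ _ P _ (grid_flip dt r) false (fun=> kac_flip n%:R dt)
    (D * r) 0 setT 1 B Phi => //.
- by move=> i b; exact: (measurable_flip (ppN _ _)).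
- move=> l; rewrite setTI mul1r.
  apply: (@grid_law _ _ _ P d i0 Y r (fun i => grid_flip dt r i @^-1` [set l i])
    (fun j => kac_flip n%:R dt (l j))) => //.
  + move=> k; apply: sigma_of_cells => j /block_index[j' [j'N _ jN jN']].
    set c := coord_of i0 k.
    have mt t : 0 <= t -> @measurable_fun _ _ (g_sigma_algebraType (\bigcup_(i in time)
        preimage_set_system setT (coord_process (Y c.1) c.2 i) measurable)) _ setT
        (coord_process (Y c.1) c.2 t).
      by move=> t0; apply: sigma_of_measurable; rewrite /time/= in_itv/= t0.
    have mprod := measurable_funM (mt _ (tk j'.+1)) (mt _ (tk j')).
    (* A flip occurs exactly when the product of the noise at both ends of the step is negative.
       This places the event in the sigma-algebra of the noise, where independence is available. *)
    pose U : set R := if l j then `]-oo, 0[%classic else `[0, +oo[%classic.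
    have mU : measurable U by rewrite /U; case: (l j).
    have := mprod (@measurableT _ _) _ mU; rewrite setTI.
    rewrite (_ : _ @^-1` U = grid_flip dt r j @^-1` [set l j])//.
    apply/funext => w; apply/propext.
    rewrite /= /coord_process !YN// /grid_flip jN jN' -/c.
    have Nle : (Nc c.1 c.2 (j'%:R * dt) w <= Nc c.1 c.2 (j'.+1%:R * dt) w)%N.
      by apply: (pp_mono (ppN _ _)); rewrite tk tS.
    set a := Nc _ _ _ w in Nle *; set b := Nc _ _ _ w in Nle *.
    rewrite mulrACA -expr2 sqr_sqrtr ?(ltW nR0)// -exprD oddB//.
    rewrite -signr_odd oddD /U; case: (l j) => /=; rewrite in_itv/= ?andbT.
      rewrite pmulr_rlt0//; case: (odd _) => /=; case: (odd _) => /=;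
        by rewrite ?expr0 ?expr1 ?ltrN10 ?ltr10.
    rewrite pmulr_rge0//; case: (odd _) => /=; case: (odd _) => /=;
      by rewrite ?expr0 ?expr1 ?ler0N1 ?ler01.
  + move=> k; set c := coord_of i0 k.
    have -> : cells (fun i => grid_flip dt r i @^-1` [set l i]) (k * r) r =
        cells (fun j => (fun w => odd (Nc c.1 c.2 (j.+1%:R * dt) w - Nc c.1 c.2 (j%:R * dt) w))
          @^-1` [set l (k * r + j)%N]) 0 r.
      rewrite -[(k * r)%N]addn0 cells_shift addn0; apply: eq_cells_in => j /=.
      rewrite add0n => jN; have [|j' [_ jE j1 j2]] := @block_index r k (k * r + j).
        by rewrite leq_addr ltn_add2l.
      have {}jE : j = j' by move/eqP: jE; rewrite eqn_add2l => /eqP.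
      by rewrite /grid_flip j1 j2 -jE.
    rewrite (poisson_flips_law nR0 (ppN _ _) (fun j => l (k * r + j)%N) r dt0).
    by rewrite [RHS]prod_iota_shift.
split => //; move: law; rewrite mul1r map_cst_iota => <-.
by apply: eq_Rintegral => w _; rewrite indicE mem_set// mul1r.
Qed.

Variables (h : R) (N : nat).
Hypothesis h0 : 0 < h.

Definition grid_integral (i : nat) (w : Omega) : R :=
  \int[mu]_(x in `](i %% N)%:R * h, (i %% N).+1%:R * h])
    (Y (coord_of i0 (i %/ N)).1 x w (coord_of i0 (i %/ N)).2 0).

Definition grid_riemann (M i : nat) (w : Omega) : R :=
  riemann (fun x => Y (coord_of i0 (i %/ N)).1 x w (coord_of i0 (i %/ N)).2 0)
    ((i %% N)%:R * h) ((i %% N).+1%:R * h) M.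

Lemma noise_right_continuous c l t w : 0 <= t ->
  Y c x w l 0 @[x --> t^'+] --> Y c t w l 0.
Proof.
move=> t0; apply: cvg_near_cst; near=> x.
have tx : t <= x by apply: ltW; near: x; exact: nbhs_right_gt.
rewrite !YN//; last exact: le_trans tx.
congr (_ * _ ^+ _); near: x; exact: (pp_right_continuous (ppN c l)).
Unshelve. all: by end_near. Qed.

Lemma noise_norm c l t w : 0 <= t -> `|Y c t w l 0| = Num.sqrt n%:R.
Proof.
by move=> t0; rewrite YN// normrM normrX normrN1 expr1n mulr1 ger0_norm// sqrtr_ge0.
Qed.

Lemma grid_riemann_cvg i w : grid_riemann M i w @[M --> \oo] --> grid_integral i w.
Proof.
have ih0 : 0 <= (i %% N)%:R * h by rewrite mulr_ge0// ltW.
have ab : (i %% N)%:R * h < (i %% N).+1%:R * h by rewrite ltr_pM2r// ltr_nat.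
have [] := @riemann_cvg _ (fun x => Y (coord_of i0 (i %/ N)).1 x w (coord_of i0 (i %/ N)).2 0)
  (fun=> Num.sqrt n%:R) _ _ ab => //.
- move=> x /andP[ax _]; apply: noise_right_continuous; exact: le_trans (ltW ax).
- by move=> x /andP[ax _]; rewrite noise_norm// (le_trans _ (ltW ax)).
- exact: integrable_cst_oc.
Qed.

Hypothesis N0 : (0 < N)%N.

(** With M steps in each cell, the Riemann sums at right endpoints are exactly the block sums of the
    sampled chain. The sign restarts at 1 for each coordinate because its Poisson process starts at
    0. *)
Lemma grid_riemannE (M : nat) (dt : R) w : (0 < M)%N -> dt = h / M%:R ->
  [seq grid_riemann M i w | i <- iota 0 (D * N)] =
  block_sums (kac_weight n%:R dt) [seq (i %% N == 0)%N | i <- iota 0 (D * N)] M 1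
    [seq grid_flip dt (N * M) j w | j <- iota 0 (D * N * M)].
Proof.
move=> M0 dtE; have MR0 : 0 < M%:R :> R by rewrite ltr0n.
have dt0 : 0 < dt by rewrite dtE divr_gt0.
have hE : h = M%:R * dt by rewrite dtE; field; rewrite gt_eqF.
pose nn i t := Nc (coord_of i0 (i %/ N)).1 (coord_of i0 (i %/ N)).2 t w.
pose sgn i k : R := (-1) ^+ nn i (((i %% N) * M + k)%:R * dt).
have tk (k : nat) : 0 <= k%:R * dt by rewrite mulr_ge0// ltW.
rewrite -[iota 0 (D * N * M)]/(iota (0 * M) (D * N * M)).
rewrite (@block_sums_map _ sgn (fun j => grid_flip dt (N * M) j w)).
- apply: eq_map => i; rewrite /grid_riemann /riemann.
  have -> : ((i %% N).+1%:R * h - (i %% N)%:R * h) / M%:R = dt.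
    by rewrite dtE -natr1; field; rewrite gt_eqF.
  rewrite !mulr_sumr; apply: eq_bigr => k _.
  have -> : (i %% N)%:R * h + k.+1%:R * dt = ((i %% N) * M + k.+1)%:R * dt.
    by rewrite hE natrD natrM; ring.
  by rewrite YN// /kac_weight /sgn /nn; ring.
- by move=> i iN; rewrite /sgn /nn iN mul0n addn0 mul0r (pp_start (ppN _ _)) expr0.
- move=> i; rewrite /sgn /nn modnS divnS//; case: (N %| i.+1)%N => //= _.
  by rewrite add0n addn0 mulSn addnC.
- move=> i k kM; have iE := divn_eq i N.
  have iN : (i %% N < N)%N by rewrite ltn_mod.
  have [|j' [_ jE j1 j2]] := @block_index (N * M) (i %/ N) (i * M + k).
    rewrite {2 3}iE mulnDl mulnA -addnA leq_addr/= ltn_add2l.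
    apply: (@leq_trans ((i %% N).+1 * M)); last by rewrite leq_mul2r iN orbT.
    by rewrite mulSn addnC ltn_add2r.
  have j'E : j' = ((i %% N) * M + k)%N.
    by move: jE; rewrite {1}iE mulnDl mulnA -addnA => /eqP; rewrite eqn_add2l => /eqP.
  rewrite /grid_flip j1 j2 j'E /sgn /nn addnS signr_odd -exprD subnKC//.
  apply: (pp_mono (ppN _ _)); rewrite tk ler_wpM2r ?(ltW dt0)// ler_nat.
  exact: leqnSn.
- by rewrite mod0n.
Qed.

Lemma cvg_seq_sum (I : Type) (s : seq I) (u : I -> nat -> R) (l : I -> R) :
  (forall i, u i @ \oo --> l i) ->
  (fun m => \sum_(i <- s) u i m) @ \oo --> \sum_(i <- s) l i.
Proof.
move=> ul; elim: s => [|i s IH].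
  by rewrite big_nil; under eq_fun do rewrite big_nil; exact: cvg_cst.
by rewrite big_cons; under eq_fun do rewrite big_cons; exact: cvgD.
Qed.

Lemma seq_dist_map (I : Type) (s : seq I) (f g : I -> R) :
  seq_dist [seq f i | i <- s] [seq g i | i <- s] = \sum_(i <- s) `|f i - g i|.
Proof.
elim: s => [|i s IH]; first by rewrite /seq_dist !big_nil.
by rewrite /= seq_dist_cons IH big_cons.
Qed.

(** Here n is fixed and the mesh tends to 0: the Riemann sums converge pathwise, so an estimate
    along arbitrarily fine meshes passes to the integrals. *)
Lemma kac_grid_limit (F : seq R -> R) (L B G kappa : R) : 0 <= L ->
  (forall v, `|F v| <= B) -> seq_lipschitz (D * N) L F ->
  (forall m0, exists M dt, [/\ (m0 <= M)%N, (0 < M)%N, dt = h / M%:R &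
    `|nestE (nseq (D * N * M) (kac_flip n%:R dt)) (fun l => F (block_sums (kac_weight n%:R dt)
      [seq (i %% N == 0)%N | i <- iota 0 (D * N)] M 1 l)) - G| <= kappa]) ->
  measurable_fun setT (fun w => F [seq grid_integral i w | i <- iota 0 (D * N)]) /\
  `|\int[P]_w F [seq grid_integral i w | i <- iota 0 (D * N)] - G| <= kappa.
Proof.
move=> L0 FB FL near_G.
pose Phi (M : nat) dt l := F (block_sums (kac_weight n%:R dt)
      [seq (i %% N == 0)%N | i <- iota 0 (D * N)] M 1 l).
have law (M : nat) : measurable_fun setT (fun w => F [seq grid_riemann M.+1 i w | i <- iota 0 (D * N)]) /\
   \int[P]_w F [seq grid_riemann M.+1 i w | i <- iota 0 (D * N)] =
   nestE (nseq (D * N * M.+1) (kac_flip n%:R (h / M.+1%:R))) (Phi M.+1 (h / M.+1%:R)).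
  have dt0 : 0 < h / M.+1%:R by rewrite divr_gt0.
  have [m e] := @grid_flip_law (h / M.+1%:R) (N * M.+1) (Phi M.+1 (h / M.+1%:R)) B dt0 (fun l => FB _).
  rewrite mulnA in m e.
  split; last first.
    by rewrite -e; apply: eq_Rintegral => w _; rewrite (@grid_riemannE M.+1 (h / M.+1%:R)).
  by apply: eq_measurable_fun m => w _; rewrite /Phi -grid_riemannE.
have Fcvg w : F [seq grid_riemann M.+1 i w | i <- iota 0 (D * N)] @[M --> \oo] -->
    F [seq grid_integral i w | i <- iota 0 (D * N)].
  apply/cvgrPdist_le => e e0.
  have S0 : (fun M => L * \sum_(i <- iota 0 (D * N)) `|grid_integral i w - grid_riemann M.+1 i w|)
      @ \oo --> L * \sum_(i <- iota 0 (D * N)) 0.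
    apply: cvgMl_tmp; apply: cvg_seq_sum => i.
    rewrite -(@normr0 _ R) -(subrr (grid_integral i w)); apply: cvg_norm.
    apply: cvgB; first exact: cvg_cst.
    have H := @cvg_shiftS _ (fun M => grid_riemann M i w) (nbhs (grid_integral i w)).
    exact: (eq_ind_r id (@grid_riemann_cvg i w) H).
  rewrite big1// mulr0 in S0.
  move/cvgrPdist_le: S0 => /(_ e e0); apply: filterS => M.
  rewrite sub0r normrN => h1; apply: le_trans (le_trans (ler_norm _) h1).
  by rewrite -seq_dist_map; apply: FL; rewrite size_map size_iota.
have mlim : measurable_fun setT (fun w => F [seq grid_integral i w | i <- iota 0 (D * N)]).
  apply: (measurable_fun_cvg (h := fun M w => F [seq grid_riemann M.+1 i w | i <- iota 0 (D * N)])).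
    by move=> M; exact: (law M).1.
  by move=> w _; exact: Fcvg.
split => //.
have cvgI := @Rintegral_dominated_cvg _ _ _ P B _ _ (fun M => (law M).1) (fun M w => FB _) Fcvg.
apply/ler_addgt0Pr => e e0.
have /cvgrPdist_le/(_ e e0)[m0 _ near_m0] := cvgI.
have [M [dt [m0M M0 dtE hG]]] := near_G m0.+1.
have ME : M.-1.+1 = M by rewrite prednK.
have := near_m0 M.-1; rewrite /= (law M.-1).2 ME -dtE => h1.
rewrite [leRHS]addrC; apply: (le_trans (ler_distD (nestE (nseq (D * N * M) (kac_flip n%:R dt)) (Phi M dt)) _ _)).
apply: lerD; last exact: hG.
by apply: h1; rewrite -ltnS ME.
Qed.

End kac_grid.

Section kac_grid_clt.
Context {R : realType} {d : nat}.
Context {dO : measure_display} {Omega : measurableType dO}.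
Variables (P : probability Omega R) (W : R -> Omega -> R).
Hypothesis bmW : brownian_motion P W.
Variables (i0 : 'I_d) (h : R) (N : nat).
Hypotheses (h0 : 0 < h) (N0 : (0 < N)%N).
Local Notation D := (#|{: bool * 'I_d}|).

(** The rank n0 is chosen before the probability space, the noises and F. Each of the D N cells is
    allowed the error e / (D N + 1). *)
Lemma kac_grid_near (L B e : R) : 0 < L -> 0 < B -> 0 < e ->
  exists n0 : nat, forall n : nat, (n0 <= n)%N -> (0 < n)%N ->
  forall (dO' : measure_display) (Omega' : measurableType dO') (Q : probability Omega' R)
    (Y : bool -> R -> Omega' -> 'cV[R]_d),
  (forall c, kac_noise Q n (Y c)) -> independent_processes Q (Y true) (Y false) ->
  forall F : seq R -> R, (forall v, `|F v| <= B) -> seq_lipschitz (D * N) L F ->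
  measurable_fun setT (fun w => F [seq grid_integral i0 Y h N i w | i <- iota 0 (D * N)]) /\
  `|\int[Q]_w F [seq grid_integral i0 Y h N i w | i <- iota 0 (D * N)] -
    gaussE (Num.sqrt h) (D * N) F| <= e.
Proof.
move=> L0 B0 e0;
have DN1 : 0 < ((D * N).+1)%:R :> R by rewrite ltr0n.
pose e1 := e / ((D * N).+1)%:R.
have e10 : 0 < e1 by rewrite divr_gt0.
have [K [n0 [K0 clt]]] := kac_clt bmW B0 L0 h0 e10.
exists n0 => n n0n npos dO' Omega' Q Y kY iY F FB FL.
have [m0 cltn] := clt n n0n.
have ex c : exists Nl : 'I_d -> R -> Omega' -> nat,
    (forall l, poisson_process Q n%:R (Nl l)) /\
    (forall l t w, 0 <= t -> Y c t w l 0 = Num.sqrt n%:R * (-1) ^+ Nl l t w).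
  by have [[Nl hN] _] := kY c; exists Nl.
have [Nc hN] := choice ex.
apply: (@kac_grid_limit _ _ _ Q d i0 n Y Nc npos (fun c => (hN c).1) (fun c => (hN c).2)
  (fun c => (kY c).2) iY h N h0 N0 F L B _ _ (ltW L0) FB FL).
move=> m1; pose m := (maxn m0 m1).+1.
exists (K * m)%N, (h / (K * m)%:R); split => //.
- apply: (@leq_trans m); first by rewrite /m leqW// leq_maxr.
  by rewrite leq_pmull.
- by rewrite muln_gt0 K0.
have dt0 : 0 < h / (K * m)%:R by rewrite divr_gt0// ltr0n muln_gt0 K0.
have nR0 : 0 < n%:R :> R by rewrite ltr0n.
have pp : pmass (kac_flip n%:R (h / (K * m)%:R)).
  by apply: flip_mass_pmass; exact: kac_corr_itv.
have m0m : (m0 <= m)%N by rewrite /m leqW// leq_maxl.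
have := @block_exchange _ (kac_flip n%:R (h / (K * m)%:R)) (kac_weight n%:R (h / (K * m)%:R))
  (Num.sqrt h) e1 L B (K * m) [seq (i %% N == 0)%N | i <- iota 0 (D * N)] 1 F pp (ltW L0).
rewrite expr1n size_map size_iota => /(_ erefl) H.
apply: (le_trans (H _ FB FL)).
  by move=> psi x s psiB psiL s2; exact: (cltn m _ m0m erefl psi x s psiB psiL s2).
rewrite /e1 mulrA ler_pdivrMr// mulrC ler_pM2l// ler_nat.
exact: leqnSn.
Qed.

End kac_grid_clt.

(** * Moments of telegraph integrals *)

Section fatou_bound.
Context {dT : measure_display} {T : measurableType dT} {R : realType}.
Variable P : {measure set T -> \bar R}.

Lemma fatou_le (S : nat -> T -> R) (I : T -> R) (c : \bar R) :
  (forall m, measurable_fun setT (S m)) -> (forall m w, 0 <= S m w) ->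
  (forall w, S m w @[m --> \oo] --> I w) ->
  (forall m, (\int[P]_w (S m w)%:E <= c)%E) -> (\int[P]_w (I w)%:E <= c)%E.
Proof.
move=> mS S0 SI Sc.
have mS' m : measurable_fun setT (fun w => (S m w)%:E) by exact/measurable_EFinP.
have := @fatou _ _ _ P setT measurableT (fun m w => (S m w)%:E) mS' (fun m w _ => S0 m w).
have -> : (\int[P]_w limn_einf (fun m => (S m w)%:E) = \int[P]_w (I w)%:E)%E.
  apply: eq_integral => w _.
  have c1 : (S m w)%:E @[m --> \oo] --> (I w)%:E by apply: cvg_EFin; [exact: nearW|exact: SI].
  rewrite is_cvg_limn_einfE; last by apply/cvg_ex; exists (I w)%:E.
  exact: (cvg_lim _ c1).
move=> h; apply: (le_trans h); rewrite limn_einf_lim.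
apply: lime_le; first exact: is_cvg_einfs.
apply: nearW => m; apply: (le_trans _ (Sc m)).
by apply: ereal_inf_lbound; exists m => /=.
Qed.

End fatou_bound.

Section noise_moments.
Context {R : realType} {dO : measure_display} {Omega : measurableType dO}.
Variable P : probability Omega R.
Variables (n : R) (N : R -> Omega -> nat).
Hypotheses (n0 : 0 < n) (ppN : poisson_process P n N).
Local Notation mu := (@lebesgue_measure R).

Lemma chain_sum_map (c sgn : nat -> R) (V : nat -> bool) (i r : nat) :
  (forall j, sgn j.+1 = sgn j * (-1) ^+ V j) ->
  chain_sum (sgn i) [seq c j | j <- iota i r] [seq V j | j <- iota i r] =
  \sum_(j <- iota i r) c j * sgn j.+1.
Proof.
move=> sV; elim: r i => [|r IH] i /=; first by rewrite big_nil.
by rewrite big_cons -sV IH.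
Qed.

Lemma chain_sum_norm_le (s : R) (cs : seq R) (l : seq bool) : s ^+ 2 = 1 ->
  `|chain_sum s cs l| <= \sum_(c <- cs) `|c|.
Proof.
elim: cs s l => [|c cs IH] s [|b l] s2 /=; rewrite ?big_nil ?normr0 ?sumr_ge0//.
rewrite big_cons; apply: (le_trans (ler_normD _ _)); apply: lerD; last first.
  by apply: IH; rewrite exprMn s2 mul1r sqrr_sign.
rewrite normrM normrM normrX normrN1 expr1n mulr1 (_ : `|s| = 1) ?mulr1//.
by apply/eqP; rewrite -(@eqrXn2 _ 2)// expr1n real_normK ?num_real// s2.
Qed.

Let noise t w : R := Num.sqrt n * (-1) ^+ N t w.

Lemma noise_path_continuous t w : 0 <= t -> noise x w @[x --> t^'+] --> noise t w.
Proof.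
move=> t0; apply: cvg_near_cst; near=> x.
rewrite /noise; congr (_ * _ ^+ _); near: x; exact: (pp_right_continuous ppN).
Unshelve. all: by end_near. Qed.

Variables (T : R) (g Psi Psi2 : R -> R).
Hypotheses (T0 : 0 < T) (gr : forall x, 0 < x < T -> g y @[y --> x^'+] --> g x)
  (gPsi : forall x, 0 < x <= T -> `|g x| <= Psi x)
  (Psi_ni : forall x y, 0 < x <= y -> y <= T -> Psi y <= Psi x)
  (iPsi : mu.-integrable `]0, T] (EFin \o Psi))
  (gPsi2 : forall x, 0 < x <= T -> g x ^+ 2 <= Psi2 x)
  (Psi2_ni : forall x y, 0 < x <= y -> y <= T -> Psi2 y <= Psi2 x)
  (iPsi2 : mu.-integrable `]0, T] (EFin \o Psi2)).

Lemma noise_integral_cvg w :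
  mu.-integrable `]0, T] (EFin \o (fun x => g x * noise x w)) /\
  riemann (fun x => g x * noise x w) 0 T m @[m --> \oo] -->
  \int[mu]_(x in `]0, T]) (g x * noise x w).
Proof.
have sn0 : 0 <= Num.sqrt n by rewrite sqrtr_ge0.
apply: (@riemann_cvg _ _ (fun x => Num.sqrt n * Psi x) _ _ T0).
- move=> x /andP[x0 xT]; apply: cvgM; first by apply: gr; rewrite x0.
  by apply: noise_path_continuous; exact: ltW.
- move=> x xT; rewrite normrM mulrC ler_pM// ?gPsi// /noise.
  by rewrite normrM normrX normrN1 expr1n mulr1 ger0_norm.
- by move=> x y xy yT; rewrite ler_wpM2l// Psi_ni.
- have := @integrableZl _ _ _ mu `]0, T]%classic _ (Num.sqrt n) _ iPsi.
  by apply.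
Qed.

Let dt M : R := T / M%:R.

(** The Riemann sum is a chain sum whose energy is the Riemann sum of g^2 on the same grid. *)
Lemma noise_riemann_moment M (k : nat) (r : R) : (0 < M)%N -> 2 * n * dt M <= 1 ->
  0 < r -> riemann (fun x => g x ^+ 2) 0 T M <= r ^+ 2 ->
  measurable_fun setT (fun w => `|riemann (fun x => g x * noise x w) 0 T M| ^+ k) /\
  (\int[P]_w (`|riemann (fun x => g x * noise x w) 0 T M| ^+ k)%:E <=
    (k`!%:R * 2 * expR 1 * (8 * r) ^+ k)%:E)%E.
Proof.
move=> M0 y1 r0 gr2.
have MR0 : 0 < M%:R :> R by rewrite ltr0n.
have dt0 : 0 < dt M by rewrite divr_gt0.
have tk (j : nat) : 0 <= j%:R * dt M by rewrite mulr_ge0// ltW.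
have tS (j : nat) : j%:R * dt M <= j.+1%:R * dt M by rewrite ler_wpM2r ?(ltW dt0)// ler_nat.
pose V j w := odd (N (j.+1%:R * dt M) w - N (j%:R * dt M) w).
pose cs := [seq g (j.+1%:R * dt M) | j <- iota 0 M].
pose Phi l := `|chain_sum 1 [seq kac_weight n (dt M) * c | c <- cs] l| ^+ k.
have sgnS w j : (-1) ^+ N (j.+1%:R * dt M) w = (-1) ^+ N (j%:R * dt M) w * (-1) ^+ V j w :> R.
  rewrite /V signr_odd -exprD subnKC//.
  by apply: (pp_mono ppN); rewrite tk tS.
have dtE : (T - 0) / M%:R = dt M by rewrite subr0.
have SE w : `|riemann (fun x => g x * noise x w) 0 T M| ^+ k = Phi [seq V j w | j <- iota 0 M].
  rewrite /Phi; congr (`|_| ^+ k).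
  rewrite /riemann dtE -(big_mkord xpredT (fun j => g (0 + j.+1%:R * dt M) * noise (0 + j.+1%:R * dt M) w)).
  rewrite /index_iota subn0 mulr_sumr.
  have one : (-1) ^+ N (0%N%:R * dt M) w = 1 :> R by rewrite mul0r (pp_start ppN) expr0.
  have := @chain_sum_map (fun j => kac_weight n (dt M) * g (j.+1%:R * dt M))
    (fun j => (-1) ^+ N (j%:R * dt M) w) (fun j => V j w) 0 M (sgnS w).
  rewrite one /cs -map_comp => ->.
  apply: eq_bigr => j _; rewrite !add0r /noise /kac_weight; ring.
have PhiB l : `|Phi l| <= (\sum_(c <- [seq kac_weight n (dt M) * c | c <- cs]) `|c|) ^+ k.
  rewrite /Phi normrX normr_id lerXn2r ?nnegrE ?sumr_ge0//.
  by apply: chain_sum_norm_le; rewrite expr1n.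
have law (l : nat -> bool) : fine (P (setT `&` cells (fun j => V j @^-1` [set l j]) 0 M)) =
    1 * \prod_(j <- iota 0 M) kac_flip n (dt M) (l j).
  by rewrite setTI mul1r; exact: poisson_flips_law.
have mV j b : measurable (V j @^-1` [set b]) by exact: (measurable_flip ppN).
have [m e] := @nestE_law _ _ _ P _ V false (fun=> kac_flip n (dt M)) M 0 setT 1 _ Phi mV measurableT PhiB law.
have mPhi : measurable_fun setT (fun w => `|riemann (fun x => g x * noise x w) 0 T M| ^+ k).
  by apply: eq_measurable_fun m => w _; rewrite SE.
split => //.
rewrite (@Rintegral_EFin _ _ _ P ((\sum_(c <- [seq kac_weight n (dt M) * c | c <- cs]) `|c|) ^+ k))//; last first.
  by move=> w; rewrite SE.
rewrite lee_fin.
have -> : \int[P]_w `|riemann (fun x => g x * noise x w) 0 T M| ^+ k =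
    nestE (nseq (size cs) (kac_flip n (dt M))) Phi.
  rewrite /cs size_map size_iota -(map_cst_iota (kac_flip n (dt M)) 0 M) -[RHS]mul1r -e.
  by apply: eq_Rintegral => w _; rewrite indicE mem_set// mul1r SE.
apply: kac_moment_le => //; last by rewrite expr1n.
apply: le_trans gr2; rewrite le_eqVlt; apply/orP; left; apply/eqP.
rewrite /energy /riemann dtE /cs big_map.
rewrite -(big_mkord xpredT (fun j => g (0 + j.+1%:R * dt M) ^+ 2)) /index_iota subn0.
by congr (_ * _); apply: eq_bigr => j _; rewrite add0r.
Qed.

(** The strict inequality leaves room for the Riemann sums of g^2 to be at most r^2 on fine grids;
    Fatou's lemma then carries the moment bound to the integral. *)
Lemma noise_integral_moment (k : nat) (r : R) : 0 < r ->
  \int[mu]_(x in `]0, T]) (g x ^+ 2) < r ^+ 2 ->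
  measurable_fun setT (fun w => \int[mu]_(x in `]0, T]) (g x * noise x w)) /\
  (\int[P]_w (`|\int[mu]_(x in `]0, T]) (g x * noise x w)| ^+ k)%:E <=
    (k`!%:R * 2 * expR 1 * (8 * r) ^+ k)%:E)%E.
Proof.
move=> r0 gr2.
have [_ cg2] : mu.-integrable `]0, T] (EFin \o (fun x => g x ^+ 2)) /\
    riemann (fun x => g x ^+ 2) 0 T m @[m --> \oo] --> \int[mu]_(x in `]0, T]) (g x ^+ 2).
  apply: (@riemann_cvg _ _ Psi2 _ _ T0) => //.
  - by move=> x xT; apply: cvgM; exact: gr.
  - by move=> x xT; rewrite ger0_norm ?sqr_ge0// gPsi2.
have [m1 _ near1] : \forall m \near \oo, riemann (fun x => g x ^+ 2) 0 T m <= r ^+ 2.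
  have d0 : 0 < r ^+ 2 - \int[mu]_(x in `]0, T]) (g x ^+ 2) by rewrite subr_gt0.
  have /cvgrPdist_le/(_ _ d0) := cg2; apply: filterS => m.
  by rewrite ler_norml => /andP[h _]; lra.
have [m2 [m20 m2ge]] := exists_nat_ge (2 * n * T).
pose m0 := maxn m1 m2.
have ok M : (m0 <= M)%N -> [/\ (0 < M)%N, 2 * n * dt M <= 1 &
    riemann (fun x => g x ^+ 2) 0 T M <= r ^+ 2].
  move=> mM; have m2M : (m2 <= M)%N by apply: leq_trans mM; rewrite leq_maxr.
  have M0 : (0 < M)%N by exact: leq_trans m2M.
  split => //; last by apply: near1; apply: leq_trans mM; rewrite leq_maxl.
  rewrite /dt mulrA ler_pdivrMr ?ltr0n// mul1r (le_trans m2ge)// ler_nat//.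
pose S m w := riemann (fun x => g x * noise x w) 0 T (m + m0).
have Sok m : (m0 <= m + m0)%N by rewrite leq_addl.
have SI w : S m w @[m --> \oo] --> \int[mu]_(x in `]0, T]) (g x * noise x w).
  have H := @cvg_shiftn m0 _ (fun m => riemann (fun x => g x * noise x w) 0 T m)
    (nbhs (\int[mu]_(x in `]0, T]) (g x * noise x w))).
  exact: (eq_ind_r id (noise_integral_cvg w).2 H).
have mS k' m : measurable_fun setT (fun w => `|S m w| ^+ k').
  by have [M0 y1 h] := ok _ (Sok m); have [] := noise_riemann_moment k' M0 y1 r0 h.
split; last first.
  apply: (@fatou_le _ _ _ P (fun m w => `|S m w| ^+ k)) => //.
  - move=> w; apply: (@continuous_cvg _ _ _ _ _ _ (fun x : R => `|x| ^+ k)) => //.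
    by apply: (@continuous_comp _ _ _ (fun x : R => `|x|) (fun x => x ^+ k));
      [exact: norm_continuous|exact: exprn_continuous].
  - by move=> m; have [M0 y1 h] := ok _ (Sok m); have [] := noise_riemann_moment k M0 y1 r0 h.
apply: (measurable_fun_cvg (h := S)) => //.
move=> m; rewrite /S /riemann.
apply: measurable_funM => //; apply: measurable_sum => j; apply: measurable_funM => //.
apply: measurable_funM => //.
apply: (@measurableT_comp _ _ _ _ _ _ (fun m : nat => (-1) ^+ m : R)) => //.
apply: (pp_measurable ppN); rewrite add0r mulr_ge0// subr0 divr_ge0//; exact: ltW.
Qed.

End noise_moments.

(** * Kernel estimates *)

Section powers.
Context {R : realType}.
Implicit Types (a x y u v : R).
Local Notation mu := (@lebesgue_measure R).

(* Equals x `^ a for 0 < x and 1 for x <= 0, where ln x = 0. *)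
Definition pw a x : R := expR (a * ln x).

Lemma pw_gt0 a x : 0 < pw a x. Proof. exact: expR_gt0. Qed.

Lemma pwD a b x : pw (a + b) x = pw a x * pw b x.
Proof. by rewrite /pw mulrDl expRD. Qed.

Lemma pwX a x (k : nat) : pw a x ^+ k = pw (k%:R * a) x.
Proof. by rewrite /pw -expRM_natl mulrA. Qed.

Lemma pw1 x : 0 < x -> pw 1 x = x.
Proof. by move=> x0; rewrite /pw mul1r lnK. Qed.

Lemma pwN1 x : 0 < x -> pw (-1) x = x^-1.
Proof. by move=> x0; rewrite /pw mulN1r expRN lnK. Qed.

Lemma pw_one a : pw a 1 = 1. Proof. by rewrite /pw ln1 mulr0 expR0. Qed.

Lemma pwM a x y : 0 < x -> 0 < y -> pw a (x * y) = pw a x * pw a y.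
Proof. by move=> x0 y0; rewrite /pw lnM ?posrE// mulrDr expRD. Qed.

Lemma ler_pw a x y : 0 <= a -> 0 < x -> x <= y -> pw a x <= pw a y.
Proof.
move=> a0 x0 xy; rewrite /pw ler_expR ler_wpM2l// ler_ln ?posrE//.
exact: lt_le_trans xy.
Qed.

Lemma ger_pw a x y : a <= 0 -> 0 < x -> x <= y -> pw a y <= pw a x.
Proof.
move=> a0 x0 xy; rewrite /pw ler_expR ler_wnM2l// ler_ln ?posrE//.
exact: lt_le_trans xy.
Qed.

Lemma is_derive_pw a x : 0 < x -> is_derive x 1 (pw a) (a * pw (a - 1) x).
Proof.
move=> x0; have h := is_derive1_ln x0.
have h2 : is_derive (a * ln x) 1 expR (expR (a * ln x)) by exact: is_derive_expR.
have h1 : is_derive x 1 (fun x => a * ln x) (a * x^-1) by exact: is_deriveZ.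
have := @is_derive1_comp _ expR (fun x => a * ln x) x _ _ h2 h1.
rewrite -/(pw a x) -(pwN1 x0) => h3; apply: (is_derive_eq h3).
by rewrite pwD; ring.
Qed.

Lemma continuous_pw a x : 0 < x -> {for x, continuous (pw a)}.
Proof.
move=> x0; apply: differentiable_continuous; apply/derivable1_diffP.
by have [] := is_derive_pw a x0.
Qed.

Lemma integral_pw a u v : a + 1 != 0 -> 0 < u -> u < v ->
  (\int[mu]_(x in `[u, v]) (pw a x)%:E = ((pw (a + 1) v - pw (a + 1) u) / (a + 1))%:E)%E.
Proof.
move=> a1 u0 uv; pose F x := pw (a + 1) x / (a + 1).
have Fd x : 0 < x -> is_derive x 1 F (pw a x).
  move=> x0; have h := is_derive_pw (a + 1) x0.
  rewrite /F; apply: is_derive_eq; rewrite /GRing.scale/= addrK; field.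
  by [].
have Fc x : 0 < x -> {for x, continuous F}.
  move=> x0; apply: differentiable_continuous; apply/derivable1_diffP.
  by have [] := Fd x x0.
have v0 := lt_trans u0 uv.
rewrite (@continuous_FTC2 _ (pw a) F u v uv).
- by rewrite -EFinB /F -mulrBl.
- apply: continuous_in_subspaceT => x; rewrite inE/= in_itv/= => /andP[ux _].
  by apply: continuous_pw; exact: lt_le_trans ux.
- split.
  + move=> x; rewrite in_itv/= => /andP[ux _].
    by have [] := Fd x (lt_trans u0 ux).
  + exact: (cvg_at_right_filter (Fc u u0)).
  + exact: (cvg_at_left_filter (Fc v v0)).
- move=> x; rewrite in_itv/= => /andP[ux _].
  by rewrite derive1E; have [_ ->] := Fd x (lt_trans u0 ux).
Qed.

(** A common majorant for all kernels. With al < 1/2 < b it is square integrable on the half-line;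
    it is also nonincreasing, as the Riemann sums require. *)
Definition envelope (al b x : R) : R := if x <= 1 then pw (- al) x else pw (- b) x.

Variables (al b : R).
Hypotheses (al0 : 0 < al < 2^-1) (b1 : 2^-1 < b).

Lemma envelope_gt0 x : 0 < envelope al b x.
Proof. by rewrite /envelope; case: ifP => _; exact: pw_gt0. Qed.

Lemma envelope_ni x y : 0 < x <= y -> envelope al b y <= envelope al b x.
Proof.
move=> /andP[x0 xy]; rewrite /envelope.
have /andP[a0 a1] := al0; have b0 : 0 < b by apply: lt_trans b1; rewrite invr_gt0.
have [y1|y1] := leP y 1.
  by rewrite (le_trans xy y1) ger_pw// oppr_le0 ltW.
have [x1|x1] := leP x 1; last by rewrite ger_pw// oppr_le0 ltW.
apply: (@le_trans _ _ 1).
  by rewrite -(pw_one (- b)) ger_pw ?oppr_le0// ltW.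
by rewrite -(pw_one (- al)) ger_pw ?oppr_le0// ltW.
Qed.

Let envelope_pieces x : 0 < x ->
  ((envelope al b x ^+ 2)%:E <= (pw (2 * - al) x * \1_(`]0%R, 1%R]%classic) x)%:E +
   (pw (2 * - b) x * \1_(`[1%R, +oo[%classic) x)%:E)%E.
Proof.
move=> x0; rewrite -EFinD lee_fin /envelope; have [x1|x1] := leP x 1.
  rewrite [\1_ _ x]indicE mem_set/= ?in_itv/= ?x0// mulr1 pwX lerDl mulr_ge0//.
  by rewrite ltW// pw_gt0.
have -> : \1_(`[1%R, +oo[%classic) x = 1 :> R.
  by rewrite indicE mem_set//= in_itv/= (ltW x1).
rewrite mulr1 pwX lerDr mulr_ge0//.
by rewrite ltW// pw_gt0.
Qed.

Let measurable_pw a : measurable_fun setT (pw a).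
Proof.
apply: (@measurableT_comp _ _ _ _ _ _ expR _ (fun x => a * ln x)).
  exact: measurable_expR.
by apply: measurable_funM.
Qed.

Lemma measurable_envelope : measurable_fun setT (envelope al b).
Proof.
apply: measurable_fun_if => //; last 2 first.
- by apply: measurable_funTS; exact: measurable_pw.
- by apply: measurable_funTS; exact: measurable_pw.
by apply: measurable_fun_ler.
Qed.

(** The two powers are integrated explicitly on segments away from 0 and infinity, and Fatou's lemma
    removes the truncation. *)
Lemma envelope_sqr_integral : exists C : R,
  (\int[mu]_(x in `]0%R, +oo[) (envelope al b x ^+ 2)%:E <= C%:E)%E.
Proof.
have /andP[a0 a1] := al0.
have lo : (\int[mu]_x (pw (2 * - al) x * \1_(`]0%R, 1%R]%classic) x)%:E <= ((2 * - al + 1)^-1)%:E)%E.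
  have e0 : 0 < 2 * - al + 1 by lra.
  pose u (m : nat) : R := m.+2%:R^-1.
  have u0 m : 0 < u m by rewrite invr_gt0.
  have u1 m : u m < 1 by rewrite invf_lt1// ltr1n.
  apply: (@fatou_le _ _ _ mu (fun m x => pw (2 * - al) x * \1_(`[u m, 1]%classic) x)).
  - by move=> m; apply: measurable_funM; [exact: measurable_pw|exact: measurable_indic].
  - by move=> m x; rewrite mulr_ge0// ltW// pw_gt0.
  - move=> x; apply: cvgMl_tmp; apply: cvg_near_cst.
    have [x0|x0] := leP x 0.
      apply: nearW => m; rewrite !indicE !memNset//= in_itv/=; first by rewrite ltNge x0.
      by rewrite leNgt (le_lt_trans x0 (u0 m)).
    have [N [N0 Nx]] := exists_nat_ge x^-1.
    exists N => // m /= Nm; rewrite !indicE; apply: (congr1 (fun b : bool => b%:R : R)).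
    have ux : u m <= x.
      rewrite /u -[x]invrK lef_pV2 ?posrE ?invr_gt0//.
      by apply: (le_trans Nx); rewrite ler_nat (leq_trans Nm)// leqW.
    by apply/idP/idP; rewrite !inE/= !in_itv/= x0 => /andP[_ ->]; rewrite ?ux.
  - move=> m.
    have -> : (\int[mu]_x (pw (2 * - al) x * \1_(`[u m, 1]%classic) x)%:E =
        \int[mu]_(x in `[u m, 1%R]) (pw (2 * - al) x)%:E)%E.
      rewrite [RHS]integral_mkcond; apply: eq_integral => x _.
      by rewrite patchE indicE; case: ifP => _; rewrite ?mulr1 ?mulr0.
    rewrite integral_pw// ?gt_eqF// pw_one lee_fin ler_pdivrMr// mulVf ?gt_eqF//.
    by rewrite lerBlDr lerDl ltW// pw_gt0.
have hi : (\int[mu]_x (pw (2 * - b) x * \1_(`[1%R, +oo[%classic) x)%:E <= ((2 * b - 1)^-1)%:E)%E.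
  have e0 : 0 < 2 * b - 1 by have := b1; lra.
  apply: (@fatou_le _ _ _ mu (fun m x => pw (2 * - b) x * \1_(`[1, m.+2%:R]%classic) x)).
  - by move=> m; apply: measurable_funM; [exact: measurable_pw|exact: measurable_indic].
  - by move=> m x; rewrite mulr_ge0// ltW// pw_gt0.
  - move=> x; apply: cvgMl_tmp; apply: cvg_near_cst.
    have [N [N0 Nx]] := exists_nat_ge x.
    exists N => // m /= Nm; rewrite !indicE; apply: (congr1 (fun b : bool => b%:R : R)).
    have xm : x <= m.+2%:R by apply: (le_trans Nx); rewrite ler_nat (leq_trans Nm)// leqW.
    by apply/idP/idP; rewrite !inE/= !in_itv/= xm andbT.
  - move=> m.
    have -> : (\int[mu]_x (pw (2 * - b) x * \1_(`[1, m.+2%:R]%classic) x)%:E =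
        \int[mu]_(x in `[1%R, m.+2%:R]) (pw (2 * - b) x)%:E)%E.
      rewrite [RHS]integral_mkcond; apply: eq_integral => x _.
      by rewrite patchE indicE; case: ifP => _; rewrite ?mulr1 ?mulr0.
    have e1 : 2 * - b + 1 < 0 by lra.
    rewrite integral_pw ?ltr1n ?lt_eqF// pw_one lee_fin.
    have -> : 2 * - b + 1 = - (2 * b - 1) by ring.
    rewrite invrN mulrN -mulNr opprB ler_pdivrMr// mulVf ?gt_eqF//.
    by rewrite lerBlDr lerDl ltW// pw_gt0.
exists ((2 * - al + 1)^-1 + (2 * b - 1)^-1).
rewrite EFinD; apply: (le_trans _ (leeD lo hi)).
rewrite -ge0_integralD//; last 4 first.
- by move=> x _; rewrite lee_fin mulr_ge0// ltW// pw_gt0.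
- by apply/measurable_EFinP; apply: measurable_funM; [exact: measurable_pw|exact: measurable_indic].
- by move=> x _; rewrite lee_fin mulr_ge0// ltW// pw_gt0.
- by apply/measurable_EFinP; apply: measurable_funM; [exact: measurable_pw|exact: measurable_indic].
rewrite [X in (X <= _)%E]integral_mkcond.
apply: (@ge0_le_integral _ _ _ mu) => //.
- by move=> x _; rewrite patchE; case: ifP => // _; rewrite lee_fin sqr_ge0.
- apply/(measurable_restrictT _ _).1 => //; apply: measurable_funTS; apply/measurable_EFinP.
  by apply: measurable_funX; exact: measurable_envelope.
- by apply: emeasurable_funD; apply/measurable_EFinP; apply: measurable_funM;
    [exact: measurable_pw|exact: measurable_indic|exact: measurable_pw|exact: measurable_indic].
- move=> x _; rewrite patchE; case: ifP => [|_].
    by rewrite inE/= in_itv/= andbT; exact: envelope_pieces.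
  by rewrite -EFinD lee_fin addr_ge0// mulr_ge0// ltW// pw_gt0.
Qed.

Lemma envelope_integrable (T : R) :
  mu.-integrable `]0, T] (EFin \o (fun x => envelope al b x ^+ 2)) /\
  mu.-integrable `]0, T] (EFin \o envelope al b).
Proof.
have [C hC] := envelope_sqr_integral.
have i2 : mu.-integrable `]0, T] (EFin \o (fun x => envelope al b x ^+ 2)).
  apply/integrableP; split.
    apply/measurable_EFinP; apply: measurable_funTS.
    by apply: measurable_funX; exact: measurable_envelope.
  apply: (@le_lt_trans _ _ C%:E); last by rewrite ltry.
  apply: le_trans hC.
  have -> : (\int[mu]_(x in `]0%R, T]) `|(EFin \o (fun x => envelope al b x ^+ 2)%R) x| =
      \int[mu]_(x in `]0%R, T]) (envelope al b x ^+ 2)%:E)%E.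
    by apply: eq_integral => x _ /=; rewrite ger0_norm// sqr_ge0.
  apply: ge0_subset_integral => //.
  - apply/measurable_EFinP; apply: measurable_funTS.
    by apply: measurable_funX; exact: measurable_envelope.
  - by move=> x _; rewrite lee_fin sqr_ge0.
  - by move=> x /=; rewrite !in_itv/= andbT => /andP[].
split => //.
have i1 := @integrable_cst_oc _ 0 T 1.
have := @integrableD _ _ _ mu `]0, T]%classic (measurable_itv _) _ _ i1 i2.
apply: le_integrable => //.
  by apply/measurable_EFinP; apply: measurable_funTS; exact: measurable_envelope.
move=> x _; change ((`|envelope al b x|)%:E <= (`|1 + envelope al b x ^+ 2|)%:E)%E.
rewrite lee_fin ger0_norm ?(ltW (envelope_gt0 _))//.
by apply: le_trans (ler_norm _); nra.
Qed.

End powers.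

Section kernel_estimates.
Context {R : realType} {d : nat}.
Variables (D A1 A2 : 'M[R]_d).
Hypotheses (hD0 : 0 < lambda_min D) (hD1 : lambda_max D < 1).

Definition ofbm_kernel (c : bool) (t x : R) : 'M[R]_d := if c then G1 D A1 A2 x t else G2 D A1 A2 x t.

Lemma kernel_mul_bound : exists C al ka : R,
  [/\ 0 < C, 0 < al < 2^-1, 0 < ka < 2^-1,
     (forall x, 0 < x -> x <= 1 -> forall i l,
       `|(kernel_pow D x *m A1) i l| <= C * pw (- al) x /\
       `|(kernel_pow D x *m A2) i l| <= C * pw (- al) x) &
     (forall x, 1 <= x -> forall i l,
       `|(kernel_pow D x *m A1) i l| <= C * pw (2^-1 - ka) x /\
       `|(kernel_pow D x *m A2) i l| <= C * pw (2^-1 - ka) x)].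
Proof.
have [K [al [ka [K0 al0 ka0 lo hi]]]] := kernel_pow_bound hD0 hD1.
pose C := K * (d%:R * (`|A1| + `|A2|)) + 1.
have C0 : 0 <= K * (d%:R * (`|A1| + `|A2|)) by rewrite !mulr_ge0// addr_ge0.
have bnd (A : 'M[R]_d) x e i l : `|A| <= `|A1| + `|A2| -> 0 <= e ->
    (forall i j, `|kernel_pow D x i j| <= K * e) -> `|(kernel_pow D x *m A) i l| <= C * e.
  move=> hA e0 h; rewrite mxE; apply: (le_trans (ler_norm_sum _ _ _)).
  apply: (@le_trans _ _ (\sum_(k < d) (K * e) * (`|A1| + `|A2|))).
    apply: ler_sum => k _; rewrite normrM ler_pM//.
    exact: le_trans (mx_entry_le _ _ _) hA.
  rewrite sumr_const card_ord -mulr_natl.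
  have -> : d%:R * (K * e * (`|A1| + `|A2|)) = K * (d%:R * (`|A1| + `|A2|)) * e by ring.
  by rewrite ler_wpM2r// /C lerDl.
have h1 : `|A1| <= `|A1| + `|A2| by rewrite lerDl.
have h2 : `|A2| <= `|A1| + `|A2| by rewrite lerDr.
exists C, al, ka; split => //; first by rewrite /C ltr_wpDl.
- move=> x x0 x1 i l; split; apply: bnd => //; rewrite ?(ltW (pw_gt0 _ _))//; move=> i' j'; exact: lo.
- move=> x x1 i l; split; apply: bnd => //; rewrite ?(ltW (pw_gt0 _ _))//; move=> i' j'; exact: hi.
Qed.

Lemma sin_lipschitz (u v : R) : `|sin u - sin v| <= `|u - v|.
Proof.
rewrite -[leRHS]mul1r; apply: (@derive_bounded_lipschitz _ sin cos 1) => x.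
by rewrite ler_norml cos_geN1 cos_le1.
Qed.

Lemma cos_lipschitz (u v : R) : `|cos u - cos v| <= `|u - v|.
Proof.
rewrite -[leRHS]mul1r; apply: (@derive_bounded_lipschitz _ cos (fun x => - sin x) 1) => x.
by rewrite normrN ler_norml sin_geN1 sin_le1.
Qed.

Lemma oscillation_bound (f : R -> R) (s t x : R) : 0 < x ->
  (forall u v, `|f u - f v| <= `|u - v|) -> (forall u, `|f u| <= 1) ->
  `|(f (t * x) - f (s * x)) / x| <= Num.min `|t - s| (2 / x).
Proof.
move=> x0 fL f1; rewrite normrM (gtr0_norm (_ : 0 < x^-1)) ?invr_gt0//.
rewrite le_min; apply/andP; split.
  rewrite ler_pdivrMr// (le_trans (fL _ _))// -mulrBl normrM (gtr0_norm x0)//.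
rewrite ler_wpM2r ?invr_ge0 ?(ltW x0)//.
by apply: (le_trans (ler_normB _ _)); have := lerD (f1 (t * x)) (f1 (s * x)).
Qed.

Lemma kernel_difference (c : bool) (s t x : R) (i l : 'I_d) : exists u v w z : R,
  [/\ ofbm_kernel c t x i l - ofbm_kernel c s x i l = u * w + v * z,
      `|u| = `|(sin (t * x) - sin (s * x)) / x|,
      `|v| = `|(cos (t * x) - cos (s * x)) / x|,
      w = (kernel_pow D x *m (if c then A1 else A2)) i l &
      z = (kernel_pow D x *m (if c then A2 else A1)) i l].
Proof.
case: c; rewrite /ofbm_kernel.
  exists ((sin (t * x) - sin (s * x)) / x), ((cos (t * x) - cos (s * x)) / x).
  do 2 eexists; split; [|by []..|reflexivity|reflexivity].
  rewrite /G1 !mxE; ring.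
exists ((sin (t * x) - sin (s * x)) / x), (- ((cos (t * x) - cos (s * x)) / x)).
do 2 eexists; split; [|by []|by rewrite normrN|reflexivity|reflexivity].
by rewrite /G2 !mxE; ring.
Qed.

(** With H = 1 / q and tau = |t - s|, the oscillation factor min(tau, 2 / x) is at most tau^H (2 /
    x)^(1 - H). At infinity this leaves the power - (1/2 + ka - H) of x, square integrable because H
    < ka; for x <= 1 the bound tau <= tau^H suffices. *)
Lemma kernel_holder : exists (C al b : R) (q : nat),
  [/\ 0 < C, 0 < al < 2^-1, 2^-1 < b, (0 < q)%N &
    forall c s t x i l, 0 <= s <= 1 -> 0 <= t <= 1 -> s != t -> 0 < x ->
      `|ofbm_kernel c t x i l - ofbm_kernel c s x i l| <= C * pw (q%:R^-1) `|t - s| * envelope al b x].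
Proof.
have [C [al [ka [C0 al0 ka0 lo hi]]]] := kernel_mul_bound.
have /andP[ka1 ka2] := ka0.
(* The exponent is the inverse of an integer, so that an integer moment can later turn it into the
   power 2; the factor 2 makes H < ka strict. *)
have [q [q0 qge]] := exists_nat_ge (2 / ka).
have qR0 : 0 < q%:R :> R by rewrite ltr0n.
pose H : R := q%:R^-1.
have H0 : 0 < H by rewrite invr_gt0.
have Hka : H < ka.
  rewrite /H invf_plt ?posrE//; apply: (lt_le_trans _ qge).
  by rewrite -[X in X < _]mul1r ltr_pM2r ?invr_gt0// ltr1n.
exists (4 * C), al, (2^-1 + ka - H), q; split => //.
- by rewrite mulr_gt0.
- by lra.
move=> c s t x i l /andP[s0 s1] /andP[t0 t1] st x0.
pose tau := `|t - s|; have tau0 : 0 < tau by rewrite normr_gt0 subr_eq0 eq_sym.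
have tau1 : tau <= 1 by rewrite /tau ler_norml; apply/andP; split; lra.
have [u [v [w [z [-> uE vE wE zE]]]]] := kernel_difference c s t x i l.
have hu := oscillation_bound s t x0 sin_lipschitz (fun u => _ : `|sin u| <= 1).
have {}hu : `|u| <= Num.min tau (2 / x).
  by rewrite uE; apply: hu => y; rewrite ler_norml sin_geN1 sin_le1.
have hv : `|v| <= Num.min tau (2 / x).
  rewrite vE; apply: oscillation_bound => // [|y]; first exact: cos_lipschitz.
  by rewrite ler_norml cos_geN1 cos_le1.
have m0 : 0 < Num.min tau (2 / x) by rewrite lt_min tau0 divr_gt0.
suff main K e : 0 <= K -> 0 <= e -> Num.min tau (2 / x) * K <= 2 * pw H tau * e ->
    `|w| <= C * K -> `|z| <= C * K ->
    `|u * w + v * z| <= 4 * C * pw H tau * e.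
  rewrite /envelope; case: ifPn => [x1|]; last rewrite -ltNge => x1.
    have [la1 la2] := lo x x0 x1 i l.
    apply: (main (pw (- al) x)); rewrite ?(ltW (pw_gt0 _ _))//.
    - rewrite ler_wpM2r ?(ltW (pw_gt0 _ _))//.
      apply: (@le_trans _ _ tau); first by rewrite ge_min lexx.
      rewrite -[X in X <= _](pw1 tau0).
      apply: (@le_trans _ _ (pw H tau)).
        rewrite /pw ler_expR ler_wnM2r ?ln_le0//; lra.
      by rewrite ler_peMl ?(ltW (pw_gt0 _ _))// ler1n.
    - by rewrite wE; case: (c).
    - by rewrite zE; case: (c).
  have [la1 la2] := hi x (ltW x1) i l.
  apply: (main (pw (2^-1 - ka) x)); rewrite ?(ltW (pw_gt0 _ _))//.
  - have mE : Num.min tau (2 / x) = pw H (Num.min tau (2 / x)) * pw (1 - H) (Num.min tau (2 / x)).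
      by rewrite -pwD (_ : H + (1 - H) = 1) ?pw1//; ring.
    have p1 : pw H (Num.min tau (2 / x)) <= pw H tau.
      by apply: ler_pw => //; [exact: ltW|rewrite ge_min lexx].
    have p2 : pw (1 - H) (Num.min tau (2 / x)) <= 2 * pw (- (1 - H)) x.
      apply: (@le_trans _ _ (pw (1 - H) (2 / x))).
        by apply: ler_pw => //; [lra|rewrite ge_min lexx orbT].
      rewrite pwM ?invr_gt0//; apply: ler_pM; rewrite ?(ltW (pw_gt0 _ _))//.
        rewrite -[leRHS]pw1// /pw ler_expR ler_wpM2r ?ln_ge0 ?ler1n//; lra.
      by rewrite /pw lnV ?posrE// mulrN mulNr.
    rewrite [X in X * _]mE.
    apply: (@le_trans _ _ (pw H tau * (2 * pw (- (1 - H)) x) * pw (2^-1 - ka) x)).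
      rewrite ler_wpM2r ?(ltW (pw_gt0 _ _))//.
      by apply: ler_pM; rewrite ?(ltW (pw_gt0 _ _)).
    have -> : - (2^-1 + ka - H) = - (1 - H) + (2^-1 - ka) by field.
    by rewrite [pw (- (1 - H) + _) x]pwD le_eqVlt; apply/orP; left; apply/eqP; ring.
  - by rewrite wE; case: (c).
  - by rewrite zE; case: (c).
move=> K0 e0 hK hw hz.
apply: (le_trans (ler_normD _ _)); rewrite !normrM.
have hh : Num.min tau (2 / x) * (C * K) <= 2 * C * pw H tau * e.
  have -> : Num.min tau (2 / x) * (C * K) = C * (Num.min tau (2 / x) * K) by ring.
  have -> : 2 * C * pw H tau * e = C * (2 * pw H tau * e) by ring.
  by rewrite ler_wpM2l// ltW.
have -> : 4 * C * pw H tau * e = 2 * C * pw H tau * e + 2 * C * pw H tau * e by ring.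
apply: lerD; apply: le_trans hh; exact: ler_pM.
Qed.

Lemma kernel_at0 c x : ofbm_kernel c 0 x = 0.
Proof.
apply/matrixP => i l; rewrite /ofbm_kernel; case: c; rewrite ?/G1 ?/G2 !mxE mul0r sin0 cos0; ring.
Qed.

Lemma continuous_kernel c t x i l : 0 < x -> {for x, continuous (fun x => ofbm_kernel c t x i l)}.
Proof.
move=> x0.
have ck (A : 'M[R]_d) : {for x, continuous (fun x => (kernel_pow D x *m A) i l)}.
  rewrite (_ : (fun x => _) = (fun x => expmx_entry (- (D - (2^-1)%:M)) A i l (ln x))); last first.
    by apply/funext => y; rewrite /kernel_pow /mxpowR expmx_mul_entryE.
  apply: continuous_comp; first exact: continuous_ln.
  exact: continuous_expmx_entry.
have cx : {for x, continuous (fun x : R => x^-1)}.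
  by apply: inv_continuous; rewrite gt_eqF.
have ctx : {for x, continuous (fun x : R => t * x)}.
  by apply: mulrl_continuous.
have cs : {for x, continuous (fun x : R => sin (t * x))}.
  by apply: continuous_comp => //; exact: continuous_sin.
have cc : {for x, continuous (fun x : R => cos (t * x))}.
  by apply: continuous_comp => //; exact: continuous_cos.
have k1 : {for x, continuous (fun x : R => (1 : R))} by exact: cst_continuous.
have c1 := continuousM cs cx; have c2 := continuousM (continuousB cc k1) cx.
have c3 := continuousM (continuousB k1 cc) cx.
case: c; rewrite /ofbm_kernel.
  rewrite (_ : (fun x => _) = fun x => sin (t * x) / x * (kernel_pow D x *m A1) i l +
    (cos (t * x) - 1) / x * (kernel_pow D x *m A2) i l); last first.
    by apply/funext => y; rewrite /G1 !mxE.
  exact: (continuousD (continuousM c1 (ck A1)) (continuousM c2 (ck A2))).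
rewrite (_ : (fun x => _) = fun x => sin (t * x) / x * (kernel_pow D x *m A2) i l +
  (1 - cos (t * x)) / x * (kernel_pow D x *m A1) i l); last first.
  by apply/funext => y; rewrite /G2 !mxE.
exact: (continuousD (continuousM c1 (ck A2)) (continuousM c3 (ck A1))).
Qed.

End kernel_estimates.

(** * Step approximation in mean square *)

Section measurable_vectors.
Context {R : realType} {dO : measure_display} {Omega : measurableType dO}.

Lemma measurable_mx_norm (m n : nat) (A : set Omega) (f : Omega -> 'M[R]_(m, n)) :
  (forall i j, measurable_fun A (fun w => f w i j)) ->
  measurable_fun A (fun w => `|f w|).
Proof.
move=> mf; rewrite (_ : (fun w => _) = fun w => \big[Num.max/0]_ij `|f w ij.1 ij.2|); last first.
  by apply/funext => w; rewrite [LHS]mx_normrE.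
elim: (index_enum _) => [|ij s IH].
  by under eq_fun do rewrite big_nil; exact: measurable_cst.
under eq_fun do rewrite big_cons; apply: measurable_maxr => //.
exact: measurableT_comp.
Qed.

Lemma mx_normX_le_sum (n : nat) (v : 'cV[R]_n) (p : nat) : (0 < p)%N ->
  `|v| ^+ p <= \sum_(i < n) `|v i 0| ^+ p.
Proof.
move=> p0; have -> : `|v| = \big[Num.max/0]_ij `|v ij.1 ij.2| by rewrite [LHS]mx_normrE.
elim/big_ind : _ => [|x y hx hy|[i j] _ /=].
- by rewrite expr0n gtn_eqF// sumr_ge0// => i _; rewrite exprn_ge0.
- by rewrite /Num.max; case: ifP.
- by rewrite ord1 (bigD1 i)//= lerDl sumr_ge0// => k _; rewrite exprn_ge0.
Qed.

Lemma normD_expn_le (x y : R) (p : nat) : `|x + y| ^+ p <= 2 ^+ p * (`|x| ^+ p + `|y| ^+ p).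
Proof.
wlog xy : x y / `|x| <= `|y|.
  move=> H; have [/H//|/ltW/H] := leP `|x| `|y|.
  by rewrite addrC [X in _ <= _ * X]addrC.
apply: (@le_trans _ _ ((2 * `|y|) ^+ p)).
  by rewrite lerXn2r ?nnegrE ?mulr_ge0// (le_trans (ler_normD _ _))// mulr_natl mulr2n lerD2r.
by rewrite exprMn ler_wpM2l ?exprn_ge0// lerDr exprn_ge0.
Qed.

Lemma norm_sum_expn_le (I : eqType) (s : seq I) (x : I -> R) (p : nat) : (0 < p)%N ->
  `|\sum_(i <- s) x i| ^+ p <= (size s)%:R ^+ p * \sum_(i <- s) `|x i| ^+ p.
Proof.
move=> p0; have [s0|s0] := eqVneq s [::].
  by rewrite s0 !big_nil normr0 expr0n gtn_eqF// mulr0.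
have [i0 i0s i0max] : exists2 i0, i0 \in s & forall i, i \in s -> `|x i| <= `|x i0|.
  elim: s s0 => // a s IH _; have [s0|s0] := eqVneq s [::].
    by exists a => [|i]; rewrite s0 ?mem_seq1// => /eqP->.
  have [j js jmax] := IH s0; have [aj|ja] := leP `|x a| `|x j|.
    exists j => [|i]; first by rewrite in_cons js orbT.
    by rewrite in_cons => /predU1P[->//|/jmax].
  exists a => [|i]; first by rewrite in_cons eqxx.
  by rewrite in_cons => /predU1P[->//|/jmax h]; exact: le_trans h (ltW ja).
apply: (@le_trans _ _ (((size s)%:R * `|x i0|) ^+ p)).
  rewrite lerXn2r ?nnegrE ?mulr_ge0//; apply: (le_trans (ler_norm_sum _ _ _)).
  rewrite big_seq; apply: (@le_trans _ _ (\sum_(i <- s | i \in s) `|x i0|)); first exact: ler_sum.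
  by rewrite -big_seq big_const_seq count_predT iter_addr_0 mulr_natl.
rewrite exprMn ler_wpM2l ?exprn_ge0//.
elim: s i0s {s0 i0max} => // a s IH; rewrite in_cons big_cons => /predU1P[->|/IH h].
  by rewrite lerDl sumr_ge0// => i _; rewrite exprn_ge0.
by apply: (le_trans h); rewrite lerDr exprn_ge0.
Qed.

Variable P : probability Omega R.

Lemma ge0_integral_sumr (I : Type) (s : seq I) (f : I -> Omega -> R) :
  (forall i, measurable_fun setT (f i)) -> (forall i w, 0 <= f i w) ->
  (\int[P]_w (\sum_(i <- s) f i w)%:E = \sum_(i <- s) \int[P]_w (f i w)%:E)%E.
Proof.
move=> mf f0; rewrite -ge0_integral_sum//.
- by apply: eq_integral => w _; rewrite sumEFin.
- by move=> i; exact/measurable_EFinP.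
- by move=> i w _; rewrite lee_fin.
Qed.

Lemma ge0_integralZlr (c : R) (f : Omega -> R) : 0 <= c ->
  measurable_fun setT f -> (forall w, 0 <= f w) ->
  (\int[P]_w (c * f w)%:E = c%:E * \int[P]_w (f w)%:E)%E.
Proof.
move=> c0 mf f0; rewrite -ge0_integralZl//.
- exact/measurable_EFinP.
- by move=> w _; rewrite lee_fin.
Qed.

Lemma ge0_le_integralr (f g : Omega -> R) : measurable_fun setT f -> measurable_fun setT g ->
  (forall w, 0 <= f w <= g w) -> (\int[P]_w (f w)%:E <= \int[P]_w (g w)%:E)%E.
Proof.
move=> mf mg fg; apply: ge0_le_integral => //.
- by move=> w _; rewrite lee_fin; case/andP: (fg w).
- exact/measurable_EFinP.
- exact/measurable_EFinP.
- by move=> w _; rewrite lee_fin; case/andP: (fg w).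
Qed.

(* Truncation makes the p-th power Lipschitz, so that its expectation passes to
   L2 limits. *)
Lemma L2_moment_le (Z : Omega -> R) (p : nat) (c : \bar R) :
  measurable_fun setT Z ->
  (forall e, 0 < e -> exists Z' : Omega -> R, [/\ measurable_fun setT Z',
    (\int[P]_w (`|Z w - Z' w| ^+ 2)%:E <= (e ^+ 2)%:E)%E &
    (\int[P]_w (`|Z' w| ^+ p)%:E <= c)%E]) ->
  (\int[P]_w (`|Z w| ^+ p)%:E <= c)%E.
Proof.
move=> mZ approx.
pose tr (A z : R) := Num.min `|z| A ^+ p.
have trB A z : 0 <= A -> `|tr A z| <= A ^+ p.
  move=> A0; rewrite /tr ger0_norm ?exprn_ge0 ?le_min ?normr_ge0//.
  by rewrite lerXn2r ?nnegrE ?le_min ?normr_ge0// ge_min lexx orbT.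
have tr_le A z : 0 <= A -> tr A z <= `|z| ^+ p.
  by move=> A0; rewrite /tr lerXn2r ?nnegrE ?le_min ?normr_ge0// ge_min lexx.
have mtr A f : measurable_fun setT f -> measurable_fun setT (fun w : Omega => tr A (f w)).
  move=> mf; apply: measurable_funX; apply: measurable_minr => //.
  exact: measurableT_comp.
have trL A : 0 < A -> exists2 L, 0 <= L & forall z z', `|tr A z - tr A z'| <= L * `|z - z'|.
  move=> A0; exists (\sum_(i < p) A ^+ (p.-1 - i) * A ^+ i).
    by apply: sumr_ge0 => i _; rewrite mulr_ge0// exprn_ge0// ltW.
  move=> z z'; rewrite /tr.
  have mA (u : R) : 0 <= Num.min `|u| A <= A.
    by rewrite le_min normr_ge0 (ltW A0) ge_min lexx orbT.
  have /andP[a0 a1] := mA z; have /andP[b0 b1] := mA z'.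
  have ab : `|Num.min `|z| A - Num.min `|z'| A| <= `|z - z'|.
    have := ler_dist_dist z z'; rewrite ler_norml => /andP[h1 h2].
    have p0 := normr_ge0 z; have q0 := normr_ge0 z'.
    by rewrite ler_norml /Num.min; case: ltP => h3; case: ltP => h4; apply/andP; split; lra.
  move: (Num.min `|z| A) (Num.min `|z'| A) a0 a1 b0 b1 ab => a b a0 a1 b0 b1 ab.
  rewrite subrXX normrM mulrC ler_pM//.
  apply: (le_trans (ler_norm_sum _ _ _)); apply: ler_sum => i _.
  rewrite normrM !normrX (ger0_norm a0) (ger0_norm b0).
  by rewrite ler_pM ?exprn_ge0// lerXn2r ?nnegrE// (le_trans a0).
have step (m : nat) : (\int[P]_w (tr m.+1%:R (Z w))%:E <= c)%E.
  have A0 : 0 < m.+1%:R :> R by [].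
  have [L L0 hL] := trL _ A0.
  have EE (f : Omega -> R) : measurable_fun setT f ->
      (\int[P]_w (tr m.+1%:R (f w))%:E = (\int[P]_w (tr m.+1%:R (f w)))%:E)%E.
    move=> mf; apply: (@Rintegral_EFin _ _ _ P (m.+1%:R ^+ p)); first exact: mtr.
    by move=> w; apply: trB; exact: ltW.
  rewrite EE//; apply/lee_addgt0Pr => e e0.
  have e10 : 0 < e / (L + 1) by rewrite divr_gt0// ltr_wpDl.
  have [Z' [mZ' dZ cZ]] := approx _ e10.
  have h := @Rintegral_dist_L2 _ _ _ P (m.+1%:R ^+ p) (m.+1%:R ^+ p) L _ (fun w => tr m.+1%:R (Z w))
    (fun w => tr m.+1%:R (Z' w)) (fun w => Z w - Z' w) e10 L0 (mtr _ _ mZ)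
    (fun w => trB _ _ (ltW A0)) (mtr _ _ mZ') (fun w => trB _ _ (ltW A0)) (measurable_funB mZ mZ')
    (fun w => hL _ _) dZ.
  have hc : (\int[P]_w (tr m.+1%:R (Z' w))%:E <= c)%E.
    apply: le_trans cZ; apply: ge0_le_integralr; first exact: mtr.
      by apply: measurable_funX; exact: measurableT_comp.
    by move=> w; rewrite tr_le ?(ltW A0)// andbT exprn_ge0// le_min normr_ge0 ltW.
  rewrite EE// in hc.
  apply: (@le_trans _ _ ((\int[P]_w tr m.+1%:R (Z' w))%:E + e%:E)%E); last by rewrite leeD2r.
  rewrite -EFinD lee_fin.
  have Le : L * (e / (L + 1)) <= e.
    rewrite mulrA ler_pdivrMr ?ltr_wpDl// mulrDr mulr1 [L * e]mulrC lerDl ltW//.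
  by move: h; rewrite ler_norml => /andP[_]; lra.
apply: (@fatou_le _ _ _ P (fun m w => tr m.+1%:R (Z w))) => //.
- by move=> m; exact: mtr.
- by move=> m w; rewrite exprn_ge0// le_min normr_ge0/=.
- move=> w; apply: cvg_near_cst; have [N [N0 Nx]] := exists_nat_ge `|Z w|.
  exists N => // m /= Nm; rewrite /tr min_l//; apply: (le_trans Nx).
  by rewrite ler_nat (leq_trans Nm).
Qed.

End measurable_vectors.

Section noise_vectors.
Context {R : realType} {dO : measure_display} {Omega : measurableType dO} {d : nat}.
Variable Q : probability Omega R.
Variables (n : nat) (Y : R -> Omega -> 'cV[R]_d).
Hypotheses (n0 : (0 < n)%N) (kY : kac_noise Q n Y).
Local Notation mu := (@lebesgue_measure R).

Variables (T : R) (H : R -> 'M[R]_d) (Psi Psi2 : R -> R).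
Hypotheses (T0 : 0 < T)
  (Hr : forall i l x, 0 < x < T -> H y i l @[y --> x^'+] --> H x i l)
  (HPsi : forall i l x, 0 < x <= T -> `|H x i l| <= Psi x)
  (Psi_ni : forall x y, 0 < x <= y -> y <= T -> Psi y <= Psi x)
  (iPsi : mu.-integrable `]0, T] (EFin \o Psi))
  (HPsi2 : forall i l x, 0 < x <= T -> H x i l ^+ 2 <= Psi2 x)
  (Psi2_ni : forall x y, 0 < x <= y -> y <= T -> Psi2 y <= Psi2 x)
  (iPsi2 : mu.-integrable `]0, T] (EFin \o Psi2)).

(* [8 r] comes from normalizing the energy of the integrand to 1/64. *)
Definition moment_const (k : nat) : R :=
  d%:R * (d%:R ^+ k * (d%:R * (k`!%:R * 2 * expR 1 * 8 ^+ k))).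

Lemma noise_coord_integral i w :
  (forall l, mu.-integrable `]0, T] (EFin \o (fun x => H x i l * Y x w l 0))) /\
  integral_upto H Y T w i 0 = \sum_l \int[mu]_(x in `]0, T]) (H x i l * Y x w l 0).
Proof.
have [[N [ppN YN]] _] := kY.
have nR0 : 0 < n%:R :> R by rewrite ltr0n.
have il l : mu.-integrable `]0, T] (EFin \o (fun x => H x i l * Y x w l 0)).
  have [h _] := noise_integral_cvg (ppN l) T0 (@Hr i l) (HPsi i l) Psi_ni iPsi w.
  apply: eq_integrable h => // x; rewrite inE/= in_itv/= => /andP[x0 _].
  by rewrite YN// ltW.
split => //.
have ii : mu.-integrable `]0, T] (EFin \o (fun x => (H x *m Y x w) i 0)).
  have := @integrable_sum _ _ _ mu `]0, T]%classic (measurable_itv _) _ (index_enum 'I_d) xpredT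
    (fun l x => (H x i l * Y x w l 0)%:E) (fun l _ => il l).
  by apply: eq_integrable => // x _; rewrite /= mxE sumEFin.
rewrite /integral_upto mxE -Rintegral_itv_obnd_cbnd//.
by under eq_Rintegral do rewrite mxE; rewrite (@Rintegral_sum _ _ _ mu).
Qed.

Lemma noise_vector_moment (k : nat) (r : R) : (0 < k)%N -> 0 < r ->
  (forall i l, \int[mu]_(x in `]0, T]) (H x i l ^+ 2) < r ^+ 2) ->
  measurable_vec (integral_upto H Y T) /\
  (\int[Q]_w (`|integral_upto H Y T w| ^+ k)%:E <= (moment_const k * r ^+ k)%:E)%E.
Proof.
move=> k0 r0 Hr2.
have [[N [ppN YN]] _] := kY.
have nR0 : 0 < n%:R :> R by rewrite ltr0n.
pose a i l w := \int[mu]_(x in `]0, T]) (H x i l * Y x w l 0).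
have aE i l w : a i l w = \int[mu]_(x in `]0, T]) (H x i l * (Num.sqrt n%:R * (-1) ^+ N l x w)).
  apply: eq_Rintegral => x; rewrite inE/= in_itv/= => /andP[x0 _].
  by rewrite YN// ltW.
have am i l : measurable_fun setT (a i l) /\
    (\int[Q]_w (`|a i l w| ^+ k)%:E <= (k`!%:R * 2 * expR 1 * (8 * r) ^+ k)%:E)%E.
  have [m h] := noise_integral_moment nR0 (ppN l) T0 (@Hr i l) (HPsi i l) Psi_ni iPsi
    (HPsi2 i l) Psi2_ni iPsi2 k r0 (Hr2 i l).
  split; first by apply: eq_measurable_fun m => w _; rewrite aE.
  by apply: le_trans h; under eq_integral do rewrite aE.
have mv : measurable_vec (integral_upto H Y T).
  move=> i; apply: (eq_measurable_fun (fun w => \sum_l a i l w)).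
    by move=> w _; rewrite (noise_coord_integral i w).2.
  by apply: measurable_sum => l; exact: (am i l).1.
split => //.
have mk i l : measurable_fun setT (fun w => `|a i l w| ^+ k).
  by apply: measurable_funX; apply: measurableT_comp => //; exact: (am i l).1.
apply: (@le_trans _ _ (\int[Q]_w (\sum_(i < d) (d%:R ^+ k * \sum_(l < d) `|a i l w| ^+ k))%:E)%E).
  apply: ge0_le_integralr.
  - apply: measurable_funX; apply: measurable_mx_norm => i j.
    by rewrite ord1; exact: mv.
  - apply: measurable_sum => i; apply: measurable_funM => //.
    by apply: measurable_sum => l; exact: mk.
  - move=> w; rewrite exprn_ge0//=; apply: (le_trans (mx_normX_le_sum _ k0)).
    apply: ler_sum => i _; rewrite (noise_coord_integral i w).2.
    apply: (le_trans (norm_sum_expn_le _ _ k0)).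
    by rewrite /index_enum -enumT size_enum_ord.
rewrite ge0_integral_sumr; last 2 first.
- move=> i; apply: measurable_funM => //; apply: measurable_sum => l; exact: mk.
- by move=> i w; rewrite mulr_ge0 ?exprn_ge0// sumr_ge0// => l _; rewrite exprn_ge0.
apply: (@le_trans _ _ (\sum_(i < d) (d%:R ^+ k * (d%:R * (k`!%:R * 2 * expR 1 * (8 * r) ^+ k)))%:E)%E).
  apply: lee_sum => i _; rewrite ge0_integralZlr ?exprn_ge0//; last 2 first.
  - by apply: measurable_sum => l; exact: mk.
  - by move=> w; rewrite sumr_ge0// => l _; rewrite exprn_ge0.
  rewrite EFinM lee_wpmul2l ?lee_fin ?exprn_ge0//.
  rewrite ge0_integral_sumr//.
  apply: (@le_trans _ _ (\sum_(l < d) (k`!%:R * 2 * expR 1 * (8 * r) ^+ k)%:E)%E).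
    by apply: lee_sum => l _; exact: (am i l).2.
  by rewrite sumEFin lee_fin sumr_const card_ord -[leLHS]mulr_natl.
rewrite sumEFin lee_fin sumr_const card_ord -[leLHS]mulr_natl /moment_const exprMn.
by rewrite le_eqVlt; apply/orP; left; apply/eqP; ring.
Qed.

End noise_vectors.

(** * Rounding of step functions to a regular grid *)

Section step_rounding.
Context {R : realType} {d : nat}.
Implicit Types (s : @step_data R d) (h x : R).
Local Notation mu := (@lebesgue_measure R).

(* Never 0, so that the rounded intervals stay away from the singularity of the
   kernels at 0. *)
Definition grid_index h (a : R) : nat := (Num.truncn (a / h)).+1.

Lemma grid_index_bounds h a : 0 < h -> 0 <= a -> a < (grid_index h a)%:R * h <= a + h.
Proof.
move=> h0 a0; have ah0 : 0 <= a / h by rewrite divr_ge0// ltW.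
have /andP[t1 t2] := truncn_itv ah0.
rewrite /grid_index -ltr_pdivrMr// t2/= -natr1 mulrDl mul1r lerD2r.
by rewrite -ler_pdivlMr.
Qed.

Lemma grid_index_le h a b : 0 < h -> 0 <= a <= b -> (grid_index h a <= grid_index h b)%N.
Proof.
move=> h0 /andP[a0 ab]; rewrite ltnS; apply: le_truncn.
by rewrite ler_pM2r ?invr_gt0.
Qed.

Definition grid_step h s : @step_data R d :=
  [seq ((grid_index h p.1.1)%:R * h, (grid_index h p.1.2)%:R * h, p.2) | p <- s].

(* Right-continuous, unlike [step_fun]: the moment bounds for telegraph integrals
   rest on Riemann sums at right endpoints. *)
Definition rstep_fun s x : 'M[R]_d :=
  \sum_(p <- s) (if p.1.1 <= x < p.1.2 then p.2 else 0).

Lemma step_fun_entry s x i l : step_fun s x i l =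
  \sum_(p <- s) (if p.1.1 < x <= p.1.2 then p.2 i l else 0).
Proof.
rewrite /step_fun summxE; apply: eq_bigr => p _.
by case: ifP => _; rewrite ?mxE.
Qed.

Lemma rstep_fun_entry s x i l : rstep_fun s x i l =
  \sum_(p <- s) (if p.1.1 <= x < p.1.2 then p.2 i l else 0).
Proof.
rewrite /rstep_fun summxE; apply: eq_bigr => p _.
by case: ifP => _; rewrite ?mxE.
Qed.

Let measurable_if_itv (I : interval R) (c : R) :
  measurable_fun setT (fun x => if x \in I then c else 0).
Proof.
rewrite (_ : (fun x => _) = fun x => c * \1_[set` I] x).
  by apply: measurable_funM => //; apply: measurable_indic; exact: measurable_itv.
apply/funext => x; rewrite indicE; case: ifP => h.
  by rewrite mem_set ?mulr1.
by rewrite memNset ?mulr0//= h.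
Qed.

Lemma measurable_step_fun s i l : measurable_fun setT (fun x => step_fun s x i l).
Proof.
under eq_fun do rewrite step_fun_entry; apply: measurable_sum => p.
have := measurable_if_itv `]p.1.1, p.1.2] (p.2 i l).
by under eq_fun do rewrite in_itv.
Qed.

Lemma measurable_rstep_fun s i l : measurable_fun setT (fun x => rstep_fun s x i l).
Proof.
under eq_fun do rewrite rstep_fun_entry; apply: measurable_sum => p.
have := measurable_if_itv `[p.1.1, p.1.2[ (p.2 i l).
by under eq_fun do rewrite in_itv.
Qed.

Lemma rstep_fun_bounded s : exists2 B, 0 <= B & forall x i l, `|rstep_fun s x i l| <= B.
Proof.
exists (\sum_(p <- s) `|p.2|); first exact: sumr_ge0.
move=> x i l; rewrite rstep_fun_entry; apply: (le_trans (ler_norm_sum _ _ _)).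
apply: ler_sum => p _; case: ifP => _; last by rewrite normr0.
exact: mx_entry_le.
Qed.

Lemma rstep_fun_near s x : \forall y \near x^'+, rstep_fun s y = rstep_fun s x.
Proof.
elim: s => [|p s IH]; first by apply: nearW => y; rewrite /rstep_fun !big_nil.
have H : \forall y \near x^'+, (p.1.1 <= y < p.1.2) = (p.1.1 <= x < p.1.2).
  have [xa|ax] := ltP x p.1.1.
    near=> y; have ya : y < p.1.1 by near: y; exact: nbhs_right_lt.
    by rewrite leNgt ya.
  have [xb|bx] := ltP x p.1.2.
    near=> y; have yb : y < p.1.2 by near: y; exact: nbhs_right_lt.
    have xy : x < y by near: y; exact: nbhs_right_gt.
    by rewrite yb (le_trans ax (ltW xy)).
  near=> y; have xy : x < y by near: y; exact: nbhs_right_gt.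
  by rewrite [y < _]ltNge (le_trans bx (ltW xy)) /= andbF.
near=> y; rewrite /rstep_fun !big_cons -/(rstep_fun s y) -/(rstep_fun s x).
have -> : rstep_fun s y = rstep_fun s x by near: y.
have -> : (p.1.1 <= y < p.1.2) = (p.1.1 <= x < p.1.2) by near: y.
by [].
Unshelve. all: by end_near. Qed.

Lemma rstep_fun_right_continuous s i l x :
  rstep_fun s y i l @[y --> x^'+] --> rstep_fun s x i l.
Proof.
apply: cvg_near_cst; have := rstep_fun_near s x.
by apply: filterS => y ->.
Qed.

Lemma sqrD_le2 (x y : R) : (x + y) ^+ 2 <= 2 * x ^+ 2 + 2 * y ^+ 2.
Proof. by rewrite -subr_ge0 (_ : _ - _ = (x - y) ^+ 2) ?sqr_ge0//; ring. Qed.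

Let measurable_step_diff h s :
  measurable_fun setT (fun x => `|step_fun s x - rstep_fun (grid_step h s) x| ^+ 2).
Proof.
apply: measurable_funX; apply: measurable_mx_norm => i j.
under eq_fun do rewrite !mxE.
by apply: measurable_funB; [exact: measurable_step_fun|exact: measurable_rstep_fun].
Qed.

(** Moving each endpoint by at most h changes the function on sets of measure at most h. The
    constant depends on s, which is fixed before h. *)
Lemma step_rounding_kernel s : step_wf s -> exists2 c, 0 <= c & forall h, 0 < h ->
  (\int[mu]_(x in time) (`|step_fun s x - rstep_fun (grid_step h s) x| ^+ 2)%:E <= (c * h)%:E)%E.
Proof.
elim: s => [|p s IH] wf.
  exists 0 => // h h0; rewrite mul0r integral0_eq// => x _.
  by rewrite /step_fun /rstep_fun !big_nil subrr normr0 expr0n.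
have [|c c0 hc] := IH; first by move=> q qs; apply: wf; rewrite in_cons qs orbT.
exists (2 * (2 * `|p.2| ^+ 2) + 2 * c).
  by rewrite addr_ge0// !mulr_ge0// exprn_ge0.
move=> h h0.
have /andP[a0 ab] := wf p (mem_head _ _).
have /andP[aa1 aa2] := grid_index_bounds h0 a0.
have /andP[bb1 bb2] := grid_index_bounds h0 (le_trans a0 ab).
set a := p.1.1 in a0 ab aa1 aa2 *; set b := p.1.2 in ab bb1 bb2 *.
set a' := (grid_index h a)%:R * h in aa1 aa2 *; set b' := (grid_index h b)%:R * h in bb1 bb2 *.
(* The two intervals cover every point where ]a, b] and [a', b'[ disagree, including a' and b',
   where the conventions on endpoints differ. *)
pose u x : R := \1_(`]a, a']%classic) x + \1_(`]b, b']%classic) x.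
have pw x : `|step_fun (p :: s) x - rstep_fun (grid_step h (p :: s)) x| ^+ 2 <=
    2 * `|p.2| ^+ 2 * u x + 2 * `|step_fun s x - rstep_fun (grid_step h s) x| ^+ 2.
  rewrite /step_fun /rstep_fun /= !big_cons -/(step_fun s x) -/(rstep_fun (grid_step h s) x) /=.
  rewrite -/a -/b -/a' -/b'.
  pose X : 'M[R]_d := (if a < x <= b then p.2 else 0) - (if a' <= x < b' then p.2 else 0).
  have XM : `|X| ^+ 2 <= `|p.2| ^+ 2 * u x.
    have u0 : 0 <= u x by rewrite /u addr_ge0.
    have MM : 0 <= `|p.2| ^+ 2 by rewrite exprn_ge0.
    have uge y y' : (y < x <= y') -> `]y, y']%classic x by rewrite /= in_itv.
    rewrite /X; case: ifPn => [/andP[ax xb]|E1]; case: ifPn => [/andP[ax' xb']|E2].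
    - by rewrite subrr normr0 expr0n mulr_ge0.
    - have xa' : x <= a'.
        rewrite leNgt; apply/negP => a'x; move: E2; rewrite (ltW a'x)/= -leNgt => b'x.
        by have := le_lt_trans xb bb1; rewrite ltNge b'x.
      rewrite subr0 ler_peMr// /u indicE mem_set; last by apply: uge; rewrite ax.
      by rewrite lerDl.
    - have bx : b < x.
        rewrite ltNge; apply/negP => xb; move: E1; rewrite xb andbT -leNgt => xa.
        by have := lt_le_trans aa1 ax'; rewrite ltNge xa.
      rewrite sub0r normrN ler_peMr// /u [X in _ + X]indicE mem_set; last by apply: uge; rewrite bx ltW.
      by rewrite lerDr.
    - by rewrite subrr normr0 expr0n mulr_ge0.
  have -> : (if a < x <= b then p.2 else 0) + step_fun s x -
      ((if a' <= x < b' then p.2 else 0) + rstep_fun (grid_step h s) x) =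
      X + (step_fun s x - rstep_fun (grid_step h s) x).
    by rewrite /X opprD addrACA.
  apply: (@le_trans _ _ ((`|X| + `|step_fun s x - rstep_fun (grid_step h s) x|) ^+ 2)).
    by rewrite lerXn2r ?nnegrE ?addr_ge0// ler_normD.
  apply: (le_trans (sqrD_le2 _ _)); rewrite lerD2r -mulrA ler_wpM2l//.
have mu_u : measurable_fun setT u by apply: measurable_funD; exact: measurable_indic.
have tm : measurable (time : set R) by rewrite /time; exact: measurable_itv.
apply: (@le_trans _ _ (\int[mu]_(x in time) ((2 * `|p.2| ^+ 2)%:E * (u x)%:E +
    2%:E * (`|step_fun s x - rstep_fun (grid_step h s) x| ^+ 2)%:E))%E).
  apply: ge0_le_integral => //.
  - by apply/measurable_EFinP; apply: measurable_funTS; exact: measurable_step_diff.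
  - apply: emeasurable_funD; apply: measurable_funeM; apply/measurable_EFinP;
      apply: measurable_funTS => //; exact: measurable_step_diff.
  - by move=> x _; rewrite -!EFinM -EFinD lee_fin; exact: pw.
have u0 x : 0 <= u x by rewrite /u addr_ge0.
have ms : measurable_fun time (fun x => (`|step_fun s x - rstep_fun (grid_step h s) x| ^+ 2)%:E).
  by apply/measurable_EFinP; apply: measurable_funTS; exact: measurable_step_diff.
have mutime : measurable_fun time (fun x => (u x)%:E).
  by apply/measurable_EFinP; exact: measurable_funTS.
rewrite ge0_integralD//; try by [apply: measurable_funeM|move=> x _; rewrite -EFinM lee_fin !mulr_ge0// exprn_ge0].
rewrite ge0_integralZl//; try by [move=> x _; rewrite lee_fin|rewrite lee_fin mulr_ge0// exprn_ge0].
rewrite ge0_integralZl//; try by [move=> x _; rewrite lee_fin exprn_ge0].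
have iu : (\int[mu]_(x in time) (u x)%:E <= (2 * h)%:E)%E.
  apply: (@le_trans _ _ (\int[mu]_x (u x)%:E)%E).
    by apply: ge0_subset_integral => //; [exact/measurable_EFinP|move=> x _; rewrite lee_fin].
  rewrite /u; under eq_integral do rewrite EFinD.
  rewrite ge0_integralD//; [|by apply/measurable_EFinP; exact: measurable_indic..].
  have iE (y y' : R) : y < y' -> (\int[mu]_x (\1_(`]y, y']%classic) x)%:E = (y' - y)%:E)%E.
    move=> yy; rewrite integral_indic// setIT; transitivity (mu `]y, y']%classic) => //.
    by rewrite lebesgue_measure_itv/= lte_fin yy.
  by rewrite (iE a a' aa1) (iE b b' bb1) -EFinD lee_fin; lra.
apply: (@le_trans _ _ ((2 * `|p.2| ^+ 2)%:E * (2 * h)%:E + 2%:E * (c * h)%:E)%E).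
  by apply: leeD; apply: lee_wpmul2l; rewrite ?lee_fin ?mulr_ge0 ?exprn_ge0//; exact: hc.
by rewrite -!EFinM -EFinD lee_fin le_eqVlt; apply/orP; left; apply/eqP; ring.
Qed.

(** The integral of a rounded step function as a fixed linear function of its values on the grid
    cells. The same function is applied to Brownian increments and to telegraph integrals; here the
    two sides meet. *)
Definition grid_functional h s (i : 'I_d) (v : 'I_d -> nat -> R) : R :=
  \sum_(p <- s) \sum_l p.2 i l * \sum_(grid_index h p.1.1 <= q < grid_index h p.1.2) v l q.

Lemma grid_functional_step_integral {dO} {Omega : measurableType dO} (W : R -> Omega -> 'cV[R]_d) h s i w :
  0 < h -> step_wf s ->
  step_integral (grid_step h s) W w i 0 =
  grid_functional h s i (fun l q => W (q.+1%:R * h) w l 0 - W (q%:R * h) w l 0).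
Proof.
move=> h0 wf; rewrite /step_integral /grid_functional big_map summxE.
rewrite big_seq [RHS]big_seq; apply: eq_bigr => p ps.
rewrite mxE; apply: eq_bigr => l _; rewrite !mxE; congr (_ * _).
rewrite (telescope_sumr (fun q => W (q%:R * h) w l 0))//.
exact: grid_index_le h0 (wf p ps).
Qed.

End step_rounding.

Section brownian_rounding.
Context {R : realType} {dO : measure_display} {Omega : measurableType dO}.
Variable P : probability Omega R.

Lemma ge0_law_expectation d1 (T1 : measurableType d1) (X : Omega -> T1)
    (mu : probability T1 R) (F : T1 -> \bar R) :
  measurable_fun setT X -> (forall U, measurable U -> P (X @^-1` U) = mu U) ->
  measurable_fun setT F -> (forall x, (0 <= F x)%E) ->
  (\int[P]_w F (X w) = \int[mu]_x F x)%E.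
Proof.
move=> mX law mF F0; pose Z : {RV P >-> T1} := mfun_Sub (mem_set mX).
rewrite -[LHS](ge0_integral_distribution Z mF F0).
by apply: eq_measure_integral => U mU _; exact: law.
Qed.

Lemma brownian_increment_L2 (B : R -> Omega -> R) (s t : R) : brownian_motion P B ->
  0 <= s < t -> (\int[P]_w ((B t w - B s w) ^+ 2)%:E = (t - s)%:E)%E.
Proof.
move=> bm st; have /andP[s0 st'] := st; have r0 : 0 < Num.sqrt (t - s) by rewrite sqrtr_gt0 subr_gt0.
have mX : @measurable_fun _ _ Omega (measurableTypeR R) setT (fun w => B t w - B s w).
  by apply: measurable_funB; apply: (bm_measurable bm) => //; rewrite ltW// (le_lt_trans s0).
have mF : @measurable_fun _ _ (measurableTypeR R) (\bar R) setT (fun x : R => (x ^+ 2)%:E).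
  by apply/measurable_EFinP; exact: exprn_measurable.
have law U : measurable U -> P ((fun w => B t w - B s w) @^-1` U) = normal_prob 0 (Num.sqrt (t - s)) U.
  by move=> mU; exact: (bm_gauss bm st mU).
have := @ge0_law_expectation _ (measurableTypeR R) _ (normal_prob 0 (Num.sqrt (t - s))) _ mX law mF
  (fun x => (_ : (0 <= (x ^+ 2)%:E)%E)).
rewrite /= => ->; last by move=> x; rewrite lee_fin sqr_ge0.
transitivity ((\int[normal_prob 0 (Num.sqrt (t - s))]_x (x ^+ 2))%:E); last first.
  by rewrite normal_variance// sqr_sqrtr// subr_ge0 ltW.
by apply/esym/fineK; exact: (integrable_fin_num measurableT (normal_pow_integrable r0 2)).
Qed.

Context {d : nat}.
Variables (W : R -> Omega -> 'cV[R]_d).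
Hypothesis hW : std_brownian_motion P W.

Lemma measurable_brownian_coord t l : 0 <= t -> measurable_fun setT (fun w => W t w l 0).
Proof. by move=> t0; have [bm _] := hW; exact: (bm_measurable (bm l)). Qed.

Lemma measurable_step_integral (s : @step_data R d) : step_wf s -> measurable_vec (step_integral s W).
Proof.
move=> wf i; rewrite (_ : (fun w => _) = fun w => \sum_(p <- s) \sum_l
    p.2 i l * (W p.1.2 w l 0 - W p.1.1 w l 0)); last first.
  apply/funext => w; rewrite /step_integral summxE; apply: eq_bigr => p _.
  by rewrite mxE; apply: eq_bigr => l _; rewrite !mxE.
elim: s wf => [|p s IH] wf; first by under eq_fun do rewrite big_nil; exact: measurable_cst.
under eq_fun do rewrite big_cons; apply: measurable_funD; last first.
  by apply: IH => q qs; apply: wf; rewrite in_cons qs orbT.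
have /andP[a0 ab] := wf p (mem_head _ _).
apply: measurable_sum => l; apply: measurable_funM => //.
apply: measurable_funB; apply: measurable_brownian_coord => //.
exact: le_trans ab.
Qed.

Lemma grid_step_wf h (s : @step_data R d) : 0 < h -> step_wf s -> step_wf (grid_step h s).
Proof.
move=> h0 wf _ /mapP[p ps ->] /=; rewrite mulr_ge0 ?(ltW h0)//=.
by rewrite ler_wpM2r ?(ltW h0)// ler_nat (grid_index_le h0 (wf p ps)).
Qed.

(** Each piece changes by two increments over times at most h, whose mean squares are at most h. The
    pieces are added by crude triangle inequalities, with a constant that depends on s only. *)
Lemma step_rounding_brownian (s : @step_data R d) : step_wf s ->
  exists2 c, 0 <= c & forall h, 0 < h ->
  (L2dist P (step_integral s W) (step_integral (grid_step h s) W) <= (c * h)%:E)%E.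
Proof.
elim: s => [|p s IH] wf.
  exists 0 => // h h0; rewrite mul0r /L2dist integral0_eq// => w _.
  by rewrite /step_integral !big_nil subrr normr0 expr0n.
have wfs : step_wf s by move=> q qs; apply: wf; rewrite in_cons qs orbT.
have [c c0 hc] := IH wfs.
have wfp : step_wf [:: p] by move=> q; rewrite mem_seq1 => /eqP ->; exact: (wf p (mem_head _ _)).
exists (2 * ((d%:R * `|p.2|) ^+ 2 * (d%:R * 4)) + 2 * c).
  by rewrite addr_ge0// !mulr_ge0// exprn_ge0// mulr_ge0.
move=> h h0; have [bm _] := hW.
have /andP[a0 ab] := wf p (mem_head _ _); have b0 := le_trans a0 ab.
have aB := grid_index_bounds h0 a0; have bB := grid_index_bounds h0 b0.
set a := p.1.1 in a0 ab aB *; set b := p.1.2 in ab b0 bB *.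
set a' := (grid_index h a)%:R * h in aB *; set b' := (grid_index h b)%:R * h in bB *.
have /andP[aa1 aa2] := aB; have /andP[bb1 bb2] := bB.
have a'0 : 0 <= a' := le_trans a0 (ltW aa1); have b'0 : 0 <= b' := le_trans b0 (ltW bb1).
pose V w := (W b w - W a w) - (W b' w - W a' w).
pose U w := step_integral s W w - step_integral (grid_step h s) W w.
have mU i j : measurable_fun setT (fun w => U w i j).
  rewrite ord1; under eq_fun do rewrite !mxE; apply: measurable_funB.
    exact: measurable_step_integral.
  by apply: measurable_step_integral; exact: grid_step_wf.
have mVl l : measurable_fun setT (fun w => V w l 0).
  under eq_fun do rewrite !mxE.
  by apply: measurable_funB; apply: measurable_funB; exact: measurable_brownian_coord.
have mMV i j : measurable_fun setT (fun w => (p.2 *m V w) i j).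
  rewrite ord1; under eq_fun do rewrite !mxE.
  by apply: measurable_sum => l; apply: measurable_funM.
have mnV : measurable_fun setT (fun w => \sum_l `|V w l 0| ^+ 2).
  by apply: measurable_sum => l; apply: measurable_funX; exact: measurableT_comp.
have mnU : measurable_fun setT (fun w => `|U w| ^+ 2).
  by apply: measurable_funX; exact: measurable_mx_norm.
have pw w : `|step_integral (p :: s) W w - step_integral (grid_step h (p :: s)) W w| ^+ 2 <=
    2 * ((d%:R * `|p.2|) ^+ 2 * \sum_l `|V w l 0| ^+ 2) + 2 * `|U w| ^+ 2.
  have -> : step_integral (p :: s) W w - step_integral (grid_step h (p :: s)) W w =
      p.2 *m V w + U w.
    rewrite /step_integral /= !big_cons /= -/(step_integral s W w) -/(step_integral (grid_step h s) W w).
    by rewrite -/a -/b -/a' -/b' opprD addrACA -mulmxBr.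
  apply: (@le_trans _ _ ((`|p.2 *m V w| + `|U w|) ^+ 2)).
    by rewrite lerXn2r ?nnegrE ?addr_ge0// ler_normD.
  apply: (le_trans (sqrD_le2 _ _)); rewrite lerD2r ler_wpM2l//.
  apply: (@le_trans _ _ ((d%:R * `|p.2| * `|V w|) ^+ 2)).
    rewrite lerXn2r ?nnegrE ?mulr_ge0//; apply: mx_norm_le; first by rewrite !mulr_ge0.
    move=> i j; rewrite mxE; apply: (le_trans (ler_norm_sum _ _ _)).
    apply: (@le_trans _ _ (\sum_(l < d) `|p.2| * `|V w|)).
      by apply: ler_sum => l _; rewrite normrM ler_pM// mx_entry_le.
    by rewrite sumr_const card_ord -[leLHS]mulr_natl mulrA.
  by rewrite exprMn ler_wpM2l ?exprn_ge0 ?mulr_ge0//; exact: mx_normX_le_sum.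
have EV l : (\int[P]_w (`|V w l 0| ^+ 2)%:E <= (4 * h)%:E)%E.
  apply: (@le_trans _ _ (\int[P]_w (2 * (W a' w l 0 - W a w l 0) ^+ 2 + 2 * (W b' w l 0 - W b w l 0) ^+ 2)%:E)%E).
    apply: ge0_le_integralr.
    - by apply: measurable_funX; exact: measurableT_comp.
    - by apply: measurable_funD; apply: measurable_funM => //; apply: measurable_funX;
        apply: measurable_funB; exact: measurable_brownian_coord.
    - move=> w; rewrite exprn_ge0//= real_normK ?num_real//.
      have -> : V w l 0 = (W a' w l 0 - W a w l 0) + - (W b' w l 0 - W b w l 0).
        by rewrite /V !mxE; ring.
      by apply: (le_trans (sqrD_le2 _ _)); rewrite sqrrN.
  under eq_integral do rewrite EFinD.
  have mW2 s' t' : 0 <= s' -> 0 <= t' -> measurable_fun setT (fun w => (W s' w l 0 - W t' w l 0) ^+ 2).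
    by move=> s0 t0; apply: measurable_funX; apply: measurable_funB; exact: measurable_brownian_coord.
  rewrite ge0_integralD//; last 4 first.
  - by move=> w _; rewrite lee_fin mulr_ge0// sqr_ge0.
  - by apply/measurable_EFinP; apply: measurable_funM => //; exact: mW2.
  - by move=> w _; rewrite lee_fin mulr_ge0// sqr_ge0.
  - by apply/measurable_EFinP; apply: measurable_funM => //; exact: mW2.
  rewrite !ge0_integralZlr//; last 4 first.
  - exact: mW2.
  - by move=> w; rewrite sqr_ge0.
  - exact: mW2.
  - by move=> w; rewrite sqr_ge0.
  have aa : 0 <= a < a' by rewrite a0. have bb : 0 <= b < b' by rewrite b0.
  rewrite (brownian_increment_L2 (bm l) aa) (brownian_increment_L2 (bm l) bb).
  by rewrite -!EFinM -EFinD lee_fin; lra.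
apply: (@le_trans _ _ (\int[P]_w (2 * ((d%:R * `|p.2|) ^+ 2 * \sum_l `|V w l 0| ^+ 2) + 2 * `|U w| ^+ 2)%:E)%E).
  apply: ge0_le_integralr.
  - apply: measurable_funX; apply: measurable_mx_norm => i j.
    rewrite ord1; under eq_fun do rewrite !mxE; apply: measurable_funB.
      exact: measurable_step_integral.
    by apply: measurable_step_integral; exact: grid_step_wf.
  - by apply: measurable_funD; apply: measurable_funM => //; apply: measurable_funM.
  - by move=> w; rewrite exprn_ge0//=; exact: pw.
under eq_integral do rewrite EFinD.
have V0 w : 0 <= \sum_l `|V w l 0| ^+ 2 by apply: sumr_ge0 => l _; rewrite exprn_ge0.
have M0 : 0 <= (d%:R * `|p.2|) ^+ 2 by rewrite exprn_ge0// mulr_ge0.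
have mcV : measurable_fun setT (fun w => (d%:R * `|p.2|) ^+ 2 * \sum_l `|V w l 0| ^+ 2).
  by apply: measurable_funM.
have cV0 w : 0 <= (d%:R * `|p.2|) ^+ 2 * \sum_l `|V w l 0| ^+ 2 by rewrite mulr_ge0.
rewrite ge0_integralD//; try by [move=> w _; rewrite lee_fin mulr_ge0// exprn_ge0|apply/measurable_EFinP; apply: measurable_funM].
rewrite ge0_integralZlr//.
rewrite [X in (_ + X)%E]ge0_integralZlr//.
rewrite ge0_integralZlr//.
rewrite ge0_integral_sumr//; last by move=> l; apply: measurable_funX; exact: measurableT_comp.
have ES : (\sum_(l < d) \int[P]_w (`|V w l 0| ^+ 2)%:E <= (d%:R * (4 * h))%:E)%E.
  apply: (@le_trans _ _ (\sum_(l < d) (4 * h)%:E)%E); first by apply: lee_sum => l _; exact: EV.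
  by rewrite sumEFin lee_fin sumr_const card_ord -[leLHS]mulr_natl.
apply: (@le_trans _ _ (2%:E * (((d%:R * `|p.2|) ^+ 2)%:E * (d%:R * (4 * h))%:E) + 2%:E * (c * h)%:E)%E).
  apply: leeD; apply: lee_wpmul2l; rewrite ?lee_fin//; last exact: hc.
  by apply: lee_wpmul2l; rewrite ?lee_fin.
by rewrite -!EFinM -EFinD lee_fin le_eqVlt; apply/orP; left; apply/eqP; ring.
Qed.

End brownian_rounding.

Section tame_kernels.
Context {R : realType} {d : nat}.
Implicit Types f g : R -> 'M[R]_d.
Local Notation mu := (@lebesgue_measure R).

(* The monotone majorants dominate the step functions of right-endpoint Riemann
   sums. *)
Definition tame f : Prop :=
  [/\ forall i l, measurable_fun (time : set R) (fun x => f x i l),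
      forall i l x, 0 < x -> f y i l @[y --> x^'+] --> f x i l &
      exists Psi Psi2 : R -> R,
      [/\ forall i l x, 0 < x -> `|f x i l| <= Psi x,
          forall i l x, 0 < x -> f x i l ^+ 2 <= Psi2 x,
          forall x y, 0 < x <= y -> Psi y <= Psi x,
          forall x y, 0 < x <= y -> Psi2 y <= Psi2 x &
          forall T : R, mu.-integrable `]0, T] (EFin \o Psi) /\
            mu.-integrable `]0, T] (EFin \o Psi2)]].

Lemma tameB f g : tame f -> tame g -> tame (fun x => f x - g x).
Proof.
move=> [mf rf [Pf [Pf2 [f1 f2 f3 f4 f5]]]] [mg rg [Pg [Pg2 [g1 g2 g3 g4 g5]]]]; split.
- by move=> i l; under eq_fun do rewrite !mxE; exact: measurable_funB.
- move=> i l x x0; rewrite !mxE; under eq_fun do rewrite !mxE.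
  by apply: cvgB; [exact: rf|exact: rg].
exists (fun x => Pf x + Pg x), (fun x => 2 * Pf2 x + 2 * Pg2 x); split.
- move=> i l x x0; rewrite !mxE; apply: (le_trans (ler_normB _ _)).
  by apply: lerD; [exact: f1|exact: g1].
- move=> i l x x0; rewrite !mxE; apply: (le_trans (sqrD_le2 _ _)); rewrite sqrrN.
  by apply: lerD; rewrite ler_wpM2l//; [exact: f2|exact: g2].
- by move=> x y xy; apply: lerD; [exact: f3|exact: g3].
- by move=> x y xy; apply: lerD; rewrite ler_wpM2l//; [exact: f4|exact: g4].
- move=> T; have [if1 if2] := f5 T; have [ig1 ig2] := g5 T; split.
    have : mu.-integrable `]0, T] ((EFin \o Pf) \+ (EFin \o Pg)) by exact: integrableD.
    by apply: eq_integrable.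
  have : mu.-integrable `]0, T] ((fun x => 2%:E * (EFin \o Pf2) x) \+ (fun x => 2%:E * (EFin \o Pg2) x))%E.
    by apply: integrableD => //; exact: integrableZl.
  by apply: eq_integrable.
Qed.

Lemma tame_rstep_fun (s : @step_data R d) : tame (rstep_fun s).
Proof.
have [B B0 hB] := rstep_fun_bounded s; split.
- by move=> i l; apply: measurable_funTS; exact: measurable_rstep_fun.
- by move=> i l x _; exact: rstep_fun_right_continuous.
exists (cst B), (cst (B ^+ 2)); split => //.
- by move=> i l x _; rewrite -real_normK ?num_real// lerXn2r ?nnegrE.
- by move=> T; split; exact: integrable_cst_oc.
Qed.

End tame_kernels.

Section tame_noise.
Context {R : realType} {dO : measure_display} {Omega : measurableType dO} {d : nat}.
Variable Q : probability Omega R.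
Variables (n : nat) (Y : R -> Omega -> 'cV[R]_d).
Hypotheses (n0 : (0 < n)%N) (kY : kac_noise Q n Y).
Local Notation mu := (@lebesgue_measure R).
Implicit Types f g : R -> 'M[R]_d.

Lemma tame_coord_integral f (T : R) i w : tame f -> 0 < T ->
  (forall l, mu.-integrable `]0, T] (EFin \o (fun x => f x i l * Y x w l 0))) /\
  integral_upto f Y T w i 0 = \sum_l \int[mu]_(x in `]0, T]) (f x i l * Y x w l 0).
Proof.
move=> [_ fr [Psi [Psi2 [f1 f2 f3 f4 f5]]]] T0.
apply: (@noise_coord_integral _ _ _ _ Q n Y n0 kY T f Psi T0).
- by move=> i' l x /andP[x0 _]; exact: fr.
- by move=> i' l x /andP[x0 _]; exact: f1.
- by move=> x y xy _; exact: f3.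
- exact: (f5 T).1.
Qed.

Lemma tame_moment f (T : R) (k : nat) (r : R) : tame f -> 0 < T -> (0 < k)%N -> 0 < r ->
  (forall i l, \int[mu]_(x in `]0, T]) (f x i l ^+ 2) < r ^+ 2) ->
  measurable_vec (integral_upto f Y T) /\
  (\int[Q]_w (`|integral_upto f Y T w| ^+ k)%:E <= (@moment_const R d k * r ^+ k)%:E)%E.
Proof.
move=> [_ fr [Psi [Psi2 [f1 f2 f3 f4 f5]]]] T0 k0 r0 hr.
apply: (@noise_vector_moment _ _ _ _ Q n Y n0 kY T f Psi Psi2 T0) => //.
- by move=> i' l x /andP[x0 _]; exact: fr.
- by move=> i' l x /andP[x0 _]; exact: f1.
- by move=> x y xy _; exact: f3.
- exact: (f5 T).1.
- by move=> i' l x /andP[x0 _]; exact: f2.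
- by move=> x y xy _; exact: f4.
- exact: (f5 T).2.
Qed.

Lemma tame_sqr_integrable f (T : R) i l : tame f ->
  mu.-integrable `]0, T] (EFin \o (fun x => f x i l ^+ 2)).
Proof.
move=> [mf fr [Psi [Psi2 [f1 f2 f3 f4 f5]]]].
apply: (le_integrable _ _ _ (f5 T).2) => //.
- apply/measurable_EFinP; apply: measurable_funX.
  by apply: measurable_funS (mf i l) => //; [exact: measurable_itv|move=> x /=; rewrite /time/= !in_itv/= => /andP[/ltW ->]].
- move=> x; rewrite /= in_itv/= => /andP[x0 _]; rewrite lee_fin normrX real_normK ?num_real//.
  by apply: (le_trans (f2 i l x x0)); exact: ler_norm.
Qed.

Lemma measurable_tame_integral f (T : R) : tame f -> 0 < T -> measurable_vec (integral_upto f Y T).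
Proof.
move=> tf T0.
(* Since r >= 1, every entry satisfies the strict bound by r, hence by r^2, under which the moment
   estimate also delivers measurability. *)
pose r : R := 1 + \sum_i \sum_l \int[mu]_(x in `]0, T]) (f x i l ^+ 2).
have I0 i l : 0 <= \int[mu]_(x in `]0, T]) (f x i l ^+ 2).
  by apply: Rintegral_ge0 => x _; exact: sqr_ge0.
have S0 : 0 <= \sum_i \sum_l \int[mu]_(x in `]0, T]) (f x i l ^+ 2).
  by apply: sumr_ge0 => i _; apply: sumr_ge0.
have r1 : 1 <= r by rewrite lerDl.
have r0 : 0 < r by apply: lt_le_trans r1.
apply: (proj1 (@tame_moment f T 1%N r tf T0 _ r0 _)) => // i l.
apply: (@lt_le_trans _ _ r); last by rewrite expr2 ler_peMr// ltW.
rewrite /r ltr_pwDl//.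
rewrite (bigD1 i)//= (bigD1 l)//= -addrA lerDl addr_ge0//.
  by apply: sumr_ge0.
by apply: sumr_ge0 => i' _; apply: sumr_ge0.
Qed.

Lemma integral_uptoB f g (T : R) w : tame f -> tame g -> 0 < T ->
  integral_upto (fun x => f x - g x) Y T w = integral_upto f Y T w - integral_upto g Y T w.
Proof.
move=> tf tg T0; apply/colP => i; rewrite [RHS]mxE.
have [if_ ->] := tame_coord_integral i w tf T0.
rewrite [in RHS]mxE; have [ig_ ->] := tame_coord_integral i w tg T0.
have [_ ->] := tame_coord_integral i w (tameB tf tg) T0.
rewrite -sumrB; apply: eq_bigr => l _.
rewrite -RintegralB//.
by apply: eq_Rintegral => x _; rewrite !mxE mulrBl.
Qed.

(** The right-continuous steps live on [a, b[ and the grid cells are of the form ]a, b]; the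
    endpoints are negligible. *)
Lemma Rintegral_piece (F : R -> R) (T a b c : R) : mu.-integrable `]0, T] (EFin \o F) ->
  0 < a <= b -> b <= T ->
  \int[mu]_(x in `]0, T]) ((if a <= x < b then c else 0) * F x) = c * \int[mu]_(x in `]a, b]) F x.
Proof.
move=> iF /andP[a0 ab] bT.
have sub : `[a, b[ `<=` `]0%R, T].
  move=> x /=; rewrite !in_itv/= => /andP[ax xb].
  by rewrite (lt_le_trans a0 ax) (le_trans (ltW xb) bT).
have sub2 : `[a, b] `<=` `]0%R, T].
  move=> x /=; rewrite !in_itv/= => /andP[ax xb].
  by rewrite (lt_le_trans a0 ax) (le_trans xb bT).
have i1 : mu.-integrable `[a, b[ (EFin \o F).
  by apply: integrableS iF => //; exact: measurable_itv.
have i2 : mu.-integrable `]a, b] (EFin \o F).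
  apply: integrableS iF => //; try exact: measurable_itv.
  by apply: subset_trans sub2; apply: subset_itvr; rewrite bnd_simp.
rewrite (_ : \int[mu]_(x in `]a, b]) F x = \int[mu]_(x in `[a, b[) F x); last first.
  by rewrite Rintegral_itv_obnd_cbnd// -Rintegral_itv_bndo_bndc.
rewrite -RintegralZl//.
rewrite -[in RHS](setIidr sub) Rintegral_mkcondr.
apply: eq_Rintegral => x _; rewrite patchE.
by rewrite mem_setE in_itv/=; case: ifP => // _; rewrite mul0r.
Qed.

Lemma Rintegral_grid_split (F : R -> R) (T h : R) (m k : nat) : 0 < h ->
  mu.-integrable `]0, T] (EFin \o F) -> (m <= k)%N -> k%:R * h <= T ->
  \sum_(m <= q < k) \int[mu]_(x in `]q%:R * h, q.+1%:R * h]) F x =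
  \int[mu]_(x in `]m%:R * h, k%:R * h]) F x.
Proof.
move=> h0 iF mk kT.
have isub (a b : nat) : (b <= k)%N -> mu.-integrable `]a%:R * h, b%:R * h] (EFin \o F).
  move=> bk; apply: integrableS iF => //; try exact: measurable_itv.
  move=> x /=; rewrite !in_itv/= => /andP[ax xb]; rewrite (le_lt_trans _ ax) ?mulr_ge0 ?(ltW h0)//=.
  by apply: (le_trans xb); apply: le_trans kT; rewrite ler_pM2r// ler_nat.
pose I (q : nat) := \int[mu]_(x in `]m%:R * h, q%:R * h]) F x.
have H q : (m <= q < k)%N -> \int[mu]_(x in `]q%:R * h, q.+1%:R * h]) F x = I q.+1 - I q.
  move=> /andP[mq qk]; rewrite /I; symmetry; apply: Rintegral_itvB.
  - exact: isub.
  - by rewrite bnd_simp ler_pM2r// ler_nat.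
  - by rewrite bnd_simp ler_pM2r// ler_nat.
rewrite big_nat (eq_bigr (fun q => I q.+1 - I q)) -?big_nat//.
rewrite telescope_sumr// /I [X in _ - X](_ : _ = 0) ?subr0//.
by rewrite set_itv_ge ?Rintegral_set0// bnd_simp ltxx.
Qed.

Lemma noise_grid_integral (s : @step_data R d) (h T : R) i w : 0 < h -> step_wf s -> 0 < T ->
  (forall p, p \in s -> (grid_index h p.1.2)%:R * h <= T) ->
  integral_upto (rstep_fun (grid_step h s)) Y T w i 0 =
  grid_functional h s i (fun l q => \int[mu]_(x in `]q%:R * h, q.+1%:R * h]) (Y x w l 0)).
Proof.
move=> h0 wf T0 hT.
have iY l : mu.-integrable `]0, T] (EFin \o (fun x => Y x w l 0)).
  have t1 : tame (fun _ : R => const_mx 1 : 'M[R]_d).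
    split; [by move=> *; exact: measurable_cst|by move=> *; exact: cvg_cst|].
    exists (cst 1), (cst 1); split => //.
    - by move=> i' l' x _; rewrite mxE normr1.
    - by move=> i' l' x _; rewrite mxE expr1n.
    - by move=> U; split; exact: integrable_cst_oc.
  have [+ _] := tame_coord_integral i w t1 T0 => /(_ l).
  by apply: eq_integrable => // x _ /=; rewrite mxE mul1r.
have [_ ->] := tame_coord_integral i w (tame_rstep_fun (grid_step h s)) T0.
rewrite /grid_functional exchange_big/=; apply: eq_bigr => l _.
under eq_Rintegral => x _ do rewrite rstep_fun_entry big_map mulr_suml/=.
have piece (p : R * R * 'M[R]_d) :
    mu.-integrable `]0, T] (EFin \o (fun x => (if (grid_index h p.1.1)%:R * h <= x < (grid_index h p.1.2)%:R * h then p.2 i l else 0) * Y x w l 0)).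
  have [+ _] := tame_coord_integral i w (tame_rstep_fun (grid_step h [:: p])) T0.
  move=> /(_ l); apply: eq_integrable => //.
  by move=> x _; rewrite /= rstep_fun_entry /grid_step/= big_seq1.
rewrite (@Rintegral_sum _ _ _ mu)//.
rewrite big_seq [RHS]big_seq; apply: eq_bigr => p ps.
have /andP[a0 ab] := wf p ps.
have mk := grid_index_le h0 (wf p ps).
rewrite Rintegral_piece//; last 2 first.
- rewrite mulr_gt0 ?ltr0n//= ler_pM2r// ler_nat//.
- exact: hT.
by rewrite (Rintegral_grid_split h0 (iY l))// hT.
Qed.

End tame_noise.

Lemma lee_twiceD {R : realType} (a b : \bar R) (e : R) : (a <= e%:E)%E -> (b <= e%:E)%E ->
  (2%:E * a + 2%:E * b <= (4 * e)%:E)%E.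
Proof.
move=> ae be; rewrite (_ : 4 * e = 2 * e + 2 * e); last by ring.
by rewrite [leRHS]EFinD; apply: leeD; rewrite [leRHS]EFinM; exact: lee_wpmul2l.
Qed.

Section L2_estimates.
Context {R : realType} {dO : measure_display} {Omega : measurableType dO} {d : nat}.
Variable P : probability Omega R.
Implicit Types U V Z : Omega -> 'cV[R]_d.

Lemma measurable_vec_norm U : measurable_vec U -> measurable_fun setT (fun w => `|U w|).
Proof. by move=> mU; apply: measurable_mx_norm => i j; rewrite ord1. Qed.

Lemma measurable_vecD U V : measurable_vec U -> measurable_vec V ->
  measurable_vec (fun w => U w + V w).
Proof. by move=> mU mV i; under eq_fun do rewrite mxE; exact: measurable_funD. Qed.

Lemma measurable_vecB U V : measurable_vec U -> measurable_vec V ->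
  measurable_vec (fun w => U w - V w).
Proof. by move=> mU mV i; under eq_fun do rewrite !mxE; exact: measurable_funB. Qed.

Lemma L2_normD U V : measurable_vec U -> measurable_vec V ->
  (\int[P]_w (`|U w + V w| ^+ 2)%:E <=
   2%:E * \int[P]_w (`|U w| ^+ 2)%:E + 2%:E * \int[P]_w (`|V w| ^+ 2)%:E)%E.
Proof.
move=> mU mV.
have mU2 : measurable_fun setT (fun w => `|U w| ^+ 2).
  by apply: measurable_funX; exact: measurable_vec_norm.
have mV2 : measurable_fun setT (fun w => `|V w| ^+ 2).
  by apply: measurable_funX; exact: measurable_vec_norm.
rewrite -!ge0_integralZlr// -ge0_integralD//; try by [move=> w _; rewrite lee_fin mulr_ge0// exprn_ge0|apply/measurable_EFinP; apply: measurable_funM].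
under [leRHS]eq_integral do rewrite -EFinD.
apply: ge0_le_integralr.
- by apply: measurable_funX; apply: measurable_vec_norm; exact: measurable_vecD.
- by apply: measurable_funD; apply: measurable_funM.
- move=> w; rewrite exprn_ge0//=; apply: le_trans (sqrD_le2 _ _).
  by rewrite lerXn2r ?nnegrE ?addr_ge0// ler_normD.
Qed.

Lemma L2dist_triangle U V Z : measurable_vec U -> measurable_vec V -> measurable_vec Z ->
  (L2dist P U Z <= 2%:E * L2dist P U V + 2%:E * L2dist P V Z)%E.
Proof.
move=> mU mV mZ; rewrite /L2dist.
have := L2_normD (measurable_vecB mU mV) (measurable_vecB mV mZ).
by under eq_integral do rewrite addrA subrK.
Qed.

Lemma L2dist_add U V U' V' : measurable_vec U -> measurable_vec V ->
  measurable_vec U' -> measurable_vec V' ->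
  (L2dist P (fun w => (U w + U' w)%R) (fun w => (V w + V' w)%R) <= 2%:E * L2dist P U V + 2%:E * L2dist P U' V')%E.
Proof.
move=> mU mV mU' mV'; rewrite /L2dist.
have := L2_normD (measurable_vecB mU mV) (measurable_vecB mU' mV').
by under eq_integral do rewrite addrACA -opprD.
Qed.

End L2_estimates.

Lemma cvg0_near_le {R : realType} {T : Type} (F : set_system T) {FF : Filter F} (u : T -> \bar R) (e : R) :
  0 < e -> u @ F --> 0%E -> \forall x \near F, (u x <= e%:E)%E.
Proof.
move=> e0 /fine_cvgP[fin cv].
have h : \forall x \near F, fine (u x) < e by apply: (cvgr_lt _ cv).
near=> x; have fx : u x \is a fin_num by near: x.
rewrite -(fineK fx) lee_fin; apply: ltW; near: x; exact: h.
Unshelve. all: by end_near. Qed.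

Section grid_approximation.
Context {R : realType} {dO : measure_display} {Omega : measurableType dO} {d : nat}.
Variable P : probability Omega R.
Local Notation mu := (@lebesgue_measure R).

(** One step function serves twice: it approximates the Wiener integral, and its distance to f in L2
    is what controls the telegraph integrals. It is any late term of the sequence that defines the
    Wiener integral. *)
Lemma wiener_grid (W : R -> Omega -> 'cV[R]_d) (f : R -> 'M[R]_d) (Z : Omega -> 'cV[R]_d) (e : R) :
  std_brownian_motion P W -> (forall i l, measurable_fun (time : set R) (fun x => f x i l)) ->
  wiener_integral P W f Z -> 0 < e ->
  exists s : @step_data R d, step_wf s /\ exists2 h0 : R, 0 < h0 & forall h, 0 < h <= h0 ->
    (L2dist P Z (step_integral (grid_step h s) W) <= e%:E)%E /\
    (\int[mu]_(x in time) (`|f x - rstep_fun (grid_step h s) x| ^+ 2)%:E <= e%:E)%E.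
Proof.
move=> hW mf [mZ [s_ [wf c1 c2]]] e0.
have e4 : 0 < e / 4 by rewrite divr_gt0.
have [k [h1 h2]] : exists k, (\int[mu]_(x in time) (`|f x - step_fun (s_ k) x| ^+ 2)%:E <= (e / 4)%:E)%E /\
    (L2dist P Z (step_integral (s_ k) W) <= (e / 4)%:E)%E.
  by near \oo => k; exists k; split; near: k; exact: cvg0_near_le.
have [a a0 ha] := step_rounding_kernel (wf k).
have [b b0 hb] := step_rounding_brownian hW (wf k).
exists (s_ k); split; first exact: wf.
exists (e / (4 * (a + b + 1))); first by rewrite divr_gt0// mulr_gt0// ltr_wpDl// addr_ge0.
move=> h /andP[hpos hle].
have hab : (a + b + 1) * h <= e / 4.
  have ab0 : 0 < a + b + 1 by rewrite ltr_wpDl// addr_ge0.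
  apply: (@le_trans _ _ ((a + b + 1) * (e / (4 * (a + b + 1))))); first by rewrite ler_wpM2l// ltW.
  by rewrite le_eqVlt; apply/orP; left; apply/eqP; field; rewrite gt_eqF.
have ah : a * h <= e / 4.
  by apply: le_trans hab; rewrite ler_wpM2r ?(ltW hpos)// -addrA lerDl addr_ge0.
have bh : b * h <= e / 4.
  by apply: le_trans hab; rewrite ler_wpM2r ?(ltW hpos)// addrAC lerDr addr_ge0.
have e4E : e = 4 * (e / 4) by field.
split.
  have := L2dist_triangle P mZ (measurable_step_integral hW (wf k)) (measurable_step_integral hW (grid_step_wf hpos (wf k))).
  move=> /le_trans; apply; rewrite [in leRHS]e4E; apply: (lee_twiceD h2).
  by apply: (le_trans (hb h hpos)); rewrite lee_fin.
have tm : measurable (time : set R) by rewrite /time; exact: measurable_itv.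
have m1 : measurable_fun (time : set R) (fun x => `|f x - step_fun (s_ k) x| ^+ 2).
  apply: measurable_funX; apply: measurable_mx_norm => i j; under eq_fun do rewrite !mxE.
  by apply: measurable_funB => //; apply: measurable_funTS; exact: measurable_step_fun.
have m2 : measurable_fun (time : set R) (fun x => `|step_fun (s_ k) x - rstep_fun (grid_step h (s_ k)) x| ^+ 2).
  apply: measurable_funX; apply: measurable_mx_norm => i j; under eq_fun do rewrite !mxE.
  by apply: measurable_funB; apply: measurable_funTS; [exact: measurable_step_fun|exact: measurable_rstep_fun].
have m3 : measurable_fun (time : set R) (fun x => `|f x - rstep_fun (grid_step h (s_ k)) x| ^+ 2).
  apply: measurable_funX; apply: measurable_mx_norm => i j; under eq_fun do rewrite !mxE.
  by apply: measurable_funB => //; apply: measurable_funTS; exact: measurable_rstep_fun.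
apply: (@le_trans _ _ (\int[mu]_(x in time) (2%:E * (`|f x - step_fun (s_ k) x| ^+ 2)%:E +
    2%:E * (`|step_fun (s_ k) x - rstep_fun (grid_step h (s_ k)) x| ^+ 2)%:E))%E).
  apply: ge0_le_integral => //.
  - exact/measurable_EFinP.
  - by apply: emeasurable_funD; apply: measurable_funeM; exact/measurable_EFinP.
  - move=> x _; rewrite -!EFinM -EFinD lee_fin; apply: le_trans (sqrD_le2 _ _).
    rewrite lerXn2r ?nnegrE ?addr_ge0//.
    by apply: le_trans (ler_normD _ _); rewrite addrA subrK.
rewrite ge0_integralD//; try by [move=> x _; rewrite -EFinM lee_fin mulr_ge0// exprn_ge0|apply: measurable_funeM; exact/measurable_EFinP].
rewrite !ge0_integralZl//; try by [move=> x _; rewrite lee_fin exprn_ge0|exact/measurable_EFinP].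
rewrite [in leRHS]e4E; apply: (lee_twiceD h1).
by apply: (le_trans (ha h hpos)); rewrite lee_fin.
Unshelve. all: by end_near. Qed.

(** The second moment of telegraph integrals acts as an isometry up to a constant, uniformly in n,
    so the error depends only on the L2 distance of the integrands. *)
Lemma noise_grid (n : nat) (theta : R -> Omega -> 'cV[R]_d) (f : R -> 'M[R]_d)
    (Z : Omega -> 'cV[R]_d) (s : @step_data R d) (h e : R) :
  (0 < n)%N -> kac_noise P n theta -> tame f -> noise_integral P theta f Z ->
  step_wf s -> 0 < h -> 0 < e ->
  (\int[mu]_(x in time) (`|f x - rstep_fun (grid_step h s) x| ^+ 2)%:E <= e%:E)%E ->
  let J w := \col_i grid_functional h s i
    (fun l q => \int[mu]_(x in `]q%:R * h, q.+1%:R * h]) (theta x w l 0)) in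
  measurable_vec J /\ (L2dist P Z J <= (2 * e + 2 * (@moment_const R d 2 * (2 * e)))%:E)%E.
Proof.
move=> n0 kY tf [mZ cZ] wf h0 e0 he J.
have tg := tame_rstep_fun (grid_step h s).
(* Beyond all rounded endpoints: from T0 on, the integral of the step function up to T no longer
   depends on T. *)
pose T0 : R := 1 + \sum_(p <- s) (grid_index h p.1.2)%:R * h.
have hT T : T0 <= T -> 0 < T /\ forall p, p \in s -> (grid_index h p.1.2)%:R * h <= T.
  move=> TT; have S0 : 0 <= \sum_(p <- s) (grid_index h p.1.2)%:R * h.
    by apply: sumr_ge0 => p _; rewrite mulr_ge0// ltW.
  split; first by apply: lt_le_trans TT; rewrite ltr_pwDl.
  move=> p ps; apply: le_trans TT; rewrite /T0 (big_rem p)//= addrCA lerDl addr_ge0//.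
  by apply: sumr_ge0 => q _; rewrite mulr_ge0// ltW.
have JE T : T0 <= T -> integral_upto (rstep_fun (grid_step h s)) theta T = J.
  move=> /hT[Tpos hp]; apply/funext => w; apply/colP => i.
  by rewrite (noise_grid_integral n0 kY i w h0 wf Tpos hp) mxE.
have [T [TT hTe]] : exists T, T0 <= T /\ (L2dist P Z (integral_upto f theta T) <= e%:E)%E.
  have [T [h1 h2]] := filter_ex (filterI (nbhs_pinfty_ge (num_real T0)) (cvg0_near_le e0 cZ)).
  by exists T.
have [Tpos _] := hT T TT.
have mJ : measurable_vec J by rewrite -(JE T TT); exact: (measurable_tame_integral n0 kY tg Tpos).
split => //.
have mI := measurable_tame_integral n0 kY tf Tpos.
apply: (le_trans (L2dist_triangle P mZ mI mJ)); rewrite [leRHS]EFinD.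
apply: leeD; first by rewrite [leRHS]EFinM; exact: lee_wpmul2l.
rewrite [leRHS]EFinM; apply: lee_wpmul2l => //.
rewrite /L2dist -(JE T TT).
under eq_integral do rewrite -(integral_uptoB n0 kY _ tf tg Tpos).
(* The energy is at most e, and 2 e provides the strict inequality that the moment bound asks
   for. *)
have r0 : 0 < Num.sqrt (2 * e) by rewrite sqrtr_gt0 mulr_gt0.
have r2 : Num.sqrt (2 * e) ^+ 2 = 2 * e by rewrite sqr_sqrtr// mulr_ge0// ltW.
have tH := tameB tf tg.
have := tame_moment n0 kY tH Tpos (isT : (0 < 2)%N) r0.
rewrite r2 => -[]// i l.
apply: (@le_lt_trans _ _ e); last by lra.
have fin := @integrable_fin_num _ _ _ mu _ (measurable_itv `]0, T]) _ (tame_sqr_integrable T i l tH).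
rewrite -lee_fin /Rintegral fineK//; apply: le_trans he.
have tm : measurable (time : set R) by rewrite /time; exact: measurable_itv.
have [mH _ _] := tH.
apply: (@le_trans _ _ (\int[mu]_(x in time) (((f x - rstep_fun (grid_step h s) x) i l) ^+ 2)%:E)%E).
  apply: ge0_subset_integral => //; try exact: measurable_itv.
  - by apply/measurable_EFinP; apply: measurable_funX; exact: mH.
  - by move=> x _; rewrite lee_fin sqr_ge0.
  - by move=> x /=; rewrite /time/= !in_itv/= => /andP[/ltW ->].
apply: ge0_le_integral => //.
- by move=> x _; rewrite lee_fin sqr_ge0.
- by apply/measurable_EFinP; apply: measurable_funX; exact: mH.
- by apply/measurable_EFinP; apply: measurable_funX; apply: measurable_mx_norm => i' j'; exact: mH.
- move=> x _; rewrite lee_fin -real_normK ?num_real// lerXn2r ?nnegrE//.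
  exact: mx_entry_le.
Qed.

End grid_approximation.

Lemma integrableZl_itv {R : realType} (f : R -> R) (a b c : R) :
  (@lebesgue_measure R).-integrable `]a, b] (EFin \o f) ->
  (@lebesgue_measure R).-integrable `]a, b] (EFin \o (fun x => c * f x)).
Proof.
move=> iF; have : (@lebesgue_measure R).-integrable `]a, b] (fun x => c%:E * (EFin \o f) x)%E.
  exact: integrableZl.
by apply: eq_integrable.
Qed.

Section kernel_L2.
Context {R : realType} {d : nat}.
Variables (D A1 A2 : 'M[R]_d).
Hypotheses (hD0 : 0 < lambda_min D) (hD1 : lambda_max D < 1).
Local Notation mu := (@lebesgue_measure R).
Local Notation G := (ofbm_kernel D A1 A2).

Lemma measurable_kernel c t i l : measurable_fun (time : set R) (fun x => G c t x i l).
Proof.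
rewrite (_ : time = [set 0] `|` `]0, +oo[); last first.
  apply/seteqP; split=> x; rewrite /time/= !in_itv/= !andbT.
    by rewrite le_eqVlt => /orP[/eqP <-|]; [left|right].
  by move=> [->|/ltW].
apply/measurable_funU => //; split; first exact: measurable_fun_set1.
apply: open_continuous_measurable_fun; first exact: interval_open.
move=> x; rewrite inE/= in_itv/= andbT => x0.
exact: (@continuous_kernel _ _ D A1 A2 c t x i l x0).
Qed.

Lemma tame_kernel c t : 0 <= t <= 1 -> tame (G c t).
Proof.
move=> /andP[t0 t1].
have [C [al [b [q [C0 al1 b1 q0 H]]]]] := kernel_holder A1 A2 hD0 hD1.
(* The Hoelder bound against time 0, where the kernel vanishes, bounds the kernel itself. *)
have bd i l x : 0 < x -> `|G c t x i l| <= C * envelope al b x.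
  move=> x0; have e0 : 0 <= C * envelope al b x by rewrite mulr_ge0// ltW// envelope_gt0.
  have [->|tn0] := eqVneq t 0; first by rewrite kernel_at0 mxE normr0.
  have t00 : 0 < t by rewrite lt_neqAle eq_sym tn0.
  have := H c 0 t x i l _ _ _ x0; rewrite kernel_at0 mxE !subr0.
  rewrite lexx ler01 t0 t1 eq_sym tn0 => /(_ isT isT isT) /le_trans; apply.
  rewrite ler_pM2r ?envelope_gt0// ler_piMr ?(ltW C0)//.
  by rewrite (ger0_norm t0) -[leRHS](pw_one (q%:R^-1)) ler_pw// invr_ge0.
split.
- by move=> i l; exact: measurable_kernel.
- move=> i l x x0; apply: cvg_at_right_filter.
  exact: (@continuous_kernel _ _ D A1 A2 c t x i l x0).
exists (fun x => C * envelope al b x), (fun x => C ^+ 2 * envelope al b x ^+ 2); split.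
- exact: bd.
- move=> i l x x0; rewrite -real_normK ?num_real// -exprMn lerXn2r ?nnegrE//.
    by rewrite mulr_ge0// ltW// envelope_gt0.
  exact: bd.
- by move=> x y xy; rewrite ler_pM2l// envelope_ni.
- move=> x y xy; rewrite ler_pM2l ?exprn_gt0// lerXn2r ?nnegrE ?(ltW (envelope_gt0 _ _ _))//.
  exact: envelope_ni.
- move=> T; have [i2 i1] := envelope_integrable al1 b1 T; split.
    exact: integrableZl_itv.
  exact: (integrableZl_itv _ i2).
Qed.

Lemma kernel_L2_holder : exists (C : R) (q : nat), [/\ 0 < C, (0 < q)%N &
  forall c s t T i l, 0 <= s <= 1 -> 0 <= t <= 1 -> s != t ->
    \int[mu]_(x in `]0, T]) ((G c t x - G c s x) i l ^+ 2) < (C * pw (q%:R^-1) `|t - s|) ^+ 2].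
Proof.
have [C [al [b [q [C0 al1 b1 q0 H]]]]] := kernel_holder A1 A2 hD0 hD1.
have [CQ hCQ] := envelope_sqr_integral al1 b1.
have CQ0 : 0 <= CQ.
  by rewrite -lee_fin; apply: le_trans hCQ; apply: integral_ge0 => x _; rewrite lee_fin sqr_ge0.
(* The added 1 makes the bound strict, as the moment estimate for telegraph integrals requires. *)
exists (C * Num.sqrt (CQ + 1)), q; split => //.
  by rewrite mulr_gt0// sqrtr_gt0 ltr_wpDl.
move=> c s t T i l hs ht st.
have p0 := pw_gt0 (q%:R^-1) `|t - s|; set p := pw _ _ in p0 *.
have iE := (envelope_integrable al1 b1 T).1.
have tH := tameB (tame_kernel c ht) (tame_kernel c hs).
apply: (@le_lt_trans _ _ (\int[mu]_(x in `]0, T]) ((C * p) ^+ 2 * envelope al b x ^+ 2))).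
  apply: le_Rintegral => //.
  - exact: tame_sqr_integrable tH.
  - exact: (integrableZl_itv _ iE).
  - move=> x; rewrite /= in_itv/= => /andP[x0 _].
    rewrite -real_normK ?num_real// -exprMn lerXn2r ?nnegrE//.
      by rewrite !mulr_ge0 ?(ltW C0) ?(ltW p0) ?(ltW (envelope_gt0 _ _ _)).
    by rewrite !mxE; exact: H.
rewrite RintegralZl//.
have le : \int[mu]_(x in `]0, T]) (envelope al b x ^+ 2) <= CQ.
  rewrite -lee_fin /Rintegral fineK; last exact: (integrable_fin_num _ iE).
  apply: le_trans hCQ; apply: ge0_subset_integral => //; try exact: measurable_itv.
  - by apply/measurable_EFinP; apply: measurable_funTS; apply: measurable_funX; exact: measurable_envelope.
  - by move=> x _; rewrite lee_fin sqr_ge0.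
  - by move=> x /=; rewrite !in_itv/= => /andP[->].
have -> : (C * Num.sqrt (CQ + 1) * p) ^+ 2 = (C * p) ^+ 2 * (CQ + 1).
  by rewrite mulrAC exprMn sqr_sqrtr// addr_ge0.
rewrite ltr_pM2l ?exprn_gt0 ?mulr_gt0//.
by apply: (le_lt_trans le); rewrite ltrDl.
Qed.

End kernel_L2.

Section noise_increment_moments.
Context {R : realType} {dO : measure_display} {Omega : measurableType dO} {d : nat}.
Variable Q : probability Omega R.
Variables (n : nat) (theta : R -> Omega -> 'cV[R]_d).
Hypotheses (n0 : (0 < n)%N) (kY : kac_noise Q n theta).
Local Notation mu := (@lebesgue_measure R).

(** The integrals over the half-line are limits in L2 only; higher moments follow from the bounds on
    [0, T], uniform in T, coordinate by coordinate through [L2_moment_le]. *)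
Lemma noise_integral_difference_moment (f g : R -> 'M[R]_d) (Z Z' : Omega -> 'cV[R]_d) (k : nat) (r : R) :
  tame f -> tame g -> noise_integral Q theta f Z -> noise_integral Q theta g Z' ->
  (0 < k)%N -> 0 < r ->
  (forall T i l, \int[mu]_(x in `]0, T]) ((f x - g x) i l ^+ 2) < r ^+ 2) ->
  (\int[Q]_w (`|Z w - Z' w| ^+ k)%:E <= (d%:R * (@moment_const R d k * r ^+ k))%:E)%E.
Proof.
move=> tf tg [mZ cZ] [mZ' cZ'] k0 r0 hr.
have mi i : measurable_fun setT (fun w => (Z w - Z' w) i 0) by exact: measurable_vecB.
have mik i : measurable_fun setT (fun w => `|(Z w - Z' w) i 0| ^+ k).
  by apply: measurable_funX; exact: measurableT_comp.
apply: (@le_trans _ _ (\int[Q]_w (\sum_i `|(Z w - Z' w) i 0| ^+ k)%:E)%E).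
  apply: ge0_le_integralr.
  - by apply: measurable_funX; apply: measurable_vec_norm; exact: measurable_vecB.
  - exact: measurable_sum.
  - by move=> w; rewrite exprn_ge0//=; exact: mx_normX_le_sum.
rewrite ge0_integral_sumr//.
apply: (@le_trans _ _ (\sum_(i < d) (@moment_const R d k * r ^+ k)%:E)%E); last first.
  by rewrite sumEFin lee_fin sumr_const card_ord -[leLHS]mulr_natl.
apply: lee_sum => i _; apply: L2_moment_le => // e e0.
have e4 : 0 < e ^+ 2 / 4 by rewrite divr_gt0// exprn_gt0.
have [T [[h1 h2] T0]] := filter_ex (filterI (filterI (cvg0_near_le e4 cZ) (cvg0_near_le e4 cZ'))
  (nbhs_pinfty_gt (num_real 0))).
have tH := tameB tf tg.
have [mI hI] := tame_moment n0 kY tH T0 k0 r0 (hr T).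
have mf := measurable_tame_integral n0 kY tf T0.
have mg := measurable_tame_integral n0 kY tg T0.
exists (fun w => integral_upto (fun x => f x - g x) theta T w i 0); split; first exact: mI.
- apply: (@le_trans _ _ (\int[Q]_w (`|(Z w - integral_upto f theta T w) + (integral_upto g theta T w - Z' w)| ^+ 2)%:E)%E).
    apply: ge0_le_integralr.
    + by apply: measurable_funX; apply: measurableT_comp => //; apply: measurable_funB.
    + apply: measurable_funX; apply: measurable_vec_norm.
      by apply: measurable_vecD; exact: measurable_vecB.
    + move=> w; rewrite exprn_ge0//= lerXn2r ?nnegrE//.
      rewrite (integral_uptoB n0 kY w tf tg T0).
      apply: le_trans (mx_entry_le _ i 0); rewrite le_eqVlt; apply/orP; left; apply/eqP; congr (`|_|).
      by rewrite !mxE; ring.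
  apply: (le_trans (L2_normD Q (measurable_vecB mZ mf) (measurable_vecB mg mZ'))).
  rewrite (_ : e ^+ 2 = 4 * (e ^+ 2 / 4)); last by field.
  have h2' : (\int[Q]_w (`|integral_upto g theta T w - Z' w| ^+ 2)%:E <= (e ^+ 2 / 4)%:E)%E.
    by apply: le_trans h2; rewrite /L2dist; under eq_integral do rewrite -normrN opprB.
  exact: (lee_twiceD h1 h2').
apply: le_trans hI; apply: ge0_le_integralr.
- by apply: measurable_funX; exact: measurableT_comp.
- by apply: measurable_funX; exact: measurable_vec_norm.
- by move=> w; rewrite exprn_ge0//= lerXn2r ?nnegrE//; exact: mx_entry_le.
Qed.

End noise_increment_moments.

(** * Finite-dimensional convergence and conclusion *)

Section vector_functionals.
Context {R : realType} {d : nat}.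
Variables (i0 : 'I_d) (M : nat).
Variables (Phi : (nat -> 'cV[R]_d) -> R) (K B : R).
Hypotheses (K0 : 0 <= K) (PhiB : forall v, `|Phi v| <= B)
  (PhiL : forall v v' e, 0 <= e ->
    (forall k, (k <= M)%N -> `|v k - v' k| <= e) -> `|Phi v - Phi v'| <= K * e).

Lemma Phi_ext v v' : (forall k, (k <= M)%N -> v k = v' k) -> Phi v = Phi v'.
Proof.
move=> vv; apply/eqP; rewrite -subr_eq0 -normr_le0.
have := @PhiL v v' 0 (lexx _); rewrite mulr0; apply.
by move=> k kM; rewrite (vv k kM) subrr normr0.
Qed.

Lemma nth_seq_dist (u u' : seq R) j : size u = size u' ->
  `|nth 0 u j - nth 0 u' j| <= seq_dist u u'.
Proof.
elim: u u' j => [|x u IH] [|y u'] j //=; first by rewrite nth_nil subrr normr0 seq_dist_refl.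
move=> [su]; rewrite seq_dist_cons; case: j => [|j] /=.
  by rewrite lerDl /seq_dist sumr_ge0.
by apply: (le_trans (IH _ _ su)); rewrite lerDr.
Qed.

Context {dO : measure_display} {Omega : measurableType dO}.

(** The M + 1 vectors on which Phi depends are laid out as one list of reals, which reduces the
    claim to Lipschitz functionals of lists. *)
Lemma measurable_Phi (V : nat -> Omega -> 'cV[R]_d) : (forall k, measurable_vec (V k)) ->
  measurable_fun setT (fun w => Phi (fun k => V k w)).
Proof.
move=> mV; have d0 : (0 < d)%N by apply: leq_ltn_trans (ltn_ord i0).
pose co j : 'I_d := insubd i0 (j %% d)%N.
have coE (k : nat) (i : 'I_d) : co (k * d + i)%N = i.
  by apply/val_inj; rewrite /co val_insubd modnMDl modn_small// ltn_ord.
pose F (u : seq R) := Phi (fun k => \col_i nth 0 u (k * d + i)%N).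
have FL : seq_lipschitz (M.+1 * d) K F.
  move=> u u' su su'; apply: PhiL; first by rewrite /seq_dist sumr_ge0.
  move=> k kM; apply: mx_norm_le; first by rewrite /seq_dist sumr_ge0.
  by move=> i j; rewrite !mxE; apply: nth_seq_dist; rewrite su su'.
pose X j w := V (j %/ d)%N w (co j) 0.
have := @seq_lipschitz_measurable R _ Omega X (M.+1 * d) 0 K F K0 (fun j => mV _ _) FL.
apply: eq_measurable_fun => w _; apply: Phi_ext => k kM; apply/colP => i; rewrite mxE.
have kd : (k * d + i < M.+1 * d)%N.
  by apply: (@leq_trans (k.+1 * d)); [rewrite mulSn addnC ltn_add2r|rewrite leq_mul2r ltnS kM orbT].
rewrite (nth_map 0%N) ?size_iota// nth_iota// add0n /X coE divnMDl// divn_small ?addn0//.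
Qed.

(** All times are compared at once through the sum D of the distances, whose mean square is at most
    (M + 1)^4 e^2. *)
Lemma Phi_L2 (P : probability Omega R) (V J : nat -> Omega -> 'cV[R]_d) (e : R) : 0 < e ->
  (forall k, measurable_vec (V k)) -> (forall k, measurable_vec (J k)) ->
  (forall k, (k <= M)%N -> (L2dist P (V k) (J k) <= (e ^+ 2)%:E)%E) ->
  `|\int[P]_w Phi (fun k => V k w) - \int[P]_w Phi (fun k => J k w)| <= K * (M.+1%:R ^+ 2 * e).
Proof.
move=> e0 mV mJ he.
have M0 : 1 <= M.+1%:R :> R by rewrite ler1n.
pose D w := \sum_(k < M.+1) `|V k w - J k w|.
have mD k : measurable_fun setT (fun w => `|V k w - J k w|).
  by apply: measurable_vec_norm; exact: measurable_vecB.
have D0 w : 0 <= D w by apply: sumr_ge0.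
apply: (@Rintegral_dist_L2 _ _ _ P B B K _ _ _ D) => //.
- by rewrite mulr_gt0// exprn_gt0// ltr0n.
- exact: measurable_Phi.
- exact: measurable_Phi.
- exact: measurable_sum.
- move=> w; apply: PhiL => // k kM; rewrite (ger0_norm (D0 w)).
  have kM' : (k < M.+1)%N by [].
  by rewrite /D (bigD1 (Ordinal kM'))//= lerDl sumr_ge0.
have mDk k : measurable_fun setT (fun w => `|V k w - J k w| ^+ 2) by exact: measurable_funX.
apply: (@le_trans _ _ (\int[P]_w (M.+1%:R ^+ 2 * \sum_(k < M.+1) `|V k w - J k w| ^+ 2)%:E)%E).
  apply: ge0_le_integralr.
  - by apply: measurable_funX; apply: measurableT_comp => //; exact: measurable_sum.
  - by apply: measurable_funM => //; apply: measurable_sum.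
  - move=> w; rewrite exprn_ge0//=; apply: (le_trans (norm_sum_expn_le _ _ (isT : (0 < 2)%N))).
    rewrite /index_enum -enumT size_enum_ord le_eqVlt; apply/orP; left; apply/eqP; congr (_ * _).
    by apply: eq_bigr => k _; rewrite ger0_norm.
rewrite ge0_integralZlr ?exprn_ge0//; last 2 first.
- exact: measurable_sum.
- by move=> w; apply: sumr_ge0 => k _; rewrite exprn_ge0.
rewrite ge0_integral_sumr//.
apply: (@le_trans _ _ ((M.+1%:R ^+ 2)%:E * \sum_(k < M.+1) (e ^+ 2)%:E)%E).
  apply: lee_wpmul2l; first by rewrite lee_fin exprn_ge0.
  by apply: lee_sum => k _; apply: he; rewrite -ltnS.
rewrite sumEFin sumr_const card_ord -EFinM lee_fin (_ : e ^+ 2 *+ M.+1 = M.+1%:R * e ^+ 2); last by rewrite mulr_natl.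
rewrite exprMn mulrA ler_pM2r ?exprn_gt0// [leRHS]expr2 ler_pM2l ?exprn_gt0 ?ltr0n//.
by rewrite expr2 ler_peMl// ler0n.
Qed.

End vector_functionals.

Section grid_values.
Context {R : realType} {d : nat}.
Variables (i0 : 'I_d) (h : R) (N : nat).
Local Notation D := (#|{: bool * 'I_d}|).

Lemma grid_functional_ext (s : @step_data R d) (i : 'I_d) (v v' : 'I_d -> nat -> R) :
  (forall p, p \in s -> (grid_index h p.1.2 <= N)%N) ->
  (forall l q, (q < N)%N -> v l q = v' l q) ->
  grid_functional h s i v = grid_functional h s i v'.
Proof.
move=> sN vv; rewrite /grid_functional big_seq [RHS]big_seq; apply: eq_bigr => p ps.
apply: eq_bigr => l _; congr (_ * _); rewrite big_nat [RHS]big_nat.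
apply: eq_bigr => q /andP[_ qg]; apply: vv; exact: leq_trans qg (sN p ps).
Qed.

(** Rebuilds the value of the process at one time from the list of all cell values: position rank N
    + q holds cell q of the coordinate with that rank. *)
Definition grid_value (s : bool -> @step_data R d) (u : seq R) : 'cV[R]_d :=
  \col_i \sum_c grid_functional h (s c) i
    (fun l q => nth 0 u (enum_rank (c, l) * N + q)%N).

Lemma grid_valueE (s : bool -> @step_data R d) (E : nat -> R) :
  (forall c p, p \in s c -> (grid_index h p.1.2 <= N)%N) ->
  grid_value s [seq E i | i <- iota 0 (D * N)] =
  \col_i \sum_c grid_functional h (s c) i (fun l q => E (enum_rank (c, l) * N + q)%N).
Proof.
move=> sN; apply/colP => i; rewrite !mxE; apply: eq_bigr => c _.
apply: (grid_functional_ext _ (sN c)) => l q qN.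
have rD := ltn_ord (enum_rank (c, l)).
have lt : (enum_rank (c, l) * N + q < D * N)%N.
  by apply: (@leq_trans ((enum_rank (c, l)).+1 * N)); [rewrite mulSn addnC ltn_add2r|rewrite leq_mul2r rD orbT].
by rewrite (nth_map 0%N) ?size_iota// nth_iota.
Qed.

Lemma grid_value_lipschitz (s : bool -> @step_data R d) : exists2 L, 0 <= L &
  forall u u', size u = size u' -> `|grid_value s u - grid_value s u'| <= L * seq_dist u u'.
Proof.
pose L : R := \sum_i \sum_c \sum_(p <- s c) \sum_l \sum_(grid_index h p.1.1 <= q < grid_index h p.1.2) `|p.2 i l|.
have L0 : 0 <= L by rewrite /L; do 5 (apply: sumr_ge0 => ? _).
exists L => // u u' su; have S0 : 0 <= seq_dist u u' by rewrite /seq_dist sumr_ge0.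
apply: mx_norm_le; first by rewrite mulr_ge0.
move=> i j; rewrite !mxE -sumrB.
apply: (@le_trans _ _ ((\sum_c \sum_(p <- s c) \sum_l \sum_(grid_index h p.1.1 <= q < grid_index h p.1.2) `|p.2 i l|) * seq_dist u u')); last first.
  rewrite ler_wpM2r// /L (bigD1 i)//= lerDl; apply: sumr_ge0 => ? _.
  by do 4 (apply: sumr_ge0 => ? _).
rewrite mulr_suml; apply: (le_trans (ler_norm_sum _ _ _)); apply: ler_sum => c _.
rewrite /grid_functional -sumrB mulr_suml; apply: (le_trans (ler_norm_sum _ _ _)); apply: ler_sum => p _.
rewrite -sumrB mulr_suml; apply: (le_trans (ler_norm_sum _ _ _)); apply: ler_sum => l _.
rewrite -mulrBr -sumrB mulr_sumr mulr_suml; apply: (le_trans (ler_norm_sum _ _ _)); apply: ler_sum => q _.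
by rewrite normrM ler_wpM2l//; exact: nth_seq_dist.
Qed.

Lemma grid_value_brownian {dO} {Omega : measurableType dO} (W : bool -> R -> Omega -> 'cV[R]_d)
    (s : bool -> @step_data R d) w : 0 < h -> (0 < N)%N ->
  (forall c, step_wf (s c)) -> (forall c p, p \in s c -> (grid_index h p.1.2 <= N)%N) ->
  grid_value s [seq grid_increment i0 h N W i w | i <- iota 0 (D * N)] =
  step_integral (grid_step h (s true)) (W true) w + step_integral (grid_step h (s false)) (W false) w.
Proof.
move=> h0 N0 wf sN; rewrite (grid_valueE (fun i => grid_increment i0 h N W i w) sN).
apply/colP => i; rewrite !mxE big_bool /=.
rewrite !grid_functional_step_integral//; congr (_ + _); apply: (grid_functional_ext _ (sN _)) => l q qN.
- by rewrite /grid_increment modnMDl modn_small// divnMDl// divn_small// addn0 coord_ofK.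
- by rewrite /grid_increment modnMDl modn_small// divnMDl// divn_small// addn0 coord_ofK.
Qed.

Lemma grid_value_noise {dO} {Omega : measurableType dO} (Y : bool -> R -> Omega -> 'cV[R]_d)
    (s : bool -> @step_data R d) w : (0 < N)%N ->
  (forall c p, p \in s c -> (grid_index h p.1.2 <= N)%N) ->
  let J c w := \col_i grid_functional h (s c) i
    (fun l q => \int[@lebesgue_measure R]_(x in `]q%:R * h, q.+1%:R * h]) (Y c x w l 0)) in
  grid_value s [seq grid_integral i0 Y h N i w | i <- iota 0 (D * N)] = J true w + J false w.
Proof.
move=> N0 sN J; rewrite (grid_valueE (fun i => grid_integral i0 Y h N i w) sN).
apply/colP => i; rewrite !mxE big_bool /=; congr (_ + _); apply: (grid_functional_ext _ (sN _)) => l q qN.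
- by rewrite /grid_integral modnMDl modn_small// divnMDl// divn_small// addn0 coord_ofK.
- by rewrite /grid_integral modnMDl modn_small// divnMDl// divn_small// addn0 coord_ofK.
Qed.

End grid_values.

Section versions.
Context {R : realType} {d : nat}.
Context {dO : measure_display} {Omega : measurableType dO}.
Variables (P : probability Omega R) (X : R -> Omega -> 'cV[R]_d)
  (Xc : {RV P >-> borel (Cspace R d)}).
Hypothesis hXc : continuous_version X Xc.

Lemma measurable_ev (t : R) : measurable_vec (fun w => ev (Xc w) t).
Proof. by move=> i; exact: (measurableT_comp (ev_coord_measurable t i)). Qed.

Lemma version_ae (t : R) : 0 <= t <= 1 -> {ae P, forall w, ev (Xc w) t = X t w}.
Proof.
by move=> t01; have := hXc (unit_pt t); rewrite val_unit_pt.
Qed.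

Lemma version_L2dist (t : R) (U : Omega -> 'cV[R]_d) : 0 <= t <= 1 ->
  measurable_vec (X t) -> measurable_vec U ->
  L2dist P (fun w => ev (Xc w) t) U = L2dist P (X t) U.
Proof.
move=> t01 mX mU; apply: ae_eq_integral => //.
- apply/measurable_EFinP; apply: measurable_funX; apply: measurable_vec_norm.
  by apply: measurable_vecB => //; exact: measurable_ev.
- apply/measurable_EFinP; apply: measurable_funX; apply: measurable_vec_norm.
  exact: measurable_vecB.
- by apply: filterS (version_ae t01) => w -> _.
Qed.

End versions.

Section approx_moments.
Context {R : realType} {d : nat}.
Variables (D A1 A2 : 'M[R]_d).
Hypotheses (hD0 : 0 < lambda_min D) (hD1 : lambda_max D < 1).

(** The choice p = 2 q turns the L2 Hoelder exponent 1 / q of the kernels into the square of t - s.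
    The constants come from the kernels alone, hence are the same for all n. *)
Lemma approx_moment : exists p C, [/\ (0 < p)%N, 0 <= C &
  forall (dO : measure_display) (Omega : measurableType dO) (Q : probability Omega R)
    (n : nat) (theta theta' : R -> Omega -> 'cV[R]_d) X (Xc : {RV Q >-> borel (Cspace R d)}),
  (0 < n)%N -> kac_noise Q n theta -> kac_noise Q n theta' ->
  ofbm_approx Q D A1 A2 theta theta' X -> continuous_version X Xc ->
  forall s t, 0 <= s <= 1 -> 0 <= t <= 1 ->
    (\int[Q]_w (`|ev (Xc w) t - ev (Xc w) s| ^+ p)%:E <= (C * (t - s) ^+ 2)%:E)%E].
Proof.
have [C [q [C0 q0 H]]] := kernel_L2_holder A1 A2 hD0 hD1.
pose p := (2 * q)%N; have p0 : (0 < p)%N by rewrite muln_gt0.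
have mc0 : 0 <= @moment_const R d p.
  by rewrite /moment_const !mulr_ge0// ?exprn_ge0// expR_ge0.
pose c0 := d%:R * (@moment_const R d p * C ^+ p).
have c00 : 0 <= c0 by rewrite /c0 !mulr_ge0// exprn_ge0// ltW.
exists p, (2 ^+ p * (c0 + c0)); split => //.
  by rewrite mulr_ge0 ?exprn_ge0// addr_ge0.
move=> dO Omega Q n theta theta' X Xc n0 kY kY' hX hXc s t hs ht.
have [<-|st] := eqVneq s t.
  under eq_integral do rewrite subrr normr0 expr0n (gtn_eqF p0).
  by rewrite integral0 subrr expr0n mulr0.
have [Y1 [Y2 [i1 i2 Xt]]] := hX t ht.
have [Z1 [Z2 [j1 j2 Xs]]] := hX s hs.
have r0 : 0 < C * pw (q%:R^-1) `|t - s| by rewrite mulr_gt0// pw_gt0.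
have B1 := noise_integral_difference_moment n0 kY (tame_kernel A1 A2 hD0 hD1 true ht)
  (tame_kernel A1 A2 hD0 hD1 true hs) i1 j1 p0 r0 (fun T i l => H true s t T i l hs ht st).
have B2 := noise_integral_difference_moment n0 kY' (tame_kernel A1 A2 hD0 hD1 false ht)
  (tame_kernel A1 A2 hD0 hD1 false hs) i2 j2 p0 r0 (fun T i l => H false s t T i l hs ht st).
have rp : (C * pw (q%:R^-1) `|t - s|) ^+ p = C ^+ p * (t - s) ^+ 2.
  have ts : 0 < `|t - s| by rewrite normr_gt0 subr_eq0 eq_sym.
  rewrite exprMn pwX /p natrM -mulrA mulfV ?pnatr_eq0 -?lt0n// mulr1.
  rewrite (_ : 2 = 1 + 1)// pwD pw1// -[(t - s) ^+ _]real_normK ?num_real//.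
move: B1 B2; rewrite rp.
rewrite (_ : d%:R * _ = c0 * (t - s) ^+ 2); last by rewrite /c0; ring.
move=> B1 B2; have [mY1 _] := i1; have [mY2 _] := i2; have [mZ1 _] := j1; have [mZ2 _] := j2.
have mXt : measurable_vec (X t) by rewrite Xt; exact: measurable_vecD.
have mXs : measurable_vec (X s) by rewrite Xs; exact: measurable_vecD.
have m1 : measurable_fun setT (fun w => `|Y1 w - Z1 w| ^+ p).
  by apply: measurable_funX; apply: measurable_vec_norm; exact: measurable_vecB.
have m2 : measurable_fun setT (fun w => `|Y2 w - Z2 w| ^+ p).
  by apply: measurable_funX; apply: measurable_vec_norm; exact: measurable_vecB.
apply: (@le_trans _ _ (\int[Q]_w (`|X t w - X s w| ^+ p)%:E)%E).
  rewrite le_eqVlt; apply/orP; left; apply/eqP; apply: ae_eq_integral => //.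
  - apply/measurable_EFinP; apply: measurable_funX; apply: measurable_vec_norm.
    by apply: measurable_vecB; exact: measurable_ev.
  - apply/measurable_EFinP; apply: measurable_funX; apply: measurable_vec_norm.
    exact: measurable_vecB.
  - by apply: filterS2 (version_ae hXc ht) (version_ae hXc hs) => w -> -> _.
apply: (@le_trans _ _ (\int[Q]_w (2 ^+ p * (`|Y1 w - Z1 w| ^+ p + `|Y2 w - Z2 w| ^+ p))%:E)%E).
  apply: ge0_le_integralr.
  - by apply: measurable_funX; apply: measurable_vec_norm; exact: measurable_vecB.
  - by apply: measurable_funM => //; exact: measurable_funD.
  - move=> w; rewrite exprn_ge0//= Xt Xs opprD addrACA.
    apply: (@le_trans _ _ (`|(`|Y1 w - Z1 w| + `|Y2 w - Z2 w|)| ^+ p)).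
      rewrite lerXn2r ?nnegrE//; apply: le_trans (ler_norm _); exact: ler_normD.
    by apply: (le_trans (normD_expn_le _ _ _)); rewrite (ger0_norm (normr_ge0 _)) (ger0_norm (normr_ge0 _)).
have m12 : measurable_fun setT (fun w => `|Y1 w - Z1 w| ^+ p + `|Y2 w - Z2 w| ^+ p).
  exact: measurable_funD.
rewrite ge0_integralZlr ?exprn_ge0//.
rewrite -mulrA EFinM; apply: lee_wpmul2l; first by rewrite lee_fin exprn_ge0.
under eq_integral do rewrite EFinD.
rewrite ge0_integralD//; try by [move=> w _; rewrite lee_fin exprn_ge0|exact/measurable_EFinP].
by rewrite mulrDl EFinD; exact: leeD.
Qed.

End approx_moments.

Lemma exists_lower_bound {R : realType} (M : nat) (f : nat -> bool -> R) : (forall k c, 0 < f k c) ->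
  exists2 h, 0 < h & forall k c, (k <= M)%N -> h <= f k c.
Proof.
move=> f0; elim: M => [|M [h h0 hM]].
  exists (Num.min (f 0%N true) (f 0%N false)); first by rewrite lt_min !f0.
  by move=> k c; rewrite leqn0 => /eqP ->; case: c; rewrite ge_min lexx ?orbT.
exists (Num.min h (Num.min (f M.+1 true) (f M.+1 false))); first by rewrite !lt_min h0 !f0.
move=> k c; rewrite leq_eqVlt => /orP[/eqP ->|kM].
  by case: c; rewrite !ge_min lexx ?orbT.
by rewrite ge_min hM.
Qed.

Lemma exists_upper_bound (M : nat) (f : nat -> bool -> nat) :
  exists2 N, (0 < N)%N & forall k c, (k <= M)%N -> (f k c <= N)%N.
Proof.
elim: M => [|M [N N0 hM]].
  exists (f 0%N true + f 0%N false).+1 => // k c.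
  by rewrite leqn0 => /eqP ->; case: c; lia.
exists (N + (f M.+1 true + f M.+1 false))%N; first by lia.
move=> k c; rewrite leq_eqVlt => /orP[/eqP ->|kM]; first by case: c; lia.
by have := hM k c kM; lia.
Qed.

Lemma dist3_le {R : realFieldType} (a b c a' b' e : R) : b = c -> `|a' - c| <= e / 3 ->
  `|a - b| <= e / 3 -> `|b' - a'| <= e / 3 -> `|a - b'| <= e.
Proof.
move=> -> h2 h1 h3; have -> : a - b' = (a - c) - (a' - c) - (b' - a') by ring.
apply: (le_trans (ler_normB _ _)); apply: (@le_trans _ _ (e / 3 + e / 3 + e / 3)); last by lra.
by apply: lerD => //; apply: (le_trans (ler_normB _ _)); exact: lerD.
Qed.

Section finite_dimensional.
Context {R : realType} {d : nat}.
Variables (i0 : 'I_d) (D A1 A2 : 'M[R]_d).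
Hypotheses (hD0 : 0 < lambda_min D) (hD1 : lambda_max D < 1).
Context {dO : measure_display} {Omega : measurableType dO}.
Variables (P : probability Omega R) (W : bool -> R -> Omega -> 'cV[R]_d).
Hypotheses (hW : forall c, std_brownian_motion P (W c))
  (iW : independent_processes P (W true) (W false)).
Variables (X : R -> Omega -> 'cV[R]_d) (Xc : {RV P >-> borel (Cspace R d)}).
Hypotheses (hX : ofbm P D A1 A2 (W true) (W false) X) (hXc : continuous_version X Xc).
Variables (m : nat) (Phi : (nat -> 'cV[R]_d) -> R) (K B : R).
Hypotheses (K0 : 0 <= K) (PhiB : forall v, `|Phi v| <= B)
  (PhiL : forall v v' e, 0 <= e ->
    (forall k, (k <= 2 ^ m)%N -> `|v k - v' k| <= e) -> `|Phi v - Phi v'| <= K * e).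
Local Notation mu := (@lebesgue_measure R).
Local Notation G := (ofbm_kernel D A1 A2).
Local Notation DN := (#|{: bool * 'I_d}|).

(** Indices are cut off at 2 ^ m, so that facts about times in [0, 1] hold for every k. *)
Let t (k : nat) : R := dyadic m (minn k (2 ^ m)).

Let t01 k : 0 <= t k <= 1.
Proof. by apply: dyadic_itv; exact: geq_minr. Qed.

Let Phi_dyadic (f : Cspace R d) : Phi (dyadic_values m f) = Phi (fun k => ev f (t k)).
Proof. by apply: (Phi_ext PhiL) => k km; rewrite /dyadic_values /t (minn_idPl km). Qed.

(** A single mesh h is found for both noises and all the dyadic times, as a minimum over finitely
    many cases; that is why the data depend on k through [minn k (2 ^ m)]. *)
Lemma brownian_grid_data (e : R) : 0 < e ->
  exists (Y : nat -> bool -> Omega -> 'cV[R]_d) (s : nat -> bool -> @step_data R d) (h : R),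
  [/\ 0 < h, forall k c, step_wf (s k c), forall k c, s k c = s (minn k (2 ^ m)) c,
      forall k, X (t k) = (fun w => Y k true w + Y k false w) &
      forall k c, [/\ measurable_vec (Y k c),
        (L2dist P (Y k c) (step_integral (grid_step h (s k c)) (W c)) <= e%:E)%E &
        (\int[mu]_(x in time) (`|G c (t k) x - rstep_fun (grid_step h (s k c)) x| ^+ 2)%:E <= e%:E)%E]].
Proof.
move=> e0.
have exY (k : nat) : exists Yk : bool -> Omega -> 'cV[R]_d,
    (forall c, wiener_integral P (W c) (G c (t k)) (Yk c)) /\
    X (t k) = (fun w => Yk true w + Yk false w).
  have [Y1 [Y2 [h1 h2 h3]]] := hX (t k).
  by exists (fun c => if c then Y1 else Y2); split; [case; [exact: h1|exact: h2]|exact: h3].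
have [Y hY] := choice exY.
have exs (kc : nat * bool) : exists sh : @step_data R d * R,
    [/\ step_wf sh.1, 0 < sh.2 & forall h, 0 < h <= sh.2 ->
    (L2dist P (Y kc.1 kc.2) (step_integral (grid_step h sh.1) (W kc.2)) <= e%:E)%E /\
    (\int[mu]_(x in time) (`|G kc.2 (t kc.1) x - rstep_fun (grid_step h sh.1) x| ^+ 2)%:E <= e%:E)%E].
  case: kc => [k c] /=; have [wY _] := hY k.
  have [s [wf [h0 h00 H]]] := wiener_grid (hW c) (fun i l => @measurable_kernel R d D A1 A2 c (t k) i l) (wY c) e0.
  by exists (s, h0).
have [s hs] := choice exs.
have [h h0 hh] := @exists_lower_bound R (2 ^ m) (fun k c => (s (k, c)).2)
  (fun k c => let: And3 _ p _ := hs (k, c) in p).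
have tE k : t (minn k (2 ^ m)) = t k by rewrite /t -minnA minnn.
exists (fun k => Y (minn k (2 ^ m))), (fun k c => (s (minn k (2 ^ m), c)).1), h; split => //.
- by move=> k c; have [] := hs (minn k (2 ^ m), c).
- by move=> k c; rewrite -minnA minnn.
- by move=> k; have [_] := hY (minn k (2 ^ m)); rewrite tE.
- move=> k c; have [_ _] := hs (minn k (2 ^ m), c) => /(_ h) /=.
  rewrite tE h0 hh ?geq_minr// => /(_ isT)[h1 h2]; split => //.
  by have [/(_ c)[]] := hY (minn k (2 ^ m)).
Qed.

(** Three errors of e / 3: replacing the kernels by step functions in the Brownian integrals, the
    same in the telegraph integrals, and the central limit theorem on the grid. The grid is built
    from the Brownian side, before n. *)
Lemma fdd_near (e : R) : 0 < e -> exists n0 : nat, forall n : nat, (n0 <= n)%N -> (0 < n)%N ->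
  forall (dO' : measure_display) (Omega' : measurableType dO') (Q : probability Omega' R)
    (Y : bool -> R -> Omega' -> 'cV[R]_d) (X' : R -> Omega' -> 'cV[R]_d)
    (Xc' : {RV Q >-> borel (Cspace R d)}),
  (forall c, kac_noise Q n (Y c)) -> independent_processes Q (Y true) (Y false) ->
  ofbm_approx Q D A1 A2 (Y true) (Y false) X' -> continuous_version X' Xc' ->
  `|\int[P]_w Phi (dyadic_values m (Xc w)) - \int[Q]_w Phi (dyadic_values m (Xc' w))| <= e.
Proof.
move=> e0; set M := (2 ^ m)%N.
pose mc := @moment_const R d 2.
have mc0 : 0 <= mc.
  by rewrite /mc /moment_const !mulr_ge0// ?exprn_ge0// expR_ge0.
(* The factor by which [noise_grid] inflates the squared distance between kernels. *)
pose k0 := 2 + 2 * (mc * 2).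
have k01 : 1 <= k0 by rewrite /k0; lra.
pose e1 := e / 3 / ((K + 1) * M.+1%:R ^+ 2).
have M0 : 0 < M.+1%:R ^+ 2 :> R by rewrite exprn_gt0// ltr0n.
have K1 : 0 < K + 1 by rewrite ltr_wpDl.
have e10 : 0 < e1 by rewrite !divr_gt0// mulr_gt0.
have Ke1 : K * (M.+1%:R ^+ 2 * e1) <= e / 3.
  have -> : e / 3 = (K + 1) * (M.+1%:R ^+ 2 * e1) by rewrite /e1; field; rewrite !gt_eqF.
  by apply: ler_wpM2r; [exact: mulr_ge0 (ltW M0) (ltW e10)|rewrite lerDl].
(* Adding the contributions of the two noises costs a further factor 4, which brings the squared
   distance to e1^2. *)
pose eta := e1 ^+ 2 / (4 * k0).
have eta0 : 0 < eta by rewrite divr_gt0 ?exprn_gt0// mulr_gt0// (lt_le_trans _ k01).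
have etaE : 4 * (k0 * eta) = e1 ^+ 2.
  by rewrite /eta; field; rewrite gt_eqF// (lt_le_trans _ k01).
have eta_le : eta <= k0 * eta by rewrite ler_peMl// ltW.
have [Z [s [h [h0 wf sE XE hZ]]]] := brownian_grid_data eta0.
have [N N0 hN] := exists_upper_bound M (fun k c => \max_(p <- s k c) grid_index h p.1.2)%N.
have sN k c p : p \in s k c -> (grid_index h p.1.2 <= N)%N.
  rewrite sE => ps; apply: leq_trans (hN (minn k M) c (geq_minr _ _)).
  by rewrite (big_rem p ps)/= leq_maxl.
have exL (k : nat) : exists l, 0 <= l /\ forall u u', size u = size u' ->
    `|grid_value h N (s k) u - grid_value h N (s k) u'| <= l * seq_dist u u'.
  by have [l l0 hl] := grid_value_lipschitz h N (s k); exists l.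
have [L hL] := choice exL.
pose F u := Phi (fun k => grid_value h N (s k) u).
pose Ls := \sum_(k < M.+1) L k.
have Ls0 : 0 <= Ls by apply: sumr_ge0 => k _; exact: (hL k).1.
(* The sum of the constants over all times dominates each of them, and the added 1 makes the
   constant positive. *)
have FL : seq_lipschitz (DN * N) (K * Ls + 1) F.
  move=> u u' su su'; have S0 : 0 <= seq_dist u u' by rewrite /seq_dist sumr_ge0.
  apply: (@le_trans _ _ (K * (Ls * seq_dist u u'))); last by rewrite mulrA ler_wpM2r// lerDl.
  apply: PhiL; first by rewrite mulr_ge0.
  move=> k km; apply: (le_trans ((hL k).2 _ _ _)); first by rewrite su su'.
  have kM : (k < M.+1)%N by [].
  rewrite ler_wpM2r// /Ls (bigD1 (Ordinal kM))//= lerDl sumr_ge0// => j _; exact: (hL j).1.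
have B0 : 0 <= B := le_trans (normr_ge0 _) (PhiB (fun=> 0)).
have B1 : 0 < B + 1 by rewrite ltr_wpDl.
have FB u : `|F u| <= B + 1 by apply: (le_trans (PhiB _)); rewrite lerDl.
have KL : 0 < K * Ls + 1 by rewrite ltr_wpDl// mulr_ge0.
have e3 : 0 < e / 3 by rewrite divr_gt0.
(* A coordinate of the limiting Brownian motion is passed along to realize the Gaussian
   convolutions. *)
have [n0 near] := kac_grid_near (proj1 (hW true) i0) i0 h0 N0 KL B1 e3.
exists n0 => n n0n npos dO' Omega' Q Y X' Xc' kY iY hX' hXc'.
have [mF clt] := near n n0n npos dO' Omega' Q Y kY iY F FB FL.
have law := brownian_grid_law i0 hW iW h0 (ltW KL) FB FL.
apply: (@dist3_le R _ _ _ _ _ e law clt).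
- under eq_Rintegral do rewrite Phi_dyadic.
  apply: le_trans Ke1; rewrite /F.
  have JE k w : grid_value h N (s k) [seq grid_increment i0 h N W i w | i <- iota 0 (DN * N)] =
      step_integral (grid_step h (s k true)) (W true) w + step_integral (grid_step h (s k false)) (W false) w.
    exact: (grid_value_brownian i0 W w h0 N0 (wf k) (sN k)).
  have mS k c : measurable_vec (step_integral (grid_step h (s k c)) (W c)).
    by apply: (measurable_step_integral (hW c)); exact: grid_step_wf.
  have mX k : measurable_vec (X (t k)).
    by rewrite XE; apply: measurable_vecD; [have [] := hZ k true|have [] := hZ k false].
  have mJ k : measurable_vec (fun w => grid_value h N (s k) [seq grid_increment i0 h N W i w | i <- iota 0 (DN * N)]).
    by under eq_fun do rewrite JE; exact: measurable_vecD.
  apply: (@Phi_L2 R d i0 M Phi K B K0 PhiB PhiL _ _ P (fun k w => ev (Xc w) (t k)) _ e1 e10 _ mJ).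
    by move=> k; exact: measurable_ev.
  move=> k km; rewrite (version_L2dist hXc (t01 k) (mX k) (mJ k)) XE.
  have -> : (fun w => grid_value h N (s k) [seq grid_increment i0 h N W i w | i <- iota 0 (DN * N)]) =
      (fun w => step_integral (grid_step h (s k true)) (W true) w + step_integral (grid_step h (s k false)) (W false) w).
    by apply/funext => w; exact: JE.
  have [m1 d1 _] := hZ k true; have [m2 d2 _] := hZ k false.
  have le_eta : (eta%:E <= (k0 * eta)%:E)%E by rewrite lee_fin.
  have L2 := lee_twiceD (le_trans d1 le_eta) (le_trans d2 le_eta); rewrite etaE in L2.
  exact: (le_trans (L2dist_add P m1 (mS k true) m2 (mS k false)) L2).
under eq_Rintegral do rewrite Phi_dyadic.
apply: le_trans Ke1; rewrite /F.
pose J k c w := \col_i grid_functional h (s k c) i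
    (fun l q => \int[mu]_(x in `]q%:R * h, q.+1%:R * h]) (Y c x w l 0)).
have JE k w : grid_value h N (s k) [seq grid_integral i0 Y h N i w | i <- iota 0 (DN * N)] =
    J k true w + J k false w.
  exact: (grid_value_noise i0 Y w N0 (sN k)).
have ng k c (Z' : Omega' -> 'cV[R]_d) : noise_integral Q (Y c) (G c (t k)) Z' ->
    measurable_vec (J k c) /\ (L2dist Q Z' (J k c) <= (k0 * eta)%:E)%E.
  move=> iZ; have [_ _ hs] := hZ k c.
  have [mJ hJ] := noise_grid npos (kY c) (tame_kernel A1 A2 hD0 hD1 c (t01 k)) iZ (wf k c) h0 eta0 hs.
  split; first exact: mJ.
  apply: (le_trans hJ); rewrite lee_fin le_eqVlt; apply/orP; left; apply/eqP.
  by rewrite /k0 -/mc; ring.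
have mX k : measurable_vec (X' (t k)) /\ forall c, measurable_vec (J k c).
  have [Y1 [Y2 [i1 i2 ->]]] := hX' (t k) (t01 k).
  have [mY1 _] := i1; have [mY2 _] := i2; split; first exact: measurable_vecD.
  by case; [exact: (ng k true Y1 i1).1|exact: (ng k false Y2 i2).1].
have mJ k : measurable_vec (fun w => grid_value h N (s k) [seq grid_integral i0 Y h N i w | i <- iota 0 (DN * N)]).
  by under eq_fun do rewrite JE; apply: measurable_vecD; exact: (mX k).2.
apply: (@Phi_L2 R d i0 M Phi K B K0 PhiB PhiL _ _ Q (fun k w => ev (Xc' w) (t k)) _ e1 e10 _ mJ).
  by move=> k; exact: measurable_ev.
move=> k km; rewrite (version_L2dist hXc' (t01 k) (mX k).1 (mJ k)).
have -> : (fun w => grid_value h N (s k) [seq grid_integral i0 Y h N i w | i <- iota 0 (DN * N)]) =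
    (fun w => J k true w + J k false w).
  by apply/funext => w; exact: JE.
have [Y1 [Y2 [i1 i2 ->]]] := hX' (t k) (t01 k).
have [mJ1 d1] := ng k true Y1 i1; have [mJ2 d2] := ng k false Y2 i2.
have [mY1 _] := i1; have [mY2 _] := i2.
have L2 := lee_twiceD d1 d2; rewrite etaE in L2.
exact: (le_trans (L2dist_add Q mY1 mJ1 mY2 mJ2) L2).
Qed.

End finite_dimensional.

Theorem theorem2p1 (R : realType) (d : nat) (hd : (1 <= d)%N)
    (D : 'M[R]_d) (hD0 : 0 < lambda_min D) (hD1 : lambda_max D < 1)
    (A : 'M[R[i]]_d) (A1 A2 : 'M[R]_d)
    (hA : A = \matrix_(i, j) (A1 i j +i* A2 i j)%C)
    (* the limit process *)
    (dO : measure_display) (Omega : measurableType dO)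
    (P : probability Omega R)
    (W1 W2 : R -> Omega -> 'cV[R]_d)
    (hW1 : std_brownian_motion P W1) (hW2 : std_brownian_motion P W2)
    (hW : independent_processes P W1 W2)
    (X : R -> Omega -> 'cV[R]_d) (hX : ofbm P D A1 A2 W1 W2 X)
    (hproper : proper_process P X)
    (Xc : {RV P >-> borel (Cspace R d)}) (hXc : continuous_version X Xc)
    (* the approximating processes, possibly each on its own space *)
    (dOn : nat -> measure_display)
    (Omegan : forall n, measurableType (dOn n))
    (Pn : forall n, probability (Omegan n) R)
    (theta theta' : forall n, R -> Omegan n -> 'cV[R]_d)
    (htheta : forall n, (0 < n)%N -> kac_noise (Pn n) n (theta n))
    (htheta' : forall n, (0 < n)%N -> kac_noise (Pn n) n (theta' n))
    (hind : forall n, (0 < n)%N ->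
      independent_processes (Pn n) (theta n) (theta' n))
    (Xn : forall n, R -> Omegan n -> 'cV[R]_d)
    (hXn : forall n, (0 < n)%N ->
      ofbm_approx (Pn n) D A1 A2 (theta n) (theta' n) (Xn n))
    (Xnc : forall n, {RV (Pn n) >-> borel (Cspace R d)})
    (hXnc : forall n, (0 < n)%N -> continuous_version (Xn n) (Xnc n)) :
  weak_cvg (fun n => distribution (Pn n) (Xnc n)) (distribution P Xc).
Proof.
apply: weak_cvg_fdd_moment => [m Phi K B K0 PhiB PhiL|].
  apply/cvgrPdist_le => e e0.
  have hWc c : std_brownian_motion P (if c then W1 else W2) by case: c.
  have [n0 near] := @fdd_near R d (Ordinal hd) D A1 A2 hD0 hD1 _ _ P
    (fun c => if c then W1 else W2) hWc hW X Xc hX hXc m Phi K B K0 PhiB PhiL e e0.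
  near=> n.
  have n0n : (n0 <= n)%N by near: n; exact: nbhs_infty_ge.
  have npos : (0 < n)%N by near: n; exact: nbhs_infty_gt.
  apply: (near n n0n npos _ _ (Pn n) (fun c => if c then theta n else theta' n) (Xn n) (Xnc n)).
  - by case; [exact: htheta|exact: htheta'].
  - exact: hind.
  - exact: hXn.
  - exact: hXnc.
have [p [C [p0 C0 H]]] := approx_moment A1 A2 hD0 hD1.
exists p, C; split => // n s t n0 hs ht.
exact: (H _ _ (Pn n) n (theta n) (theta' n) (Xn n) (Xnc n) n0 (htheta n n0) (htheta' n n0)
  (hXn n n0) (hXnc n n0) s t hs ht).
Unshelve. all: by end_near. Qed.
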